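(* Assume that $\Gamma$ is unbounded and that $(\Omega,m,\mu)$ satisfies (H1)--(H6). Then there exist two bounded linear operators $\mathrm{Tr}:W\to H$ and $\mathrm{Ext}:H\to W$ (bounded with respect to the semi-norms $\|\cdot\|_W$ and $\|\cdot\|_H$) such that for every $u\in W$ and $\mu$-almost every $x\in\Gamma$, $$\mathrm{Tr}\,u(x)=\lim_{X\in\gamma(x),\ \delta(X)\to0}\ \frac1{m(B(X,\delta(X)/2))}\int_{B(X,\delta(X)/2)}u\,dm,$$ and such that for every $g\in H$ and $\mu$-almost every $x\in\Gamma$, $$\mathrm{Tr}\circ\mathrm{Ext}\,g(x)=g(x).$$
   Context: Setting. $\Omega\subset\mathbb R^n$ is a domain (connected open set), $\Gamma=\partial\Omega$, $\delta(X)=\mathrm{dist}(X,\Gamma)$, $B(x,r)$ is the open ball and $\lambda B$ the concentric ball with radius multiplied by $\lambda$. $\Gamma$ is unbounded. $\mu$ is a Borel measure on $\Gamma$, positive and finite on balls centered on $\Gamma$, and $m$ is a measure on $\Omega$. Hypotheses: (H1) There is $C_1$ such that for all $x\in\Gamma$, $r>0$ there is $X\in B(x,r)$ with $B(X,C_1^{-1}r)\subset\Omega$. (H2) There is an integer $C_2=N+1$ such that, for every $r>0$, if $X,Y\in\Omega$, $\delta(X)>r$, $\delta(Y)>r$ and $|X-Y|\le 7C_1r$, there are points $Z_0=X,Z_1,\dots,Z_N=Y$ in $\Omega$ with $|Z_i-Z_{i+1}|<\frac12\delta(Z_i)$ for $0\le i<N$. (H3) $\mathrm{supp}\,\mu=\Gamma$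 and $\mu(B(x,2r))\le C_3\mu(B(x,r))$ for $x\in\Gamma$, $r>0$. (H4) $dm=w\,dX$ with $w\in L^1_{loc}(\Omega)$, $w>0$ a.e., and $m(B(X,2r)\cap\Omega)\le C_4m(B(X,r)\cap\Omega)$ for $X\in\overline\Omega$, $r>0$. (H5) $\rho(x,r)=\frac{m(B(x,r)\cap\Omega)}{r\mu(B(x,r))}$ satisfies $\rho(x,r)/\rho(x,s)\le C_5(r/s)^{1-\epsilon}$ for $x\in\Gamma$, $0<s<r$, with $\epsilon=1/C_5$. (H6) (a) If $D$ is open and relatively compact in $\Omega$, $u_i\in C^\infty(\overline D)$, $\int_D|u_i|\,dm\to0$ and $\int_D|\nabla u_i-v|^2dm\to0$ for some vector-valued $v\in L^2(D,m)$, then $v=0$. (b) For every ball $B$ of radius $r$ with $2B\subset\Omega$ and every $u\in C^\infty(\overline B)$, $\frac1{m(B)}\int_B|u-u_B|dm\le C_6r\big(\frac1{m(B)}\int_B|\nabla u|^2dm\big)^{1/2}$, $u_B=\frac1{m(B)}\int_Bu\,dm$. Energy space. $W$ is the set of $u\in L^1_{loc}(\Omega,m)$ for which there are a vector-valued $v\in L^2(\Omega,m)$ and $\varphi_i\in C^\infty(\overline\Omega)$ with $\int_\Omega|\nabla\varphi_i|^2dm<\infty$, $\int_B|\varphi_i-u|dm\to0$ for every ball $B$ with $2B\subset\Omega$, and $\int_\Omega|\nabla\varphi_i-v|^2dm\to0$. By (H6) $v$ is unique; $\nabla u:=v$ and $\|u\|_W=\|\nabla u\|_{L^2(\Omega,m)}$.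 Boundary space. $H$ is the set of $\mu$-measurable $g:\Gamma\to\mathbb R$ with $$\|g\|_H=\left(\int_\Gamma\int_\Gamma\frac{\rho(x,|x-y|)^2|g(x)-g(y)|^2}{m(B(x,|x-y|)\cap\Omega)}\,d\mu(y)\,d\mu(x)\right)^{1/2}<\infty$$ (the integrand is $0$ for $x=y$). Dyadic cubes on $\Gamma$. Fix a Christ dyadic decomposition $\mathbb D=\bigcup_{k\in\mathbb Z}\mathbb D_k$ of $(\Gamma,\mu)$, with $a_0>0$ depending only on $C_3$: each $\mathbb D_k$ is a partition of $\Gamma$ into measurable sets; if $\ell\ge k$, $Q'\in\mathbb D_\ell$, $Q\in\mathbb D_k$, then $Q'\subset Q$ or $Q'\cap Q=\emptyset$; each $Q\in\mathbb D_k$ has a unique ancestor in $\mathbb D_\ell$ for each $\ell<k$; $\mathrm{diam}\,Q\le2^{-k}$ and $Q\supset B(z_Q,a_02^{-k})\cap\Gamma$ for some $z_Q\in\Gamma$, when $Q\in\mathbb D_k$. A cube comes with its generation $k$, and $\ell(Q)=2^{-k}$. Access cones. $\mathcal W$ is the collection of (true) dyadic cubes $I\subset\Omega$ of $\mathbb R^n$ such that $4\,\mathrm{diam}\,I\le\mathrm{dist}(4I,\Gamma)$ but the dyadic parent of $I$ does not satisfy the same inequality; $\ell(I)$ is the side length. For $Q\in\mathbb D$, $\mathcal W_Q=\{I\in\mathcal W:\ C_a^{-1}\ell(Q)\le\ell(I),\ \mathrm{dist}(I,Q)\le2\ell(Q)\}$ with $C_a=1000C_1\sqrt n$, $U_Q=\bigcup_{I\in\mathcal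 W_Q}I$, and for $x\in\Gamma$, $\gamma(x)=\bigcup_{Q\in\mathbb D,\,Q\ni x}U_Q$. *)

(* Defs.v *)
From HB Require Import structures.
From mathcomp Require Import all_boot all_order all_algebra.
From mathcomp Require Import all_classical all_reals all_analysis.
From mathcomp Require Import measurable_realfun lra.

Set Implicit Arguments.
Unset Strict Implicit.
Unset Printing Implicit Defensive.

Import Order.TTheory GRing.Theory Num.Theory.
Import numFieldNormedType.Exports.

Local Open Scope classical_set_scope.
Local Open Scope ring_scope.

Definition borel_mx_display : measure_display.
Proof. exact: default_measure_display. Qed.

Section borel_matrix.
Context (R : realType) (p q : nat).

Definition borel_mx : set (set 'M[R]_(p, q)) := <<s [set A | open A] >>.

HB.instance Definition _ := @isMeasurable.Build borel_mx_display 'M[R]_(p, q)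
  borel_mx (@sigma_algebra0 _ setT _) (@sigma_algebraC _ _)
  (@sigma_algebra_bigcup _ setT _).

End borel_matrix.

Section borel_lemmas.
Context {R : realType}.

Lemma open_measurable_mx p q (A : set 'M[R]_(p, q)) : open A -> measurable A.
Proof. exact: sub_sigma_algebra. Qed.

Lemma measurable_coord n (i : 'I_n) :
  measurable_fun setT (fun x : 'rV[R]_n => x ord0 i).
Proof.
apply: (measurability _ (RGenOpens.measurableE R)).
move=> _ [_ [a [b ->] <-]]; rewrite setTI.
apply: open_measurable_mx; apply: open_comp; last exact: interval_open.
by move=> x _; exact: coord_continuous.
Qed.

Lemma measurable_rV d (T : measurableType d) n (f : T -> 'rV[R]_n) :
  (forall i, measurable_fun setT (fun t => f t ord0 i)) ->
  measurable_fun setT f.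
Proof.
move=> mf; apply: (@measurability _ _ T 'rV[R]_n setT f [set A | open A] erefl).
move=> _ [U oU <-]; rewrite setTI.
pose bx := fun c : 'rV[rat]_n * nat =>
  [set x : 'rV[R]_n | forall i, ratr (c.1 ord0 i) - c.2.+1%:R^-1 < x ord0 i
                   < ratr (c.1 ord0 i) + c.2.+1%:R^-1].
have UE : U = \bigcup_c (if `[< bx c `<=` U >] then bx c else set0).
  apply/seteqP; split; last by move=> x [c _]; case: asboolP => // h /h.
  move=> x Ux.
  have /nbhs_ballP[e /= e0 eU] := oU _ Ux.
  have e20 : 0 < e / 2 by rewrite divr_gt0.
  near \oo => k.
  have ke : k.+1%:R^-1 < e / 2.
    by near: k; exact: (near_infty_natSinv_lt (PosNum e20)).
  have k0 : 0 < k.+1%:R^-1 :> R by rewrite invr_gt0.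
  have H i : exists r : rat, x ord0 i - k.+1%:R^-1 < ratr r
                             < x ord0 i + k.+1%:R^-1.
    have : x ord0 i - k.+1%:R^-1 < x ord0 i + k.+1%:R^-1.
      by rewrite ltrBlDr -addrA ltrDl addr_gt0.
    by move=> /rat_in_itvoo[r]; rewrite in_itv/=; exists r.
  have [r rP] := choice H.
  exists ((\row_i r i), k) => //; rewrite asboolT /=.
    move=> i; rewrite mxE; have /andP[h1 h2] := rP i.
    by rewrite ltrBlDr h2/= -ltrBlDr h1.
  move=> y yb; apply: eU; split => // a i; have -> : a = ord0 by apply/val_inj; case: a => -[].
  have := yb i; rewrite mxE /= => /andP[h1 h2]; have /andP[h3 h4] := rP i.
  rewrite /ball/= ltr_norml; move: (ratr (r i)) (x ord0 i) (y ord0 i) (k.+1%:R^-1) h1 h2 h3 h4 ke => q x1 y1 kk h1 h2 h3 h4 ke.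
  apply/andP; split; lra.
rewrite UE preimage_bigcup.
apply: countable_bigcupT_measurable => [|c]; first exact: countableP.
case: asboolP => _; last by rewrite preimage_set0.
rewrite (_ : _ @^-1` _ = \bigcap_(i in [set: 'I_n]) ((fun t => f t ord0 i) @^-1`
   `]ratr (c.1 ord0 i) - c.2.+1%:R^-1, ratr (c.1 ord0 i) + c.2.+1%:R^-1[)).
  apply: fin_bigcap_measurable => // i _.
  by rewrite -[X in measurable X]setTI; apply: mf => //; exact: measurable_itv.
apply/seteqP; split => t /=.
  by move=> h i _ /=; rewrite in_itv/=; exact: h.
by move=> h i; have := h i Logic.I; rewrite /= in_itv.
Unshelve. all: by end_near. Qed.


Definition rV_cons n (p : measurableTypeR R * 'rV[R]_n) : 'rV[R]_n.+1 :=
  \row_i oapp (p.2 ord0) p.1 (unlift ord0 i).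

Lemma measurable_rV_cons n : measurable_fun setT (@rV_cons n).
Proof.
apply: measurable_rV => i; under eq_fun do rewrite mxE.
case: unliftP => [j|] _ /=; last exact: measurable_fst.
exact: (measurableT_comp (measurable_coord j) measurable_snd).
Qed.

HB.instance Definition _ n :=
  isMeasurableFun.Build _ _ _ _ (@rV_cons n) (@measurable_rV_cons n).

Section lebesgue_step.
Context n (l : {sigma_finite_measure set 'rV[R]_n -> \bar R}).

Definition lebesgue_step : set 'rV[R]_n.+1 -> \bar R :=
  pushforward (@lebesgue_measure R \x l)%E (@rV_cons n).

Let lebesgue_step0 : lebesgue_step set0 = 0%E.
Proof. by rewrite /lebesgue_step /pushforward preimage_set0 measure0. Qed.

Let lebesgue_step_ge0 A : (0 <= lebesgue_step A)%E.
Proof. exact: measure_ge0. Qed.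

Let lebesgue_step_sigma_additive : semi_sigma_additive lebesgue_step.
Proof.
exact: (@measure_semi_sigma_additive _ _ _
  (measure_function_pushforward__canonical__measure_function_Measure
    (@lebesgue_measure R \x l)%E (@measurable_rV_cons n))).
Qed.

HB.instance Definition _ := isMeasure.Build _ _ _ lebesgue_step
  lebesgue_step0 lebesgue_step_ge0 lebesgue_step_sigma_additive.

Let lebesgue_step_sigma_finite : sigma_finite setT lebesgue_step.
Proof.
have /sigma_finiteP[F [TF ndF Foo]] := sigma_finiteT (@lebesgue_measure R).
have /sigma_finiteP[G [TG ndG Goo]] := sigma_finiteT l.
pose g (x : 'rV[R]_n.+1) : measurableTypeR R * 'rV[R]_n :=
  (x ord0 ord0, \row_i x ord0 (lift ord0 i)).
have gK p : g (rV_cons p) = p.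
  case: p => t x; congr pair; rewrite /rV_cons; first by rewrite mxE unlift_none.
  by apply/rowP => i; rewrite !mxE liftK /=.
have mg : measurable_fun setT g.
  apply/measurable_fun_pairP; split; first exact: measurable_coord.
  by apply: measurable_rV => i; under eq_fun do rewrite mxE; exact: measurable_coord.
exists (fun k => g @^-1` (F k `*` G k)) => [|k].
  apply/seteqP; split=> // x _.
  have : [set: R] (g x).1 by []. rewrite TF => -[i _ Fi].
  have : [set: 'rV[R]_n] (g x).2 by []. rewrite TG => -[j _ Gj].
  exists (maxn i j) => //; split.
  - by move: Fi; exact/subsetPset/ndF/leq_maxl.
  - by move: Gj; exact/subsetPset/ndG/leq_maxr.
have [mF Fk] := Foo k; have [mG Gk] := Goo k; split.
  by rewrite -[X in measurable X]setTI; apply: mg => //; exact: measurableX.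
rewrite /lebesgue_step /pushforward (_ : _ @^-1` _ = F k `*` G k).
  by rewrite product_measure1E// lte_mul_pinfty// ge0_fin_numE.
by apply/funext => p; rewrite /preimage /mkset gK.
Qed.

HB.instance Definition _ := Measure_isSigmaFinite.Build _ _ _ lebesgue_step
  lebesgue_step_sigma_finite.

End lebesgue_step.

Fixpoint lebesgue_rV n : {sigma_finite_measure set 'rV[R]_n -> \bar R} :=
  if n is k.+1 then lebesgue_step (lebesgue_rV k) else \d_(0 : 'rV[R]_0).

Lemma lebesgue_rV_box n (a b : 'rV[R]_n) :
  (forall i, a ord0 i <= b ord0 i) ->
  lebesgue_rV n [set x | forall i, a ord0 i < x ord0 i <= b ord0 i] =
  (\prod_i (b ord0 i - a ord0 i))%:E.
Proof.
elim: n a b => [|n IH] a b ab /=.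
  by rewrite big_ord0 diracE mem_set// => -[].
rewrite /lebesgue_step /pushforward.
pose a' : 'rV[R]_n := \row_i a ord0 (lift ord0 i).
pose b' : 'rV[R]_n := \row_i b ord0 (lift ord0 i).
set B' := [set x : 'rV[R]_n | forall i, a' ord0 i < x ord0 i <= b' ord0 i].
have mB' : measurable B'.
  rewrite (_ : B' = \bigcap_(i in [set: 'I_n])
      ((fun x : 'rV[R]_n => x ord0 i) @^-1` `]a' ord0 i, b' ord0 i])).
    apply: fin_bigcap_measurable => // i _.
    rewrite -[X in measurable X]setTI.
    by apply: measurable_coord => //; exact: measurable_itv.
  apply/seteqP; split => x /=.
    by move=> h i _ /=; rewrite in_itv/=; exact: h.
  by move=> h i; have := h i Logic.I; rewrite /= in_itv.
rewrite (_ : _ @^-1` _ = `]a ord0 ord0, b ord0 ord0] `*` B'); last first.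
  apply/seteqP; split => -[t x] /=; rewrite in_itv /= => h.
    split; first by have := h ord0; rewrite mxE unlift_none.
    by move=> i; have := h (lift ord0 i); rewrite !mxE liftK.
  case: h => h1 h2 i; rewrite mxE; case: unliftP => [j ->|->] //=.
  by have := h2 j; rewrite !mxE.
rewrite product_measure1E//=.
rewrite -[X in (X * _)%E]/(@lebesgue_measure R _) lebesgue_measure_itv /= IH => [|i]; last by rewrite !mxE.
rewrite big_ord_recl EFinM; congr (_ * _)%E.
  rewrite lte_fin; case: ltP => [_|ba]; first by rewrite EFinB.
  by rewrite (@le_anti _ _ (a ord0 ord0) (b ord0 ord0)) ?ab// subrr.
by congr EFin; apply: eq_bigr => i _; rewrite !mxE.
Qed.

End borel_lemmas.

Section euclidean.
Context {R : realType} {n : nat}.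
Implicit Types (x y : 'rV[R]_n) (A B : set 'rV[R]_n).

(* The library's norm and balls on ['rV[R]_n] are those of the sup norm, which
   defines the same topology. *)
Definition enorm x : R := Num.sqrt (\sum_i x ord0 i ^+ 2).

Definition eball x (r : R) : set 'rV[R]_n := [set y | enorm (y - x) < r].

Definition edist A B : R := inf [set enorm (x - y) | x in A & y in B].

(* extended-real valued, so that an unbounded set has diameter [+oo] *)
Definition ediam A : \bar R :=
  ereal_sup [set (enorm (x - y))%:E | x in A & y in A].

Definition boundary A : set 'rV[R]_n := closure A `\` interior A.

Definition domain A := [/\ open A, connected A & A !=set0].

End euclidean.

Section calculus.
Context {R : realType} {n : nat}.
Implicit Types (f : 'rV[R]_n -> R) (x : 'rV[R]_n).

Definition partial (i : 'I_n) f : 'rV[R]_n -> R :=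
  fun x => 'D_(delta_mx ord0 i) f x.

(* C^infinity on the whole space.  For a closed set [K], C^infinity(K) is the
   set of restrictions to [K] of such functions; below, "u in C^infinity(K)" is
   therefore rendered by a smooth [u] of which only the values on [K] matter. *)
Definition smooth f := forall s : seq 'I_n,
  let g := foldr partial f s in
  continuous g /\ forall i x, derivable g x (delta_mx ord0 i).

Definition grad f x : 'rV[R]_n := \row_i partial i f x.

End calculus.

Section integrability.
Context {R : realType} {n : nat} (nu : {measure set 'rV[R]_n -> \bar R}).
Implicit Types (D : set 'rV[R]_n) (f : 'rV[R]_n -> R) (v : 'rV[R]_n -> 'rV[R]_n).

(* [nu] is a Borel measure; "nu-measurable" refers to its completion.  The
   library integral of a [nu]-measurable function against the Borel measure
   [nu] is its integral against the completion, because replacing the function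
   by a Borel one equal almost everywhere does not change it. *)
Definition nu_measurable D := completed_algebra_gen nu D.

Definition nu_measurable_fun D f :=
  forall B, measurable B -> nu_measurable (D `&` f @^-1` B).

Definition L1loc D f :=
  nu_measurable_fun D f /\
  forall K, K `<=` D -> compact K -> (\int[nu]_(x in K) `|f x|%:E < +oo)%E.

Definition L2vec D v :=
  (forall i, nu_measurable_fun D (fun x => v x ord0 i)) /\
  (\int[nu]_(x in D) (enorm (v x) ^+ 2)%:E < +oo)%E.

Definition average D f : R := (fine (nu D))^-1 * \int[nu]_(x in D) f x.

End integrability.

Section hypotheses.
Context {R : realType} {n : nat}.
Variable (Omega : set 'rV[R]_n).
(* [m] and [mu] are measures on [Omega] and on its boundary, extended by zero
   to the Borel sets of the whole space. *)
Variables (m mu : {measure set 'rV[R]_n -> \bar R}).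
Local Notation Gamma := (boundary Omega).

Definition delta (X : 'rV[R]_n) : R := edist [set X] Gamma.

Definition borel_measure_on_boundary :=
  mu (~` Gamma) = 0%E /\
  forall x r, Gamma x -> 0 < r -> (0 < mu (eball x r) < +oo)%E.

Definition corkscrew_points (C1 : R) := forall x r, Gamma x -> 0 < r ->
  exists2 X, eball x r X & eball X (C1^-1 * r) `<=` Omega.

Definition harnack_chains (C1 : R) := exists N : nat, forall r, 0 < r ->
  forall X Y, Omega X -> Omega Y -> r < delta X -> r < delta Y ->
  enorm (X - Y) <= 7 * C1 * r ->
  exists Z : nat -> 'rV[R]_n, [/\ Z 0%N = X, Z N = Y,
    forall i, (i <= N)%N -> Omega (Z i) &
    forall i, (i < N)%N -> enorm (Z i - Z i.+1) < 2^-1 * delta (Z i)].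

Definition measure_support : set 'rV[R]_n :=
  [set x | forall r, 0 < r -> (0 < mu (eball x r))%E].

Definition mu_doubling (C3 : R) := measure_support = Gamma /\
  forall x r, Gamma x -> 0 < r ->
    (mu (eball x (2 * r)) <= C3%:E * mu (eball x r))%E.

Definition m_density_doubling (C4 : R) :=
  (exists w : 'rV[R]_n -> R,
    [/\ L1loc (lebesgue_rV n) Omega w,
        \forall X \ae (lebesgue_rV n), Omega X -> 0 < w X &
        forall A, measurable A ->
          (m A = \int[lebesgue_rV n]_(X in A `&` Omega) (w X)%:E)%E]) /\
  forall X r, closure Omega X -> 0 < r ->
    (m (eball X (2 * r) `&` Omega) <= C4%:E * m (eball X r `&` Omega))%E.

Definition rho (x : 'rV[R]_n) (r : R) : R :=
  fine (m (eball x r `&` Omega)) / (r * fine (mu (eball x r))).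

Definition rho_growth (C5 : R) := forall x r s, Gamma x -> 0 < s -> s < r ->
  rho x r / rho x s <= C5 * (r / s) `^ (1 - C5^-1).

Definition gradient_uniqueness :=
  forall (D : set 'rV[R]_n) (u : nat -> 'rV[R]_n -> R)
    (v : 'rV[R]_n -> 'rV[R]_n),
  open D -> compact (closure D) -> closure D `<=` Omega ->
  (forall i, smooth (u i)) -> L2vec m D v ->
  (\int[m]_(x in D) `|u i x|%:E)%E @[i --> \oo] --> 0%E ->
  (\int[m]_(x in D) (enorm (grad (u i) x - v x) ^+ 2)%:E)%E @[i --> \oo]
    --> 0%E ->
  \forall x \ae m, D x -> v x = 0.

Definition weak_poincare (C6 : R) :=
  forall (X : 'rV[R]_n) (r : R) (u : 'rV[R]_n -> R), 0 < r ->
  eball X (2 * r) `<=` Omega -> smooth u ->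
  let B := eball X r in
  average m B (fun Y => `|u Y - average m B u|) <=
  C6 * r * Num.sqrt (average m B (fun Y => enorm (grad u Y) ^+ 2)).

End hypotheses.

Section spaces.
Context {R : realType} {n : nat}.

(* A space of functions, its elements being identified when related by
   [space_eq], with an extended-real valued seminorm *)
Record function_space := FunctionSpace {
  space_mem : set ('rV[R]_n -> R);
  space_eq : ('rV[R]_n -> R) -> ('rV[R]_n -> R) -> Prop;
  seminorm : ('rV[R]_n -> R) -> \bar R }.

Definition bounded_linear_operator (E F : function_space)
    (T : ('rV[R]_n -> R) -> ('rV[R]_n -> R)) :=
  [/\ forall u, space_mem E u -> space_mem F (T u),
      forall u v, space_mem E u -> space_mem E v ->
        space_eq E u v -> space_eq F (T u) (T v),
      forall (a : R) u v, space_mem E u -> space_mem E v ->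
        space_eq F (T (fun x => a * u x + v x)) (fun x => a * T u x + T v x) &
      exists C : R, forall u, space_mem E u ->
        (seminorm F (T u) <= C%:E * seminorm E u)%E].

Variable (Omega : set 'rV[R]_n).
Variables (m mu : {measure set 'rV[R]_n -> \bar R}).
Local Notation Gamma := (boundary Omega).

Definition weak_gradient (u : 'rV[R]_n -> R) (v : 'rV[R]_n -> 'rV[R]_n) :=
  L2vec m Omega v /\
  exists phi : nat -> 'rV[R]_n -> R,
  [/\ forall i, smooth (phi i),
      forall i, (\int[m]_(x in Omega) (enorm (grad (phi i) x) ^+ 2)%:E < +oo)%E,
      forall X r, 0 < r -> eball X (2 * r) `<=` Omega ->
        (\int[m]_(x in eball X r) `|phi i x - u x|%:E)%E @[i --> \oo] --> 0%E &
      (\int[m]_(x in Omega) (enorm (grad (phi i) x - v x) ^+ 2)%:E)%E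
        @[i --> \oo] --> 0%E].

Definition nabla (u : 'rV[R]_n -> R) : 'rV[R]_n -> 'rV[R]_n :=
  get (weak_gradient u).

Definition energy_space : function_space := FunctionSpace
  [set u | L1loc m Omega u /\ exists v, weak_gradient u v]
  (fun u v => \forall x \ae m, Omega x -> u x = v x)
  (fun u => (\int[m]_(x in Omega) (enorm (nabla u x) ^+ 2)%:E) `^ 2^-1)%E.

Definition boundary_integrand (g : 'rV[R]_n -> R) (x y : 'rV[R]_n) : R :=
  let r := enorm (x - y) in
  if x == y then 0 else
  rho Omega m mu x r ^+ 2 * `|g x - g y| ^+ 2 / fine (m (eball x r `&` Omega)).

Definition boundary_norm (g : 'rV[R]_n -> R) : \bar R :=
  ((\int[mu]_(x in Gamma) \int[mu]_(y in Gamma) (boundary_integrand g x y)%:E)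
    `^ 2^-1)%E.

Definition boundary_space : function_space := FunctionSpace
  [set g | nu_measurable_fun mu Gamma g /\ (boundary_norm g < +oo)%E]
  (fun g h => \forall x \ae mu, Gamma x -> g x = h x)
  boundary_norm.

End spaces.

Section cubes.
Context {R : realType} {n : nat}.
Variable (Omega : set 'rV[R]_n).
Local Notation Gamma := (boundary Omega).

Definition generation_length (k : int) : R := 2 ^ (- k).

(* [cubes k] is the collection of cubes of generation [k]. *)
Record christ_decomposition (mu : {measure set 'rV[R]_n -> \bar R}) (a0 : R)
    (cubes : int -> set (set 'rV[R]_n)) : Prop := {
  christ_partition : forall k, partition (cubes k) id Gamma;
  christ_measurable : forall k Q, cubes k Q -> nu_measurable mu Q;
  christ_nested : forall k l Q Q', k <= l -> cubes l Q' -> cubes k Q ->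
    Q' `<=` Q \/ Q' `&` Q = set0;
  christ_ancestor : forall k l Q, l < k -> cubes k Q ->
    exists! P, cubes l P /\ Q `<=` P;
  christ_diam : forall k Q, cubes k Q ->
    (ediam Q <= (generation_length k)%:E)%E;
  christ_ball : forall k Q, cubes k Q -> exists2 z, Gamma z &
    eball z (a0 * generation_length k) `&` Gamma `<=` Q }.

(* The concentric dilation by [lam] of the closed dyadic cube of side [2^-k]
   with lowest corner [2^-k z] *)
Definition dilated_cube (lam : R) (k : int) (z : 'I_n -> int) :
    set 'rV[R]_n :=
  [set x | forall i,
    `|x ord0 i - ((z i)%:~R + 2^-1) * generation_length k|
      <= lam * generation_length k / 2].

Definition dyadic_cube := dilated_cube 1.

Definition whitney_size k z :=
  (4%:E * ediam (dyadic_cube k z) <= (edist (dilated_cube 4 k z) Gamma)%:E)%E.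

Definition whitney (k : int) (z : 'I_n -> int) :=
  [/\ dyadic_cube k z `<=` Omega, whitney_size k z &
      ~ whitney_size (k - 1) (fun i => (z i %/ 2)%Z)].

Definition whitney_of_cube (C1 : R) (j : int) (Q : set 'rV[R]_n)
    (k : int) (z : 'I_n -> int) :=
  let Ca := 1000 * C1 * Num.sqrt n%:R in
  [/\ whitney k z, Ca^-1 * generation_length j <= generation_length k &
      edist (dyadic_cube k z) Q <= 2 * generation_length j].

Definition whitney_region C1 j Q : set 'rV[R]_n :=
  [set X | exists k z, whitney_of_cube C1 j Q k z /\ dyadic_cube k z X].

Definition access_cone C1 (cubes : int -> set (set 'rV[R]_n)) x :
    set 'rV[R]_n :=
  [set X | exists j Q, [/\ cubes j Q, Q x & whitney_region C1 j Q X]].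

Definition cone_limit C1 cubes (f : 'rV[R]_n -> R) (x : 'rV[R]_n) (l : R) :=
  forall eps, 0 < eps -> exists2 eta, 0 < eta &
    forall X, access_cone C1 cubes x X -> delta Omega X < eta ->
      `|f X - l| < eps.

End cubes.

(* Main.v *)
From HB Require Import structures.
Require Import Defs.
From mathcomp Require Import all_boot all_order all_algebra.
From mathcomp Require Import all_classical all_reals all_analysis.
From mathcomp Require Import measurable_realfun zify ring lra.
Set Implicit Arguments.
Unset Strict Implicit.
Unset Printing Implicit Defensive.
Import Order.TTheory GRing.Theory Num.Theory.
Import numFieldNormedType.Exports.
Local Open Scope classical_set_scope.
Local Open Scope ring_scope.

(* Let [h X] be the average of [u] over the ball of radius [delta X / 2] around
   [X].  The Poincare inequality bounds [(h X - h Y)^2] by the energy of [u] near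
   a Harnack chain from [X] to [Y]; with the growth condition on [rho], chaining
   over dyadic scales bounds the oscillation of [h] in a cone at [x], truncated
   at height [s], by [s / rho x s] times an integral of [|grad u|^2] over a cone
   with a weight that decays towards [x].  That integral is finite for almost
   every [x] by Tonelli's theorem, which gives the non-tangential limit [Tr u];
   inserting the bound in the double integral over the boundary and exchanging
   integrals gives the boundedness of [Tr].

   [Ext g] glues, with smooth lattice partitions of unity, the averages of [g]
   over balls of radius [2^-k] into a function at scale [2^-k], and uses it at
   distance about [2^-k] from the boundary.  Its gradient is controlled by the
   differences of neighbouring averages, hence by Jensen's inequality by a double
   integral of [|g y - g y'|^2], and Tonelli's theorem gives the energy bound.
   The same comparison of averages with [g x] shows that [Ext g] converges
   non-tangentially to [g x] wherever the inner integral of the boundary energy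
   is finite. *)

(** * Euclidean balls, lower integrals and completions *)

(** Two constraints shape the details. Elements of both spaces are measurable only for the completed
    measures and the trace is obtained by choice, whereas Tonelli's theorem needs Borel integrands:
    functions are replaced by Borel versions off null sets, and the double integral of the trace is
    only compared, as a lower integral, with a measurable kernel. Constants may not depend on [u],
    so each estimate fixes its constant before the pair [h], [f]. The trace is taken as a limit in
    cones of every aperture: such a limit does not mention the cubes and is already determined by a
    sequence of corkscrew points, whence uniqueness, linearity and the identification of the trace
    of [Ext g]. Membership of [Ext g] in the energy space asks for approximants that are smooth on
    the whole space; lattice averages make sense on both sides of the boundary, so freezing the
    scale provides them. Finally the seminorm involves a gradient picked by choice, and
    [gradient_uniqueness] is what identifies it with the classical gradient of [Ext g]. *)

Section euclidean_norm.
Context {R : realType} {n : nat}.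
Implicit Types x y z : 'rV[R]_n.

Lemma enorm_ge0 x : 0 <= enorm x. Proof. exact: sqrtr_ge0. Qed.
Hint Resolve enorm_ge0 : core.

Lemma enorm_sqr x : enorm x ^+ 2 = \sum_i x ord0 i ^+ 2.
Proof. by rewrite sqr_sqrtr// sumr_ge0// => i _; rewrite sqr_ge0. Qed.

Lemma enormN x : enorm (- x) = enorm x.
Proof. by congr Num.sqrt; apply: eq_bigr => i _; rewrite mxE sqrrN. Qed.

Lemma enorm_sub x y : enorm (x - y) = enorm (y - x).
Proof. by rewrite -enormN opprB. Qed.

Lemma enormZ a x : enorm (a *: x) = `|a| * enorm x.
Proof.
rewrite /enorm -sqrtr_sqr -sqrtrM ?sqr_ge0// mulr_sumr.
by congr Num.sqrt; apply: eq_bigr => i _; rewrite mxE exprMn.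
Qed.

Lemma enorm0 : enorm (0 : 'rV[R]_n) = 0.
Proof. by rewrite -(scale0r 0) enormZ normr0 mul0r. Qed.

Lemma coord_le_enorm x i : `|x ord0 i| <= enorm x.
Proof.
rewrite -sqrtr_sqr ler_wsqrtr// (bigD1 i)//= lerDl sumr_ge0// => j _.
exact: sqr_ge0.
Qed.

Lemma enorm_eq0 x : enorm x = 0 -> x = 0.
Proof.
move=> x0; apply/rowP => i; apply/eqP; rewrite mxE -normr_le0 -x0.
exact: coord_le_enorm.
Qed.

(** Cauchy-Schwarz: with [P] the inner product, the squared length of [|y|^2 x - P y] is nonnegative
    and equals [|y|^2 (|x|^2 |y|^2 - P^2)]. *)
Lemma dot_le_enorm x y : \sum_i x ord0 i * y ord0 i <= enorm x * enorm y.
Proof.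
set P := \sum_i _; have [y0|y0] := eqVneq (enorm y) 0.
  by rewrite /P (enorm_eq0 y0) enorm0 mulr0 big1// => i _; rewrite mxE mulr0.
have : 0 <= \sum_i (enorm y ^+ 2 * x ord0 i - P * y ord0 i) ^+ 2.
  by apply: sumr_ge0 => i _; exact: sqr_ge0.
have -> p e : \sum_i (e ^+ 2 * x ord0 i - p * y ord0 i) ^+ 2 =
    e ^+ 4 * enorm x ^+ 2 - 2 * p * e ^+ 2 * (\sum_i x ord0 i * y ord0 i)
    + p ^+ 2 * enorm y ^+ 2.
  rewrite !enorm_sqr !mulr_sumr -sumrB -big_split /=; apply: eq_bigr => i _; ring.
rewrite -/P (_ : _ + _ = enorm y ^+ 2 * ((enorm y * enorm x) ^+ 2 - P ^+ 2)); last by ring.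
have y1 : 0 < enorm y by rewrite lt0r y0/=.
rewrite pmulr_rge0 ?exprn_gt0// subr_ge0 mulrC => h.
have [P0|/ltW P0] := lerP P 0; first by rewrite (le_trans P0)// mulr_ge0.
by rewrite -(@ler_pXn2r _ 2)// nnegrE mulr_ge0.
Qed.

Lemma enormD x y : enorm (x + y) <= enorm x + enorm y.
Proof.
rewrite -(@ler_pXn2r _ 2)// ?nnegrE ?addr_ge0// sqrrD !enorm_sqr.
have -> : \sum_i (x + y) ord0 i ^+ 2 = \sum_i x ord0 i ^+ 2 +
    (\sum_i x ord0 i * y ord0 i) *+ 2 + \sum_i y ord0 i ^+ 2.
  by rewrite -sumrMnl -!big_split; apply: eq_bigr => i _; rewrite !mxE sqrrD.
by rewrite lerD2r lerD2l lerMn2r dot_le_enorm.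
Qed.

Lemma enorm_triangle y x z : enorm (x - z) <= enorm (x - y) + enorm (y - z).
Proof. by rewrite -[x - z](subrKA y) (le_trans (enormD _ _)). Qed.

Lemma norm_le_enorm x : `|x| <= enorm x.
Proof.
rewrite [`|x|]/Num.norm/= mx_normrE; apply: bigmax_le => //= -[i j] _ /=.
by rewrite (ord1 i) coord_le_enorm.
Qed.

Lemma coord_le_norm x i : `|x ord0 i| <= `|x|.
Proof.
rewrite [X in _ <= X]/Num.norm/= mx_normrE.
exact: (le_bigmax _ (fun ij : 'I_1 * 'I_n => `|x ij.1 ij.2|) (ord0, i)).
Qed.

Lemma enorm_le_sum x : enorm x <= \sum_i `|x ord0 i|.
Proof.
rewrite -(@ler_pXn2r _ 2)// ?nnegrE ?sumr_ge0// enorm_sqr expr2 mulr_suml.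
apply: ler_sum => i _; rewrite -real_normK ?num_real// expr2 ler_wpM2l//.
by rewrite (bigD1 i)//= lerDl sumr_ge0.
Qed.

Lemma enorm_le_max x e : (forall i, `|x ord0 i| <= e) -> enorm x <= n%:R * e.
Proof.
move=> xe; rewrite (le_trans (enorm_le_sum x))//.
by rewrite (le_trans (ler_sum _ (fun i _ => xe i)))// sumr_const card_ord mulr_natl.
Qed.

Lemma enorm_le_norm x : enorm x <= n%:R * `|x|.
Proof. by apply: enorm_le_max => i; exact: coord_le_norm. Qed.

Lemma eball_center x r : 0 < r -> eball x r x.
Proof. by rewrite /eball/= subrr enorm0. Qed.

Lemma eball_subset x y r s : enorm (x - y) + r <= s -> eball x r `<=` eball y s.
Proof.
move=> h z; rewrite /eball/= => zx.
have := enorm_triangle x z y; lra.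
Qed.

(** The divisor is [n.+1] rather than [n] so that the radius is positive in every dimension,
    including [0]. *)
Lemma ball_sub_eball x e : 0 < e -> ball x (e / n.+1%:R) `<=` eball x e.
Proof.
move=> e0 y; rewrite -ball_normE /ball_/eball/= => xy.
rewrite enorm_sub (le_lt_trans (enorm_le_norm _))//.
apply: (@le_lt_trans _ _ (n.+1%:R * `|x - y|)).
  by rewrite ler_wpM2r// ler_nat.
by rewrite mulrC -ltr_pdivlMr.
Qed.

Lemma eball_sub_ball x e : eball x e `<=` ball x e.
Proof.
move=> y; rewrite -ball_normE /ball_/eball/= => xy.
by rewrite (le_lt_trans (norm_le_enorm _))// enorm_sub.
Qed.

(** Bridge between the topology, which comes from the sup norm, and the Euclidean balls in which all
    hypotheses are stated. *)
Lemma nbhs_eballP x (A : set 'rV[R]_n) :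
  nbhs x A <-> exists2 e, 0 < e & eball x e `<=` A.
Proof.
split=> [/nbhs_ballP[e/= e0 eA]|[e e0 eA]].
  by exists e => //; apply: subset_trans eA; exact: eball_sub_ball.
apply/nbhs_ballP; exists (e / n.+1%:R) => /=; first by rewrite divr_gt0.
by apply: subset_trans eA; exact: ball_sub_eball.
Qed.

Lemma eball_open x r : open (eball x r).
Proof.
rewrite openE => y xy; apply/nbhs_eballP; exists (r - enorm (y - x)).
  by rewrite subr_gt0.
by apply: eball_subset; lra.
Qed.

Lemma eball_nbhs x r : 0 < r -> nbhs x (eball x r).
Proof. by move=> r0; apply/nbhs_eballP; exists r. Qed.

Lemma measurable_eball x r : measurable (eball x r).
Proof. by apply: open_measurable_mx; exact: eball_open. Qed.

Lemma enorm_continuous : continuous (@enorm R n).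
Proof.
move=> x; apply/(@cvgrPdist_lt _ _ _ (nbhs x) (nbhs_filter x)) => e e0; apply: filterS (eball_nbhs x e0) => y.
rewrite /eball/= ltr_norml => yx.
have := enorm_triangle x y 0; have := enorm_triangle y x 0.
rewrite !subr0 (enorm_sub x y) => h1 h2; apply/andP; split; lra.
Qed.

Lemma closed_eball x r : closed [set y | enorm (y - x) <= r].
Proof.
rewrite [X in closed X](_ : _ = ~` [set y | r < enorm (y - x)]); last first.
  by apply/seteqP; split => y /=; rewrite leNgt => /negP.
apply: open_closedC; rewrite openE => y ry.
apply/nbhs_eballP; exists (enorm (y - x) - r); first by rewrite subr_gt0.
move=> z; rewrite /eball/= => zy; have := enorm_triangle z y x.
by rewrite (enorm_sub y z) => h; lra.
Qed.

Lemma compact_eball x r : compact [set y | enorm (y - x) <= r].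
Proof.
apply: bounded_closed_compact; last exact: closed_eball.
exists (r + enorm x); split; first exact: num_real.
move=> M M0 y /= yx; have := enorm_triangle x y 0; rewrite !subr0 => h.
by rewrite (le_trans (norm_le_enorm _))//; lra.
Qed.

Lemma continuous_measurable_rV (f : 'rV[R]_n -> R) :
  continuous f -> measurable_fun setT f.
Proof.
move=> cf; apply: (measurability _ (RGenOpens.measurableE R)).
move=> _ [_ [a [b ->] <-]]; rewrite setTI.
by apply: open_measurable_mx; apply: open_comp; [|exact: interval_open].
Qed.

Lemma measurable_enorm : measurable_fun setT (@enorm R n).
Proof. by apply: continuous_measurable_rV; exact: enorm_continuous. Qed.

Lemma measurable_enormB d (T : measurableType d) (f g : T -> 'rV[R]_n) :
  measurable_fun setT f -> measurable_fun setT g ->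
  measurable_fun setT (fun t => enorm (f t - g t)).
Proof.
move=> mf mg; apply: (measurableT_comp measurable_enorm).
apply: measurable_rV => i.
rewrite (_ : (fun t => _) = (fun t => f t ord0 i - g t ord0 i)); last first.
  by apply/funext => t; rewrite !mxE.
by apply: measurable_funB; exact: (measurableT_comp (measurable_coord i)).
Qed.

End euclidean_norm.
#[global] Hint Resolve enorm_ge0 : core.

Section lower_integrals.
Local Open Scope ereal_scope.
Context d (T : measurableType d) (R : realType).
Import HBNNSimple.
Variable nu : {measure set T -> \bar R}.
Implicit Types (f g : T -> \bar R) (D N : set T).

(* For a function that is not measurable, the integral is the supremum of the
   integrals of the simple functions below it. *)
Lemma le_integral_ge0 D f g : (forall x, D x -> 0 <= f x) ->
  (forall x, D x -> f x <= g x) ->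
  \int[nu]_(x in D) f x <= \int[nu]_(x in D) g x.
Proof.
move=> f0 fg; rewrite !ge0_integralE//; last first.
  by move=> x Dx; rewrite (le_trans (f0 x Dx))// fg.
apply: le_ereal_sup => _ [h /= hf <-]; exists h => //= x.
rewrite (le_trans (hf x))// /patch; case: ifPn => // /set_mem Dx; exact: fg.
Qed.

Lemma integral_le_abs D f :
  \int[nu]_(x in D) f x <= \int[nu]_(x in D) `|f x|.
Proof.
rewrite integralE; apply: (@le_trans _ _ (\int[nu]_(x in D) f^\+ x)).
  by rewrite geeDl// oppe_le0 integral_ge0.
apply: le_integral_ge0 => x _; first exact: funepos_ge0.
by rewrite funeposE ge_max lee_abs abse_ge0.
Qed.

(** Holds for arbitrary [f], because the integral is a supremum over simple functions below [f], and
    the integral of each of these ignores [N]. *)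
Lemma ge0_integral_setD_null D N f : measurable N -> nu N = 0 ->
  (forall x, D x -> 0 <= f x) ->
  \int[nu]_(x in D) f x = \int[nu]_(x in D `\` N) f x.
Proof.
move=> mN N0 f0; apply/eqP; rewrite eq_le; apply/andP; split; last first.
  rewrite -[leRHS]/(integral _ D f) setDE integral_mkcondr.
  apply: le_integral_ge0 => x Dx; rewrite /patch; case: ifPn => // _; exact: f0.
rewrite {1}ge0_integralE//; apply: ge_ereal_sup => _ [h /= hf <-].
have -> : sintegral nu h = \int[nu]_x (h x)%:E.
  by rewrite (integral_nnsfun nu measurableT) patch_setT.
rewrite (ge0_negligible_integral mN measurableT)//; last 2 first.
  by apply/measurable_EFinP; exact: measurable_funP.
  by move=> x _; rewrite lee_fin; exact: fun_ge0.
rewrite setTD setDE setIC integral_mkcondr.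
apply: le_integral_ge0 => x Nx; first by rewrite lee_fin; exact: fun_ge0.
exact: hf.
Qed.

Lemma integral_setD_null D N f : measurable N -> nu N = 0 ->
  \int[nu]_(x in D) f x = \int[nu]_(x in D `\` N) f x.
Proof.
move=> mN N0; rewrite integralE [RHS]integralE.
by congr (_ - _); apply: ge0_integral_setD_null.
Qed.

End lower_integrals.

(** * Functions measurable for the completed measure *)

Section completion.
Context {R : realType} {n : nat} (nu : {measure set 'rV[R]_n -> \bar R}).
Implicit Types (D N : set 'rV[R]_n) (f : 'rV[R]_n -> R).

(** The preimage of each ray with rational endpoint is Borel off a null set. The union of these
    countably many null sets serves all rays at once, and rays generate the Borel sets. *)
Lemma nu_measurable_fun_Borel D f : measurable D -> nu_measurable_fun nu D f ->
  exists N, [/\ measurable N, nu N = 0%E & measurable_fun (D `\` N) f].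
Proof.
move=> mD mf.
have H (q : rat) : exists N, [/\ measurable N, nu N = 0%E &
    measurable ((D `\` N) `&` f @^-1` `]ratr q, +oo[)].
  have [A mA [P [N [mN N0 PN]] APD]] := mf _ (measurable_itv `]ratr q, +oo[).
  exists N; split => //.
  suff -> : (D `\` N) `&` f @^-1` `]ratr q, +oo[ = (A `\` N) by exact: measurableD.
  rewrite setDE setIAC -setDE -APD setDUl; apply/seteqP; split => x.
    by move=> [//|[/PN]].
  by move=> ?; left.
(* Re-indexing the rationals by [nat] lets the null sets form a sequence; indices that code no
   rational get the empty set. *)
have {}H (k : nat) : exists N, [/\ measurable N, nu N = 0%E &
    forall q : rat, pickle q = k ->
      measurable ((D `\` N) `&` f @^-1` `]ratr q, +oo[)].
  case Ek : (unpickle k) => [q|].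
    have [N [mN N0 DN]] := H q; exists N; split => // p pk.
    by move: Ek; rewrite -pk pickleK => -[->].
  by exists set0; split => // q qk; move: Ek; rewrite -qk pickleK.
have [N_ N_P] := choice H.
have mN k : measurable (N_ k) by have [] := N_P k.
have mU : measurable (\bigcup_k N_ k) by exact: bigcup_measurable.
exists (\bigcup_k N_ k); split => //.
  apply/(negligibleP nu mU)/negligible_bigcup => k.
  by apply/negligibleP => //; have [] := N_P k.
have mDU : measurable (D `\` \bigcup_k N_ k) by exact: measurableD.
apply: (measurability _ (RGenOInfty.measurableE R)) => //.
move=> _ [_ [x ->] <-].
rewrite (_ : `]x, +oo[%classic = \bigcup_q (if x < ratr q :> R then `]ratr (q : rat), +oo[%classic else set0)); last first.
  apply/seteqP; split => y /=.
    rewrite in_itv/= andbT => xy; have [q] := rat_in_itvoo xy.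
    by rewrite in_itv/= => /andP[xq qy]; exists q => //=; rewrite xq/= in_itv/= andbT.
  move=> [q _ /=]; case: ifPn => // xq; rewrite /= !in_itv/= !andbT; exact: lt_trans.
rewrite preimage_bigcup setI_bigcupr.
apply: countable_bigcupT_measurable => [|q]; first exact: countableP.
case: ifPn => _; last by rewrite preimage_set0 setI0.
have [_ _ /(_ q erefl) mq] := N_P (pickle q).
rewrite (_ : _ `&` _ = ((D `\` N_ (pickle q)) `&` f @^-1` `]ratr q, +oo[)
   `&` ~` \bigcup_k N_ k); first by apply: measurableI => //; exact: measurableC.
apply/seteqP; split => y /=.
  by move=> [[Dy Uy] yq]; split => //; split => //; split => // Ny; apply: Uy; exists (pickle q).
by move=> [[[Dy Uy] yq] Vy].
Qed.

Lemma Borel_nu_measurable_fun D N f : measurable D -> measurable N ->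
  nu N = 0%E -> measurable_fun (D `\` N) f -> nu_measurable_fun nu D f.
Proof.
move=> mD mN N0 mf B mB; exists ((D `\` N) `&` f @^-1` B).
  by apply: mf => //; exact: measurableD.
exists ((D `&` N) `&` f @^-1` B).
  by exists N; split => // x [[]].
rewrite -setIUl; congr (_ `&` _); apply/seteqP; split=> x; first by move=> [[]|[]].
by move=> Dx; have [Nx|Nx] := pselect (N x); [right|left].
Qed.

End completion.

(** * Smooth partitions of unity on dyadic lattices *)

Section Ck_functions.
Context {R : realType} {n : nat}.
Implicit Types (f g : 'rV[R]_n -> R) (x : 'rV[R]_n).
Local Notation e_ i := (delta_mx ord0 i : 'rV[R]_n).

(** Counting one derivative at a time allows induction on [k] for sums, products, inverses and
    gluing; [smoothP] converts to [smooth], which quantifies over sequences of directions. *)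
Fixpoint Ck (k : nat) f : Prop := continuous f /\
  if k is k'.+1 then
    forall i, (forall x, derivable f x (e_ i)) /\ Ck k' (partial i f)
  else True.

Lemma Ck_continuous k f : Ck k f -> continuous f.
Proof. by case: k => [|k] []. Qed.

Lemma CkW k f : Ck k.+1 f -> Ck k f.
Proof.
elim: k f => [|k IH] f [cf fS]; split=> // i.
by have [df /IH] := fS i.
Qed.

Lemma CkS_derive k f (d : 'I_n -> 'rV[R]_n -> R) : continuous f ->
  (forall i x, is_derive x (e_ i) f (d i x)) -> (forall i, Ck k (d i)) ->
  Ck k.+1 f.
Proof.
move=> cf fd Cd; split => // i; split=> [x|]; first by have [] := fd i x.
rewrite (_ : partial i f = d i)//; apply/funext => x.
by have [_] := fd i x.
Qed.

Lemma smoothP f : smooth f <-> forall k, Ck k f.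
Proof.
split=> [sf k|Cf s].
  rewrite -[f]/(foldr partial f [::]).
  elim: k [::] => [|k IH] s; have [cg dg] := sf s; split=> // i.
  by split=> [x|]; [exact: dg|exact: (IH (i :: s))].
have {}Cf k : Ck k (foldr partial f s).
  by elim: s k => [//|i s IH] k /=; have [_ /(_ i)[]] := IH k.+1.
split=> [|i x]; first exact: Ck_continuous (Cf 0%N).
by have [_ /(_ i)[]] := Cf 1%N.
Qed.

Lemma near_eq_continuous_at f g x : (\forall y \near x, f y = g y) ->
  {for x, continuous g} -> {for x, continuous f}.
Proof.
move=> gf; have fx : f x = g x := nbhs_singleton gf.
rewrite /prop_for /continuous_at fx => cg.
apply: (cvg_trans _ cg); apply: (@near_eq_cvg _ _ (nbhs x) (nbhs_filter x)).
by apply: filterS gf => y ->.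
Qed.

(** Regularity is local, so functions given by different formulas in different places, such as
    [scaled_sum] and [ext_approx], can be treated one neighbourhood at a time. *)
Lemma Ck_local k f :
  (forall x, exists2 g, Ck k g & \forall y \near x, f y = g y) -> Ck k f.
Proof.
elim: k f => [|k IH] f fg.
  split => // x; have [g [cg _] gf] := fg x.
  exact: near_eq_continuous_at gf (cg x).
split=> [x|i].
  have [g [cg _] gf] := fg x.
  exact: near_eq_continuous_at gf (cg x).
split=> [x|].
  have [g [_ /(_ i)[dg _]] gf] := fg x.
  by apply: near_eq_derivable (dg x); apply: filterS gf => y ->.
apply: IH => x; have [g [_ /(_ i)[dg Cg]] gf] := fg x.
exists (partial i g) => //.
(* Agreement near [x] is agreement near every point close to [x], so the partial derivatives agree
   near [x] too and the induction hypothesis applies to them. *)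
have := nbhs_interior gf; apply: filterS => y.
by rewrite /interior/= => yfg; apply: near_eq_derive.
Qed.

Lemma Ck_cst k (c : R) : Ck k (fun=> c).
Proof.
elim: k c => [|k IH] c; first by split => //; exact: cst_continuous.
apply: (@CkS_derive _ _ (fun=> fun=> 0)) => //; exact: cst_continuous.
Qed.

Lemma CkD k f g : Ck k f -> Ck k g -> Ck k (fun x => f x + g x).
Proof.
elim: k f g => [|k IH] f g [cf Cf] [cg Cg].
  by split => // x; apply: continuousD; [exact: cf|exact: cg].
apply: (@CkS_derive _ _ (fun i x => partial i f x + partial i g x)).
- by move=> x; apply: continuousD; [exact: cf|exact: cg].
- move=> i x; have [df _] := Cf i; have [dg _] := Cg i.
  by apply: is_deriveD; apply: derivableP.
- by move=> i; apply: IH; [have [] := Cf i|have [] := Cg i].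
Qed.

Lemma CkM k f g : Ck k f -> Ck k g -> Ck k (fun x => f x * g x).
Proof.
elim: k f g => [|k IH] f g Cf Cg.
  have [cf _] := Cf; have [cg _] := Cg.
  by split => // x; apply: continuousM; [exact: cf|exact: cg].
apply: (@CkS_derive _ _ (fun i x => f x * partial i g x + g x * partial i f x)).
- by move=> x; apply: continuousM; [exact: (Ck_continuous Cf)|exact: (Ck_continuous Cg)].
- move=> i x; have [_ /(_ i)[df _]] := Cf; have [_ /(_ i)[dg _]] := Cg.
  by apply: is_deriveM; apply: derivableP.
- move=> i; apply: CkD; apply: IH; try exact: CkW.
    by have [_ /(_ i)[]] := Cg.
  by have [_ /(_ i)[]] := Cf.
Qed.

Lemma CkV k f : (forall x, f x != 0) -> Ck k f -> Ck k (fun x => (f x)^-1).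
Proof.
move=> f0; elim: k => [|k IH] Cf.
  by have [cf _] := Cf; split => // x; apply: continuousV => //; exact: cf.
apply: (@CkS_derive _ _
  (fun i x => -1 * (((f x)^-1 * (f x)^-1) * partial i f x))).
- by move=> x; apply: continuousV => //; exact: (Ck_continuous Cf).
- move=> i x; have [_ /(_ i)[df _]] := Cf.
  apply: DeriveDef; first exact: derivableV.
  by rewrite deriveV// mulN1r -mulNr -expr2 exprVn.
- have Cfk := IH (CkW Cf).
  move=> i; apply: CkM; first exact: Ck_cst.
  by apply: CkM; [exact: CkM|have [_ /(_ i)[]] := Cf].
Qed.

Lemma Ck_sum k (I : Type) (s : seq I) (F : I -> 'rV[R]_n -> R) :
  (forall i, Ck k (F i)) -> Ck k (fun x => \sum_(i <- s) F i x).
Proof.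
move=> CF; elim: s => [|i s IH].
  by under eq_fun do rewrite big_nil; exact: Ck_cst.
by under eq_fun do rewrite big_cons; exact: CkD.
Qed.

Lemma Ck_prod k (I : Type) (s : seq I) (F : I -> 'rV[R]_n -> R) :
  (forall i, Ck k (F i)) -> Ck k (fun x => \prod_(i <- s) F i x).
Proof.
move=> CF; elim: s => [|i s IH].
  by under eq_fun do rewrite big_nil; exact: Ck_cst.
by under eq_fun do rewrite big_cons; exact: CkM.
Qed.

(** Reduces a directional derivative to a derivative on the real line, where the chain rule is
    applied. *)
Lemma is_derive_lineP f x v (d : R) : is_derive x v f d <->
  is_derive (0 : R) (1 : R) (fun h => f (h *: v + x)) d.
Proof.
have E : 'D_v f x = 'D_1 (fun h : R => f (h *: v + x)) 0.
  rewrite /derive; set g1 := fun h => h^-1 *: _; set g2 := fun h => h^-1 *: _.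
  suff -> : g1 = g2 by [].
  by rewrite funeqE /g1 /g2 => h /=; rewrite addr0 scale0r add0r [_%:A]mulr1.
split=> -[df dE]; apply: DeriveDef; [|by rewrite -E| |by rewrite E].
  exact/(derivable1P f x v).
exact/(derivable1P f x v).
Qed.

Lemma is_derive_scale1 (a t : R) : is_derive t 1 (fun h : R => a * h) a.
Proof.
have := is_deriveM (is_derive_cst a t 1) (is_derive_id t 1).
rewrite (_ : cst a * id = (fun h => a * h))// => /is_derive_eq; apply.
by rewrite scaler0 addr0 /GRing.scale/= mulr1.
Qed.

Lemma is_derive_affine1 (a b t : R) : is_derive t 1 (fun h : R => a * h + b) a.
Proof.
have := is_deriveD (is_derive_scale1 a t) (is_derive_cst b t 1).
rewrite (_ : _ + cst b = (fun h => a * h + b))// => /is_derive_eq; apply.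
by rewrite addr0.
Qed.

Lemma is_derive_scale_shift f (a : R) b x v d :
  is_derive (a *: x + b) v f d -> is_derive x v (fun y => f (a *: y + b)) (a * d).
Proof.
move=> /is_derive_lineP fd; apply/is_derive_lineP.
rewrite (_ : (fun h => _) =
   (fun h => f (h *: v + (a *: x + b))) \o (fun h => a * h)); last first.
  by apply/funext => h /=; rewrite scalerDr scalerA addrA.
rewrite mulrC; apply: is_derive1_comp; last exact: is_derive_scale1.
by rewrite mulr0.
Qed.

Lemma continuous_scale_shift f (a : R) (b : 'rV[R]_n) :
  continuous f -> continuous (fun y : 'rV[R]_n => f (a *: y + b)).
Proof.
move=> cf x.
have c1 : {for x, continuous (fun y : 'rV[R]_n => a *: y + b)}.
  apply: continuousD; last exact: cst_continuous.
  exact: scaler_continuous.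
exact: (continuous_comp c1 (cf _)).
Qed.

Lemma Ck_scale_shift k f (a : R) b : Ck k f -> Ck k (fun y => f (a *: y + b)).
Proof.
elim: k f => [|k IH] f [cf Cf].
  by split => //; exact: continuous_scale_shift.
apply: (@CkS_derive _ _ (fun i x => a * partial i f (a *: x + b))).
- exact: continuous_scale_shift.
- move=> i x; apply: is_derive_scale_shift; have [df _] := Cf i.
  exact: derivableP.
- by move=> i; apply: CkM; [exact: Ck_cst|apply: IH; have [] := Cf i].
Qed.

End Ck_functions.

(** * Flat functions and a smooth step *)

Section flat.
Context {R : realType}.
Implicit Types (p : {poly R}) (t : R).

(* The derivative of [flat p] is again some [flat q]. *)
Definition flat p t : R := if 0 < t then p.[t^-1] * expR (- t^-1) else 0.

Lemma horner_le_expR p (k : nat) : exists2 c, 0 <= c &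
  forall s, 0 < s -> `|p.[s]| * s ^+ k <= c * expR s.
Proof.
have pow (j : nat) (s : R) : 0 < s -> s ^+ j <= j`!%:R * expR s.
  case: j => [|j] s0.
    rewrite expr0 mul1r; have := expR_ge1Dx s; lra.
  rewrite -ler_pdivrMl ?ltr0n ?fact_gt0// mulrC.
  by have := expR_ge1Dxn j (ltW s0); lra.
elim/poly_ind: p k => [|p c0 IH] k.
  by exists 0 => // s s0; rewrite horner0 normr0 !mul0r.
have [c c_ge0 Hc] := IH k.+1.
exists (c + `|c0| * k`!%:R) => [|s s0]; first by rewrite addr_ge0// mulr_ge0.
rewrite !hornerE mulrDl (le_trans (ler_wpM2r _ (ler_normD _ _)))//.
  by rewrite exprn_ge0// ltW.
rewrite mulrDl lerD//.
  by rewrite normrM (gtr0_norm s0) -mulrA -exprS Hc.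
by rewrite -mulrA ler_wpM2l// pow.
Qed.

(** Applied to [p * 'X], this bounds the difference quotient of [flat p] at [0]. *)
Lemma flat_le p : exists2 c, 0 <= c & forall t, `|flat p t| <= c * `|t|.
Proof.
have [c c0 Hc] := horner_le_expR p 1; exists c => // t; rewrite /flat.
case: ifPn => [t0|_]; last by rewrite normr0 mulr_ge0.
have := Hc t^-1; rewrite invr_gt0 => /(_ t0).
rewrite expr1 normrM (gtr0_norm (expR_gt0 _)) (gtr0_norm t0) expRN.
move=> h; rewrite ler_pdivrMr ?expR_gt0//; move: h.
by rewrite ler_pdivrMr ?invr_gt0// ?ler_pdivrMr// mulrAC.
Qed.

Lemma is_derive_inv t : t != 0 ->
  is_derive t 1 (fun s : R => s^-1) (- t ^- 2).
Proof.
move=> t0; apply: DeriveDef; first exact: (@derivableV _ _ id).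
by rewrite (@deriveV _ _ id)// derive_id /GRing.scale/= mulr1.
Qed.

(** For positive [t] this is the chain rule, the factor [t ^- 2] being absorbed as ['X^2]. At [0]
    the difference quotient is [flat (p * 'X)], which is [O(|t|)]. *)
Lemma is_derive_flat p t :
  is_derive t 1 (flat p) (flat ('X^2 * (p - p^`())) t).
Proof.
have [t0|t0|->] := ltgtP t 0.
- rewrite {2}/flat ltNge (ltW t0)/=.
  have H0 : is_derive t (1 : R) (fun=> 0 : R) (0 : R) by exact: is_derive_cst.
  apply: near_eq_is_derive H0.
  apply: filterS (lt_nbhsl t0) => s s0; by rewrite /flat ltNge (ltW s0).
- have t1 : t != 0 by rewrite gt_eqF.
  apply: (@near_eq_is_derive _ _ _
    ((horner p \o (fun s => s^-1)) * (expR \o (fun s => -1 * s^-1)))).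
    apply: filterS (lt_nbhsr t0) => s s0.
    change (p.[s^-1] * expR (-1 * s^-1) = flat p s).
    by rewrite /flat s0 mulN1r.
  have d1 := is_derive_inv t1.
  have d2 : is_derive t 1 (fun s => -1 * s^-1) (-1 * - t ^- 2) :=
    is_derive1_comp (is_derive_scale1 (-1) t^-1) d1.
  have := is_deriveM (is_derive1_comp (is_derive_poly p t^-1) d1)
    (@is_derive1_comp _ expR (fun s => -1 * s^-1) _ _ _ (is_derive_expR _) d2).
  move=> /is_derive_eq; apply.
  rewrite /flat t0 hornerM hornerXn hornerD hornerN.
  change (p.[t^-1] * (expR (-1 * t^-1) * (-1 * - t ^- 2)) +
    expR (-1 * t^-1) * (p^`().[t^-1] * - t ^- 2) =
    t^-1 ^+ 2 * (p.[t^-1] - p^`().[t^-1]) * expR (- t^-1)).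
  rewrite (mulN1r t^-1) -exprVn.
  ring.
- rewrite {2}/flat ltxx; have [c c0 Hc] := flat_le (p * 'X).
  have H : (fun h : R => h^-1 *: ((flat p \o shift 0) (h *: 1) - flat p 0)) @ 0^' --> (0 : R).
    apply/cvgrPdist_le => e e0; near=> h.
    have h0 : h != 0 by near: h; exact: nbhs_dnbhs_neq.
    rewrite sub0r normrN /= addr0 {2}/flat ltxx subr0 /GRing.scale/= mulr1.
    have -> : h^-1 * flat p h = flat (p * 'X) h.
      rewrite /flat; case: ifP => _; last by rewrite mulr0.
      by rewrite hornerMX mulrA [h^-1 * _]mulrC.
    rewrite (le_trans (Hc h))// (@le_trans _ _ ((c + 1) * `|h|))//.
      by rewrite ler_wpM2r// lerDl.
    rewrite mulrC -ler_pdivlMr ?ltr_wpDl//.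
    near: h; apply: dnbhs0_le; by rewrite divr_gt0// ltr_wpDl.
  by apply: DeriveDef; [apply/cvg_ex; exists 0|exact/cvg_lim].
Unshelve. all: by end_near. Qed.

Lemma continuous_flat p : continuous (flat p).
Proof.
move=> t; apply/differentiable_continuous/derivable1_diffP.
by have [] := is_derive_flat p t.
Qed.

(** The standard transition from [0] to [1] over the unit interval. The denominator is positive
    because [t] and [1 - t] are never both nonpositive. *)
Definition smooth_step t : R := flat 1 t / (flat 1 t + flat 1 (1 - t)).

Lemma flat1_ge0 t : 0 <= flat 1 t.
Proof. by rewrite /flat; case: ifP => // _; rewrite hornerE mul1r expR_ge0. Qed.

Lemma flat1_gt0 t : 0 < t -> 0 < flat 1 t.
Proof. by move=> t0; rewrite /flat t0 hornerE mul1r expR_gt0. Qed.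

Lemma flat1_eq0 t : t <= 0 -> flat 1 t = 0.
Proof. by rewrite /flat ltNge => ->. Qed.

Lemma flat1_den t : 0 < flat 1 t + flat 1 (1 - t).
Proof.
have [t0|t0] := ltP 0 t.
  by rewrite ltr_pwDl ?flat1_gt0 ?flat1_ge0.
by rewrite ltr_wpDl ?flat1_ge0// flat1_gt0//; lra.
Qed.

Lemma smooth_step0 t : t <= 0 -> smooth_step t = 0.
Proof. by move=> t0; rewrite /smooth_step flat1_eq0// mul0r. Qed.

Lemma smooth_step1 t : 1 <= t -> smooth_step t = 1.
Proof.
move=> t1; rewrite /smooth_step (@flat1_eq0 (1 - t)); last by lra.
by rewrite addr0 divff// gt_eqF// flat1_gt0//; lra.
Qed.

Lemma smooth_step_ge0 t : 0 <= smooth_step t.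
Proof. by rewrite divr_ge0 ?flat1_ge0// ltW// flat1_den. Qed.

Lemma smooth_step_le1 t : smooth_step t <= 1.
Proof. by rewrite ler_pdivrMr ?flat1_den// mul1r lerDl flat1_ge0. Qed.

Definition hat t : R := smooth_step (t + 1) - smooth_step t.

Lemma hat_ge0 t : 0 <= hat t.
Proof.
rewrite /hat; have [t0|t0] := lerP t 0.
  by rewrite (smooth_step0 t0) subr0 smooth_step_ge0.
by rewrite smooth_step1 ?subr_ge0 ?smooth_step_le1//; lra.
Qed.

Lemma hat_eq0 t : 1 <= `|t| -> hat t = 0.
Proof.
rewrite /hat ler_normr => /orP[t1|t1].
  by rewrite !smooth_step1 ?subrr//; lra.
by rewrite !smooth_step0 ?subrr//; lra.
Qed.

End flat.

Section tensor_bump.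
Context {R : realType} {n : nat}.

(** The induction needs all polynomials at once, since differentiation replaces [p] by another
    polynomial. *)
Lemma Ck_flat_coord k (p : {poly R}) (a b : R) (i : 'I_n) :
  Ck k (fun x : 'rV[R]_n => flat p (a * x ord0 i + b)).
Proof.
have cf (q : {poly R}) : continuous (fun x : 'rV[R]_n => flat q (a * x ord0 i + b)).
  move=> x; apply: (@continuous_comp _ _ _ (fun x : 'rV[R]_n => a * x ord0 i + b) (flat q));
    last exact: continuous_flat.
  apply: continuousD; last exact: cst_continuous.
  apply: continuousM; [exact: cst_continuous|exact: coord_continuous].
elim: k p => [|k IH] p; first by split => //; exact: cf.
apply: (@CkS_derive _ _ _ _ (fun j x => (a * (j == i)%:R) *
  flat ('X^2 * (p - p^`())) (a * x ord0 i + b))) => //.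
- move=> j x; apply/is_derive_lineP.
  rewrite (_ : (fun h => _) = flat p \o
    (fun h => (a * (j == i)%:R) * h + (a * x ord0 i + b))); last first.
    apply/funext => h /=; rewrite !mxE eqxx/= eq_sym; congr flat; ring.
  rewrite [X in is_derive _ _ _ X]mulrC.
  apply: is_derive1_comp; last exact: is_derive_affine1.
  rewrite mulr0 add0r; exact: is_derive_flat.
- by move=> j; apply: CkM; [exact: Ck_cst|exact: IH].
Qed.

Lemma Ck_smooth_step k (a b : R) (i : 'I_n) :
  Ck k (fun x : 'rV[R]_n => smooth_step (a * x ord0 i + b)).
Proof.
have E (y : R) : 1 - (a * y + b) = (- a) * y + (1 - b) by ring.
apply: CkM; first exact: Ck_flat_coord.
apply: CkV => [x|]; first by rewrite gt_eqF// flat1_den.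
apply: CkD; first exact: Ck_flat_coord.
by under eq_fun do rewrite E; exact: Ck_flat_coord.
Qed.

Definition tensor_bump (x : 'rV[R]_n) : R := \prod_i hat (x ord0 i).

Lemma Ck_bump k : Ck k tensor_bump.
Proof.
apply: Ck_prod => i; rewrite /hat.
have E (x : 'rV[R]_n) : smooth_step (x ord0 i + 1) - smooth_step (x ord0 i) =
    smooth_step (1 * x ord0 i + 1) + -1 * smooth_step (1 * x ord0 i + 0).
  by rewrite !mul1r addr0 mulN1r.
under eq_fun do rewrite E; apply: CkD; first exact: Ck_smooth_step.
by apply: CkM; [exact: Ck_cst|exact: Ck_smooth_step].
Qed.

Lemma bump_ge0 x : 0 <= tensor_bump x.
Proof. by apply: prodr_ge0 => i _; exact: hat_ge0. Qed.

Lemma bump_eq0 (x : 'rV[R]_n) i : 1 <= `|x ord0 i| -> tensor_bump x = 0.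
Proof. by move=> xi; rewrite /tensor_bump (bigD1 i)//= hat_eq0// mul0r. Qed.

(** A continuous derivative is bounded on the compact ball of radius [n]; outside that ball some
    coordinate exceeds [1] in absolute value, and the bump vanishes nearby. *)
Lemma partial_bump_bounded :
  exists2 C : R, 0 < C & forall i x, `|partial i tensor_bump x| <= C.
Proof.
have H i : exists M : R, forall x, `|partial i tensor_bump x| <= M.
  have [_ /(_ i)[_ Cp]] := Ck_bump 1.
  pose K := [set y : 'rV[R]_n | enorm (y - 0) <= n%:R].
  have [c _ Hc] : exists2 c, c \in K & forall t, t \in K -> `|partial i tensor_bump t| <= `|partial i tensor_bump c|.
    apply: EVT_max_rV; first by exists 0; rewrite /K/= subrr enorm0.
      exact: compact_eball.
    apply: continuous_subspaceT => x.
    apply: (@continuous_comp _ _ _ (partial i tensor_bump) (fun r : R => `|r|)).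
      exact: (proj1 Cp).
    exact: norm_continuous.
  exists `|partial i tensor_bump c| => x.
  have [xK|xK] := pselect (K x); first by apply: Hc; rewrite inE.
  have [j xj] : exists j, 1 < `|x ord0 j|.
    apply: contrapT => /forallNP H; apply: xK; rewrite /K/= subr0.
    by rewrite -[n%:R]mulr1 enorm_le_max// => j; rewrite leNgt; apply/negP.
  rewrite /partial (@near_eq_derive _ _ _ _ (cst 0)) ?derive_cst ?normr0//.
  apply/nbhs_eballP; exists (`|x ord0 j| - 1); first by rewrite subr_gt0.
  move=> y; rewrite /eball/= => yx; apply: (bump_eq0 (i := j)).
  have := coord_le_enorm (y - x) j; rewrite !mxE => h.
  have := lerB_dist (x ord0 j) (y ord0 j); rewrite distrC; lra.
have [M HM] := choice H.
exists (1 + \sum_i `|M i|) => [|i x]; first by rewrite ltr_pwDl// sumr_ge0.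
rewrite (le_trans (HM i x))// (le_trans (ler_norm _))// (bigD1 i)//=.
by rewrite addrCA lerDl addr_ge0// sumr_ge0.
Qed.

End tensor_bump.

(** * Lattice partitions of unity *)

Section lattice_sums.
Context {R : realType} {n : nat}.
Local Notation lattice := {ffun 'I_n -> int}.
Implicit Types (c : lattice -> R) (x y : 'rV[R]_n) (w z : lattice).

Definition lattice_point z : 'rV[R]_n := \row_i (z i)%:~R.

(** With the offset [-1] and width [4], the box contains every lattice point at distance less than
    [2] from [y] in each coordinate. A bump reaches only to distance [1], so the box of [y] still
    serves all points within [1] of [y]. *)
Definition box_corner y : lattice := [ffun i => Num.floor (y ord0 i) - 1].

Definition box_point w (e : {ffun 'I_n -> 'I_4}) : lattice :=
  [ffun i => w i + (e i : nat)%:Z].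

(* The integer translates of [tensor_bump] sum to [1], and those that do not vanish
   near [y] are centered in the box with lowest corner [box_corner y]. *)
Definition lattice_sum c y : R := \sum_e
  c (box_point (box_corner y) e) *
  tensor_bump (y - lattice_point (box_point (box_corner y) e)).

Lemma box_pointP w z :
  reflect (exists e, z = box_point w e) [forall i, w i <= z i < w i + 4].
Proof.
apply: (iffP forallP) => [h|[e ->] i]; last first.
  by rewrite ffunE lerDl ltrD2l/= ltz_nat ltn_ord.
have h4 i : (absz (z i - w i)%R < 4)%N.
  have /andP[h1 h2] := h i; rewrite -ltz_nat gez0_abs ?subr_ge0//.
  by rewrite ltrBlDl.
exists [ffun i => Ordinal (h4 i)]; apply/ffunP => i; rewrite !ffunE/=.
by have /andP[h1 h2] := h i; rewrite gez0_abs ?subr_ge0// addrC subrK.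
Qed.

Lemma box_point_inj w : injective (box_point w).
Proof.
move=> e e' /ffunP ee'; apply/ffunP => i; apply/val_inj.
by have := ee' i; rewrite !ffunE => /addrI[].
Qed.

(** Each side is the sum of [F] over the same finite support, which both boxes contain and, by
    injectivity of [box_point], list without repetition. *)
Lemma eq_box_sum w w' (F : lattice -> R) :
  (forall z, F z != 0 -> [forall i, w i <= z i < w i + 4] /\
                         [forall i, w' i <= z i < w' i + 4]) ->
  \sum_e F (box_point w e) = \sum_e F (box_point w' e).
Proof.
move=> HF.
have E v : \sum_e F (box_point v e) =
    \sum_(z <- seq.filter (fun z => F z != 0) (map (box_point v) (index_enum _))) F z.
  rewrite big_filter big_map [RHS]big_mkcond; apply: eq_bigr => e _.
  by case: ifPn => //; rewrite negbK => /eqP.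
rewrite !E; apply/perm_big/uniq_perm.
- by rewrite filter_uniq// map_inj_uniq ?index_enum_uniq//; exact: box_point_inj.
- by rewrite filter_uniq// map_inj_uniq ?index_enum_uniq//; exact: box_point_inj.
move=> z; rewrite !mem_filter; case: (boolP (F z != 0)) => //= Fz.
have [/box_pointP[e ->] /box_pointP[e' zE]] := HF z Fz.
rewrite (map_f (box_point w) (mem_index_enum e)).
by rewrite zE (map_f (box_point w') (mem_index_enum e')).
Qed.

Lemma box_near x y z : (forall i, `|y ord0 i - x ord0 i| < 1) ->
  tensor_bump (y - lattice_point z) != 0 ->
  [forall i, box_corner x i <= z i < box_corner x i + 4].
Proof.
move=> yx yz; apply/forallP => i; rewrite ffunE.
have {yz} : `|(y - lattice_point z) ord0 i| < 1.
  by rewrite ltNge; apply: contra yz => h; rewrite (bump_eq0 h).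
rewrite !mxE => yz; have := yx i; have := floor_itv (x ord0 i).
rewrite !ltr_norml in yz *.
set f := Num.floor _ => /andP[f1 f2] /andP[h1 h2].
have /andP[h3 h4] := yz.
rewrite intrD in f2.
have : f%:~R - 2 < (z i)%:~R :> R by lra.
have : (z i)%:~R < f%:~R + 3 :> R by lra.
have -> : f%:~R + 3 = (f + 3)%:~R :> R by rewrite intrD.
have -> : f%:~R - 2 = (f - 2)%:~R :> R by rewrite intrB.
rewrite !ltr_int => h5 h6; apply/andP; split; lia.
Qed.

(** Freezes the box: near [x] the sum is one fixed finite combination of bumps and can be
    differentiated term by term. *)
Lemma lattice_sum_near c x y : (forall i, `|y ord0 i - x ord0 i| < 1) ->
  lattice_sum c y = \sum_e c (box_point (box_corner x) e) *
    tensor_bump (y - lattice_point (box_point (box_corner x) e)).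
Proof.
move=> yx; apply: (@eq_box_sum _ _ (fun z => c z * tensor_bump (y - lattice_point z))).
move=> z; rewrite mulf_eq0 negb_or => /andP[_ yz]; split; last exact: box_near yz.
by apply: box_near yz => i; rewrite subrr normr0.
Qed.

(** With [s] the fractional part of [t], the four terms telescope to [smooth_step (s + 2) -
    smooth_step (s - 2)]. *)
Lemma hat_partition (t : R) :
  \sum_(j < 4) hat (t - (Num.floor t - 1 + (j : nat)%:Z)%:~R) = 1.
Proof.
have := floor_itv t; set f := Num.floor t; rewrite intrD => /andP[f1 f2].
rewrite !big_ord_recr big_ord0 /= add0r.
set s := t - f%:~R.
have E (j : nat) : t - (f - 1 + j%:Z)%:~R = s + 1 - j%:R.
  by rewrite intrD intrB /s -pmulrn; ring.
rewrite !E /hat (@smooth_step1 _ (s + 1 - 0 + 1)); last by rewrite /s; lra.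
rewrite (@smooth_step0 _ (s + 1 - 3%:R)); last by rewrite /s; lra.
rewrite (_ : s + 1 - 1 + 1 = s + 1 - 0); last by ring.
rewrite (_ : s + 1 - 2%:R + 1 = s + 1 - 1); last by ring.
rewrite (_ : s + 1 - 3%:R + 1 = s + 1 - 2%:R); last by ring.
ring.
Qed.

Lemma bump_partition y :
  \sum_e tensor_bump (y - lattice_point (box_point (box_corner y) e)) = 1.
Proof.
rewrite /tensor_bump (eq_bigr (fun e : {ffun 'I_n -> 'I_4} => \prod_i
  hat (y ord0 i - (Num.floor (y ord0 i) - 1 + (e i : nat)%:Z)%:~R))); last first.
  by move=> e _; apply: eq_bigr => i _; rewrite !mxE !ffunE.
rewrite -(bigA_distr_bigA (fun i (j : 'I_4) =>
   hat (y ord0 i - (Num.floor (y ord0 i) - 1 + (j : nat)%:Z)%:~R))).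
by rewrite big1// => i _; exact: hat_partition.
Qed.

Lemma lattice_sum_cst (a : R) y : lattice_sum (fun=> a) y = a.
Proof. by rewrite /lattice_sum -mulr_sumr bump_partition mulr1. Qed.

Lemma lattice_sumD c c' y :
  lattice_sum (fun z => c z + c' z) y = lattice_sum c y + lattice_sum c' y.
Proof. by rewrite -big_split; apply: eq_bigr => e _; rewrite mulrDl. Qed.

Lemma lattice_sumZ (a : R) c y :
  lattice_sum (fun z => a * c z) y = a * lattice_sum c y.
Proof. by rewrite mulr_sumr; apply: eq_bigr => e _; rewrite mulrA. Qed.

Lemma box_corner_dist y e i :
  `|y ord0 i - (box_point (box_corner y) e i)%:~R| <= 2.
Proof.
rewrite !ffunE; have := floor_itv (y ord0 i).
set f := Num.floor _; rewrite !intrD mulrNz => /andP[f1 f2].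
have : (e i : nat)%:~R <= 3%:R :> R by rewrite ler_nat -ltnS ltn_ord.
have : 0 <= (e i : nat)%:~R :> R by rewrite ler0n.
move: ((e i : nat)%:~R) => E E0 E3; rewrite ler_norml; apply/andP; split; lra.
Qed.

(** The sum is a convex combination of the coefficients at the lattice points within [1] of [y]. *)
Lemma lattice_sum_dist c (a M : R) y :
  (forall z, (forall i, `|y ord0 i - (z i)%:~R| < 1) -> `|c z - a| <= M) ->
  `|lattice_sum c y - a| <= M.
Proof.
move=> H; rewrite -{1}(lattice_sum_cst a y) -sumrB.
rewrite (le_trans (ler_norm_sum _ _ _))//.
rewrite -[M]mulr1 -(bump_partition y) mulr_sumr; apply: ler_sum => e _.
rewrite -mulrBl normrM (ger0_norm (bump_ge0 _)).
have [->|b0] := eqVneq (tensor_bump (y - lattice_point (box_point (box_corner y) e))) 0.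
  by rewrite !mulr0.
rewrite ler_wpM2r ?bump_ge0//; apply: H => i; rewrite ltNge.
apply: contra b0 => h; by rewrite (@bump_eq0 _ _ _ i)// !mxE.
Qed.

Lemma is_derive_bigsum (I : Type) (s : seq I) (F : I -> 'rV[R]_n -> R) d x v :
  (forall e, is_derive x v (F e) (d e)) ->
  is_derive x v (fun y => \sum_(e <- s) F e y) (\sum_(e <- s) d e).
Proof.
move=> Fd; elim: s => [|e s IH].
  by under eq_fun do rewrite big_nil; rewrite big_nil; exact: is_derive_cst.
under eq_fun do rewrite big_cons; rewrite big_cons; exact: is_deriveD.
Qed.

Definition scaled_sum (k : int) c x : R := lattice_sum c ((2 : R) ^ k *: x).

Lemma scaled_sum_local k c x : \forall y \near x,
  scaled_sum k c y = \sum_e c (box_point (box_corner (2 ^ k *: x)) e) *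
    tensor_bump ((2 : R) ^ k *: y - lattice_point (box_point (box_corner (2 ^ k *: x)) e)).
Proof.
apply/nbhs_eballP; exists ((2 : R) ^ k)^-1; first by rewrite invr_gt0 exprz_gt0.
move=> y; rewrite /eball/= => yx; apply: lattice_sum_near => i.
rewrite !mxE -mulrBr normrM gtr0_norm ?exprz_gt0//.
rewrite mulrC -ltr_pdivlMr ?exprz_gt0// mul1r (le_lt_trans _ yx)//.
by have := coord_le_enorm (y - x) i; rewrite !mxE.
Qed.

Lemma Ck_scaled_sum j k c : Ck j (scaled_sum k c).
Proof.
apply: Ck_local => x; eexists; last exact: scaled_sum_local.
apply: Ck_sum => e; apply: CkM; first exact: Ck_cst.
by apply: Ck_scale_shift; exact: Ck_bump.
Qed.

Lemma partial_scaled_sum : exists2 C : R, 0 < C & forall k c (a M : R) x i,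
  (forall z, (forall j, `|2 ^ k * x ord0 j - (z j)%:~R| <= 2) -> `|c z - a| <= M) ->
  `|partial i (scaled_sum k c) x| <= C * 2 ^ k * M.
Proof.
have [C C0 HC] := @partial_bump_bounded R n.
exists (C *+ #|{ffun 'I_n -> 'I_4}|).
  by rewrite pmulrn_lgt0// card_ffun !card_ord expn_gt0.
move=> k c a M x i H.
pose c' z := c z - a.
have E : scaled_sum k c = scaled_sum k c' + cst a.
  apply/funext => y; rewrite -[RHS]/(lattice_sum c' (2 ^ k *: y) + a).
  rewrite -(lattice_sum_cst a (2 ^ k *: y)) -lattice_sumD /scaled_sum.
  by apply: (congr1 (lattice_sum ^~ _)); apply/funext => z; rewrite /c' subrK.
have [_ /(_ i)[dc' _]] := Ck_scaled_sum 1 k c'.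
rewrite /partial E deriveD// derive_cst addr0.
set w := box_corner (2 ^ k *: x).
have D : is_derive x (delta_mx ord0 i)
   (fun y => \sum_e c' (box_point w e) *
      tensor_bump ((2 : R) ^ k *: y - lattice_point (box_point w e)))
   (\sum_e c' (box_point w e) *
    (2 ^ k * partial i tensor_bump (2 ^ k *: x - lattice_point (box_point w e)))).
  apply: is_derive_bigsum => e.
  have [_ /(_ i)[db _]] := @Ck_bump R n 1.
  have := is_derive_scale_shift (derivableP (db (2 ^ k *: x - lattice_point (box_point w e)))).
  by move=> /(is_deriveZ (c' (box_point w e))); exact.
rewrite (near_eq_derive _ (scaled_sum_local k c' x)) -/w (@derive_val _ _ _ _ _ _ _ D).
rewrite (le_trans (ler_norm_sum _ _ _))//.
rewrite !mulrnAl -sumr_const; apply: ler_sum => e _.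
rewrite !normrM (gtr0_norm (exprz_gt0 _ _))// mulrC [leRHS]mulrC.
rewrite mulrC ler_pM ?mulr_ge0 ?exprz_ge0//.
  by apply: H => j; have := box_corner_dist (2 ^ k *: x) e j; rewrite !mxE.
by rewrite mulrC ler_wpM2r ?exprz_ge0.
Qed.

End lattice_sums.

(** * Distance to the boundary and Harnack chains *)

Section distance_to_boundary.
Context {R : realType} {n : nat} (Omega : set 'rV[R]_n).
Local Notation Gamma := (boundary Omega).
Local Notation delta := (delta Omega).
Implicit Types (X Y x y : 'rV[R]_n).
Hypothesis oO : open Omega.
Hypothesis Gamma0 : Gamma !=set0.

Lemma boundaryP x : Gamma x <-> closure Omega x /\ ~ Omega x.
Proof. by rewrite /boundary; move/interior_id : oO => ->. Qed.

Lemma closed_boundary : closed Gamma.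
Proof.
rewrite (_ : Gamma = closure Omega `&` ~` Omega).
  by apply: closedI; [exact: closed_closure|exact: open_closedC].
by apply/seteqP; split => x /boundaryP.
Qed.

Lemma measurable_boundary : measurable Gamma.
Proof.
rewrite -[Gamma]setCK; apply: measurableC; apply: open_measurable_mx.
by rewrite openC; exact: closed_boundary.
Qed.

Lemma boundary_closure x : Gamma x -> closure Omega x.
Proof. by move/boundaryP => []. Qed.

Let dist_set X := [set enorm (x - y) | x in [set X] & y in Gamma].

Let has_inf_dist X : has_inf (dist_set X).
Proof.
have [y Gy] := Gamma0; split; first by exists (enorm (X - y)); exists X => //; exists y.
by exists 0 => _ [? _ [z _ <-]]; exact: enorm_ge0.
Qed.

Lemma delta_le X y : Gamma y -> delta X <= enorm (X - y).
Proof.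
move=> Gy; apply: ge_inf; first by have [] := has_inf_dist X.
by exists X => //; exists y.
Qed.

Lemma delta_lb X e : (forall y, Gamma y -> e <= enorm (X - y)) -> e <= delta X.
Proof.
move=> h; apply: lb_le_inf; first by have [] := has_inf_dist X.
by move=> _ [_ -> [y Gy <-]]; exact: h.
Qed.

Lemma delta_ge0 X : 0 <= delta X.
Proof. by apply: delta_lb => y _; exact: enorm_ge0. Qed.

Lemma delta_lt X e : delta X < e -> exists2 y, Gamma y & enorm (X - y) < e.
Proof.
move=> de; apply: contrapT => h.
have : e <= delta X.
  apply: delta_lb => y Gy; rewrite leNgt; apply/negP => ye; apply: h.
  by exists y.
by rewrite leNgt de.
Qed.

Lemma delta_lip X Y : delta X <= delta Y + enorm (X - Y).
Proof.
rewrite -lerBlDr; apply: delta_lb => y Gy; rewrite lerBlDr.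
apply: (le_trans (delta_le X Gy)); rewrite [leRHS]addrC; exact: enorm_triangle.
Qed.

Lemma eball_subset_delta X r : eball X r `<=` Omega -> r <= delta X.
Proof.
move=> BO; apply: delta_lb => y /boundaryP[_ Oy]; rewrite leNgt.
by apply/negP => Xy; apply: Oy; apply: BO; rewrite /eball/= enorm_sub.
Qed.

Lemma delta_gt0 X : Omega X -> 0 < delta X.
Proof.
move=> OX; have /nbhs_eballP[e e0 eO] : nbhs X Omega by exact: open_nbhs_nbhs.
exact: lt_le_trans e0 (eball_subset_delta eO).
Qed.

(* On a segment leaving [Omega], the first exit point lies on the boundary. *)
Lemma eball_delta X : Omega X -> eball X (delta X) `<=` Omega.
Proof.
move=> OX Y; rewrite /eball/= => XY; apply: contrapT => OY.
pose p (t : R) : 'rV[R]_n := X + t *: (Y - X).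
have cp : continuous p.
  move=> t; rewrite /p; apply: (@continuousD _ _ _ (fun=> X)
    (fun t : R => t *: (Y - X))); first exact: cst_continuous.
  exact: scalel_continuous.
pose S := [set t : R | 0 <= t <= 1 /\ ~ Omega (p t)].
have S1 : S 1 by split; rewrite ?ler01 ?lexx// /p scale1r addrC subrK.
have hS : has_inf S by split; [exists 1|exists 0 => t [/andP[]]].
have infS : 0 <= inf S <= 1.
  rewrite lb_le_inf ?ge_inf//; [by case: hS|by exists 1|by move=> t [/andP[]]].
have nO : ~ Omega (p (inf S)).
  move=> OpS.
  have : nbhs (inf S) (p @^-1` Omega) by apply: cp; exact: open_nbhs_nbhs.
  move=> /nbhs_ballP[e/= e0 eS].
  have [t St te] := inf_adherent e0 hS.
  have [_] := St; apply; apply: eS; rewrite /ball/= distrC ger0_norm ?subr_ge0.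
    by rewrite ltrBlDl.
  by apply: ge_inf => //; case: hS.
have cO : closure Omega (p (inf S)).
  move=> B /cp /nbhs_ballP[e/= e0 eB].
  have [S0|S0] := eqVneq (inf S) 0.
    exists X; split=> //; rewrite (_ : X = p 0); last by rewrite /p scale0r addr0.
    by apply: eB; rewrite S0; exact: ballxx.
  have iS0 : 0 < inf S by rewrite lt0r S0/=; case/andP: infS.
  pose t := Num.max (inf S - e / 2) (inf S / 2).
  have tS : t < inf S by rewrite gt_max; apply/andP; split; lra.
  have t0 : 0 <= t by rewrite le_max; apply/orP; right; lra.
  exists (p t); split.
    apply: contrapT => Ot; have : S t.
      by split=> //; rewrite t0/= ltW// (lt_le_trans tS)//; case/andP: infS.
    by move=> /(ge_inf (proj2 hS)); rewrite leNgt tS.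
  apply: eB; rewrite /ball/= ger0_norm; last by rewrite subr_ge0 ltW.
  have : inf S - e / 2 <= t by rewrite le_max lexx.
  lra.
have Gp : Gamma (p (inf S)) by exact/boundaryP.
have := delta_le X Gp; rewrite /p opprD addNKr enormN enormZ.
rewrite leNgt => /negP; apply; apply: le_lt_trans XY.
rewrite ger0_norm; last by case/andP: infS.
by rewrite -[leRHS]mul1r ler_wpM2r ?enorm_ge0//; case/andP: infS.
Qed.

Lemma delta_continuous : continuous delta.
Proof.
move=> X; apply/(@cvgrPdist_lt _ _ _ (nbhs X) (nbhs_filter X)) => e e0.
apply: filterS (eball_nbhs X e0) => Y.
rewrite /eball/= ltr_norml => YX.
have := delta_lip X Y; have := delta_lip Y X; rewrite (enorm_sub X Y) => h1 h2.
by apply/andP; split; lra.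
Qed.

Lemma measurable_delta : measurable_fun setT delta.
Proof. by apply: continuous_measurable_rV; exact: delta_continuous. Qed.

Definition reachable (N : nat) X Y := exists Z : nat -> 'rV[R]_n,
  [/\ Z 0%N = X, Z N = Y, forall i, (i <= N)%N -> Omega (Z i) &
    forall i, (i < N)%N -> enorm (Z i - Z i.+1) < 2^-1 * delta (Z i)].

Lemma reachable_refl N X : Omega X -> reachable N X X.
Proof.
by move=> OX; exists (fun=> X); split => // i _; rewrite subrr enorm0 mulr_gt0// delta_gt0.
Qed.

Lemma reachable_trans N N' X Y Z : reachable N X Y -> reachable N' Y Z ->
  reachable (N + N') X Z.
Proof.
move=> [p [p0 pN Op Sp]] [q [q0 qN Oq Sq]].
exists (fun i => if (i <= N)%N then p i else q (i - N)%N); split => //.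
- case: N' qN {Oq Sq} => [|N'] qN; first by rewrite addn0 leqnn pN -q0 qN.
  by rewrite ifF ?addKn//; apply/negbTE; rewrite -ltnNge; lia.
- by move=> i iN; case: ifPn => [/Op//|iN']; apply: Oq; lia.
- move=> i iN; case: (ltngtP i N) => iN'.
  + exact: Sp.
  + by rewrite subSn//; [apply: Sq; lia|exact: ltnW].
  + by rewrite iN' subSn// subnn pN -q0; apply: Sq; lia.
Qed.

(** A step shorter than half the distance to the boundary changes that distance by a factor between
    [1 / 2] and [3 / 2]; the displacements add up geometrically. *)
Lemma chain_bounds N (Z : nat -> 'rV[R]_n) :
  (forall i, (i < N)%N -> enorm (Z i - Z i.+1) < 2^-1 * delta (Z i)) ->
  forall i, (i <= N)%N -> [/\ delta (Z 0%N) <= 2 ^+ i * delta (Z i),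
    delta (Z i) <= 2 ^+ i * delta (Z 0%N) &
    enorm (Z i - Z 0%N) <= 2 ^+ i * delta (Z 0%N)].
Proof.
move=> SZ; elim=> [_|i IH iN].
  by rewrite !expr0 !mul1r subrr enorm0 delta_ge0.
have [h1 h2 h3] := IH (ltnW iN); have h4 := SZ i iN.
have := delta_lip (Z i) (Z i.+1); have := delta_lip (Z i.+1) (Z i).
have := enorm_triangle (Z i) (Z i.+1) (Z 0%N).
rewrite (enorm_sub (Z i.+1) (Z i)) => h5 h6 h7.
have p0 : 0 < 2 ^+ i :> R by rewrite exprn_gt0.
have d0 := delta_ge0 (Z 0%N).
rewrite exprS -!mulrA; split; [|lra..].
rewrite (le_trans h1)// -mulrCA ler_pM2l//; lra.
Qed.

Section corkscrews.
Variable C1 : R.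
Hypothesis C1_gt0 : 0 < C1.
Hypothesis cs : corkscrew_points Omega C1.

Lemma corkscrew x r : Gamma x -> 0 < r ->
  exists X, [/\ Omega X, enorm (X - x) < r & C1^-1 * r <= delta X].
Proof.
move=> Gx r0; have [X Xx XO] := cs Gx r0.
exists X; split=> //; first by apply: XO; apply: eball_center; rewrite mulr_gt0// invr_gt0.
exact: eball_subset_delta.
Qed.

Lemma C1_gt1 : 1 < C1.
Proof.
have [x Gx] := Gamma0; have [X [OX Xx dX]] := corkscrew Gx (@ltr01 R).
have := delta_le X Gx => h.
have : C1^-1 < 1 by rewrite mulr1 in dX; lra.
by rewrite invf_lt1.
Qed.

Hypothesis hc : harnack_chains Omega C1.

(* Raising both points to three times their distance to the boundary divides
   the ratio [enorm (X - Y) / d] by about three, so that induction reaches every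
   ratio [L] from the single ratio [7 * C1] of the hypothesis. *)
Lemma reachable_chains (L : R) : exists N, forall d X Y, 0 < d ->
  Omega X -> Omega Y -> d < delta X -> d < delta Y -> enorm (X - Y) <= L * d ->
  reachable N X Y.
Proof.
have [N0 HN0] := hc.
have c1 := C1_gt1.
(* Solution of [Lk k.+1 + 13 * C1 = 3 * Lk k] with [Lk 0 = 7 * C1]: the recursion says that raising
   both points costs [13 * C1 * d] in distance and triples [d]. *)
pose Lk (k : nat) : R := (13 / 2 + 3 ^+ k / 2) * C1.
suff H k : exists N, forall d X Y, 0 < d -> Omega X -> Omega Y ->
    d < delta X -> d < delta Y -> enorm (X - Y) <= Lk k * d -> reachable N X Y.
  pose k := Num.truncn (2 * `|L|).
  have [N HN] := H k.+1; exists N => d X Y d0 OX OY dX dY XY.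
  apply: (HN d) => //; rewrite (le_trans XY)// ler_pM2r// /Lk.
  have : 2 * `|L| < k.+1%:R by rewrite truncnS_gt// ?mulr_ge0.
  have : k.+1%:R <= 3 ^+ k.+1 :> R.
    by rewrite -natrX ler_nat ltnW// ltn_expl.
  have : L <= `|L| by exact: ler_norm.
  have : 1 <= (13 / 2 + 3 ^+ k.+1 / 2) :> R.
    have : 0 <= 3 ^+ k.+1 :> R by rewrite exprn_ge0.
    lra.
  move: (3 ^+ k.+1) => q h1 h2 h3 h4.
  have : (13 / 2 + q / 2) * 1 <= (13 / 2 + q / 2) * C1.
    by rewrite ler_wpM2l//; lra.
  lra.
elim: k => [|k [N HN]].
  exists N0 => d X Y d0 OX OY dX dY XY; apply: (HN0 d) => //.
  rewrite (le_trans XY)// ler_pM2r// /Lk expr0 ler_pM2r//; lra.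
have up d X : 0 < d -> Omega X -> d < delta X -> exists X',
    [/\ Omega X', 3 * d < delta X', enorm (X - X') <= 13 / 2 * C1 * d,
        reachable N0 X X' & reachable N0 X' X].
  move=> d0 OX dX; have [X3|X3] := ltP (3 * d) (delta X).
    exists X; split => //; try exact: reachable_refl.
    by rewrite subrr enorm0 !mulr_ge0// ltW.
  (* Here [13 / 4] lies between [3] and [7 / 2]. Being above [3] it puts the corkscrew point at
     distance more than [3 * d] from the boundary; being below [7 / 2] it keeps the displacement, at
     most [13 / 2 * C1 * d], in the range of the hypothesis. *)
  have [x Gx Xx] : exists2 x, Gamma x & enorm (X - x) < 13 / 4 * d.
    by apply: delta_lt; lra.
  have r0 : 0 < 13 / 4 * C1 * d by rewrite !mulr_gt0.
  have [X' [OX' X'x dX']] := corkscrew Gx r0.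
  have dX'2 : 13 / 4 * d <= delta X'.
    apply: le_trans dX'; rewrite (mulrC _ C1) -(mulrA C1) mulKf// gt_eqF//.
  have XX' : enorm (X - X') <= 13 / 2 * C1 * d.
    have := enorm_triangle x X X'; rewrite (enorm_sub x X') => h.
    have : 1 * d <= C1 * d by rewrite ler_pM2r// ltW.
    rewrite -!mulrA in X'x *; lra.
  have Cd : 0 < C1 * d by rewrite mulr_gt0.
  rewrite -!mulrA in XX' *.
  exists X'; split => //; first lra.
    apply: (HN0 d) => //; [lra|rewrite -!mulrA; lra].
  apply: (HN0 d) => //; [lra|rewrite enorm_sub -!mulrA; lra].
exists (N0 + N + N0)%N => d X Y d0 OX OY dX dY XY.
have [X' [OX' dX' XX' rX _]] := up d X d0 OX dX.
have [Y' [OY' dY' YY' _ rY]] := up d Y d0 OY dY.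
apply: reachable_trans rY; apply: reachable_trans rX _; apply: (HN (3 * d)) => //.
  by rewrite mulr_gt0.
have := enorm_triangle X X' Y'; have := enorm_triangle Y X Y'.
rewrite (enorm_sub X' X) => h1 h2.
have : Lk k.+1 * d + 13 * C1 * d <= Lk k * (3 * d).
  by rewrite /Lk exprS; lra.
lra.
Qed.

End corkscrews.

End distance_to_boundary.

(** * Doubling measures *)

Section sigma_finite_packing.
Context d (T : measurableType d) (R : realType).

Section pack.
Variable nu : {measure set T -> \bar R}.
Hypothesis sf : sigma_finite setT nu.

(* The structure cannot be attached to the variable [nu] itself. *)
Let alias : set T -> \bar R := nu.

HB.instance Definition _ := Measure.on alias.
HB.instance Definition _ := @Measure_isSigmaFinite.Build _ _ _ alias sf.

Lemma sigma_finite_pack :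
  exists nu' : {sigma_finite_measure set T -> \bar R}, nu = nu' :> {measure set T -> \bar R}.
Proof.
by exists alias; exact: eq_measure.
Qed.

End pack.

End sigma_finite_packing.

Section volume.
Context {R : realType} {n : nat} (nu : {measure set 'rV[R]_n -> \bar R}).
Variables (E : set 'rV[R]_n).
Hypothesis mE : measurable E.
Implicit Types (x y : 'rV[R]_n) (r s : R).

(** The set [E] will be [Omega] for [m] and the whole space for [mu], so that both doubling
    conditions are exploited by the same lemmas. *)
Definition vol x r : R := fine (nu (eball x r `&` E)).

Lemma vol_ge0 x r : 0 <= vol x r.
Proof. exact/fine_ge0/measure_ge0. Qed.

Lemma measurable_ballE x r : measurable (eball x r `&` E).
Proof. by apply: measurableI => //; exact: measurable_eball. Qed.

Section doubling.
Variables (S : set 'rV[R]_n) (C : R).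
Hypothesis nuS : forall x r, S x -> 0 < r -> (0 < nu (eball x r `&` E) < +oo)%E.
Hypothesis doubling : forall x r, S x -> 0 < r ->
  (nu (eball x (2 * r) `&` E) <= C%:E * nu (eball x r `&` E))%E.

Lemma volE x r : S x -> 0 < r -> nu (eball x r `&` E) = (vol x r)%:E.
Proof.
move=> Sx r0; rewrite /vol fineK// ge0_fin_numE ?measure_ge0//.
by case/andP: (nuS Sx r0).
Qed.

Lemma vol_gt0 x r : S x -> 0 < r -> 0 < vol x r.
Proof. by move=> Sx r0; have := nuS Sx r0; rewrite volE// lte_fin => /andP[]. Qed.

Lemma vol_le x y r s : S y -> 0 < s -> enorm (x - y) + r <= s -> vol x r <= vol y s.
Proof.
move=> Sy s0 h; apply: fine_le; rewrite ?ge0_fin_numE ?measure_ge0//.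
- apply: le_lt_trans (proj2 (andP (nuS Sy s0))).
  apply: le_measure; rewrite ?inE; try exact: measurable_ballE.
  by apply: setSI; exact: eball_subset.
- by case/andP: (nuS Sy s0).
- apply: le_measure; rewrite ?inE; try exact: measurable_ballE.
  by apply: setSI; exact: eball_subset.
Qed.

Lemma vol_le_radius x r s : S x -> 0 < s -> r <= s -> vol x r <= vol x s.
Proof. by move=> Sx s0 rs; apply: vol_le; rewrite ?subrr ?enorm0 ?add0r. Qed.

Lemma doubling_gt0 : S !=set0 -> 0 < C.
Proof.
move=> [x Sx]; have := doubling Sx ltr01; rewrite mulr1 !volE// -EFinM lee_fin => h.
rewrite -(pmulr_lgt0 _ (vol_gt0 Sx ltr01)); exact: lt_le_trans (vol_gt0 _ _) h.
Qed.

Lemma vol_doubling (k : nat) x r : S x -> 0 < r ->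
  vol x (2 ^+ k * r) <= C ^+ k * vol x r.
Proof.
move=> Sx r0; elim: k => [|k IH]; first by rewrite !expr0 !mul1r.
have C0 : 0 < C by apply: doubling_gt0; exists x.
have r1 : 0 < 2 ^+ k * r by rewrite mulr_gt0// exprn_gt0.
have := doubling Sx r1; rewrite !volE ?mulr_gt0// -EFinM lee_fin mulrA -exprS => h.
by rewrite (le_trans h)// exprS -mulrA ler_pM2l.
Qed.

(** Balls of comparable radius at comparable distance have comparable volume: the ball at [y] lies
    in a dyadic dilate of the ball at [x], reached by finitely many doublings. *)
Lemma vol_dilate (L : R) : S !=set0 -> exists2 C' : R, 1 <= C' & forall x y r s, S x -> S y ->
  0 < r -> 0 < s -> enorm (x - y) <= L * r -> s <= L * r -> vol y s <= C' * vol x r.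
Proof.
move=> S0; have C0 := doubling_gt0 S0.
pose k := (Num.truncn (2 * `|L|)).+1.
have Lk : 2 * L <= 2 ^+ k.
  rewrite (@le_trans _ _ k%:R)//; last by rewrite -natrX ler_nat ltnW// ltn_expl.
  by rewrite ltW// (le_lt_trans _ (truncnS_gt _))// ler_wpM2l// ler_norm.
exists (Num.max 1 (C ^+ k)) => [|x y r s Sx Sy r0 s0 xy sL].
  by rewrite le_max lexx.
have r1 : 0 < 2 ^+ k * r by rewrite mulr_gt0// exprn_gt0.
apply: (@le_trans _ _ (vol x (2 ^+ k * r))).
  apply: vol_le => //; rewrite enorm_sub.
  have : 2 * L * r <= 2 ^+ k * r by rewrite ler_pM2r.
  lra.
rewrite (le_trans (vol_doubling _ Sx r0))// ler_wpM2r ?vol_ge0//.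
by rewrite le_max lexx orbT.
Qed.

End doubling.
End volume.

Section volume_measurable.
Context {R : realType} {n : nat} (nu : {sigma_finite_measure set 'rV[R]_n -> \bar R}).
Variables (E : set 'rV[R]_n).
Hypothesis mE : measurable E.

Lemma measurable_lt_set d (T : measurableType d) (f g : T -> R) :
  measurable_fun setT f -> measurable_fun setT g ->
  measurable [set t | f t < g t].
Proof.
move=> mf mg; rewrite -[X in measurable X]setTI.
rewrite (_ : [set t | _] = (fun t => f t < g t) @^-1` [set true]).
  exact: measurable_fun_ltr.
by apply/seteqP; split => t /=.
Qed.

(** The volume is the measure of a section of a measurable subset of a product, which depends
    measurably on the section because the measure is sigma-finite. *)
Lemma measurable_vol d (T : measurableType d) (c : T -> 'rV[R]_n) (r : T -> R) :
  measurable_fun setT c -> measurable_fun setT r ->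
  measurable_fun setT (fun t => vol nu E (c t) (r t)).
Proof.
move=> mc mr.
pose A := [set p : T * 'rV[R]_n | enorm (p.2 - c p.1) < r p.1] `&` (snd @^-1` E).
have mA : measurable A.
  apply: measurableI; last first.
    by rewrite -[X in measurable X]setTI; exact: measurable_snd.
  apply: measurable_lt_set.
    apply: measurable_enormB; first exact: measurable_snd.
    exact: (measurableT_comp mc measurable_fst).
  exact: (measurableT_comp mr measurable_fst).
apply: (@measurableT_comp _ _ _ _ _ _ fine) => //.
rewrite (_ : (fun t => _) = nu \o xsection A); first exact: measurable_fun_xsection.
apply/funext => t /=; congr (nu _); apply/seteqP; split => z; rewrite /xsection/=.
  by move=> [h1 h2]; rewrite inE.
by rewrite inE => -[].
Qed.

End volume_measurable.

Section annuli.
Context {R : realType} {n : nat} (nu : {measure set 'rV[R]_n -> \bar R}).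
Variables (E : set 'rV[R]_n).
Hypothesis mE : measurable E.

(* Dyadic decomposition into the annuli 2^k tau <= |y - x| < 2^(k+1) tau. *)
Lemma integral_annuli_le (x : 'rV[R]_n) (tau b q : R) (phi : R -> R) :
  0 < tau -> 0 <= q -> q < 1 -> 0 <= b ->
  (forall t, 0 < t -> 0 <= phi t) ->
  (forall s t, 0 < s -> s <= t -> phi t <= phi s) ->
  (forall k : nat, ((phi (2 ^+ k * tau))%:E * nu (eball x (2 ^+ k.+1 * tau) `&` E)
     <= (b * q ^+ k)%:E)%E) ->
  (\int[nu]_(y in E `&` [set y | (tau <= enorm (y - x))%R]) (phi (enorm (y - x)))%:E <=
   (b / (1 - q))%:E)%E.
Proof.
move=> tau0 q0 q1 b0 phi0 phi_dec Hk.
pose F (k : nat) (y : 'rV[R]_n) : \bar R :=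
  ((phi (2 ^+ k * tau))%:E * (\1_(eball x (2 ^+ k.+1 * tau)) y)%:E)%E.
have tk k : 0 < 2 ^+ k * tau by rewrite mulr_gt0// exprn_gt0.
have F0 k y : (0 <= F k y)%E by rewrite mule_ge0// lee_fin phi0.
apply: (@le_trans _ _ (\int[nu]_(y in E) \sum_(k <oo) F k y)%E).
  rewrite integral_mkcondr; apply: le_integral_ge0 => y Ey.
    rewrite /patch; case: ifPn => // /set_mem/= ty.
    by rewrite lee_fin phi0// (lt_le_trans tau0).
  rewrite /patch; case: ifPn => [/set_mem/= ty|_]; last first.
    exact: nneseries_ge0.
  pose k := Num.truncn (enorm (y - x) / tau).
  have [j [j1 j2]] : exists j : nat, 2 ^+ j * tau <= enorm (y - x) /\ enorm (y - x) < 2 ^+ j.+1 * tau.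
    have [N HN] : exists N : nat, enorm (y - x) < 2 ^+ N * tau.
      exists k.+1; rewrite -ltr_pdivrMr// (lt_le_trans (truncnS_gt _))//.
      by rewrite -natrX ler_nat ltnW// ltn_expl.
    elim: N HN => [|N IH] HN; first by move: HN; rewrite expr0 mul1r ltNge ty.
    have [h|h] := ltP (enorm (y - x)) (2 ^+ N * tau); first exact: IH.
    by exists N.
  apply: (@le_trans _ _ (F j y)).
    rewrite /F indicE mem_set// mule1 lee_fin phi_dec//.
  rewrite (@nneseriesD1 _ (F ^~ y) j xpredT)//.
  by rewrite leeDl// nneseries_ge0.
rewrite integral_nneseries//; last first.
  move=> k; apply: measurable_funeM; apply/measurable_EFinP.
  apply: measurable_funTS; apply: measurable_indic; exact: measurable_eball.
apply: (@le_trans _ _ (\sum_(k <oo) (b * q ^+ k)%:E)%E).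
  apply: lee_nneseries => [k _ _|k _]; first by apply: integral_ge0 => y _.
  rewrite ge0_integralZl//; last 2 first.
    by apply/measurable_EFinP; apply: measurable_funTS; apply: measurable_indic;
      exact: measurable_eball.
    by rewrite lee_fin phi0.
  by rewrite integral_indic//; exact: measurable_eball.
apply: lime_le.
  by apply: is_cvg_nneseries => k _ _; rewrite lee_fin mulr_ge0// exprn_ge0.
apply: nearW => k; rewrite sumEFin lee_fin.
have [q00|qn0] := eqVneq q 0.
  rewrite q00 subr0 divr1; case: k => [|k]; first by rewrite big_nil.
  rewrite big_nat_recl// expr0 mulr1 big1 ?addr0// => i _.
  by rewrite exprS mul0r mulr0.
have := @geometric_le_lim R k b q b0; rewrite lt0r qn0 q0 ger0_norm// => /(_ erefl q1).
by rewrite /series.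
Qed.

End annuli.

Section sigma_finite_on_balls.
Context {R : realType} {n : nat} (nu : {measure set 'rV[R]_n -> \bar R}).

Lemma sigma_finite_balls :
  (forall r, 0 < r -> (nu (eball (0 : 'rV[R]_n) r) < +oo)%E) -> sigma_finite setT nu.
Proof.
move=> h; exists (fun k => eball (0 : 'rV[R]_n) k.+1%:R) => [|k].
  apply/seteqP; split => // x _; exists (Num.truncn (enorm x)) => //.
  by rewrite /eball/= subr0 truncnS_gt.
by split; [exact: measurable_eball|exact: h].
Qed.

End sigma_finite_on_balls.

(** * Positivity and finiteness of the weighted measure *)

Section lebesgue_positive.
Context {R : realType} {n : nat}.

Lemma lebesgue_open_gt0 (U : set 'rV[R]_n) : open U -> U !=set0 ->
  (0 < lebesgue_rV n U)%E.
Proof.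
move=> oU [x Ux]; have /nbhs_eballP[e e0 eU] : nbhs x U by exact: open_nbhs_nbhs.
pose h := e / (2 * n.+1%:R).
have h0 : 0 < h by rewrite divr_gt0// mulr_gt0.
pose a : 'rV[R]_n := \row_i (x ord0 i - h).
pose b : 'rV[R]_n := \row_i (x ord0 i + h).
pose B := [set y : 'rV[R]_n | forall i, a ord0 i < y ord0 i <= b ord0 i].
have mB : measurable B.
  rewrite (_ : B = \bigcap_(i in [set: 'I_n])
      ((fun x : 'rV[R]_n => x ord0 i) @^-1` `]a ord0 i, b ord0 i])).
    apply: fin_bigcap_measurable => // i _.
    rewrite -[X in measurable X]setTI.
    by apply: measurable_coord => //; exact: measurable_itv.
  apply/seteqP; split => y /=.
    by move=> H i _ /=; rewrite in_itv/=; exact: H.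
  by move=> H i; have := H i Logic.I; rewrite /= in_itv.
have BU : B `<=` U.
  move=> y By; apply: eU; rewrite /eball/=.
  apply: (@le_lt_trans _ _ (n%:R * h)).
    apply: enorm_le_max => i; have := By i; rewrite !mxE => /andP[h1 h2].
    by rewrite ler_norml; apply/andP; split; lra.
  rewrite /h mulrA ltr_pdivrMr ?mulr_gt0// mulrC ltr_pM2l//.
  rewrite -natrM ltr_nat; lia.
apply: (@lt_le_trans _ _ (lebesgue_rV n B)); last first.
  by apply: le_measure; rewrite ?inE//; exact: open_measurable_mx.
rewrite (@lebesgue_rV_box _ _ a b); last by move=> i; rewrite !mxE; lra.
rewrite lte_fin prodr_gt0// => i _; rewrite !mxE; lra.
Qed.

End lebesgue_positive.

Section density.
Context {R : realType} {n : nat} (Omega : set 'rV[R]_n).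
Variables (m : {measure set 'rV[R]_n -> \bar R}) (C4 : R).
Hypothesis oO : open Omega.
Hypothesis O0 : Omega !=set0.
Hypothesis Hm : m_density_doubling Omega m C4.

Let mO : measurable Omega. Proof. exact: open_measurable_mx. Qed.

Lemma density_null_compl : m (~` Omega) = 0%E.
Proof.
have [[w [_ _ mE]] _] := Hm.
by rewrite (mE _ (measurableC mO)) setICl integral_set0.
Qed.

(** If [m Omega] vanished, the positive density would vanish almost everywhere on [Omega], making a
    nonempty open set Lebesgue null. *)
Lemma density_gt0 : (0 < m Omega)%E.
Proof.
rewrite lt0e measure_ge0 andbT; apply/eqP => m0.
have [[w [[mw _] [N2 [mN2 N20 wN2]] mE]] _] := Hm.
have [N [mN N0 wN]] := nu_measurable_fun_Borel mO mw.
have mN3 : measurable (N `|` N2) by exact: measurableU.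
have N30 : lebesgue_rV n (N `|` N2) = 0%E.
  rewrite -N0; exact: measureU0.
pose D := Omega `\` (N `|` N2).
have mD : measurable D by exact: measurableD.
have mwD : measurable_fun D w.
  by apply: measurable_funS wN => //; [exact: measurableD|exact: setDS (@subsetUl _ _ _)].
have wD x : D x -> 0 < w x.
  move=> [Ox Nx]; apply: contrapT => wx; apply: Nx; right; apply: wN2 => /=.
  by move/(_ Ox).
have I0 : (\int[lebesgue_rV n]_(x in D) (w x)%:E = 0)%E.
  by rewrite -integral_setD_null//; have := mE _ mO; rewrite setIid m0 => <-.
have : (\int[lebesgue_rV n]_(x in D) `|(w x)%:E| = 0)%E.
  rewrite -[RHS]I0; apply: eq_integral => x /set_mem Dx.
  by rewrite gee0_abs// lee_fin ltW// wD.
move/(ae_eq_integral_abs (lebesgue_rV n) mD); move=> /(_ _)[].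
  exact/measurable_EFinP.
move=> N4 [mN4 N40 DN4].
have D0 : lebesgue_rV n D = 0%E.
  apply: (subset_measure0 mD mN4 _ N40) => x Dx; apply: DN4 => /= h.
  by have := wD x Dx; have := h Dx => -[->]; rewrite ltxx.
have : lebesgue_rV n Omega = 0%E.
  apply: (@subset_measure0 _ _ _ _ _ (D `|` (N `|` N2))) => //.
  - exact: measurableU.
  - by move=> x Ox; have [Nx|Nx] := pselect ((N `|` N2) x); [right|left].
  - by rewrite -D0; exact: measureU0.
by apply/eqP; rewrite gt_eqF// lebesgue_open_gt0.
Qed.

(** Doubling carries nullity and finiteness to all larger concentric balls. A null ball would make
    [Omega] null; a small closed ball inside [Omega] is compact, has finite mass by local
    integrability of the density, and its dilates contain any given ball. *)
Lemma density_ball X r : closure Omega X -> 0 < r ->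
  (0 < m (eball X r `&` Omega) < +oo)%E.
Proof.
have mB Y s : measurable (eball Y s `&` Omega).
  by apply: measurableI => //; exact: measurable_eball.
move=> cX r0; have [[w [[mw wK] _ mE]] dbl] := Hm; apply/andP; split.
  rewrite lt0e measure_ge0 andbT; apply/eqP => m0.
  have B0 (k : nat) : m (eball X (2 ^+ k * r) `&` Omega) = 0%E.
    elim: k => [|k IH]; first by rewrite expr0 mul1r.
    have rk : 0 < 2 ^+ k * r by rewrite mulr_gt0// exprn_gt0.
    have := dbl X _ cX rk; rewrite IH mule0 mulrA -exprS measure_le0.
    by move/eqP.
  suff : m Omega = 0%E by apply/eqP; rewrite gt_eqF// density_gt0.
  apply: measure_negligible => //.
  apply: (@negligibleS _ _ _ m (\bigcup_k (eball X (2 ^+ k * r) `&` Omega))).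
    move=> Y OY; exists (Num.truncn (enorm (Y - X) / r)).+1 => //; split => //.
    rewrite /eball/= -ltr_pdivrMr// (lt_le_trans (truncnS_gt _))//.
    by rewrite -natrX ler_nat ltnW// ltn_expl.
  by apply: negligible_bigcup => k; apply/negligibleP => //; exact: B0.
have [X0 OX0] := O0.
have /nbhs_eballP[e e0 eO] : nbhs X0 Omega by exact: open_nbhs_nbhs.
pose K := [set y | enorm (y - X0) <= e / 2].
have KO : K `<=` Omega.
  by move=> y; rewrite /K/= => yX; apply: eO; rewrite /eball/=; lra.
have mK : measurable K.
  rewrite -[K]setCK; apply: measurableC; apply: open_measurable_mx.
  by rewrite openC; exact: closed_eball.
have fK : (m (eball X0 (e / 2) `&` Omega) < +oo)%E.
  apply: (@le_lt_trans _ _ (m K)).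
    apply: le_measure; rewrite ?inE// => y [h _]; rewrite /K/= ltW//.
  rewrite mE// (setIidl KO); apply: le_lt_trans (wK K KO _); last exact: compact_eball.
  exact: integral_le_abs.
have fB (k : nat) : (m (eball X0 (2 ^+ k * (e / 2)) `&` Omega) < +oo)%E.
  elim: k => [|k IH]; first by rewrite expr0 mul1r.
  have rk : 0 < 2 ^+ k * (e / 2) by rewrite mulr_gt0 ?exprn_gt0// divr_gt0.
  have := dbl X0 _ (subset_closure OX0) rk; rewrite [2 * _]mulrA -exprS => h.
  apply: le_lt_trans h _.
  rewrite -(@fineK _ (m (eball X0 (2 ^+ k * (e / 2)) `&` Omega))).
    by rewrite -EFinM ltry.
  by rewrite ge0_fin_numE// measure_ge0.
apply: le_lt_trans (fB (Num.truncn ((enorm (X - X0) + r) / (e / 2))).+1).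
apply: le_measure; rewrite ?inE//; apply: setSI; apply: eball_subset.
rewrite -ler_pdivrMr ?divr_gt0// ltW// (lt_le_trans (truncnS_gt _))//.
by rewrite -natrX ler_nat ltnW// ltn_expl.
Qed.

Lemma density_ball_fin r : 0 < r -> (m (eball (0 : 'rV[R]_n) r) < +oo)%E.
Proof.
move=> r0; have [X0 OX0] := O0.
have mB : measurable (eball (0 : 'rV[R]_n) r) by exact: measurable_eball.
have r1 : 0 < enorm (0 - X0) + r by rewrite ltr_wpDl// enorm_ge0.
have /andP[_] := density_ball (subset_closure OX0) r1.
apply: le_lt_trans; rewrite -(setIT (eball 0 r)) -(setUv Omega) setIUr.
have mA : measurable (eball 0 r `&` Omega) by exact: measurableI.
rewrite measureU0; rewrite ?measurableI//; last 2 first.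
- by apply: measurableI => //; exact: measurableC.
- apply: (subset_measure0 _ _ _ density_null_compl) => //.
  + by apply: measurableI => //; exact: measurableC.
  + exact: measurableC.
apply: le_measure; rewrite ?inE//; first by apply: measurableI => //; exact: measurable_eball.
by apply: setSI; exact: eball_subset.
Qed.

End density.

(** * Trace estimates *)

Section restricted_tonelli.
Local Open Scope ereal_scope.
Context d1 d2 (T1 : measurableType d1) (T2 : measurableType d2) (R : realType).
Variables (m1 : {sigma_finite_measure set T1 -> \bar R})
          (m2 : {sigma_finite_measure set T2 -> \bar R}).

Lemma restricted_tonelli (A : set (T1 * T2)) (k : T1 * T2 -> \bar R) :
  measurable A -> measurable_fun setT k -> (forall p, 0 <= k p) ->
  \int[m1]_x \int[m2]_(y in [set y | A (x, y)]) k (x, y) =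
  \int[m2]_y \int[m1]_(x in [set x | A (x, y)]) k (x, y).
Proof.
move=> mA mk k0.
have := @fubini_tonelli _ _ _ _ _ m1 m2 (k \_ A).
move=> H; transitivity (\int[m1]_x \int[m2]_y (k \_ A) (x, y)).
  by apply: eq_integral => x _; rewrite integral_mkcond.
rewrite H; last 2 first.
- by apply/(measurable_restrictT _ _).1 => //; exact: measurable_funTS.
- by move=> p; rewrite /patch; case: ifP.
by apply: eq_integral => y _; rewrite [RHS]integral_mkcond.
Qed.

Lemma measurable_section_integral (A : set (T1 * T2)) (k : T1 * T2 -> \bar R) :
  measurable A -> measurable_fun setT k -> (forall p, 0 <= k p) ->
  measurable_fun setT (fun x => \int[m2]_(y in [set y | A (x, y)]) k (x, y)).
Proof.
move=> mA mk k0.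
rewrite (_ : (fun x => _) = fubini_F m2 (k \_ A)).
  apply: measurable_fun_fubini_tonelli_F.
    by apply/(measurable_restrictT _ _).1 => //; exact: measurable_funTS.
  by move=> p; rewrite /patch; case: ifP.
by apply/funext => x; rewrite /fubini_F [LHS]integral_mkcond.
Qed.

Lemma tonelli_on (D1 : set T1) (D2 : set T2) (k : T1 * T2 -> \bar R) :
  measurable D1 -> measurable D2 -> measurable_fun setT k -> (forall p, 0 <= k p) ->
  \int[m1]_(x in D1) \int[m2]_(y in D2) k (x, y) =
  \int[m2]_(y in D2) \int[m1]_(x in D1) k (x, y).
Proof.
move=> mD1 mD2 mk k0.
have := restricted_tonelli (measurableX mD1 mD2) mk k0.
set a := (X in X = _); set b := (X in _ = X) => ab.
transitivity a.
  rewrite integral_mkcond; apply: eq_integral => x _; rewrite patchE.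
  case: ifPn => [/set_mem Dx|nDx].
    by congr (integral _ _ _); apply/seteqP; split => y //= [].
  rewrite (_ : [set y | _] = set0) ?integral_set0//.
  by apply/seteqP; split => // y [Dx _]; move: nDx; rewrite notin_setE.
rewrite ab [RHS]integral_mkcond; apply: eq_integral => y _; rewrite patchE.
case: ifPn => [/set_mem Dy|nDy].
  by congr (integral _ _ _); apply/seteqP; split => x //= [].
rewrite (_ : [set x | _] = set0) ?integral_set0//.
by apply/seteqP; split => // x [_ Dy]; move: nDy; rewrite notin_setE.
Qed.

End restricted_tonelli.

Lemma geometric_increments (R : realType) (a : nat -> R) (c q : R) :
  0 <= c -> 0 < q < 1 -> (forall j, `|a j.+1 - a j| <= c * q ^+ j) ->
  exists2 l, a @ \oo --> l & forall j, `|a j - l| <= c * q ^+ j / (1 - q).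
Proof.
move=> c0 /andP[q0 q1] Ha.
have ageo j p : `|a (j + p)%N - a j| <= c * q ^+ j / (1 - q).
  apply: (@le_trans _ _ (series (geometric (c * q ^+ j) q) p)); last first.
    by apply: geometric_le_lim; rewrite ?mulr_ge0 ?exprn_ge0 ?ger0_norm// ltW.
  elim: p => [|p IH]; first by rewrite addn0 subrr normr0 /series/= big_geq.
  rewrite /series/= big_nat_recr//= addnS.
  rewrite -(subrK (a (j + p)%N) (a (j + p).+1)) -addrA addrC.
  rewrite (le_trans (ler_normD _ _))// lerD//.
  by rewrite (le_trans (Ha _))// exprD mulrA.
have q1' : `|q| < 1 by rewrite gtr0_norm.
have ca : cvgn (series (telescope a)).
  apply: (@normed_cvg R R^o); apply: (@series_le_cvg _ (fun j => `|telescope a j|) (geometric c q)).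
  - by move=> j /=; rewrite normr_ge0.
  - by move=> j /=; rewrite mulr_ge0// exprn_ge0// ltW.
  - by move=> j /=; exact: Ha.
  - exact: is_cvg_geometric_series.
have /cvg_ex[l0 al0] := ca.
have al : a @ \oo --> l0 + a 0%N.
  have aE : a = series (telescope a) \+ cst (a 0%N).
    by apply/funext => j /=; rewrite telescopeK/= subrK.
  rewrite {1}aE.
  by apply: cvgD; [exact: al0|exact: cvg_cst].
exists (l0 + a 0%N) => // j; apply/ler_addgt0Pr => e e0.
move/cvgrPdist_lt : al => /(_ e e0)[N _ HN].
have {}HN := HN (j + N)%N (leq_addl _ _).
rewrite -(subrKA (a (j + N)%N)) (le_trans (ler_normD _ _))//.
by apply: lerD; [rewrite distrC ageo|rewrite distrC ltW].
Qed.

(** The quotients [Ms / (s * Us)] and [Mt / (t * Ut)] are the values of [rho] at the two scales; the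
    conclusion is the same inequality for the reciprocals multiplied by the scale. *)
Lemma growth_algebra (R : realType) (Ms Mt Us Ut s t p c : R) :
  0 < Ms -> 0 < Mt -> 0 < Us -> 0 < Ut -> 0 < s -> 0 < t ->
  Ms / (s * Us) / (Mt / (t * Ut)) <= c * (s / t * p) ->
  t ^+ 2 * Ut / Mt <= c * (p * (s ^+ 2 * Us / Ms)).
Proof.
move=> Ms0 Mt0 Us0 Ut0 s0 t0 h.
have k0 : 0 <= s * Us * t / Ms by rewrite divr_ge0 ?mulr_ge0 ?ltW.
have := ler_wpM2r k0 h.
have -> : Ms / (s * Us) / (Mt / (t * Ut)) * (s * Us * t / Ms) = t ^+ 2 * Ut / Mt.
  by field; rewrite !gt_eqF.
have -> // : c * (s / t * p) * (s * Us * t / Ms) = c * (p * (s ^+ 2 * Us / Ms)).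
by field; rewrite !gt_eqF.
Qed.

Lemma measurable_inv_ge0 d (T : measurableType d) (R : realType) (g : T -> R) :
  (forall t, 0 <= g t) -> measurable_fun setT g ->
  measurable_fun setT (fun t => (g t)^-1).
Proof.
move=> g0 mg; rewrite (_ : (fun t => _) = (fun t => g t `^ (-1))).
  exact: (measurableT_comp (measurable_powR _)).
by apply/funext => t; rewrite powR_inv1.
Qed.

Lemma inv_le_div (R : realType) (a b c : R) : 0 < a -> 0 < b -> b <= c * a ->
  a^-1 <= c / b.
Proof. by move=> a0 b0 h; rewrite ler_pdivlMr// mulrC ler_pdivrMr. Qed.

Lemma int_lt_opp (k : int) (J : nat) : k < - J%:Z ->
  exists j : nat, k + 1 = - j%:Z /\ (J <= j)%N.
Proof. by move=> kJ; exists (absz (k + 1)); split; lia. Qed.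

Lemma dyadic_floor (R : realType) (t : R) : 0 < t ->
  exists k : int, 2 ^ k <= t < 2 ^ (k + 1).
Proof.
have ge1 (u : R) : 1 <= u -> exists k : nat, 2 ^+ k <= u < 2 ^+ k.+1.
  move=> u1; have [N HN] : exists N : nat, u < 2 ^+ N.
    exists (Num.truncn u).+1; rewrite (lt_le_trans (truncnS_gt _))//.
    by rewrite -natrX ler_nat ltnW// ltn_expl.
  elim: N HN => [|N IH] HN; first by move: HN; rewrite expr0 ltNge u1.
  have [h|h] := ltP u (2 ^+ N); first exact: IH.
  by exists N; rewrite h.
move=> t0; have [t1|t1] := leP 1 t.
  by have [k Hk] := ge1 t t1; exists k%:Z; rewrite -PoszD addn1.
have t1' : 1 <= t^-1 by rewrite invf_ge1// ltW.
have [k /andP[k1 k2]] := ge1 _ t1'.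
have k3 : t <= 2 ^- k by rewrite -[t]invrK lef_pV2 ?posrE ?exprn_gt0 ?invr_gt0.
have k4 : 2 ^- k.+1 < t.
  by rewrite -[t]invrK ltf_pV2 ?posrE ?exprn_gt0 ?invr_gt0.
have [tk|tk] := eqVneq t (2 ^- k).
  exists (- k%:Z); rewrite -invr_expz -exprnP tk lexx/=.
  by rewrite exprzDr ?unitfE// -invr_expz -exprnP expr1z ltr_pMr ?invr_gt0 ?exprn_gt0// ltr1n.
exists (- k.+1%:Z); rewrite -invr_expz -exprnP ltW//=.
rewrite (_ : - k.+1%:Z + 1 = - k%:Z); last by lia.
by rewrite -invr_expz -exprnP lt_neqAle tk.
Qed.

Lemma sqr_sum3_le (R : realType) (p q r : R) :
  (p + q + r) ^+ 2 <= 3 * (p ^+ 2 + q ^+ 2 + r ^+ 2).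
Proof.
have := sqr_ge0 (p - q); have := sqr_ge0 (q - r); have := sqr_ge0 (p - r).
by move=> *; lra.
Qed.

(** Lets a bound by two integrals be proved by real arithmetic, the case of an infinite integral
    being trivial. *)
Lemma lee_fin_mul_add (R : realType) (A B : \bar R) (a b c k : R) :
  0 < a -> 0 < b -> 0 < c -> (0 <= A)%E -> (0 <= B)%E ->
  ((A < +oo)%E -> (B < +oo)%E -> k <= c * (a * fine A + b * fine B)) ->
  (k%:E <= c%:E * (a%:E * A + b%:E * B))%E.
Proof.
move=> a0 b0 c0; case: A => [A| |]//; last first.
  by move=> _ B0 _; rewrite gt0_muley ?lte_fin// addye ?gt0_muley ?leey ?lte_fin//; case: B B0 => [B| |]// _; rewrite gt0_muley ?lte_fin.
case: B => [B| |]// A0 _; last first.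
  by move=> _; rewrite gt0_muley ?lte_fin// addey ?gt0_muley ?leey ?lte_fin.
by move=> /(_ (ltry _) (ltry _)) h; rewrite lee_fin.
Qed.

(** * Cone integrals and non-tangential limits *)

Section trace_estimates.
Context {R : realType} {n : nat} (Omega : set 'rV[R]_n).
Variables (m mu : {sigma_finite_measure set 'rV[R]_n -> \bar R}).
Variables (C1 C3 C4 C5 : R).
Local Notation Gamma := (boundary Omega).
Local Notation delta := (delta Omega).
Hypothesis oO : open Omega.
Hypothesis O0 : Omega !=set0.
Hypothesis Gamma0 : Gamma !=set0.
Hypothesis C1_gt0 : 0 < C1.
Hypothesis cs : corkscrew_points Omega C1.
Hypothesis hc : harnack_chains Omega C1.
Hypothesis m_ball : forall X r, closure Omega X -> 0 < r ->
  (0 < m (eball X r `&` Omega) < +oo)%E.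
Hypothesis m_dbl : forall X r, closure Omega X -> 0 < r ->
  (m (eball X (2 * r) `&` Omega) <= C4%:E * m (eball X r `&` Omega))%E.
Hypothesis mu_ball : forall x r, Gamma x -> 0 < r ->
  (0 < mu (eball x r `&` setT) < +oo)%E.
Hypothesis mu_dbl : forall x r, Gamma x -> 0 < r ->
  (mu (eball x (2 * r) `&` setT) <= C3%:E * mu (eball x r `&` setT))%E.
Hypothesis rho_gr : rho_growth Omega m mu C5.

Local Notation M := (vol m Omega).
Local Notation U := (vol mu setT).

Let mO : measurable Omega. Proof. exact: open_measurable_mx. Qed.
Let mG : measurable Gamma. Proof. exact: measurable_boundary. Qed.
Let cO0 : closure Omega !=set0.
Proof. by have [X OX] := O0; exists X; exact: subset_closure. Qed.

Lemma rhoE x r : rho Omega m mu x r = M x r / (r * U x r).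
Proof. by rewrite /rho /vol setIT. Qed.

(** The gain [epsilon] in the growth condition on [rho]. *)
Definition gexp : R := C5^-1.

Lemma growth_gt0 : 0 < C5.
Proof.
have [x Gx] := Gamma0.
have := rho_gr Gx (ltr01 : 0 < 1 :> R) (ltr1n R 2 : 1 < 2 :> R).
rewrite !rhoE => h.
have M0 r : 0 < r -> 0 < M x r.
  by move=> r0; apply: (vol_gt0 m_ball) => //; exact: boundary_closure.
have U0 r : 0 < r -> 0 < U x r by move=> r0; exact: (vol_gt0 mu_ball).
rewrite -(pmulr_lgt0 _ (powR_gt0 (1 - C5^-1) (_ : 0 < 2 / 1))); last by rewrite divr_gt0.
by apply: lt_le_trans h; rewrite !divr_gt0 ?mulr_gt0// ?M0 ?U0.
Qed.

(* The quantity [t^2 U / M] equals [t / rho]. *)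
Definition inv_rho x t : R := t ^+ 2 * U x t / M x t.

(** Multiplied by [t], the growth factor [(s / t) ^ (1 - epsilon)] of [rho] becomes the decay
    [(t / s) ^ epsilon] of [t / rho]. The constant is at least [1] to cover [t = s], whereas the
    growth condition compares distinct scales. *)
Lemma growth : exists2 C : R, 1 <= C & forall x s t, Gamma x -> 0 < t -> t <= s ->
  inv_rho x t <= C * ((t / s) `^ gexp * inv_rho x s).
Proof.
exists (Num.max 1 C5) => [|x s t Gx t0 ts]; first by rewrite le_max lexx.
have s0 : 0 < s by exact: lt_le_trans ts.
have M0 r : 0 < r -> 0 < M x r.
  by move=> r0; apply: (vol_gt0 m_ball) => //; exact: boundary_closure.
have U0 r : 0 < r -> 0 < U x r by move=> r0; exact: (vol_gt0 mu_ball).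
have i0 r : 0 < r -> 0 < inv_rho x r.
  by move=> r0; rewrite /inv_rho divr_gt0 ?mulr_gt0 ?exprn_gt0 ?U0 ?M0.
have [ts0|ts0] := eqVneq t s.
  rewrite ts0 divff ?gt_eqF// powR1 mul1r ler_peMl ?(ltW (i0 _ _))//.
  by rewrite le_max lexx.
have {}ts : t < s by rewrite lt_neqAle ts0.
have := rho_gr Gx t0 ts; rewrite !rhoE => h.
apply: (@le_trans _ _ (C5 * ((t / s) `^ gexp * inv_rho x s))); last first.
  by rewrite ler_wpM2r ?le_max ?lexx ?orbT// mulr_ge0 ?powR_ge0 ?ltW ?i0.
apply: growth_algebra; rewrite ?M0 ?U0//; apply: le_trans h _.
rewrite ler_pM2l ?growth_gt0// powRB ?powRr1 ?divr_ge0 ?(ltW s0) ?(ltW t0)//; last first.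
  by apply/implyP => _; rewrite gt_eqF// divr_gt0.
suff -> : (t / s) `^ gexp = ((s / t) `^ gexp)^-1 by [].
by rewrite -powRN -mulN1r powRrM powR_inv1 ?invf_div// divr_ge0 ?ltW.
Qed.

Let M0 X r : closure Omega X -> 0 < r -> 0 < M X r.
Proof. exact: (vol_gt0 m_ball). Qed.
Let U0 x r : Gamma x -> 0 < r -> 0 < U x r.
Proof. exact: (vol_gt0 mu_ball). Qed.

Lemma inv_rho_gt0 x r : Gamma x -> 0 < r -> 0 < inv_rho x r.
Proof.
move=> Gx r0; rewrite divr_gt0 ?mulr_gt0 ?exprn_gt0 ?U0// M0//.
exact: boundary_closure.
Qed.

Let alpha : R := gexp / 2.
Let alpha_gt0 : 0 < alpha.
Proof. by rewrite divr_gt0// invr_gt0 growth_gt0. Qed.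

(** Seen from a boundary point [x], the part of the cone at height [r]: both the distance to [x] and
    the distance to the boundary are comparable to [r]. *)
Definition cone_ball L x r := Omega `&`
  [set Z | enorm (Z - x) < L * r] `&` [set Z | r < L * delta Z].

Lemma measurable_cone_ball L x r : measurable (cone_ball L x r).
Proof.
apply: measurableI; first apply: measurableI => //.
  by apply: measurable_lt_set => //; apply: measurable_enormB.
apply: measurable_lt_set => //; apply: measurable_funM => //.
exact: measurable_delta.
Qed.

Definition truncated_cone L x s := Omega `&` [set Z | enorm (Z - x) < L * s]
  `&` [set Z | enorm (Z - x) < L * delta Z].

Lemma measurable_truncated_cone L x s : measurable (truncated_cone L x s).
Proof.
apply: measurableI; first apply: measurableI => //.
  by apply: measurable_lt_set => //; apply: measurable_enormB.
apply: measurable_lt_set => //; first exact: measurable_enormB.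
by apply: measurable_funM => //; exact: measurable_delta.
Qed.

Definition corkscrew_seq x s (Y : nat -> 'rV[R]_n) := forall j,
  [/\ Omega (Y j), enorm (Y j - x) < s * 2^-1 ^+ j & s * 2^-1 ^+ j <= C1 * delta (Y j)].

Lemma corkscrew_seq_exists x s : Gamma x -> 0 < s -> exists Y, corkscrew_seq x s Y.
Proof.
move=> Gx s0.
suff /choice[Y HY] : forall j, exists X, [/\ Omega X,
    enorm (X - x) < s * 2^-1 ^+ j & s * 2^-1 ^+ j <= C1 * delta X] by exists Y.
move=> j; have r0 : 0 < s * 2^-1 ^+ j by rewrite mulr_gt0// exprn_gt0// invr_gt0.
have [X [OX Xx dX]] := corkscrew oO Gamma0 C1_gt0 cs Gx r0.
by exists X; split => //; rewrite -ler_pdivrMl.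
Qed.

Lemma expr_half_lt (eps : R) : 0 < eps -> exists J : nat, 2^-1 ^+ J < eps.
Proof.
move=> e0; exists (Num.truncn eps^-1).+1.
rewrite -[ltRHS]invrK exprVn ltf_pV2 ?posrE ?exprn_gt0 ?invr_gt0//.
by rewrite (lt_le_trans (truncnS_gt _))// -natrX ler_nat ltnW// ltn_expl.
Qed.

Section density_function.
Variable f : 'rV[R]_n -> R.
Hypothesis mf : measurable_fun setT f.
Hypothesis f0 : forall Z, 0 <= f Z.

Lemma integral_density_fin A : (\int[m]_(Z in Omega) (f Z)%:E < +oo)%E ->
  measurable A -> A `<=` Omega ->
  (0 <= \int[m]_(Z in A) (f Z)%:E < +oo)%E.
Proof.
move=> fI mA AO; apply/andP; split.
  by apply: integral_ge0 => Z _; rewrite lee_fin.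
apply: le_lt_trans fI; apply: ge0_subset_integral => //.
- by apply/measurable_EFinP; exact: measurable_funTS.
- by move=> Z _; rewrite lee_fin.
Qed.

Definition cone_weight x s Z : R :=
  f Z * ((enorm (Z - x) / s) `^ alpha / U x (enorm (Z - x))).

Definition cone_fun L x s : \bar R :=
  (\int[m]_(Z in truncated_cone L x s) (cone_weight x s Z)%:E)%E.

Lemma cone_weight_ge0 x s Z : 0 <= cone_weight x s Z.
Proof. by rewrite mulr_ge0// divr_ge0 ?powR_ge0 ?vol_ge0. Qed.

Lemma cone_fun_ge0 L x s : (0 <= cone_fun L x s)%E.
Proof. by apply: integral_ge0 => Z _; rewrite lee_fin cone_weight_ge0. Qed.

Lemma measurable_cone_weight x s : measurable_fun setT (cone_weight x s).
Proof.
apply: measurable_funM => //; apply: measurable_funM.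
  apply: (measurableT_comp (measurable_powR _)).
  by apply: measurable_funM => //; exact: measurable_enormB.
apply: measurable_inv_ge0 => [Z|]; first exact: vol_ge0.
by apply: measurable_vol => //; exact: measurable_enormB.
Qed.

Lemma cone_fun_mono L L' x s : 0 < s -> L <= L' ->
  (cone_fun L x s <= cone_fun L' x s)%E.
Proof.
move=> s0 LL; apply: ge0_subset_integral.
- exact: measurable_truncated_cone.
- exact: measurable_truncated_cone.
- by apply/measurable_EFinP/measurable_funTS; exact: measurable_cone_weight.
- by move=> Z _; rewrite lee_fin cone_weight_ge0.
- move=> Z [[OZ /= h1] h2]; split; first split => //=.
    by rewrite (lt_le_trans h1)// ler_pM2r.
  by rewrite /= (lt_le_trans h2)// ler_wpM2r// delta_ge0.
Qed.

(** The square of a conical area function when [f] is [|grad u|^2]. Membership of [x] in the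
    boundary is put into the domain of integration so that this domain is a section of the
    measurable set [cone_set L]. *)
Definition cone_total L x : \bar R :=
  (\int[m]_(Z in [set Z | Gamma x /\ Omega Z /\ (enorm (Z - x) < L * delta Z)%R])
    (f Z / U x (enorm (Z - x)))%:E)%E.

Definition cone_set L := [set p : 'rV[R]_n * 'rV[R]_n |
  Gamma p.1 /\ Omega p.2 /\ (enorm (p.2 - p.1) < L * delta p.2)%R].

Lemma measurable_cone_set L : measurable (cone_set L).
Proof.
rewrite (_ : cone_set L = fst @^-1` Gamma `&` (snd @^-1` Omega `&`
   [set p | enorm (p.2 - p.1) < L * delta p.2])); last by apply/seteqP; split.
apply: measurableI.
  by rewrite -[X in measurable X]setTI; exact: measurable_fst.
apply: measurableI.
  by rewrite -[X in measurable X]setTI; exact: measurable_snd.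
apply: measurable_lt_set.
  by apply: measurable_enormB; [exact: measurable_snd|exact: measurable_fst].
apply: measurable_funM => //.
exact: (measurableT_comp (measurable_delta Gamma0) measurable_snd).
Qed.

Lemma measurable_cone_kernel : measurable_fun setT
  (fun p : 'rV[R]_n * 'rV[R]_n => (f p.2 / U p.1 (enorm (p.2 - p.1)))%:E).
Proof.
apply/measurable_EFinP; apply: measurable_funM.
  exact: (measurableT_comp mf measurable_snd).
apply: measurable_inv_ge0 => [p|]; first exact: vol_ge0.
apply: measurable_vol => //.
by apply: measurable_enormB; [exact: measurable_snd|exact: measurable_fst].
Qed.

Lemma measurable_cone_total L : measurable_fun setT (cone_total L).
Proof.
apply: (measurable_section_integral m (measurable_cone_set L) measurable_cone_kernel).
by move=> p; rewrite lee_fin divr_ge0// vol_ge0.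
Qed.

Lemma cone_total_ge0 L x : (0 <= cone_total L x)%E.
Proof. by apply: integral_ge0 => Z _; rewrite lee_fin divr_ge0// vol_ge0. Qed.

(** All integer apertures at once, so that one null set serves every cone. *)
Definition good x := forall L : nat, (cone_total L%:R x < +oo)%E.

End density_function.

(** After exchanging the integrals, a point [Z] is seen only from boundary points of a ball of
    radius about [delta Z]. There the denominator is comparable to the measure of that ball, so
    these points contribute a bounded total. *)
Lemma integral_cone_total_le L : 0 < L -> exists2 C : R, 0 <= C &
  forall f : 'rV[R]_n -> R, measurable_fun setT f -> (forall Z, 0 <= f Z) ->
  (\int[mu]_(x in Gamma) cone_total f L x <= C%:E * \int[m]_(Z in Omega) (f Z)%:E)%E.
Proof.
move=> L0; have [C C1' HC] := vol_dilate measurableT mu_ball mu_dbl (2 * L) Gamma0.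
have C_gt0 : 0 < C by lra.
exists C => [|f mf f0]; first exact: ltW.
apply: (@le_trans _ _ (\int[mu]_x cone_total f L x)%E).
  apply: ge0_subset_integral => //.
  - by apply: measurable_funTS; exact: (measurable_cone_total mf f0).
  - by move=> x _; exact: (cone_total_ge0 f0).
rewrite /cone_total.
have k0 p : (0 <= (f p.2 / U p.1 (enorm (p.2 - p.1)))%:E)%E.
  by rewrite lee_fin divr_ge0// vol_ge0.
rewrite (restricted_tonelli mu m (measurable_cone_set L) (measurable_cone_kernel mf) k0) /=.
rewrite -ge0_integralZl//; last 3 first.
- by apply/measurable_EFinP/measurable_funTS.
- by move=> Z _; rewrite lee_fin.
- by rewrite lee_fin ltW.
rewrite [leRHS]integral_mkcond; apply: le_integral_ge0 => Z _.
  by apply: integral_ge0 => x _; rewrite lee_fin divr_ge0// vol_ge0.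
set A := [set x | _].
have mA : measurable A.
  have := measurable_ysection Z (measurable_cone_set L).
  rewrite (_ : ysection _ _ = A)//; apply/seteqP; split => x; rewrite /ysection/=.
    by rewrite inE.
  by rewrite inE.
have [[x0 [Gx0 [OZ x0Z]]]|A0] := pselect (A !=set0); last first.
  have -> : A = set0 by apply/seteqP; split => // x Ax; apply: A0; exists x.
  by rewrite integral_set0 /patch; case: ifP => // _; rewrite -EFinM lee_fin mulr_ge0// ltW.
rewrite patchE mem_set//.
have dZ0 : 0 < delta Z by exact: delta_gt0.
(* Two boundary points that see [Z] are both within [L * delta Z] of it, hence within [r] of each
   other. *)
pose r := 2 * L * delta Z.
have r0 : 0 < r by rewrite /r !mulr_gt0.
have Ur : 0 < U x0 r by exact: U0.
have AB : A `<=` eball x0 r.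
  move=> x [_ [_ xZ]]; rewrite /eball/= /r.
  by have := enorm_triangle Z x x0; rewrite (enorm_sub x Z); lra.
apply: (@le_trans _ _ (\int[mu]_(x in A) (f Z * (C / U x0 r))%:E)%E).
  apply: le_integral_ge0 => x; first by rewrite lee_fin divr_ge0// vol_ge0.
  move=> Ax; have [Gx [_ xZ]] := Ax; rewrite lee_fin ler_wpM2l//.
  have dZ : delta Z <= enorm (Z - x) by exact: delta_le.
  have d0 : 0 < enorm (Z - x) by exact: lt_le_trans dZ.
  apply: inv_le_div => //; first exact: U0.
  apply: HC => //.
    have := AB x Ax; rewrite /eball/= /r => xx0.
    by rewrite (le_trans (ltW xx0))// ler_pM2l// mulr_gt0.
  by rewrite /r ler_pM2l// mulr_gt0.
rewrite integral_cst// -EFinM.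
apply: (@le_trans _ _ ((f Z * (C / U x0 r))%:E * (U x0 r)%:E)%E).
  apply: lee_wpmul2l; first by rewrite lee_fin mulr_ge0// divr_ge0 ?ltW.
  rewrite -(volE mu_ball)// setIT; apply: le_measure; rewrite ?inE//.
  exact: measurable_eball.
by rewrite -EFinM lee_fin -mulrA divfK ?gt_eqF// mulrC.
Qed.

Lemma good_ae (f : 'rV[R]_n -> R) : measurable_fun setT f -> (forall Z, 0 <= f Z) ->
  (\int[m]_(Z in Omega) (f Z)%:E < +oo)%E -> {ae mu, forall x, Gamma x -> good f x}.
Proof.
move=> mf f0 fI.
have H (L : nat) : {ae mu, forall x, Gamma x -> (cone_total f L%:R x < +oo)%E}.
  (* The next aperture is used because the integral bound asks for a positive aperture and [L] may
     be [0]. *)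
  have L1 : 0 < L.+1%:R :> R by [].
  have [C C_ge0 /(_ f mf f0) HC] := integral_cone_total_le L1.
  have mcL k : measurable_fun Gamma (cone_total f k).
    by apply: measurable_funTS; exact: (measurable_cone_total mf f0).
  have mono x : (cone_total f L%:R x <= cone_total f L.+1%:R x)%E.
    apply: ge0_subset_integral.
    - have := measurable_xsection x (measurable_cone_set L%:R).
      rewrite (_ : xsection _ _ = [set Z | Gamma x /\ Omega Z /\ (enorm (Z - x) < L%:R * delta Z)%R])//.
      by apply/seteqP; split => Z; rewrite /xsection/= inE.
    - have := measurable_xsection x (measurable_cone_set L.+1%:R).
      rewrite (_ : xsection _ _ = [set Z | Gamma x /\ Omega Z /\ (enorm (Z - x) < L.+1%:R * delta Z)%R])//.
      by apply/seteqP; split => Z; rewrite /xsection/= inE.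
    - apply: measurable_funTS.
      exact: (measurableT_comp (measurable_cone_kernel mf) (measurable_pair1 x)).
    - by move=> Z _; rewrite lee_fin divr_ge0// vol_ge0.
    - move=> Z [Gx [OZ h1]]; split => //; split => //.
      by rewrite (lt_le_trans h1)// ler_wpM2r ?delta_ge0// ler_nat.
  have int : mu.-integrable Gamma (cone_total f L.+1%:R).
    apply/integrableP; split => //.
    rewrite (eq_integral (cone_total f L.+1%:R)); last first.
      by move=> x _; rewrite gee0_abs// (cone_total_ge0 f0).
    apply: le_lt_trans HC _; rewrite -(fineK (_ : (\int[m]_(Z in Omega) (f Z)%:E)%E \is a fin_num)).
      by rewrite -EFinM ltry.
    by rewrite ge0_fin_numE// integral_ge0// => Z _; rewrite lee_fin.
  have [N [mN N0 HN]] := integrable_ae mG int.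
  exists N; split => // x /= nx; apply: HN => /= tx; apply: nx => Gx.
  apply: le_lt_trans (mono x) _.
  by have := tx Gx; rewrite ge0_fin_numE// (cone_total_ge0 f0).
have [N HN] := choice H.
exists (\bigcup_L N L); split.
- by apply: bigcup_measurable => L _; have [] := HN L.
- apply/(negligibleP mu).
    by apply: bigcup_measurable => L _; have [] := HN L.
  apply: negligible_bigcup => L; have [mN N0 _] := HN L.
  exact/negligibleP.
- move=> x /= /not_implyP[Gx] /existsNP[L nL]; exists L => //.
  by have [_ _] := HN L; apply => /= tx; apply: nL; exact: tx.
Qed.

Lemma cone_fun_lt_pinfty (f : 'rV[R]_n -> R) L x s : measurable_fun setT f ->
  (forall Z, 0 <= f Z) -> Gamma x -> good f x -> 0 < s -> 0 < L ->
  (cone_fun f L x s < +oo)%E.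
Proof.
move=> mf f0 Gx gx s0 L0; pose k := (Num.truncn L).+1.
have Lk : L < k%:R by exact: truncnS_gt.
apply: (@le_lt_trans _ _ ((L `^ alpha)%:E * cone_total f k%:R x)%E); last first.
  rewrite -(fineK (_ : cone_total f k%:R x \is a fin_num)); first by rewrite -EFinM ltry.
  by rewrite ge0_fin_numE ?(cone_total_ge0 f0)// gx.
rewrite -ge0_integralZl//; last 4 first.
- have := measurable_xsection x (measurable_cone_set k%:R).
  rewrite (_ : xsection _ _ = [set Z | Gamma x /\ Omega Z /\ (enorm (Z - x) < k%:R * delta Z)%R])//.
  by apply/seteqP; split => Z; rewrite /xsection/= inE.
- apply: measurable_funTS.
  exact: (measurableT_comp (measurable_cone_kernel mf) (measurable_pair1 x)).
- by move=> Z _; rewrite lee_fin divr_ge0// vol_ge0.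
- by rewrite lee_fin powR_ge0.
rewrite [leLHS]integral_mkcond [leRHS]integral_mkcond.
apply: le_integral_ge0 => Z _; rewrite /patch.
  by case: ifP => // _; rewrite lee_fin (cone_weight_ge0 f0).
case: ifPn => [/set_mem[[OZ /= h1] h2]|_]; last first.
  by case: ifP => // _; rewrite -EFinM lee_fin mulr_ge0 ?powR_ge0// divr_ge0 ?vol_ge0.
have dZ0 : 0 < delta Z by exact: delta_gt0.
rewrite mem_set; last first.
  by split => //; split => //; rewrite (lt_trans h2)// ltr_pM2r.
rewrite -EFinM lee_fin /cone_weight [leRHS]mulrCA ler_wpM2l//.
rewrite ler_wpM2r ?invr_ge0 ?vol_ge0//.
apply: ge0_ler_powR; rewrite ?nnegrE ?(ltW alpha_gt0) ?(ltW L0)//.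
  by rewrite divr_ge0 ?enorm_ge0// ltW.
by rewrite ler_pdivrMr// ltW.
Qed.

(* [f] stands for [|grad u|^2] and [h] for the interior averages of [u]; the
   last inequality is what the Poincare inequality gives. *)
Definition oscillation_pair (C0 : R) (h f : 'rV[R]_n -> R) := [/\
  measurable_fun setT f, forall Z, 0 <= f Z,
  (\int[m]_(Z in Omega) (f Z)%:E < +oo)%E &
  forall X Y, Omega X -> Omega Y -> enorm (X - Y) < 2^-1 * delta X ->
  (((h X - h Y) ^+ 2)%:E <= (C0 * delta X ^+ 2 / M X (delta X / 2))%:E *
    \int[m]_(Z in eball X (delta X / 2) `|` eball Y (delta Y / 2)) (f Z)%:E)%E].

Section uniform_estimates.
Variable C0 : R.
Hypothesis C0_ge0 : 0 <= C0.

Lemma chain_oscillation (K : R) : 0 < K -> exists C L, [/\ 0 < C, 1 <= L &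
  forall h f, oscillation_pair C0 h f -> forall x X Y r, Gamma x -> 0 < r -> Omega X -> Omega Y ->
  enorm (X - x) <= r -> enorm (Y - x) <= r -> r <= K * delta X -> r <= K * delta Y ->
  (((h X - h Y) ^+ 2)%:E <= (C * (r ^+ 2 / M x r))%:E *
    \int[m]_(Z in cone_ball L x r) (f Z)%:E)%E].
Proof.
move=> K0; have [N HN] := reachable_chains oO Gamma0 C1_gt0 cs hc (4 * K).
(* The largest factor by which the distance to the boundary can change along a chain of [N] steps,
   by [chain_bounds]. *)
pose P : R := 2 ^+ N.
have P1 : 1 <= P by rewrite exprn_ege1// ler1n.
have P0 : 0 < P by exact: lt_le_trans P1.
have KP0 : 0 < K * P by rewrite mulr_gt0.
pose L := 4 * (K * P) + 4 * P.
have [C' C'1 HC'] := vol_dilate mO m_ball m_dbl ((P + 1) * (2 * (K * P))) cO0.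
(* The square of [N] comes from a telescoping sum of [N] increments, each at most the square root of
   [B]; the summand [1] only makes the constant positive. *)
exists (N%:R ^+ 2 * (C0 * P ^+ 2 * C') + 1), L; split.
- rewrite ltr_wpDl// !mulr_ge0 ?exprn_ge0 ?(le_trans _ C'1)// ltW//.
- by rewrite /L; lra.
move=> h f [mf f0 fI osc] x X Y r Gx r0 OX OY Xx Yx rX rY.
set S := cone_ball L x r; set I := (\int[m]_(Z in S) _)%E.
have SO : S `<=` Omega by move=> Z [[]].
have mS : measurable S by exact: measurable_cone_ball.
have /andP[I0 Ioo] := integral_density_fin mf f0 fI mS SO.
have IE : I = (fine I)%:E by rewrite fineK// ge0_fin_numE.
have i0 : 0 <= fine I by exact: fine_ge0.
have Mx0 : 0 < M x r by apply: M0 => //; exact: boundary_closure.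
pose B := C0 * P ^+ 2 * C' * (r ^+ 2 / M x r) * fine I.
have B0 : 0 <= B.
  by rewrite /B !mulr_ge0 ?exprn_ge0 ?(le_trans _ C'1)// ?invr_ge0 ltW.
have dX0 : 0 < delta X by exact: delta_gt0.
have dXr : delta X <= r by rewrite (le_trans (delta_le Gamma0 X Gx)).
(* Both points are farther than [r / (2 * K)] from the boundary and at most [2 * r] apart, which is
   [4 * K] times that distance. *)
have [Z [Z0 ZN OZ SZ]] : reachable Omega N X Y.
  apply: (HN (r / (2 * K))) => //.
  - by rewrite divr_gt0// mulr_gt0.
  - by rewrite ltr_pdivrMr ?mulr_gt0//; have := mulr_gt0 K0 dX0; lra.
  - have dY0 : 0 < delta Y by exact: delta_gt0.
    by rewrite ltr_pdivrMr ?mulr_gt0//; have := mulr_gt0 K0 dY0; lra.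
  - rewrite (_ : 4 * K * (r / (2 * K)) = 2 * r); last by field; rewrite gt_eqF.
    by have := enorm_triangle x X Y; rewrite (enorm_sub x Y); lra.
have bZ i : (i <= N)%N -> [/\ delta (Z i) <= P * r, r <= K * P * delta (Z i) &
    enorm (Z i - x) <= P * r + r].
  move=> iN; have [h1 h2 h3] := chain_bounds Gamma0 SZ iN.
  have iP : 2 ^+ i <= P by rewrite ler_weXn2l// ler1n.
  have i1 : 0 <= 2 ^+ i :> R by rewrite exprn_ge0.
  have Pr : 2 ^+ i * delta X <= P * r by rewrite ler_pM// ltW.
  rewrite Z0 in h1 h2 h3; split; first lra.
    rewrite (le_trans rX)// -mulrA ler_pM2l// (le_trans h1)//.
    by rewrite ler_wpM2r ?delta_ge0.
  have := enorm_triangle X (Z i) x; lra.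
have BS i : (i <= N)%N -> eball (Z i) (delta (Z i) / 2) `<=` S.
  move=> iN W; rewrite /eball/= => WZ; have [h1 h2 h3] := bZ i iN.
  have Zi0 : 0 < delta (Z i) by apply: delta_gt0 => //; exact: OZ.
  have dW := delta_lip Gamma0 (Z i) W; rewrite (enorm_sub (Z i)) in dW.
  split; [split|].
  - by apply: (eball_delta oO Gamma0 (OZ i iN)); rewrite /eball/=; lra.
  - rewrite /= /L; have := enorm_triangle (Z i) W x.
    have : 0 < K * P * r by rewrite mulr_gt0.
    have : r <= P * r by rewrite ler_peMl// ltW.
    lra.
  - rewrite /= /L.
    have : K * P * delta (Z i) < K * P * (2 * delta W) by rewrite ltr_pM2l//; lra.
    have : 0 < K * P * delta W by rewrite mulr_gt0//; lra.
    have : 0 < P * delta W by rewrite mulr_gt0//; lra.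
    lra.
have step i : (i < N)%N -> `|h (Z i) - h (Z i.+1)| <= Num.sqrt B.
  move=> iN; have iN' := ltnW iN.
  have := osc _ _ (OZ i iN') (OZ i.+1 iN) (SZ i iN).
  set J := (\int[m]_(Z in _) _)%E => hJ.
  have JI : (J <= I)%E.
    apply: ge0_subset_integral => //.
    - by apply: measurableU; exact: measurable_eball.
    - by apply/measurable_EFinP; exact: measurable_funTS.
    - by move=> W _; rewrite lee_fin.
    - by rewrite subUset; split; exact: BS.
  have [h1 h2 h3] := bZ i iN'.
  have Zi0 : 0 < delta (Z i) by apply: delta_gt0 => //; exact: OZ.
  have cZ : closure Omega (Z i) by apply: subset_closure; exact: OZ.
  have Zi2 : 0 < delta (Z i) / 2 by rewrite divr_gt0.
  have MM : M x r <= C' * M (Z i) (delta (Z i) / 2).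
    apply: HC' => //; first exact: boundary_closure.
      rewrite (le_trans h3)//.
      rewrite (_ : _ * (delta (Z i) / 2) = (P + 1) * (K * P * delta (Z i))); last by field.
      have p10 : 0 <= P + 1 by lra.
      by have := ler_wpM2l p10 h2; lra.
    rewrite (_ : _ * (delta (Z i) / 2) = (P + 1) * (K * P * delta (Z i))); last by field.
    by rewrite (le_trans h2)// ler_peMl ?lerDr ?ltW// mulr_gt0.
  rewrite -sqrtr_sqr ler_wsqrtr// -lee_fin; apply: le_trans hJ _.
  apply: (@le_trans _ _ ((C0 * P ^+ 2 * C' * (r ^+ 2 / M x r))%:E * I)%E); last first.
    by rewrite IE -EFinM lee_fin.
  apply: lee_pmul => //.
  - by rewrite lee_fin !mulr_ge0 ?exprn_ge0 ?delta_ge0// invr_ge0 vol_ge0.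
  - by apply: integral_ge0 => W _; rewrite lee_fin.
  rewrite lee_fin -[_ / _ in leLHS]mulrA.
  have -> : C0 * P ^+ 2 * C' * (r ^+ 2 / M x r) = C0 * ((P * r) ^+ 2 * (C' / M x r)).
    by rewrite exprMn; ring.
  rewrite ler_wpM2l//.
  rewrite ler_pM ?exprn_ge0 ?invr_ge0 ?vol_ge0 ?delta_ge0//.
    by rewrite ler_pXn2r// nnegrE ?delta_ge0// mulr_ge0// ltW.
  by apply: inv_le_div => //; exact: M0.
have tel i : (i <= N)%N -> `|h (Z 0%N) - h (Z i)| <= i%:R * Num.sqrt B.
  elim: i => [_|i IH iN]; first by rewrite subrr normr0 mul0r.
  rewrite -(subrKA (h (Z i))) (le_trans (ler_normD _ _))//.
  by rewrite -natr1 mulrDl mul1r lerD ?IH ?step// ltnW.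
have := tel N (leqnn N); rewrite Z0 ZN => hXY.
rewrite IE -EFinM lee_fin -real_normK ?num_real//.
apply: (@le_trans _ _ ((N%:R * Num.sqrt B) ^+ 2)).
  by rewrite ler_pXn2r// nnegrE ?mulr_ge0// sqrtr_ge0.
rewrite exprMn sqr_sqrtr// /B.
have : 0 <= r ^+ 2 / M x r * fine I by rewrite mulr_ge0// divr_ge0 ?exprn_ge0// ltW.
lra.
Qed.

(* The decay [(t / s) `^ alpha] is half of the exponent available from [growth];
   the other half is kept as the weight in [cone_fun], which makes the estimates
   over successive dyadic scales summable. *)
Lemma step_oscillation (K : R) : 0 < K -> exists C L, [/\ 0 < C, 1 <= L &
  forall h f, oscillation_pair C0 h f -> forall x X Y s t, Gamma x -> 0 < t -> t <= s -> Omega X -> Omega Y ->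
  enorm (X - x) <= t -> enorm (Y - x) <= t -> t <= K * delta X -> t <= K * delta Y ->
  (((h X - h Y) ^+ 2)%:E <= (C * inv_rho x s * (t / s) `^ alpha)%:E *
    cone_fun f L x s)%E].
Proof.
move=> K0; have [C [L0 [C_gt0 L01 H]]] := chain_oscillation K0.
have [Cg Cg1 Hg] := growth.
have [C' C'1 HC'] := vol_dilate measurableT mu_ball mu_dbl L0 Gamma0.
have L00 : 0 < L0 by lra.
have C'0 : 0 < C' by lra.
have La0 : 0 < L0 `^ alpha by rewrite powR_gt0.
exists (C * (C' * L0 `^ alpha) * Cg), (L0 ^+ 2); split.
- by rewrite !mulr_gt0//; lra.
- by rewrite exprn_ege1.
move=> h f hf x X Y s t Gx t0 ts OX OY Xx Yx tX tY.
have [mf f0 fI _] := hf.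
have s0 : 0 < s by exact: lt_le_trans ts.
set p := (t / s) `^ alpha.
have p0 : 0 < p by rewrite powR_gt0// divr_gt0.
have Ut : 0 < U x t by exact: U0.
(* On [cone_ball L0 x t] the distance [d] from [Z] to [x] satisfies [t / L0 < d < L0 * t]. Doubling
   then bounds [U x d] by [C' * U x t], and the decaying factor is at least [p] divided by a power
   of [L0]. *)
pose c := C' * U x t * (L0 `^ alpha / p).
have c0 : 0 < c by rewrite /c !mulr_gt0// invr_gt0.
have I1 : (\int[m]_(Z in cone_ball L0 x t) (f Z)%:E <= c%:E * cone_fun f (L0 ^+ 2) x s)%E.
  rewrite -ge0_integralZl//; last 4 first.
  - exact: measurable_truncated_cone.
  - by apply/measurable_EFinP/measurable_funTS; exact: (measurable_cone_weight mf).
  - by move=> Z _; rewrite lee_fin (cone_weight_ge0 f0).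
  - by rewrite lee_fin ltW.
  rewrite [leLHS]integral_mkcond [leRHS]integral_mkcond.
  apply: le_integral_ge0 => Z _; rewrite /patch.
    by case: ifP => // _; rewrite lee_fin.
  case: ifPn => [/set_mem[[OZ /= dL] tL]|_]; last first.
    by case: ifP => // _; rewrite -EFinM lee_fin mulr_ge0 ?(cone_weight_ge0 f0)// ltW.
  set d := enorm (Z - x) in dL *.
  have dZ : delta Z <= d by exact: delta_le.
  have d0 : 0 < d by exact: lt_le_trans (delta_gt0 oO Gamma0 OZ) dZ.
  have L0dZ : L0 * delta Z <= L0 * d by rewrite ler_pM2l.
  rewrite mem_set; last first.
    split; first split => //=; rewrite -/d expr2.
      rewrite -mulrA (lt_le_trans dL)// ler_pM2l//.
      by rewrite (le_trans ts)// ler_peMl// ltW.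
    by rewrite /= -/d -mulrA (lt_le_trans dL)// ler_pM2l// ltW.
  rewrite -EFinM lee_fin /cone_weight -/d /c.
  have Ud : 0 < U x d by exact: U0.
  have r1 : 1 <= C' * U x t / U x d.
    rewrite ler_pdivlMr// mul1r; apply: HC' => //; last exact: ltW.
    by rewrite subrr enorm0 mulr_ge0// ltW.
  have r2 : 1 <= L0 `^ alpha / p * (d / s) `^ alpha.
    rewrite mulrAC ler_pdivlMr// mul1r -powRM ?divr_ge0 ?(ltW d0) ?(ltW s0) ?(ltW L00)//.
    apply: ge0_ler_powR; rewrite ?nnegrE ?(ltW alpha_gt0)//.
    - by rewrite divr_ge0 ?ltW.
    - by rewrite mulr_ge0 ?divr_ge0 ?ltW.
    - rewrite mulrA ler_pM2r ?invr_gt0//; lra.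
  have := ler_pM ler01 ler01 r1 r2; rewrite mulr1 => r3.
  have := ler_wpM2l (f0 Z) r3; rewrite mulr1 => r4.
  by apply: le_trans r4 _; rewrite le_eqVlt; apply/orP; left; apply/eqP; ring.
apply: le_trans (H h f hf x X Y t Gx t0 OX OY Xx Yx tX tY) _.
have Mt : 0 < M x t by apply: M0 => //; exact: boundary_closure.
apply: (@le_trans _ _ ((C * (t ^+ 2 / M x t))%:E * (c%:E * cone_fun f (L0 ^+ 2) x s))%E).
  by apply: lee_wpmul2l => //; rewrite lee_fin mulr_ge0 ?divr_ge0 ?exprn_ge0// ltW.
rewrite muleA -EFinM; apply: lee_wpmul2r; first exact: (cone_fun_ge0 f0).
rewrite lee_fin.
have -> : C * (t ^+ 2 / M x t) * c = C * (C' * L0 `^ alpha) * (inv_rho x t / p).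
  by rewrite /c /inv_rho; ring.
rewrite -!(mulrA (C * _)) ler_pM2l ?mulr_gt0//.
have := Hg x s t Gx t0 ts.
have -> : (t / s) `^ gexp = p * p.
  rewrite /p -powRD; first by congr (_ `^ _); rewrite /alpha; lra.
  by apply/implyP => _; rewrite gt_eqF// divr_gt0.
by move=> hg; rewrite ler_pdivrMr// (le_trans hg)// le_eqVlt; apply/orP; left; apply/eqP; ring.
Qed.

(** Ratio of the increments of [h] between successive dyadic scales; a square root because
    [step_oscillation] bounds squares. *)
Let q : R := Num.sqrt (2^-1 `^ alpha).

Let q01 : 0 < q < 1.
Proof.
have h1 : 0 < 2^-1 `^ alpha by rewrite powR_gt0// invr_gt0.
rewrite sqrtr_gt0 h1 -[ltRHS]sqrtr1 ltr_sqrt//=.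
have := @gt0_ltr_powR R alpha alpha_gt0 2^-1 1.
by rewrite !nnegrE powR1; apply => //; rewrite ?invr_ge0// invf_lt1// ltr1n.
Qed.

Let sqr_q j : (q ^+ j) ^+ 2 = (2^-1 ^+ j) `^ alpha.
Proof.
rewrite -exprM mulnC exprM sqr_sqrtr ?powR_ge0//.
elim: j => [|j IH]; first by rewrite !expr0 powR1.
by rewrite !exprS powRM ?IH ?exprn_ge0// invr_ge0.
Qed.

Lemma corkscrew_limit : exists C L, [/\ 0 < C, 1 <= L &
  forall h f, oscillation_pair C0 h f -> forall x s Y, Gamma x -> 0 < s -> corkscrew_seq x s Y -> (cone_fun f L x s < +oo)%E ->
  exists2 l, (fun j => h (Y j)) @ \oo --> l & forall j,
    `|h (Y j) - l| <= C * Num.sqrt (inv_rho x s * fine (cone_fun f L x s)) * q ^+ j].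
Proof.
(* The points of generations [j] and [j.+1] are compared at the scale of generation [j], which costs
   the second one a factor [2] in its corkscrew constant. *)
have C20 : 0 < 2 * C1 by rewrite mulr_gt0.
have [C [L [C_gt0 L1 H]]] := step_oscillation C20.
have /andP[q0 q1] := q01.
exists (Num.sqrt C / (1 - q)), L; split => //.
  by rewrite divr_gt0 ?sqrtr_gt0 ?subr_gt0.
move=> h f hf x s Y Gx s0 HY Foo; have [mf f0 fI _] := hf.
set F := fine _; have F0 : 0 <= F by rewrite fine_ge0// (cone_fun_ge0 f0).
have FE : cone_fun f L x s = F%:E by rewrite fineK// ge0_fin_numE// (cone_fun_ge0 f0).
have i0 : 0 < inv_rho x s by exact: inv_rho_gt0.
have := @geometric_increments R (fun j => h (Y j)) (Num.sqrt C * Num.sqrt (inv_rho x s * F)) q.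
move=> /(_ (mulr_ge0 (sqrtr_ge0 _) (sqrtr_ge0 _)) q01) [j|l Yl Hl].
  have [OY Yx dY] := HY j; have [OY' Yx' dY'] := HY j.+1.
  have t0 : 0 < s * 2^-1 ^+ j by rewrite mulr_gt0// exprn_gt0// invr_gt0.
  have p1 : 2^-1 ^+ j <= 1 :> R by rewrite exprn_ile1// ?invr_ge0// invf_le1// ler1n.
  have hS : s * 2^-1 ^+ j.+1 = s * 2^-1 ^+ j / 2 by rewrite exprSr mulrA.
  have := H h f hf x (Y j.+1) (Y j) s (s * 2^-1 ^+ j) Gx t0.
  rewrite hS in Yx' dY'; rewrite FE -EFinM lee_fin => /(_ _ OY' OY) HH.
  have {}HH : (h (Y j.+1) - h (Y j)) ^+ 2 <=
     C * inv_rho x s * (s * 2^-1 ^+ j / s) `^ alpha * F.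
    have := delta_gt0 oO Gamma0 OY; have := delta_gt0 oO Gamma0 OY' => d1 d2.
    have c1 : 0 < C1 * delta (Y j) by rewrite mulr_gt0.
    by apply: HH; rewrite -?mulrA ?ger_pMr//; lra.
  rewrite -sqrtr_sqr -(ger0_norm (exprn_ge0 j (ltW q0))) -[`|q ^+ j|]sqrtr_sqr.
  have CiF : 0 <= inv_rho x s * F by apply: mulr_ge0 => //; exact: ltW.
  have CiF2 : 0 <= C * (inv_rho x s * F) by apply: mulr_ge0 => //; exact: ltW.
  rewrite -(sqrtrM _ (ltW C_gt0)) -(sqrtrM _ CiF2).
  rewrite ler_wsqrtr// (le_trans HH)// sqr_q.
  have -> : s * 2^-1 ^+ j / s = 2^-1 ^+ j by rewrite mulrAC divff ?gt_eqF// mul1r.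
  by rewrite le_eqVlt; apply/orP; left; apply/eqP; ring.
exists l => // j; rewrite (le_trans (Hl j))//.
by rewrite le_eqVlt; apply/orP; left; apply/eqP; ring.
Qed.

(** Convergence in cones of every aperture. It makes no reference to the cubes, and it implies
    [cone_limit] because access cones lie in a cone of some fixed aperture. *)
Definition nt_limit (h : 'rV[R]_n -> R) x l := forall K eps, 0 < K -> 0 < eps -> exists2 eta, 0 < eta &
  forall X, Omega X -> enorm (X - x) <= K * delta X -> enorm (X - x) < eta ->
  `|h X - l| < eps.

Lemma nt_limit_corkscrew (h : 'rV[R]_n -> R) x s Y l : 0 < s -> corkscrew_seq x s Y -> nt_limit h x l ->
  (fun j => h (Y j)) @ \oo --> l.
Proof.
move=> s0 HY xl; apply/cvgrPdist_lt => e e0.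
have [eta eta0 Heta] := xl C1 e C1_gt0 e0.
have [J HJ] := expr_half_lt (divr_gt0 eta0 s0).
exists J => // j /= Jj; have [OY Yx dY] := HY j.
rewrite distrC; apply: Heta => //; first by rewrite (le_trans (ltW Yx)).
rewrite (lt_trans Yx)// mulrC -ltr_pdivlMr//; apply: le_lt_trans HJ.
by rewrite ler_wiXn2l// ?invr_ge0// invf_le1// ler1n.
Qed.

(** The limit is first found along one corkscrew sequence. A point of any cone is then compared with
    the member of that sequence at its own height. *)
Lemma nt_limit_exists h f x : oscillation_pair C0 h f -> Gamma x -> good f x -> exists l, nt_limit h x l.
Proof.
move=> hf Gx gx; have [mf f0 fI _] := hf; have [C [L [C_gt0 L1 H]]] := corkscrew_limit.
have [Y HY] := corkscrew_seq_exists Gx (@ltr01 R).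
have Foo L' : 0 < L' -> (cone_fun f L' x 1 < +oo)%E by move=> L'0; exact: (cone_fun_lt_pinfty mf f0).
have [l Yl Hl] := H h f hf x 1 Y Gx ltr01 HY (Foo L (lt_le_trans ltr01 L1)).
exists l => K eps K0 eps0.
(* The maximum covers the aperture of [X] and that of the corkscrew points; doubling it absorbs the
   rounding of [enorm (X - x)] up to a power of [2]. *)
pose K' := Num.max K C1 *+ 2.
have K'0 : 0 < K' by rewrite pmulrn_lgt0// lt_max K0.
have [C' [L' [C'_gt0 L'1 H']]] := step_oscillation K'0.
have /andP[q0 q1] := q01.
have L'0 : 0 < L' by lra.
set c1 := C * Num.sqrt _ in Hl.
pose F := fine (cone_fun f L' x 1).
have F0 : 0 <= F by rewrite fine_ge0// (cone_fun_ge0 f0).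
have FE : cone_fun f L' x 1 = F%:E by rewrite fineK// ge0_fin_numE ?(cone_fun_ge0 f0)// Foo.
have i0 : 0 < inv_rho x 1 by exact: inv_rho_gt0.
pose c2 := Num.sqrt (C' * inv_rho x 1 * F).
have c10 : 0 <= c1 by rewrite mulr_ge0 ?sqrtr_ge0// ltW.
have c20 : 0 <= c2 by exact: sqrtr_ge0.
have [J HJ] : exists J : nat, (c1 + c2) * q ^+ J < eps.
  have := @cvg_geometric R (c1 + c2) q; rewrite gtr0_norm// => /(_ q1).
  move/cvgrPdist_lt => /(_ eps eps0)[J _ HJ]; exists J.
  have := HJ J (leqnn J); rewrite /= sub0r normrN.
  by move/(le_lt_trans (ler_norm _)).
exists (2^-1 ^+ J) => [|X OX XK XJ]; first by rewrite exprn_gt0// invr_gt0.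
have dX0 : 0 < delta X by exact: delta_gt0.
have t0 : 0 < enorm (X - x) by apply: lt_le_trans dX0 _; exact: delta_le.
(* Rounding gives [j] with [enorm (X - x) < 2 ^ -j <= 2 * enorm (X - x)]; closeness of [X] to [x]
   forces [J <= j]. *)
have [k /andP[k1 k2]] := dyadic_floor t0.
have [j jk] : exists j : nat, 2 ^ (k + 1) = 2^-1 ^+ j :> R /\ (J <= j)%N.
  have : 2 ^ k < 2 ^ (- J%:Z) :> R.
    by rewrite -invr_expz -exprnP -exprVn (le_lt_trans k1).
  rewrite ltr_eXz2l ?ltr1n// => kJ.
  have [j [-> Jj]] := int_lt_opp kJ; exists j; split => //.
  by rewrite -invr_expz -exprnP exprVn.
have [jE Jj] := jk.
have jE2 : 2^-1 ^+ j <= 2 * enorm (X - x).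
  by rewrite -jE exprzDr ?unitfE// expr1z mulrC ler_pM2l.
have [OY Yx dY] := HY j; rewrite mul1r in Yx dY.
have j0 : 0 < 2^-1 ^+ j :> R by rewrite exprn_gt0// invr_gt0.
have j1 : 2^-1 ^+ j <= 1 :> R by rewrite exprn_ile1// ?invr_ge0// invf_le1// ler1n.
have dY0 : 0 < delta (Y j) by exact: delta_gt0.
have := H' h f hf x X (Y j) 1 (2^-1 ^+ j) Gx j0 j1 OX OY.
rewrite FE -EFinM lee_fin divr1 -sqr_q => HH.
have {}HH : `|h X - h (Y j)| <= c2 * q ^+ j.
  rewrite -sqrtr_sqr -(ger0_norm (exprn_ge0 j (ltW q0))) -[`|q ^+ j|]sqrtr_sqr.
  have CiF : 0 <= C' * inv_rho x 1 * F.
    by apply: mulr_ge0 => //; apply: mulr_ge0; exact: ltW.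
  rewrite -(sqrtrM _ CiF).
  rewrite ler_wsqrtr//; apply: le_trans (HH _ _ _ _) _.
  - by rewrite -jE ltW.
  - exact: ltW.
  - rewrite (le_trans jE2)// /K' mulr2n mulrDl.
    have : K * delta X <= Num.max K C1 * delta X by rewrite ler_pM2r// le_max lexx.
    lra.
  - rewrite (le_trans dY)// /K' mulr2n mulrDl.
    have : C1 * delta (Y j) <= Num.max K C1 * delta (Y j).
      by rewrite ler_pM2r// le_max lexx orbT.
    have : 0 < C1 * delta (Y j) by rewrite mulr_gt0.
    lra.
  - by rewrite le_eqVlt; apply/orP; left; apply/eqP; ring.
apply: le_lt_trans HJ; rewrite -(subrKA (h (Y j))) (le_trans (ler_normD _ _))//.
apply: (@le_trans _ _ ((c1 + c2) * q ^+ j)).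
  by rewrite mulrDl addrC lerD.
rewrite ler_wpM2l ?addr_ge0// ler_wiXn2l// ltW//.
Qed.

(** The first corkscrew point at height [s] serves as an intermediary: the geometric increments
    bound its distance to the limit, and a single step at scale [s] compares it with [X]. *)
Lemma limit_estimate (K : R) : 0 < K -> exists C L, [/\ 0 < C, 1 <= L &
  forall h f, oscillation_pair C0 h f -> forall x X s l, Gamma x -> 0 < s -> Omega X -> enorm (X - x) <= s ->
  s <= K * delta X -> nt_limit h x l ->
  (((h X - l) ^+ 2)%:E <= (C * inv_rho x s)%:E * cone_fun f L x s)%E].
Proof.
move=> K0; pose K' := Num.max K C1.
have K'0 : 0 < K' by rewrite lt_max K0.
have [C [L [C_gt0 L1 H]]] := corkscrew_limit.
have [C' [L' [C'_gt0 L'1 H']]] := step_oscillation K'0.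
pose L2 := Num.max L L'.
exists ((C + Num.sqrt C') ^+ 2), L2; split.
- by rewrite exprn_gt0// ltr_wpDr// sqrtr_ge0.
- by rewrite le_max L1.
move=> h f hf x X s l Gx s0 OX Xx sX xl.
have [mf f0 fI _] := hf.
have i0 : 0 < inv_rho x s by exact: inv_rho_gt0.
(* If the cone integral is infinite the right-hand side is too, because its constant is positive. *)
have [Foo|Foo] := ltP (cone_fun f L2 x s) +oo%E; last first.
  move: Foo; rewrite leye_eq => /eqP ->; rewrite gt0_muley ?leey//.
  by rewrite lte_fin mulr_gt0// exprn_gt0// ltr_wpDr// sqrtr_ge0.
have LE : (cone_fun f L x s <= cone_fun f L2 x s)%E.
  by apply: (cone_fun_mono mf f0) => //; rewrite le_max lexx.
have LE' : (cone_fun f L' x s <= cone_fun f L2 x s)%E.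
  by apply: (cone_fun_mono mf f0) => //; rewrite le_max lexx orbT.
have fin k : (cone_fun f k x s <= cone_fun f L2 x s)%E -> cone_fun f k x s \is a fin_num.
  by move=> hk; rewrite ge0_fin_numE ?(cone_fun_ge0 f0)// (le_lt_trans hk).
pose F := fine (cone_fun f L2 x s).
have F0 : 0 <= F by rewrite fine_ge0// (cone_fun_ge0 f0).
have FE : cone_fun f L2 x s = F%:E by rewrite fineK// fin.
have [Y HY] := corkscrew_seq_exists Gx s0.
have [l' Yl' Hl'] := H h f hf x s Y Gx s0 HY (le_lt_trans LE Foo).
have ll : l = l'.
  have Yl := nt_limit_corkscrew s0 HY xl.
  exact: (cvg_unique _ Yl Yl').
have [OY Yx dY] := HY 0%N; rewrite expr0 mulr1 in Yx dY.
have dX0 : 0 < delta X by exact: delta_gt0.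
have dY0 : 0 < delta (Y 0%N) by exact: delta_gt0.
have h1 : `|h (Y 0%N) - l| <= C * Num.sqrt (inv_rho x s * F).
  rewrite ll (le_trans (Hl' 0%N))// expr0 mulr1 ler_wpM2l ?(ltW C_gt0)//.
  rewrite ler_wsqrtr// ler_wpM2l ?(ltW i0)// fine_le//; [exact: fin|exact: fin].
have h2 : `|h X - h (Y 0%N)| <= Num.sqrt C' * Num.sqrt (inv_rho x s * F).
  rewrite -sqrtr_sqr -sqrtrM ?(ltW C'_gt0)// ler_wsqrtr// -lee_fin.
  apply: le_trans (H' h f hf x X (Y 0%N) s s Gx s0 (lexx s) OX OY Xx (ltW Yx) _ _) _.
  - by rewrite (le_trans sX)// ler_pM2r// le_max lexx.
  - by rewrite (le_trans dY)// ler_pM2r// le_max lexx orbT.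
  have -> : C' * (inv_rho x s * F) = C' * inv_rho x s * F by rewrite mulrA.
  rewrite divff ?gt_eqF// powR1 mulr1 [leRHS]EFinM -FE.
  by apply: lee_wpmul2l => //; rewrite lee_fin mulr_ge0 ?ltW.
rewrite FE -EFinM lee_fin -real_normK ?num_real//.
have -> : (C + Num.sqrt C') ^+ 2 * inv_rho x s * F =
   ((C + Num.sqrt C') * Num.sqrt (inv_rho x s * F)) ^+ 2.
  by rewrite exprMn sqr_sqrtr ?mulrA// mulr_ge0// ltW.
rewrite ler_pXn2r// ?nnegrE ?mulr_ge0 ?addr_ge0 ?sqrtr_ge0 ?(ltW C_gt0)//.
rewrite -(subrKA (h (Y 0%N))) (le_trans (ler_normD _ _))//.
by rewrite mulrDl addrC lerD.
Qed.

(** For fixed [x] and a point at distance [d] from it, sums over the boundary points [y] whose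
    truncated cones reach that far. On the annulus at distance [2 ^ k * d / L] the decaying factor
    is geometric in [k], and the denominator cancels the measure of the annulus up to doubling. *)
Lemma integral_far_kernel_le (L : R) : 0 < L -> exists2 C : R, 0 <= C &
  forall x d, Gamma x -> 0 < d ->
  (\int[mu]_(y in [set y | Gamma y /\ (d < L * enorm (y - x))%R])
    ((d / enorm (y - x)) `^ alpha / U x (enorm (y - x)))%:E <= C%:E)%E.
Proof.
move=> L0; have [C' C'1 HC'] := vol_dilate measurableT mu_ball mu_dbl 2 Gamma0.
pose p : R := 2^-1 `^ alpha.
have p0 : 0 < p by rewrite powR_gt0// invr_gt0.
have p1 : p < 1.
  have := @gt0_ltr_powR R alpha alpha_gt0 2^-1 1.
  by rewrite !nnegrE powR1; apply => //; rewrite ?invr_ge0// invf_lt1// ltr1n.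
have La : 0 < L `^ alpha by rewrite powR_gt0.
have b0 : 0 <= L `^ alpha * C' by rewrite mulr_ge0 ?ltW//; lra.
exists (L `^ alpha * C' / (1 - p)); first by rewrite divr_ge0// subr_ge0 ltW.
move=> x d Gx d0.
pose phi t := (d / t) `^ alpha / U x t.
have phi0 t : 0 <= phi t by rewrite divr_ge0 ?powR_ge0 ?vol_ge0.
have tau0 : 0 < d / L by rewrite divr_gt0.
apply: le_trans (integral_annuli_le (nu := mu) mG (x := x) (phi := phi) tau0 (ltW p0) p1 b0 _ _ _) => //.
- apply: ge0_subset_integral.
  + rewrite (_ : [set y | _] = Gamma `&` [set y | d < L * enorm (y - x)]); last by apply/seteqP; split.
    apply: measurableI => //; apply: measurable_lt_set => //.
    by apply: measurable_funM => //; exact: measurable_enormB.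
  + apply: measurableI => //; rewrite (_ : [set y | _] = ~` [set y | enorm (y - x) < d / L]).
      by apply: measurableC; apply: measurable_lt_set => //; exact: measurable_enormB.
    by apply/seteqP; split => y /=; rewrite leNgt => /negP.
  + apply/measurable_EFinP/measurable_funTS; apply: measurable_funM.
      apply: (measurableT_comp (measurable_powR _)); apply: measurable_funM => //.
      by apply: measurable_inv_ge0; [move=> ?; exact: enorm_ge0|exact: measurable_enormB].
    apply: measurable_inv_ge0 => [y|]; first exact: vol_ge0.
    by apply: measurable_vol => //; exact: measurable_enormB.
  + by move=> y _; rewrite lee_fin divr_ge0 ?powR_ge0 ?vol_ge0.
  + by move=> y [Gy /= dy]; split => //=; rewrite ler_pdivrMr// mulrC ltW.
- move=> a t a0 at_; rewrite /phi; have t0 : 0 < t by exact: lt_le_trans at_.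
  rewrite ler_pM ?powR_ge0 ?invr_ge0 ?vol_ge0//.
    apply: ge0_ler_powR; rewrite ?nnegrE; first exact: ltW.
    + by rewrite divr_ge0 ?ltW.
    + by rewrite divr_ge0 ?ltW.
    + by rewrite ler_pM2l// lef_pV2.
  rewrite lef_pV2 ?posrE ?U0//; exact: (vol_le_radius measurableT mu_ball).
- move=> k; set t := 2 ^+ k * (d / L).
  have t0 : 0 < t by rewrite mulr_gt0// exprn_gt0.
  have t20 : 0 < 2 ^+ k.+1 * (d / L) by rewrite mulr_gt0// exprn_gt0.
  apply: (@le_trans _ _ ((phi t)%:E * (U x (2 ^+ k.+1 * (d / L)))%:E)%E).
    apply: lee_wpmul2l; first by rewrite lee_fin.
    rewrite -(volE mu_ball)//; apply: le_measure; rewrite ?inE.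
    + by apply: measurableI => //; exact: measurable_eball.
    + by apply: measurableI => //; exact: measurable_eball.
    + exact: setIS.
  rewrite -EFinM lee_fin /phi -[leLHS]mulrA.
  have -> : L `^ alpha * C' * p ^+ k = (L `^ alpha * p ^+ k) * C' by ring.
  rewrite ler_pM ?powR_ge0 ?mulr_ge0 ?invr_ge0 ?vol_ge0//.
    have -> : d / t = L * 2^-1 ^+ k.
      by rewrite /t exprVn; field; rewrite !gt_eqF ?exprn_gt0.
    rewrite powRM ?(ltW L0) ?exprn_ge0 ?invr_ge0// ler_wpM2l ?(ltW La)//.
    rewrite /p; elim: (k) => [|j IH]; first by rewrite !expr0 powR1.
    by rewrite !exprS powRM ?invr_ge0 ?exprn_ge0 ?invr_ge0// ler_wpM2l ?powR_ge0.
  rewrite mulrC ler_pdivrMr ?U0//; apply: HC' => //.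
    by rewrite subrr enorm0 mulr_ge0// ltW.
  by rewrite exprS -mulrA.
Qed.

(** The truncation height is twice the distance between [x] and [y], which leaves room for corkscrew
    points of both. *)
Definition pair_energy (f : 'rV[R]_n -> R) L x y : \bar R :=
  (((U x (enorm (y - x)))^-1)%:E * cone_fun f L x (2 * enorm (y - x)))%E.

Definition pair_kernel (f : 'rV[R]_n -> R) (p : ('rV[R]_n * 'rV[R]_n) * 'rV[R]_n) : R :=
  cone_weight f p.1.1 (2 * enorm (p.1.2 - p.1.1)) p.2 / U p.1.1 (enorm (p.1.2 - p.1.1)).

Definition pair_set L := [set p : ('rV[R]_n * 'rV[R]_n) * 'rV[R]_n |
  truncated_cone L p.1.1 (2 * enorm (p.1.2 - p.1.1)) p.2].

Lemma measurable_pair_set L : measurable (pair_set L).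
Proof.
have m11 : measurable_fun setT (fun p : ('rV[R]_n * 'rV[R]_n) * 'rV[R]_n => p.1.1).
  exact: (measurableT_comp measurable_fst measurable_fst).
have m12 : measurable_fun setT (fun p : ('rV[R]_n * 'rV[R]_n) * 'rV[R]_n => p.1.2).
  exact: (measurableT_comp measurable_snd measurable_fst).
rewrite (_ : pair_set L = snd @^-1` Omega `&`
  [set p | enorm (p.2 - p.1.1) < L * (2 * enorm (p.1.2 - p.1.1))] `&`
  [set p | enorm (p.2 - p.1.1) < L * delta p.2]); last by apply/seteqP; split.
apply: measurableI; first apply: measurableI.
- by rewrite -[X in measurable X]setTI; exact: measurable_snd.
- apply: measurable_lt_set; first by apply: measurable_enormB.
  by apply: measurable_funM => //; apply: measurable_funM => //; exact: measurable_enormB.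
- apply: measurable_lt_set; first by apply: measurable_enormB.
  apply: measurable_funM => //.
  exact: (measurableT_comp (measurable_delta Gamma0) measurable_snd).
Qed.

Lemma measurable_pair_kernel (f : 'rV[R]_n -> R) : measurable_fun setT f ->
  measurable_fun setT (fun p => (pair_kernel f p)%:E).
Proof.
move=> mf; apply/measurable_EFinP.
have m11 : measurable_fun setT (fun p : ('rV[R]_n * 'rV[R]_n) * 'rV[R]_n => p.1.1).
  exact: (measurableT_comp measurable_fst measurable_fst).
have m12 : measurable_fun setT (fun p : ('rV[R]_n * 'rV[R]_n) * 'rV[R]_n => p.1.2).
  exact: (measurableT_comp measurable_snd measurable_fst).
apply: measurable_funM; last first.
  apply: measurable_inv_ge0 => [p|]; first exact: vol_ge0.
  by apply: measurable_vol => //; exact: measurable_enormB.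
apply: measurable_funM; first exact: (measurableT_comp mf measurable_snd).
apply: measurable_funM.
  apply: (measurableT_comp (measurable_powR _)); apply: measurable_funM.
    exact: measurable_enormB.
  apply: measurable_inv_ge0 => [p|]; first by rewrite mulr_ge0// enorm_ge0.
  by apply: measurable_funM => //; exact: measurable_enormB.
apply: measurable_inv_ge0 => [p|]; first exact: vol_ge0.
by apply: measurable_vol => //; exact: measurable_enormB.
Qed.

Lemma pair_kernel_ge0 (f : 'rV[R]_n -> R) p : (forall Z, 0 <= f Z) -> (0 <= (pair_kernel f p)%:E)%E.
Proof.
by move=> f0; rewrite lee_fin divr_ge0 ?vol_ge0// cone_weight_ge0.
Qed.

Lemma pair_energyE (f : 'rV[R]_n -> R) L x y : measurable_fun setT f -> (forall Z, 0 <= f Z) ->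
  pair_energy f L x y = (\int[m]_(Z in [set Z | pair_set L ((x, y), Z)])
    (pair_kernel f ((x, y), Z))%:E)%E.
Proof.
move=> mf f0; rewrite /pair_energy -ge0_integralZl//.
- by apply: eq_integral => Z _; rewrite -EFinM mulrC.
- exact: measurable_truncated_cone.
- by apply/measurable_EFinP/measurable_funTS; exact: measurable_cone_weight.
- by move=> Z _; rewrite lee_fin cone_weight_ge0.
- by rewrite lee_fin invr_ge0 vol_ge0.
Qed.

Lemma measurable_pair_energy (f : 'rV[R]_n -> R) L : measurable_fun setT f -> (forall Z, 0 <= f Z) ->
  measurable_fun setT (fun p : 'rV[R]_n * 'rV[R]_n => pair_energy f L p.1 p.2).
Proof.
move=> mf f0.
have := measurable_section_integral m (measurable_pair_set L)
  (measurable_pair_kernel mf) (fun p => pair_kernel_ge0 p f0).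
apply: eq_measurable_fun => -[x y] _; by rewrite pair_energyE.
Qed.

Lemma pair_energy_ge0 (f : 'rV[R]_n -> R) L x y : (forall Z, 0 <= f Z) -> (0 <= pair_energy f L x y)%E.
Proof. by move=> f0; rewrite mule_ge0 ?cone_fun_ge0// lee_fin invr_ge0 vol_ge0. Qed.

(** For fixed [x], exchanging [y] and [Z] puts the weight in [y] innermost. By
    [integral_far_kernel_le] its integral is bounded, and what remains is [cone_total]. The weight
    kept in [cone_weight] is what makes this integral converge. *)
Lemma integral_pair_energy_le (L : R) : 0 < L -> exists2 C : R, 0 <= C &
  forall f : 'rV[R]_n -> R, measurable_fun setT f -> (forall Z, 0 <= f Z) ->
  (\int[mu]_(x in Gamma) \int[mu]_(y in Gamma) pair_energy f L x y <=
   C%:E * \int[m]_(Z in Omega) (f Z)%:E)%E.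
Proof.
move=> L0; have [Ct Ct0 Ht] := integral_cone_total_le L0.
have L20 : 0 < 2 * L by rewrite mulr_gt0.
have [Ck Ck0 Hk] := integral_far_kernel_le L20.
exists (Ck * Ct) => [|f mf f0]; first exact: mulr_ge0.
apply: (@le_trans _ _ (\int[mu]_(x in Gamma) (Ck%:E * cone_total f L x))%E); last first.
  rewrite ge0_integralZl//; last 2 first.
  - by apply: measurable_funTS; exact: measurable_cone_total.
  - by move=> x _; exact: cone_total_ge0.
  by rewrite EFinM -muleA; apply: lee_wpmul2l; [rewrite lee_fin|exact: Ht].
apply: le_integral_ge0 => x Gx.
  by apply: integral_ge0 => y _; exact: pair_energy_ge0.
pose B := [set p : 'rV[R]_n * 'rV[R]_n | Gamma p.1 /\ pair_set L ((x, p.1), p.2)].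
have mpx : measurable_fun setT (fun p : 'rV[R]_n * 'rV[R]_n => ((x, p.1), p.2)).
  apply/measurable_fun_pairP; split; last exact: measurable_snd.
  apply: (measurable_fun_pair (f := fun=> x) (g := fst)) => //; exact: measurable_fst.
have mB : measurable B.
  rewrite (_ : B = fst @^-1` Gamma `&` (fun p => ((x, p.1), p.2)) @^-1` (pair_set L));
    last by apply/seteqP; split.
  apply: measurableI.
    by rewrite -[X in measurable X]setTI; exact: measurable_fst.
  rewrite -[X in measurable X]setTI.
  exact: (mpx measurableT _ (measurable_pair_set L)).
have mk : measurable_fun setT (fun p : 'rV[R]_n * 'rV[R]_n => (pair_kernel f ((x, p.1), p.2))%:E).
  exact: (measurableT_comp (measurable_pair_kernel mf) mpx).
have -> : (\int[mu]_(y in Gamma) pair_energy f L x y =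
   \int[mu]_y \int[m]_(Z in [set Z | B (y, Z)]) (pair_kernel f ((x, y), Z))%:E)%E.
  rewrite integral_mkcond; apply: eq_integral => y _; rewrite patchE.
  case: ifPn => [/set_mem Gy|nGy].
    rewrite pair_energyE//; congr (integral _ _ _).
    by apply/seteqP; split => Z //= [].
  rewrite (_ : [set Z | _] = set0) ?integral_set0//.
  by apply/seteqP; split => // Z [Gy _]; move: nGy; rewrite notin_setE.
rewrite (restricted_tonelli mu m mB mk); last by move=> p; exact: pair_kernel_ge0.
rewrite /cone_total -ge0_integralZl//; last 3 first.
- have := measurable_xsection x (measurable_cone_set L).
  rewrite (_ : xsection _ _ = [set Z | Gamma x /\ Omega Z /\ (enorm (Z - x) < L * delta Z)%R])//.
  by apply/seteqP; split => Z; rewrite /xsection/= inE.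
- apply: measurable_funTS.
  exact: (measurableT_comp (measurable_cone_kernel mf) (measurable_pair1 x)).
- by move=> Z _; rewrite lee_fin divr_ge0// vol_ge0.
- rewrite [leRHS]integral_mkcond; apply: le_integral_ge0 => Z _.
    by apply: integral_ge0 => y _; exact: pair_kernel_ge0.
  set A := [set y | _].
  have [[y0 [Gy0 [[OZ h1] h2]]]|A0] := pselect (A !=set0); last first.
    have -> : A = set0 by apply/seteqP; split => // y Ay; apply: A0; exists y.
    rewrite integral_set0 patchE; case: ifP => // _.
    by rewrite -EFinM lee_fin mulr_ge0// divr_ge0 ?vol_ge0.
  rewrite patchE mem_set//; set d := enorm (Z - x).
  have d0 : 0 < d by apply: lt_le_trans (delta_gt0 oO Gamma0 OZ) _; exact: delta_le.
  have Ud : 0 < U x d by exact: U0.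
  have mG2 : measurable [set y | Gamma y /\ (d < 2 * L * enorm (y - x))%R].
    rewrite (_ : [set y | _] = Gamma `&` [set y | d < 2 * L * enorm (y - x)]); last by apply/seteqP; split.
    apply: measurableI => //; apply: measurable_lt_set => //.
    by apply: measurable_funM => //; exact: measurable_enormB.
  apply: (@le_trans _ _ ((f Z / U x d)%:E * \int[mu]_(y in [set y | Gamma y /\ (d < 2 * L * enorm (y - x))%R])
    ((d / enorm (y - x)) `^ alpha / U x (enorm (y - x)))%:E)%E); last first.
    rewrite muleC; apply: lee_wpmul2r; first by rewrite lee_fin divr_ge0// ltW.
    exact: Hk.
  rewrite -ge0_integralZl//; last 3 first.
  + apply/measurable_EFinP/measurable_funTS; apply: measurable_funM.
      apply: (measurableT_comp (measurable_powR _)); apply: measurable_funM => //.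
      by apply: measurable_inv_ge0; [move=> ?; exact: enorm_ge0|exact: measurable_enormB].
    apply: measurable_inv_ge0 => [y|]; first exact: vol_ge0.
    by apply: measurable_vol => //; exact: measurable_enormB.
  + by move=> y _; rewrite lee_fin divr_ge0 ?powR_ge0 ?vol_ge0.
  + by rewrite lee_fin divr_ge0// ltW.
  rewrite [leLHS]integral_mkcond [leRHS]integral_mkcond.
  apply: le_integral_ge0 => y _; first by apply: erestrict_ge0 => ? _; exact: pair_kernel_ge0.
  rewrite !patchE; case: ifPn => [/set_mem[Gy [[_ /= k1] _]]|_]; last first.
    by case: ifP => // _; rewrite -EFinM lee_fin mulr_ge0 ?divr_ge0 ?powR_ge0 ?vol_ge0// ltW.
  rewrite mem_set; last by split => //; rewrite -/d in k1; lra.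
  rewrite -EFinM lee_fin /pair_kernel /cone_weight /= -/d.
  rewrite -/d in k1; set e := enorm (y - x) in k1 *.
  have e0 : 0 < e.
    have : 0 < L * (2 * e) by exact: lt_trans k1.
    by rewrite pmulr_rgt0// pmulr_rgt0.
  have Ue : 0 < U x e by exact: U0.
  have pp : (d / (2 * e)) `^ alpha <= (d / e) `^ alpha.
    apply: ge0_ler_powR; rewrite ?nnegrE ?(ltW alpha_gt0) ?divr_ge0 ?mulr_ge0 ?(ltW d0) ?(ltW e0)//.
    by rewrite ler_pM2l// lef_pV2 ?posrE ?mulr_gt0//; lra.
  have := ler_wpM2l (mulr_ge0 (mulr_ge0 (f0 Z) (ltW (_ : 0 < (U x d)^-1))) (ltW (_ : 0 < (U x e)^-1))) pp.
  rewrite !invr_gt0 => /(_ Ud Ue) h3.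
  rewrite [leLHS](_ : _ = f Z / U x d / U x e * (d / (2 * e)) `^ alpha); last by ring.
  by rewrite [leRHS](_ : _ = f Z / U x d / U x e * (d / e) `^ alpha)//; ring.
Qed.

(** At a single scale and center, [rho ^+ 2 / M] equals [(inv_rho * U)^-1], so the product is
    [U^-1]; doubling absorbs the change of scale and center. *)
Lemma kernel_inv_rho_le : exists2 C : R, 0 < C & forall x y z, Gamma x -> Gamma y ->
  x != y -> z = x \/ z = y ->
  rho Omega m mu x (enorm (x - y)) ^+ 2 / M x (enorm (x - y)) *
    inv_rho z (2 * enorm (x - y)) <= C / U z (enorm (x - y)).
Proof.
have [C' C'1 HC'] := vol_dilate measurableT mu_ball mu_dbl 4 Gamma0.
have C'0 : 0 < C' by lra.
exists (4 * C' ^+ 2) => [|x y z Gx Gy xy zxy]; first by rewrite mulr_gt0// exprn_gt0.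
set s := enorm (x - y).
have s0 : 0 < s.
  rewrite lt_neqAle enorm_ge0 andbT eq_sym; apply: contraNneq xy.
  by move=> /enorm_eq0/eqP; rewrite subr_eq0.
have s20 : 0 < 2 * s by lra.
have Gz : Gamma z by case: zxy => ->.
have xz : enorm (x - z) <= s.
  by case: zxy => ->; rewrite ?subrr ?enorm0 ?(ltW s0).
have cz : closure Omega z by exact: boundary_closure.
have a0 : 0 < U x s by exact: U0.
have b0 : 0 < U z s by exact: U0.
have c0 : 0 < U z (2 * s) by exact: U0.
have d0 : 0 < M x s by apply: M0 => //; exact: boundary_closure.
have e0 : 0 < M z (2 * s) by exact: M0.
have h1 : U z (2 * s) <= C' * U x s by apply: HC' => //; lra.
have h2 : U z s <= C' * U x s by apply: HC' => //; lra.
have h3 : M x s <= M z (2 * s) by apply: (vol_le mO m_ball) => //; lra.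
have -> : rho Omega m mu x s ^+ 2 / M x s * inv_rho z (2 * s) =
   4 * (M x s / M z (2 * s)) * (U z (2 * s) / U x s) * (U x s)^-1.
  by rewrite rhoE /inv_rho; field; rewrite !gt_eqF.
have k1 : M x s / M z (2 * s) <= 1 by rewrite ler_pdivrMr// mul1r.
have k2 : U z (2 * s) / U x s <= C' by rewrite ler_pdivrMr.
have k3 : (U x s)^-1 <= C' / U z s by exact: inv_le_div.
have -> : 4 * C' ^+ 2 / U z s = 4 * 1 * C' * (C' / U z s) by ring.
by rewrite !ler_pM ?mulr_ge0 ?invr_ge0 ?(ltW a0) ?(ltW c0) ?(ltW d0) ?(ltW e0).
Qed.

(** The difference of the two limits is split at corkscrew points [X] and [Y] of scale
    [enorm (x - y)]. The outer differences are bounded by [limit_estimate], the middle one by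
    [step_oscillation]. *)
Lemma boundary_integrand_le : exists C L, [/\ 0 < C, 1 <= L &
  forall h f, oscillation_pair C0 h f -> forall T x y, Gamma x -> Gamma y ->
  nt_limit h x (T x) -> nt_limit h y (T y) ->
  ((boundary_integrand Omega m mu T x y)%:E <=
   C%:E * (pair_energy f L x y + pair_energy f L y x))%E].
Proof.
have K0 : 0 < 2 * C1 by rewrite mulr_gt0.
have [Cl [Ll [Cl0 Ll1 Hl]]] := limit_estimate K0.
have [Cs [Ls [Cs0 Ls1 Hs]]] := step_oscillation K0.
have [Ck Ck0 Hk] := kernel_inv_rho_le.
pose C := Cl + Cs; have C_gt0 : 0 < C by rewrite addr_gt0.
pose L := Num.max Ll Ls.
have LlL : Ll <= L by rewrite le_max lexx.
have LsL : Ls <= L by rewrite le_max lexx orbT.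
exists (6 * C * Ck), L; split; rewrite ?mulr_gt0 ?(le_trans Ll1)//.
move=> h f hf T x y Gx Gy Tx Ty; have [mf f0 fI _] := hf.
rewrite /boundary_integrand; have [xy|xy] := eqVneq x y.
  by rewrite mule_ge0 ?adde_ge0 ?pair_energy_ge0// lee_fin !mulr_ge0// ltW.
rewrite /pair_energy (enorm_sub y x); set s := enorm (x - y).
have s0 : 0 < s.
  rewrite lt_neqAle enorm_ge0 andbT eq_sym; apply: contraNneq xy.
  by move=> /enorm_eq0/eqP; rewrite subr_eq0.
have s20 : 0 < 2 * s by lra.
have Ux : 0 < U x s by exact: U0.
have Uy : 0 < U y s by exact: U0.
have Mx : 0 < M x s by apply: M0 => //; exact: boundary_closure.
have CC : 0 < 6 * C * Ck by rewrite !mulr_gt0.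
have Fx0 := cone_fun_ge0 f0 L x (2 * s); have Fy0 := cone_fun_ge0 f0 L y (2 * s).
have [Fx' eFx] : exists z, cone_fun f L x (2 * s) = z by eexists.
have [Fy' eFy] : exists z, cone_fun f L y (2 * s) = z by eexists.
rewrite eFx in Fx0 *; rewrite eFy in Fy0 *.
apply: lee_fin_mul_add.
- by rewrite invr_gt0; exact: Ux.
- by rewrite invr_gt0; exact: Uy.
- exact: CC.
- exact: Fx0.
- exact: Fy0.
move=> Fxoo Fyoo.
have FxE : Fx' = (fine Fx')%:E by apply/esym/fineK; rewrite ge0_fin_numE.
have FyE : Fy' = (fine Fy')%:E by apply/esym/fineK; rewrite ge0_fin_numE.
have : 0 <= fine Fx' by exact: fine_ge0.
have : 0 <= fine Fy' by exact: fine_ge0.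
rewrite {}FxE in eFx *; rewrite {}FyE in eFy *.
move: (fine Fx') (fine Fy') eFx eFy => Fx Fy FxE FyE /= Fy_ge0 Fx_ge0.
have [X [OX Xx dX]] := corkscrew oO Gamma0 C1_gt0 cs Gx s0.
have [Y [OY Yy dY]] := corkscrew oO Gamma0 C1_gt0 cs Gy s0.
rewrite ler_pdivrMl// in dX; rewrite ler_pdivrMl// in dY.
have ix := inv_rho_gt0 Gx s20; have iy := inv_rho_gt0 Gy s20.
have hx : (h X - T x) ^+ 2 <= C * inv_rho x (2 * s) * Fx.
  rewrite -lee_fin; apply: le_trans (Hl h f hf x X (2 * s) (T x) Gx s20 OX _ _ Tx) _.
  - lra.
  - lra.
  rewrite [leRHS]EFinM -FxE; apply: lee_pmul.
  - by rewrite lee_fin mulr_ge0 ?ltW.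
  - exact: cone_fun_ge0.
  - by rewrite lee_fin ler_pM2r// lerDl ltW.
  - exact: cone_fun_mono.
have hy : (h Y - T y) ^+ 2 <= C * inv_rho y (2 * s) * Fy.
  rewrite -lee_fin; apply: le_trans (Hl h f hf y Y (2 * s) (T y) Gy s20 OY _ _ Ty) _.
  - lra.
  - lra.
  rewrite [leRHS]EFinM -FyE; apply: lee_pmul.
  - by rewrite lee_fin mulr_ge0 ?ltW.
  - exact: cone_fun_ge0.
  - by rewrite lee_fin ler_pM2r// lerDl ltW.
  - exact: cone_fun_mono.
have hxy : (h X - h Y) ^+ 2 <= C * inv_rho x (2 * s) * Fx.
  rewrite -lee_fin; apply: le_trans (Hs h f hf x X Y (2 * s) (2 * s) Gx s20 (lexx _) OX OY _ _ _ _) _.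
  - lra.
  - by have := enorm_triangle y Y x; rewrite (enorm_sub y x) -/s; lra.
  - lra.
  - lra.
  rewrite divff ?gt_eqF// powR1 mulr1 [leRHS]EFinM -FxE; apply: lee_pmul.
  - by rewrite lee_fin mulr_ge0 ?ltW.
  - exact: cone_fun_ge0.
  - by rewrite lee_fin ler_pM2r// lerDr ltW.
  - exact: cone_fun_mono.
have kx := Hk x y x Gx Gy xy (or_introl erefl).
have ky := Hk x y y Gx Gy xy (or_intror erefl).
rewrite -/s in kx ky; move: kx ky; set w := _ / M x s; move=> kx ky.
have w0 : 0 <= w by apply: divr_ge0; [exact: sqr_ge0|exact: ltW].
have TT : `|T x - T y| ^+ 2 <= 3 * C * (2 * (inv_rho x (2 * s) * Fx) + inv_rho y (2 * s) * Fy).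
  rewrite real_normK ?num_real//.
  apply: (@le_trans _ _ (3 * ((h X - T x) ^+ 2 + (h X - h Y) ^+ 2 + (h Y - T y) ^+ 2))).
    have := sqr_sum3_le (T x - h X) (h X - h Y) (h Y - T y).
    have -> : T x - h X + (h X - h Y) + (h Y - T y) = T x - T y by ring.
    by rewrite -(sqrrN (T x - h X)) opprB.
  lra.
rewrite (_ : rho Omega m mu x s ^+ 2 * `|T x - T y| ^+ 2 / fine _ = w * `|T x - T y| ^+ 2);
  last by rewrite /w /vol; ring.
apply: (@le_trans _ _ (w * (3 * C * (2 * (inv_rho x (2 * s) * Fx) + inv_rho y (2 * s) * Fy)))).
  exact: ler_wpM2l.
have := ler_wpM2r Fx_ge0 kx; have := ler_wpM2r Fy_ge0 ky.
have : 0 <= Ck / U y s * Fy by apply: mulr_ge0 => //; apply: divr_ge0; exact: ltW.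
set a := inv_rho x _; set b := inv_rho y _; set c := (U x s)^-1; set e := (U y s)^-1.
move=> h0 h1 h2.
have -> : w * (3 * C * (2 * (a * Fx) + b * Fy)) = 3 * C * (2 * (w * a * Fx) + w * b * Fy) by ring.
have -> : 6 * C * Ck * (c * Fx + e * Fy) = 3 * C * (2 * (Ck * c * Fx) + 2 * (Ck * e * Fy)) by ring.
rewrite ler_wpM2l; [lra|by rewrite mulr_ge0// ltW|].
by move: (w * a * Fx) (w * b * Fy) (Ck * c * Fx) (Ck * e * Fy) h0 h1 h2 => *; lra.
Qed.

(** The function [T] is any choice of limits. Off a null set in each variable its integrand lies
    below a measurable kernel, whose two summands have equal double integrals by symmetry in [x] and
    [y]. *)
Lemma trace_norm_le : exists2 C : R, 0 <= C &
  forall h f, oscillation_pair C0 h f -> forall T,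
  (forall x, Gamma x -> good f x -> nt_limit h x (T x)) ->
  (\int[mu]_(x in Gamma) \int[mu]_(y in Gamma) (boundary_integrand Omega m mu T x y)%:E
   <= C%:E * \int[m]_(Z in Omega) (f Z)%:E)%E.
Proof.
have [C [L [C_gt0 L1 H]]] := boundary_integrand_le.
have L0 : 0 < L by lra.
have [C' C'0 H'] := integral_pair_energy_le L0.
exists (C * (2 * C')) => [|h f hf T HT]; first by rewrite !mulr_ge0// ltW.
have [mf f0 fI _] := hf.
have [N [mN N0 HN]] := good_ae mf f0 fI.
have gN x : Gamma x -> ~ N x -> good f x.
  by move=> Gx nNx; apply: contrapT => ng; apply: nNx; apply: HN => /= /(_ Gx).
have BI0 x y : Gamma x -> (0 <= (boundary_integrand Omega m mu T x y)%:E)%E.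
  move=> Gx; rewrite lee_fin /boundary_integrand; case: ifP => // _.
  apply: divr_ge0; first by apply: mulr_ge0; rewrite ?sqr_ge0 ?exprn_ge0.
  exact: fine_ge0.
have mE : measurable_fun setT (fun p : 'rV[R]_n * 'rV[R]_n => pair_energy f L p.1 p.2).
  exact: measurable_pair_energy.
have mE' : measurable_fun setT (fun p : 'rV[R]_n * 'rV[R]_n => pair_energy f L p.2 p.1).
  exact: (measurableT_comp mE (measurable_fun_pair measurable_snd measurable_fst)).
have mS : measurable_fun setT (fun p : 'rV[R]_n * 'rV[R]_n =>
    (C%:E * (pair_energy f L p.1 p.2 + pair_energy f L p.2 p.1))%E).
  by apply: measurable_funeM; exact: emeasurable_funD.
have E0 x y : (0 <= pair_energy f L x y)%E by exact: pair_energy_ge0.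
have S0 x y : (0 <= C%:E * (pair_energy f L x y + pair_energy f L y x))%E.
  by rewrite mule_ge0 ?adde_ge0// lee_fin ltW.
apply: (@le_trans _ _ (\int[mu]_(x in Gamma) \int[mu]_(y in Gamma)
    (C%:E * (pair_energy f L x y + pair_energy f L y x)))%E).
  rewrite (ge0_integral_setD_null mN N0); last first.
    by move=> x Gx; apply: integral_ge0 => y _; exact: BI0.
  rewrite [leRHS](ge0_integral_setD_null mN N0); last first.
    by move=> x Gx; exact: integral_ge0.
  apply: le_integral_ge0 => x [Gx nNx].
    by apply: integral_ge0 => y _; exact: BI0.
  rewrite (ge0_integral_setD_null mN N0); last by move=> y _; exact: BI0.
  rewrite [leRHS](ge0_integral_setD_null mN N0); last by move=> y _.
  apply: le_integral_ge0 => y [Gy nNy]; first exact: BI0.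
  by apply: (H h f hf) => //; apply: HT => //; exact: gN.
have mEx x : measurable_fun Gamma (fun y => pair_energy f L x y).
  apply: measurable_funTS; exact: (measurableT_comp mE (measurable_pair1 x)).
have mEy x : measurable_fun Gamma (fun y => pair_energy f L y x).
  apply: measurable_funTS; exact: (measurableT_comp mE (measurable_pair2 x)).
have mI (k : 'rV[R]_n * 'rV[R]_n -> \bar R) : measurable_fun setT k -> (forall p, 0 <= k p)%E ->
    measurable_fun Gamma (fun x => \int[mu]_(y in Gamma) k (x, y))%E.
  move=> mk k0; apply: measurable_funTS.
  have := measurable_section_integral mu (measurableX measurableT mG) mk k0.
  apply: eq_measurable_fun => x _; congr (integral _ _ _).
  by apply/seteqP; split => y //= [].
under eq_integral.
  move=> x _.
  rewrite ge0_integralZl//; last 3 first.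
  - by apply: emeasurable_funD.
  - by move=> y _; exact: adde_ge0.
  - by rewrite lee_fin ltW.
  rewrite ge0_integralD//.
  over.
rewrite ge0_integralZl//; last 3 first.
- apply: emeasurable_funD; first exact: (mI _ mE).
  exact: (mI _ mE').
- by move=> x _; rewrite adde_ge0// integral_ge0.
- by rewrite lee_fin ltW.
rewrite ge0_integralD//; last 4 first.
- by move=> x _; exact: integral_ge0.
- exact: (mI _ mE).
- by move=> x _; exact: integral_ge0.
- exact: (mI _ mE').
rewrite [X in (_ * (_ + X))%E](_ : _ = \int[mu]_(x in Gamma) \int[mu]_(y in Gamma) pair_energy f L x y)%E; last first.
  exact: (esym (tonelli_on mu mu mG mG mE (fun p => E0 _ _))).
rewrite EFinM -muleA; apply: lee_wpmul2l; first by rewrite lee_fin ltW.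
have := H' f mf f0; set I := (X in (X <= _)%E); set J := (\int[m]_(Z in _) _)%E => HI.
rewrite EFinM -muleA (_ : 2%:E = 1 + 1)%E// ge0_muleDl// mul1e; exact: leeD.
Qed.

End uniform_estimates.
End trace_estimates.

(** * Functions of finite energy *)

Section averages.
Context {R : realType} {n : nat} (nu : {measure set 'rV[R]_n -> \bar R}).
Implicit Types (A B : set 'rV[R]_n) (f g : 'rV[R]_n -> R).

Lemma integrable_cst_fin B c : measurable B -> (nu B < +oo)%E ->
  nu.-integrable B (EFin \o cst c).
Proof.
move=> mB Boo; apply: measurable_bounded_integrable => //.
by exists `|c|; split; rewrite ?num_real// => y cy x _ /=; exact: ltW.
Qed.

Lemma integrable_abs_diff_cst B g c : measurable B -> (nu B < +oo)%E ->
  nu.-integrable B (EFin \o g) -> nu.-integrable B (EFin \o (fun x => `|g x - c|)).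
Proof.
move=> mB Boo ig.
have ic : nu.-integrable B (EFin \o cst c) by exact: integrable_cst_fin.
by have := integrable_abse (integrableB mB ig ic).
Qed.

Lemma average_sub_le A B g c : measurable A -> measurable B -> A `<=` B ->
  (0 < nu A)%E -> (nu B < +oo)%E -> nu.-integrable B (EFin \o g) ->
  `|average nu A g - c| <= (fine (nu A))^-1 * \int[nu]_(x in B) `|g x - c|.
Proof.
move=> mA mB AB A0 Boo ig.
have Aoo : (nu A < +oo)%E by apply: le_lt_trans Boo; apply: le_measure; rewrite ?inE.
have fA0 : 0 < fine (nu A) by rewrite fine_gt0// A0.
have igA : nu.-integrable A (EFin \o g) by exact: integrableS ig.
have icA : nu.-integrable A (EFin \o cst c) by exact: integrable_cst_fin.
have -> : average nu A g - c = (fine (nu A))^-1 * \int[nu]_(x in A) (g x - c).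
  rewrite (RintegralB mA igA icA) Rintegral_cst// mulrBr /average.
  by congr (_ - _); field; rewrite gt_eqF.
rewrite normrM gtr0_norm ?invr_gt0// ler_pM2l ?invr_gt0//.
have id : nu.-integrable A (EFin \o (fun x => g x - c)) by exact: (integrableB mA igA icA).
apply: (le_trans (le_normr_Rintegral mA id)).
have iB := integrable_abs_diff_cst c mB Boo ig.
rewrite /Rintegral; apply: fine_le.
- apply: integrable_fin_num => //; exact: integrableS iB.
- exact: integrable_fin_num.
- by apply: ge0_subset_integral => //; case/integrableP : iB.
Qed.

Lemma averageB A f g : measurable A ->
  nu.-integrable A (EFin \o f) -> nu.-integrable A (EFin \o g) ->
  average nu A (fun x => f x - g x) = average nu A f - average nu A g.
Proof. by move=> mA fi gi; rewrite /average RintegralB// mulrBr. Qed.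

Lemma average_lin A f g a : measurable A ->
  nu.-integrable A (EFin \o f) -> nu.-integrable A (EFin \o g) ->
  average nu A (fun x => a * f x + g x) = a * average nu A f + average nu A g.
Proof.
move=> mA fi gi; rewrite /average RintegralD//; last first.
  by have := integrableZl mA a fi; apply: eq_integrable.
by rewrite RintegralZl//; ring.
Qed.

Lemma average_ae_eq A N f g : measurable N -> nu N = 0%E ->
  (forall x, (A `\` N) x -> f x = g x) -> average nu A f = average nu A g.
Proof.
move=> mN N0 fg; rewrite /average /Rintegral (integral_setD_null A _ mN N0).
rewrite [in RHS](integral_setD_null A _ mN N0).
by congr (_ * fine _); apply: eq_integral => x /set_mem ANx; rewrite fg.
Qed.

Lemma cvge0_fine (a : nat -> \bar R) : a @ \oo --> 0%E ->
  (\forall i \near \oo, a i \is a fin_num) /\ (fun i => fine (a i)) @ \oo --> (0 : R).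
Proof. by move=> /fine_cvgP. Qed.

Lemma average_cvg A B (phi : nat -> 'rV[R]_n -> R) u : measurable A -> measurable B ->
  A `<=` B -> (0 < nu A)%E -> (nu B < +oo)%E ->
  (forall i, nu.-integrable B (EFin \o phi i)) -> nu.-integrable B (EFin \o u) ->
  (\int[nu]_(x in B) `|phi i x - u x|%:E)%E @[i --> \oo] --> 0%E ->
  (fun i => average nu A (phi i)) @ \oo --> average nu A u.
Proof.
move=> mA mB AB A0 Boo iphi iu /cvge0_fine[_ h].
have iphiA i : nu.-integrable A (EFin \o phi i) by exact: integrableS (iphi i).
have iuA : nu.-integrable A (EFin \o u) by exact: integrableS iu.
have idB i : nu.-integrable B (EFin \o (fun x => phi i x - u x)).
  exact: (integrableB mB (iphi i) iu).
have h0 : (fun i => (fine (nu A))^-1 * fine (\int[nu]_(x in B) `|phi i x - u x|%:E)%E) @ \oo --> (0 : R).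
  by rewrite -[X in _ --> X](mulr0 (fine (nu A))^-1); apply: cvgMr.
apply/subr_cvg0; apply/norm_cvg0P.
apply: squeeze_cvgr; [|exact: cvg_cst|exact: h0].
apply: nearW => i; rewrite normr_ge0/=.
rewrite -(averageB mA (iphiA i) iuA) -[X in `|X|]subr0.
apply: (le_trans (average_sub_le 0 mA mB AB A0 Boo (idB i))).
rewrite ler_wpM2l ?invr_ge0 ?fine_ge0//.
by rewrite /Rintegral; under eq_integral do rewrite subr0.
Qed.

End averages.

Section energy.
Context {R : realType} {n : nat} (nu : {measure set 'rV[R]_n -> \bar R}).
Implicit Types (A B D : set 'rV[R]_n).

(** Elements of the function spaces are measurable for the completed measure, while Tonelli's
    theorem is applied to Borel functions on the whole space. *)
Lemma Borel_version D (f : 'rV[R]_n -> R) : measurable D -> nu_measurable_fun nu D f ->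
  exists N (g : 'rV[R]_n -> R), [/\ measurable N, nu N = 0%E, measurable_fun setT g &
    forall x, (D `\` N) x -> g x = f x].
Proof.
move=> mD /(nu_measurable_fun_Borel mD)[N [mN N0 mf]].
exists N, (f \_ (D `\` N)); split => //.
  by apply/(measurable_restrictT _ _).1 => //; exact: measurableD.
by move=> x Dx; rewrite patchE mem_set.
Qed.

Lemma Borel_version_vec D (v : 'rV[R]_n -> 'rV[R]_n) : measurable D ->
  (forall i, nu_measurable_fun nu D (fun x => v x ord0 i)) ->
  exists N (w : 'rV[R]_n -> 'rV[R]_n), [/\ measurable N, nu N = 0%E, measurable_fun setT w &
    forall x, (D `\` N) x -> w x = v x].
Proof.
move=> mD mv.
have /choice[N HN] i : exists N, exists g : 'rV[R]_n -> R,
    [/\ measurable N, nu N = 0%E, measurable_fun setT g &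
    forall x, (D `\` N) x -> g x = v x ord0 i] by exact: Borel_version.
have /choice[g Hg] := HN.
(* Pads the [n] null sets to a sequence indexed by [nat], the remaining terms being empty. *)
pose M k := oapp N set0 (insub k : option 'I_n).
have MN k : measurable (M k) /\ nu (M k) = 0%E.
  by rewrite /M; case: insub => [i|] /=; [have [] := Hg i|].
have mM : measurable (\bigcup_k M k) by apply: bigcup_measurable => k _; have [] := MN k.
exists (\bigcup_k M k), (fun x => \row_i g i x); split => //.
- apply/(negligibleP nu) => //; apply: negligible_bigcup => k.
  by have [? ?] := MN k; exact/negligibleP.
- apply: measurable_rV => i; under eq_fun do rewrite mxE; by have [] := Hg i.
- move=> x [Dx nN]; apply/rowP => i; rewrite mxE; have [_ _ _ -> //] := Hg i.
  by split => // Nx; apply: nN; exists i => //; rewrite /M valK.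
Qed.

Lemma continuous_bounded_eball (f : 'rV[R]_n -> R) X r : continuous f ->
  [bounded f x | x in eball X r].
Proof.
move=> cf.
have : compact (f @` [set y | enorm (y - X) <= r]).
  apply: continuous_compact; last exact: compact_eball.
  exact: continuous_subspaceT.
move=> /compact_bounded[M [Mr HM]]; exists M; split => // y My x /= xX.
by apply: (HM y My); exists x => //=; exact: ltW.
Qed.

Lemma continuous_integrable_eball (f : 'rV[R]_n -> R) X r : continuous f ->
  (nu (eball X r) < +oo)%E -> nu.-integrable (eball X r) (EFin \o f).
Proof.
move=> cf Boo; apply: measurable_bounded_integrable => //.
- exact: measurable_eball.
- by apply: measurable_funTS; exact: continuous_measurable_rV.
- exact: continuous_bounded_eball.
Qed.

Lemma smooth_grad_continuous (f : 'rV[R]_n -> R) i : smooth f -> continuous (partial i f).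
Proof. by move=> /(_ [:: i])[]. Qed.

Lemma smooth_partial (f : 'rV[R]_n -> R) i : smooth f -> smooth (partial i f).
Proof. by move=> sf s; have := sf (rcons s i); rewrite foldr_rcons. Qed.

Lemma measurable_grad (f : 'rV[R]_n -> R) : smooth f -> measurable_fun setT (grad f).
Proof.
move=> sf; apply: measurable_rV => i; under eq_fun do rewrite mxE.
by apply: continuous_measurable_rV; exact: smooth_grad_continuous.
Qed.

Lemma measurable_enorm_sqr (v : 'rV[R]_n -> 'rV[R]_n) : measurable_fun setT v ->
  measurable_fun setT (fun x => enorm (v x) ^+ 2).
Proof. by move=> mv; apply: measurable_funX; exact: (measurableT_comp measurable_enorm). Qed.

Lemma measurable_enormB_sqr (v w : 'rV[R]_n -> 'rV[R]_n) : measurable_fun setT v ->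
  measurable_fun setT w -> measurable_fun setT (fun x => enorm (v x - w x) ^+ 2).
Proof. by move=> mv mw; apply: measurable_funX; exact: measurable_enormB. Qed.

Lemma enorm_sqr_le_double (a b : 'rV[R]_n) :
  enorm a ^+ 2 <= 2 * enorm b ^+ 2 + 2 * enorm (a - b) ^+ 2.
Proof.
have := enormD (a - b) b; rewrite subrK => h.
have := enorm_ge0 a; have := enorm_ge0 b; have := enorm_ge0 (a - b).
move: (enorm a) (enorm b) (enorm (a - b)) h => x y z h z0 y0 x0.
have : x ^+ 2 <= (z + y) ^+ 2 by rewrite ler_pXn2r// nnegrE addr_ge0.
by have := sqr_ge0 (z - y); lra.
Qed.

Lemma continuous_grad_sqr (f : 'rV[R]_n -> R) : smooth f ->
  continuous (fun x => enorm (grad f x) ^+ 2).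
Proof.
move=> sf; apply: (@Ck_continuous _ _ 0).
have -> : (fun x => enorm (grad f x) ^+ 2) = (fun x => \sum_i partial i f x * partial i f x).
  by apply/funext => x; rewrite enorm_sqr; apply: eq_bigr => i _; rewrite mxE expr2.
apply: (@Ck_sum _ _ 0 _ _ (fun i x => partial i f x * partial i f x)) => i.
by apply: CkM; move: 0%N; apply/smoothP; exact: smooth_partial.
Qed.

(** The Poincare inequality is known for the smooth approximants. Enlarging the average over [A] to
    an integral over the ball turns it into a bound for a difference of averages, a quantity that
    passes to the limit; the factor [2] comes from replacing the approximate gradients by [v]. *)
Lemma poincare_limit (E : set 'rV[R]_n) (phi : nat -> 'rV[R]_n -> R) u v X r C6 A :
  0 < r -> eball X r `<=` E -> measurable E -> (nu (eball X r) < +oo)%E ->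
  (forall i, let B := eball X r in
    average nu B (fun Y => `|phi i Y - average nu B (phi i)|) <=
    C6 * r * Num.sqrt (average nu B (fun Y => enorm (grad (phi i) Y) ^+ 2))) ->
  (forall i, smooth (phi i)) -> nu.-integrable (eball X r) (EFin \o u) ->
  measurable_fun setT v -> (\int[nu]_(x in E) (enorm (v x) ^+ 2)%:E < +oo)%E ->
  (\int[nu]_(x in eball X r) `|phi i x - u x|%:E)%E @[i --> \oo] --> 0%E ->
  (\int[nu]_(x in E) (enorm (grad (phi i) x - v x) ^+ 2)%:E)%E @[i --> \oo] --> 0%E ->
  measurable A -> A `<=` eball X r -> (0 < nu A)%E ->
  (((average nu A u - average nu (eball X r) u) ^+ 2)%:E <=
   (2 * (C6 * r) ^+ 2 * fine (nu (eball X r)) / fine (nu A) ^+ 2)%:E *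
   \int[nu]_(x in eball X r) (enorm (v x) ^+ 2)%:E)%E.
Proof.
set B := eball X r => r0 BE mE Boo poinc sphi iu mv Ev hu hv mA AB A0.
have mB : measurable B by exact: measurable_eball.
have B0 : (0 < nu B)%E by apply: lt_le_trans A0 _; apply: le_measure; rewrite ?inE.
have Aoo : (nu A < +oo)%E by apply: le_lt_trans Boo; apply: le_measure; rewrite ?inE.
have fB : 0 < fine (nu B) by rewrite fine_gt0// B0.
have fA : 0 < fine (nu A) by rewrite fine_gt0// A0.
have iphi i : nu.-integrable B (EFin \o phi i).
  by apply: continuous_integrable_eball => //; have /(_ [::])[] := sphi i.
have cA := average_cvg mA mB AB A0 Boo iphi iu hu.
have cB := average_cvg mB mB (@subset_refl _ B) B0 Boo iphi iu hu.
have msq (w : 'rV[R]_n -> 'rV[R]_n) D : measurable_fun setT w ->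
    measurable_fun D (fun x => (enorm (w x) ^+ 2)%:E).
  by move=> mw; apply/measurable_EFinP/measurable_funTS; exact: measurable_enorm_sqr.
have mdif i : measurable_fun setT (fun x => grad (phi i) x - v x).
  apply: measurable_rV => j;
  rewrite (_ : (fun t => _) = (fun t => grad (phi i) t ord0 j - v t ord0 j)); last first.
    by apply/funext => t; rewrite [LHS]mxE [X in _ + X]mxE.
  apply: measurable_funB; first exact: (measurableT_comp (measurable_coord j) (measurable_grad (sphi i))).
  exact: (measurableT_comp (measurable_coord j) mv).
pose V := fine (\int[nu]_(x in B) (enorm (v x) ^+ 2)%:E)%E.
have V0 : (0 <= \int[nu]_(x in B) (enorm (v x) ^+ 2)%:E)%E.
  by apply: integral_ge0 => x _; rewrite lee_fin sqr_ge0.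
have VE : (\int[nu]_(x in B) (enorm (v x) ^+ 2)%:E)%E = V%:E.
  apply/esym/fineK; rewrite ge0_fin_numE//; apply: le_lt_trans Ev.
  by apply: ge0_subset_integral => //; [exact: msq|move=> x _; rewrite lee_fin sqr_ge0].
have [fin cv] := cvge0_fine hv.
set eps := (fun i => fine _) in cv.
pose K := (C6 * r) ^+ 2 * fine (nu B) / fine (nu A) ^+ 2.
(* Restricted to indices whose gradient error is finite, which holds for all large ones. *)
have est i : (\int[nu]_(x in E) (enorm (grad (phi i) x - v x) ^+ 2)%:E)%E \is a fin_num ->
    (average nu A (phi i) - average nu B (phi i)) ^+ 2 <= K * (2 * V + 2 * eps i).
  move=> fi.
  have := average_sub_le (average nu B (phi i)) mA mB AB A0 Boo (iphi i).
  have := poinc i; rewrite /= -/B /average ler_pdivrMl// => p1 p2.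
  have {p1}p2 := le_trans p2 (ler_wpM2l (ltW (_ : 0 < (fine (nu A))^-1)) p1).
  have {}p2 := p2 (eq_ind_r (fun b => is_true b) fA (invr_gt0 (fine (nu A)))).
  set G := \int[nu]_(x in B) enorm _ ^+ 2 in p2.
  have G0 : 0 <= G by apply: Rintegral_ge0 => x _; exact: sqr_ge0.
  have GV : G <= 2 * V + 2 * eps i.
    rewrite -lee_fin /G /Rintegral fineK; last first.
      apply: integrable_fin_num => //; apply: continuous_integrable_eball => //.
      exact: continuous_grad_sqr.
    rewrite EFinD !EFinM -VE /eps fineK//.
    apply: (@le_trans _ _ (\int[nu]_(x in B) (2 * enorm (v x) ^+ 2 + 2 * enorm (grad (phi i) x - v x) ^+ 2)%:E)%E).
      apply: le_integral_ge0 => x _; first by rewrite lee_fin sqr_ge0.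
      by rewrite lee_fin enorm_sqr_le_double.
    under eq_integral do rewrite EFinD !(EFinM 2).
    have sq0 (w : 'rV[R]_n -> 'rV[R]_n) x : (0 <= (enorm (w x) ^+ 2)%:E)%E.
      by rewrite lee_fin sqr_ge0.
    have s2 (w : 'rV[R]_n -> 'rV[R]_n) x : (0 <= 2%:E * (enorm (w x) ^+ 2)%:E)%E.
      by rewrite mule_ge0.
    rewrite ge0_integralD; [|exact: mB|by move=> x _; exact: s2
      |by apply: measurable_funeM; exact: msq
      |by move=> x _; exact: (s2 (fun x => grad (phi i) x - v x))
      |by apply: measurable_funeM; exact: (msq (fun x => grad (phi i) x - v x))].
    rewrite !ge0_integralZl//; try exact: msq; try exact: (msq (fun x => grad (phi i) x - v x)).
    apply: leeD => //; apply: lee_wpmul2l => //.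
    apply: ge0_subset_integral => //; exact: (msq (fun x => grad (phi i) x - v x)).
  rewrite -real_normK ?num_real//.
  have K0 : 0 <= K.
    by apply: divr_ge0; [apply: mulr_ge0; [exact: sqr_ge0|exact: ltW]|exact: sqr_ge0].
  apply: (@le_trans _ _ (K * G)); last exact: ler_wpM2l.
  set y := (X in _ <= X) in p2.
  have y0 : 0 <= y by exact: le_trans p2.
  apply: (@le_trans _ _ (y ^+ 2)); first by rewrite ler_pXn2r// nnegrE.
  rewrite /y !exprMn sqr_sqrtr; last by rewrite mulr_ge0// invr_ge0 ltW.
  by rewrite le_eqVlt; apply/orP; left; apply/eqP; rewrite /K; field; rewrite !gt_eqF.
rewrite VE -EFinM lee_fin.
have -> : 2 * (C6 * r) ^+ 2 * fine (nu B) / fine (nu A) ^+ 2 * V = K * (2 * V + 2 * 0).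
  by rewrite /K; ring.
have c1 : (fun i => (average nu A (phi i) - average nu B (phi i)) ^+ 2) @ \oo -->
    (average nu A u - average nu B u) ^+ 2 by apply: cvgM; exact: cvgB.
have c2 : (fun i => K * (2 * V + 2 * eps i)) @ \oo --> K * (2 * V + 2 * 0).
  by apply: cvgMr; apply: cvgD; [exact: cvg_cst|exact: cvgMr].
apply: (ler_cvg_to c1 c2).
by near=> i; apply: est; near: i.
Unshelve. all: by end_near. Qed.

End energy.

Section energy_functions.
Context {R : realType} {n : nat} (Omega : set 'rV[R]_n).
Variables (m : {sigma_finite_measure set 'rV[R]_n -> \bar R}) (C4 C6 : R).
Local Notation Gamma := (boundary Omega).
Local Notation delta := (delta Omega).
Hypothesis oO : open Omega.
Hypothesis O0 : Omega !=set0.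
Hypothesis Gamma0 : Gamma !=set0.
Hypothesis m_ball : forall X r, closure Omega X -> 0 < r ->
  (0 < m (eball X r `&` Omega) < +oo)%E.
Hypothesis m_dbl : forall X r, closure Omega X -> 0 < r ->
  (m (eball X (2 * r) `&` Omega) <= C4%:E * m (eball X r `&` Omega))%E.
Hypothesis poinc : weak_poincare Omega m C6.

Let mO : measurable Omega. Proof. exact: open_measurable_mx. Qed.

Lemma interior_ball X r : 0 < r -> eball X r `<=` Omega ->
  [/\ (0 < m (eball X r))%E, (m (eball X r) < +oo)%E &
    fine (m (eball X r)) = vol m Omega X r].
Proof.
move=> r0 XO; have OX : Omega X by apply: XO; exact: eball_center.
have := m_ball (subset_closure OX) r0.
by rewrite /vol (setIidl XO) => /andP[].
Qed.

Lemma L1loc_integrable u u' N X r : L1loc m Omega u -> measurable N -> m N = 0%E ->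
  measurable_fun setT u' -> (forall x, (Omega `\` N) x -> u' x = u x) ->
  0 < r -> eball X (2 * r) `<=` Omega -> m.-integrable (eball X r) (EFin \o u').
Proof.
move=> [_ uK] mN N0 mu' uu' r0 XO.
apply/integrableP; split; first by apply/measurable_EFinP; exact: measurable_funTS.
have BO : eball X r `<=` Omega.
  by apply: subset_trans XO; apply: eball_subset; rewrite subrr enorm0; lra.
rewrite (integral_setD_null _ _ mN N0).
rewrite (eq_integral (fun x => `|u x|%:E)); last first.
  by move=> x /set_mem[Bx nNx] /=; rewrite uu'//; split => //; exact: BO.
rewrite -(integral_setD_null _ _ mN N0).
apply: le_lt_trans (uK [set y | enorm (y - X) <= r] _ (@compact_eball _ _ X r)); last first.
  by move=> y /= yX; apply: XO; rewrite /eball/=; lra.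
rewrite integral_mkcond [leRHS]integral_mkcond.
apply: le_integral_ge0 => x _; rewrite !patchE; first by case: ifP.
case: ifPn => [/set_mem Bx|_]; last by case: ifP => // _; rewrite lee_fin.
by rewrite mem_set//=; exact: ltW.
Qed.

Lemma average_ball_lin u v a X r : L1loc m Omega u -> L1loc m Omega v ->
  0 < r -> eball X (2 * r) `<=` Omega ->
  average m (eball X r) (fun x => a * u x + v x) =
  a * average m (eball X r) u + average m (eball X r) v.
Proof.
move=> Lu Lv r0 XO.
have BO : eball X r `<=` Omega.
  by apply: subset_trans XO; apply: eball_subset; rewrite subrr enorm0; lra.
have [N [u' [mN N0 mu' uu']]] := Borel_version mO (proj1 Lu).
have [N2 [v' [mN2 N20 mv' vv']]] := Borel_version mO (proj1 Lv).
have iu := L1loc_integrable Lu mN N0 mu' uu' r0 XO.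
have iv := L1loc_integrable Lv mN2 N20 mv' vv' r0 XO.
have eu : average m (eball X r) u' = average m (eball X r) u.
  by apply: (average_ae_eq mN N0) => x [Bx nx]; apply: uu'; split => //; exact: BO.
have ev : average m (eball X r) v' = average m (eball X r) v.
  by apply: (average_ae_eq mN2 N20) => x [Bx nx]; apply: vv'; split => //; exact: BO.
rewrite -eu -ev -average_lin//; last exact: measurable_eball.
apply/esym/(@average_ae_eq _ _ _ _ (N `|` N2)).
- exact: measurableU.
- by apply: null_set_setU.
- by move=> x [Bx /not_orP[nx nx2]]; rewrite uu' ?vv'//; split => //; exact: BO.
Qed.

Definition energy_version (u : 'rV[R]_n -> R) v (N : set 'rV[R]_n) u' (w : 'rV[R]_n -> 'rV[R]_n) :=
  [/\ measurable N, m N = 0%E, measurable_fun setT u', measurable_fun setT w &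
    forall x, (Omega `\` N) x -> u' x = u x /\ w x = v x].

Lemma energy_version_exists u v : L1loc m Omega u -> weak_gradient Omega m u v ->
  exists N u' w, energy_version u v N u' w.
Proof.
move=> [mu _] [[mv _] _].
have [N [u' [mN N0 mu' uu']]] := Borel_version mO mu.
have [N2 [w [mN2 N20 mw vw]]] := Borel_version_vec mO mv.
exists (N `|` N2), u', w; split => //; [exact: measurableU|exact: null_set_setU|].
by move=> x [Ox /not_orP[nx nx2]]; split; [exact: uu'|exact: vw].
Qed.

Lemma integral_energy_version u v N u' w : energy_version u v N u' w ->
  (\int[m]_(x in Omega) (enorm (w x) ^+ 2)%:E = \int[m]_(x in Omega) (enorm (v x) ^+ 2)%:E)%E.
Proof.
move=> [mN N0 _ _ H]; rewrite (integral_setD_null _ _ mN N0) [RHS](integral_setD_null _ _ mN N0).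
by apply: eq_integral => x /set_mem/H[_ ->].
Qed.

Lemma energy_poincare u v N u' w X r A : L1loc m Omega u -> weak_gradient Omega m u v ->
  energy_version u v N u' w -> 0 < r -> eball X (2 * r) `<=` Omega ->
  measurable A -> A `<=` eball X r -> (0 < m A)%E ->
  (((average m A u - average m (eball X r) u) ^+ 2)%:E <=
   (2 * (C6 * r) ^+ 2 * fine (m (eball X r)) / fine (m A) ^+ 2)%:E *
   \int[m]_(x in eball X r) (enorm (w x) ^+ 2)%:E)%E.
Proof.
move=> Lu [[mv voo] [phi [sphi gphi hu hv]]] EV r0 XO mA AB A0.
have [mN N0 mu' mw H] := EV.
have BO : eball X r `<=` Omega.
  by apply: subset_trans XO; apply: eball_subset; rewrite subrr enorm0; lra.
have [B0 Boo _] := interior_ball r0 BO.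
have ae A' : A' `<=` Omega -> average m A' u = average m A' u'.
  by move=> AO; apply: (average_ae_eq mN N0) => x [/AO Ox nx]; have [] := H x.
rewrite !ae//; last exact: subset_trans BO.
apply: (poincare_limit r0 BO mO Boo _ sphi _ mw _ _ _ mA AB A0).
- by move=> i; exact: poinc.
- by apply: L1loc_integrable Lu mN N0 mu' _ r0 XO => x /H[].
- by rewrite (integral_energy_version EV).
- rewrite (_ : (fun i => _) = (fun i => (\int[m]_(x in eball X r) `|phi i x - u x|%:E)%E)).
    exact: hu.
  apply/funext => i.
  rewrite (integral_setD_null _ _ mN N0) [RHS](integral_setD_null _ _ mN N0).
  by apply: eq_integral => x /set_mem[Bx nx]; have [|-> _ //] := H x; split => //; exact: BO.
- rewrite (_ : (fun i => _) = (fun i => (\int[m]_(x in Omega) (enorm (grad (phi i) x - v x) ^+ 2)%:E)%E)).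
    exact: hv.
  apply/funext => i.
  rewrite (integral_setD_null _ _ mN N0) [RHS](integral_setD_null _ _ mN N0).
  by apply: eq_integral => x /set_mem/H[_ ->].
Qed.

Definition interior_average (u : 'rV[R]_n -> R) X := average m (eball X (delta X / 2)) u.

Lemma delta_ball X : Omega X -> eball X (2 * (delta X / 2)) `<=` Omega.
Proof.
move=> OX; rewrite mulrC divfK; last by rewrite pnatr_eq0.
exact: eball_delta.
Qed.

(** Both interior averages are compared, through the Poincare inequality on their own balls, with
    the average over a smaller ball contained in both. *)
Lemma energy_oscillation : exists2 C0 : R, 0 <= C0 &
  forall u v N u' w, L1loc m Omega u -> weak_gradient Omega m u v ->
  energy_version u v N u' w ->
  oscillation_pair Omega m C0 (interior_average u) (fun Z => enorm (w Z) ^+ 2).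
Proof.
have cO0 : closure Omega !=set0 by have [X OX] := O0; exists X; exact: subset_closure.
have [C' C'1 HC'] := vol_dilate mO m_ball m_dbl 8 cO0.
have C'0 : 0 < C' by lra.
pose C0 := 32 * C6 ^+ 2 * C' ^+ 2.
have C0_ge0 : 0 <= C0.
  by apply: mulr_ge0; [apply: mulr_ge0 => //|]; exact: sqr_ge0.
exists C0 => // u v N u' w Lu wg EV.
have [mN N0 mu' mw H] := EV; split.
- exact: measurable_enorm_sqr.
- by move=> Z; exact: sqr_ge0.
- by rewrite (integral_energy_version EV); case: wg => -[].
move=> X Y OX OY XY.
have dX0 : 0 < delta X by exact: delta_gt0.
have dY0 : 0 < delta Y by exact: delta_gt0.
have dXY := delta_lip Gamma0 X Y; have dYX := delta_lip Gamma0 Y X.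
rewrite (enorm_sub Y X) in dYX.
(* A quarter of the way from [Y] to [X], a ball of radius [delta X / 8] fits in both balls. Towards
   [X] this is [3/8 + 1/8 = 1/2] of [delta X]; towards [Y] it is less than [1/8 + 1/8] of [delta X],
   and [delta X / 4 < delta Y / 2]. *)
pose W := Y + 4^-1 *: (X - Y); pose A := eball W (delta X / 8).
have WY : enorm (W - Y) = enorm (X - Y) / 4.
  by rewrite /W addrC addKr enormZ gtr0_norm ?invr_gt0// mulrC.
have WX : enorm (W - X) = 3 / 4 * enorm (X - Y).
  have -> : W - X = - (3 / 4 *: (X - Y)).
    rewrite /W; apply/rowP => i; rewrite !mxE; by field.
  by rewrite enormN enormZ gtr0_norm.
have AX : A `<=` eball X (delta X / 2) by apply: eball_subset; rewrite WX; lra.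
have AY : A `<=` eball Y (delta Y / 2) by apply: eball_subset; rewrite WY; lra.
have BX := delta_ball OX; have BY := delta_ball OY.
have hX : 0 < delta X / 2 by rewrite divr_gt0.
have hY : 0 < delta Y / 2 by rewrite divr_gt0.
have XO : eball X (delta X / 2) `<=` Omega.
  by apply: subset_trans BX; apply: eball_subset; rewrite subrr enorm0; lra.
have YO : eball Y (delta Y / 2) `<=` Omega.
  by apply: subset_trans BY; apply: eball_subset; rewrite subrr enorm0; lra.
have h8 : 0 < delta X / 8 by rewrite divr_gt0.
have AO : A `<=` Omega by exact: subset_trans XO.
have [A0 Aoo fA] := interior_ball h8 AO.
have [_ _ fX] := interior_ball hX XO.
have [_ _ fY] := interior_ball hY YO.
have mA : measurable A by exact: measurable_eball.
have := energy_poincare Lu wg EV hX BX mA AX A0.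
have := energy_poincare Lu wg EV hY BY mA AY A0.
rewrite -/A fX fY fA.
have OW : closure Omega W by apply: subset_closure; apply: AO; exact: eball_center.
have cX := subset_closure OX; have cY := subset_closure OY.
have MX : 0 < vol m Omega X (delta X / 2) by exact: (vol_gt0 m_ball).
have MY : 0 < vol m Omega Y (delta Y / 2) by exact: (vol_gt0 m_ball).
have MW : 0 < vol m Omega W (delta X / 8) by exact: (vol_gt0 m_ball).
have dXW : vol m Omega X (delta X / 2) <= C' * vol m Omega W (delta X / 8).
  by apply: HC' => //; rewrite ?WX; lra.
have dYW : vol m Omega Y (delta Y / 2) <= C' * vol m Omega W (delta X / 8).
  by apply: HC' => //; rewrite ?WY; lra.
set I := (\int[m]_(x in _ `|` _) _)%E.
have IX : (\int[m]_(x in eball X (delta X / 2)) (enorm (w x) ^+ 2)%:E <= I)%E.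
  apply: ge0_subset_integral => //.
  - exact: measurable_eball.
  - by apply: measurableU; exact: measurable_eball.
  - by apply/measurable_EFinP/measurable_funTS; exact: measurable_enorm_sqr.
  - by move=> x _; rewrite lee_fin sqr_ge0.
have IY : (\int[m]_(x in eball Y (delta Y / 2)) (enorm (w x) ^+ 2)%:E <= I)%E.
  apply: ge0_subset_integral => //.
  - exact: measurable_eball.
  - by apply: measurableU; exact: measurable_eball.
  - by apply/measurable_EFinP/measurable_funTS; exact: measurable_enorm_sqr.
  - by move=> x _; rewrite lee_fin sqr_ge0.
have I0 : (0 <= I)%E by apply: integral_ge0 => x _; rewrite lee_fin sqr_ge0.
have Ioo : (I < +oo)%E.
  apply: (@le_lt_trans _ _ (\int[m]_(x in Omega) (enorm (w x) ^+ 2)%:E)%E).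
    apply: ge0_subset_integral => //.
    - by apply: measurableU; exact: measurable_eball.
    - by apply/measurable_EFinP/measurable_funTS; exact: measurable_enorm_sqr.
    - by move=> x _; rewrite lee_fin sqr_ge0.
    - by rewrite subUset.
  by rewrite (integral_energy_version EV); case: wg => -[].
pose J := fine I; have IJ : I = J%:E by apply/esym/fineK; rewrite ge0_fin_numE.
have J0 : 0 <= J by exact: fine_ge0.
rewrite IJ in IX IY *.
have bound r V V' (a b : R) K : 0 <= r -> r <= delta X -> 0 < V' -> V <= C' * V' ->
    (K <= J%:E)%E -> (((a - b) ^+ 2)%:E <= (2 * (C6 * r) ^+ 2 * V / V' ^+ 2)%:E * K)%E ->
    0 <= V ->
    (a - b) ^+ 2 <= 2 * C6 ^+ 2 * delta X ^+ 2 * (C' / V') * J.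
  move=> r0 rX V'0 VV KJ h V0; rewrite -lee_fin; apply: le_trans h _.
  apply: (@le_trans _ _ ((2 * (C6 * r) ^+ 2 * V / V' ^+ 2)%:E * J%:E)%E).
    apply: lee_wpmul2l => //; rewrite lee_fin.
    by apply: divr_ge0; [apply: mulr_ge0 => //; apply: mulr_ge0 => //|]; exact: sqr_ge0.
  rewrite -EFinM lee_fin ler_wpM2r// exprMn.
  have -> : 2 * (C6 ^+ 2 * r ^+ 2) * V / V' ^+ 2 = 2 * C6 ^+ 2 * r ^+ 2 * (V / V' ^+ 2) by ring.
  apply: ler_pM.
  - by apply: mulr_ge0; [apply: mulr_ge0 => //|]; exact: sqr_ge0.
  - by apply: divr_ge0 => //; exact: sqr_ge0.
  - apply: ler_wpM2l; first by apply: mulr_ge0 => //; exact: sqr_ge0.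
    by rewrite ler_pXn2r// nnegrE (le_trans r0).
  - rewrite ler_pdivrMr ?exprn_gt0//.
    by have -> : C' / V' * V' ^+ 2 = C' * V' by field; rewrite gt_eqF.
move=> hYe hXe.
have {}hYe := bound _ _ _ _ _ _ (ltW hY) (_ : delta Y / 2 <= delta X) MW dYW IY hYe (ltW MY).
have {}hXe := bound _ _ _ _ _ _ (ltW hX) (_ : delta X / 2 <= delta X) MW dXW IX hXe (ltW MX).
rewrite -EFinM lee_fin /interior_average.
have {}hYe := hYe ltac:(lra); have {}hXe := hXe ltac:(lra).
move: (average m A u) (average m (eball X _) u) (average m (eball Y _) u) hYe hXe => a b c hY2 hX2.
have kW : C' / vol m Omega W (delta X / 8) <= C' ^+ 2 / vol m Omega X (delta X / 2).
  rewrite expr2 -mulrA ler_pM2l//.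
  by apply: inv_le_div.
have P0 : 0 <= 2 * C6 ^+ 2 * delta X ^+ 2 * J.
  by apply: mulr_ge0 => //; apply: mulr_ge0; [apply: mulr_ge0 => //|]; exact: sqr_ge0.
have := ler_wpM2l P0 kW; move: hX2 hY2.
rewrite /C0; set k1 := C' / _; set k2 := C' ^+ 2 / _ => hX2 hY2 k12.
have -> : 32 * C6 ^+ 2 * C' ^+ 2 * delta X ^+ 2 / vol m Omega X (delta X / 2) * J =
  16 * (2 * C6 ^+ 2 * delta X ^+ 2 * J * k2) by rewrite /k2; ring.
have e1 : 2 * C6 ^+ 2 * delta X ^+ 2 * k1 * J = 2 * C6 ^+ 2 * delta X ^+ 2 * J * k1 by ring.
rewrite e1 in hX2 hY2; have := sqr_ge0 (2 * a - b - c).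
have : 0 <= 2 * C6 ^+ 2 * delta X ^+ 2 * J * k2.
  by apply: le_trans k12; apply: mulr_ge0 => //; rewrite divr_ge0// ltW.
have := sqr_ge0 (a - b); have := sqr_ge0 (a - c).
move: (_ * k1) (_ * k2) hX2 hY2 k12 => p q *; lra.
Qed.

End energy_functions.

(** Making the cover disjoint determines the index uniquely, so each preimage is a countable union
    of measurable pieces. *)
Lemma measurable_selection d (T : measurableType d) (R : realType) (D : set T) (A : nat -> set T) :
  measurable D -> (forall i, measurable (A i)) -> D `<=` \bigcup_i A i ->
  exists idx : T -> nat, (forall x, D x -> A (idx x) x) /\
    forall c : nat -> R, measurable_fun D (fun x => c (idx x)).
Proof.
move=> mD mA DA.
have /choice[idx Hidx] x : exists i, D x -> seqDU A i x.
  have [Dx|nD] := pselect (D x); last by exists 0%N.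
  by have := DA x Dx; rewrite seqDU_bigcup_eq => -[i _ ?]; exists i.
have mS i : measurable (seqDU A i).
  rewrite /seqDU; apply: measurableD => //.
  by apply: bigsetU_measurable => j _; exact: mA.
exists idx; split=> [x /Hidx|c]; first by rewrite /seqDU => -[].
move=> _ B mB.
rewrite (_ : D `&` _ = \bigcup_(i in [set i | B (c i)]) (D `&` seqDU A i)).
  by apply: bigcup_measurable => i _; exact: measurableI.
apply/seteqP; split=> [x [Dx Bx]|x [i Bi [Dx Ax]]].
  by exists (idx x) => //; split => //; exact: Hidx.
split => //=; rewrite (_ : idx x = i)//.
apply: (@trivIset_seqDU _ A) => //.
by exists x; split => //; exact: Hidx.
Qed.

Lemma dense_sequence (R : realType) (n : nat) : exists q : nat -> 'rV[R]_n,
  forall X e, 0 < e -> exists i, enorm (q i - X) < e.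
Proof.
exists (fun i => odflt 0 (omap (map_mx ratr) (unpickle i : option 'rV[rat]_n))).
move=> X e e0; pose e' := e / n.+1%:R.
have e'0 : 0 < e' by rewrite divr_gt0.
have /choice[r Hr] (i : 'I_n) : exists r : rat, `|ratr r - X ord0 i| <= e'.
  have : X ord0 i < X ord0 i + e' by rewrite ltrDl.
  move=> /rat_in_itvoo[r]; rewrite in_itv/= => /andP[h1 h2]; exists r.
  by rewrite ger0_norm; lra.
exists (pickle (\row_i r i)); rewrite pickleK /=.
apply: (@le_lt_trans _ _ (n%:R * e')).
  by apply: enorm_le_max => i; rewrite !mxE.
rewrite /e' mulrA ltr_pdivrMr// mulrC ltr_pM2l//.
by rewrite ltr_nat.
Qed.

(** * The trace operator *)

Section trace.
Context {R : realType} {n : nat} (Omega : set 'rV[R]_n).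
Variables (m mu : {sigma_finite_measure set 'rV[R]_n -> \bar R}).
Variables (C1 C3 C4 C5 C6 : R).
Local Notation Gamma := (boundary Omega).
Local Notation delta := (delta Omega).
Hypothesis oO : open Omega.
Hypothesis O0 : Omega !=set0.
Hypothesis Gamma0 : Gamma !=set0.
Hypothesis C1_gt0 : 0 < C1.
Hypothesis cs : corkscrew_points Omega C1.
Hypothesis hc : harnack_chains Omega C1.
Hypothesis m_ball : forall X r, closure Omega X -> 0 < r ->
  (0 < m (eball X r `&` Omega) < +oo)%E.
Hypothesis m_dbl : forall X r, closure Omega X -> 0 < r ->
  (m (eball X (2 * r) `&` Omega) <= C4%:E * m (eball X r `&` Omega))%E.
Hypothesis mu_ball : forall x r, Gamma x -> 0 < r ->
  (0 < mu (eball x r `&` setT) < +oo)%E.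
Hypothesis mu_dbl : forall x r, Gamma x -> 0 < r ->
  (mu (eball x (2 * r) `&` setT) <= C3%:E * mu (eball x r `&` setT))%E.
Hypothesis rho_gr : rho_growth Omega m mu C5.
Hypothesis poinc : weak_poincare Omega m C6.

Let mG : measurable Gamma. Proof. exact: measurable_boundary. Qed.

Lemma nt_limit_unique h x l l' : Gamma x -> nt_limit Omega h x l ->
  nt_limit Omega h x l' -> l = l'.
Proof.
move=> Gx xl xl'.
have [Y HY] := corkscrew_seq_exists oO Gamma0 C1_gt0 cs Gx (@ltr01 R).
have Yl := nt_limit_corkscrew C1_gt0 ltr01 HY xl.
have Yl' := nt_limit_corkscrew C1_gt0 ltr01 HY xl'.
exact: (cvg_unique _ Yl Yl').
Qed.

Lemma nt_limit_eq h h' x l : (forall X, Omega X -> h X = h' X) ->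
  nt_limit Omega h x l -> nt_limit Omega h' x l.
Proof.
move=> hh hl K e K0 e0; have [eta eta0 H] := hl K e K0 e0.
by exists eta => // X OX XK Xe; rewrite -hh// H.
Qed.

Lemma nt_limit_lin h h' a x l l' : nt_limit Omega h x l -> nt_limit Omega h' x l' ->
  nt_limit Omega (fun X => a * h X + h' X) x (a * l + l').
Proof.
move=> hl hl' K e K0 e0.
have a0 : 0 < 2 * (`|a| + 1) by rewrite mulr_gt0// ltr_wpDl.
have [eta eta0 H] := hl K (e / (2 * (`|a| + 1))) K0 (divr_gt0 e0 a0).
have [eta' eta'0 H'] := hl' K (e / 2) K0 (divr_gt0 e0 (ltr0n _ 2)).
exists (Num.min eta eta') => [|X OX XK]; first by rewrite lt_min eta0.
rewrite lt_min => /andP[Xe Xe'].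
have {}H := H X OX XK Xe; have {}H' := H' X OX XK Xe'.
have -> : a * h X + h' X - (a * l + l') = a * (h X - l) + (h' X - l') by ring.
rewrite (le_lt_trans (ler_normD _ _))// normrM.
have : `|a| * `|h X - l| <= (`|a| + 1) * `|h X - l| by rewrite ler_wpM2r// lerDl.
rewrite ltr_pdivlMr// in H; lra.
Qed.

(** The limit is approached along points of a countable dense set, selected measurably among those
    that lie in a cone at [x] at scale [2 ^ -k]; each approximation is thus a countably valued
    measurable function. *)
Lemma nt_limit_measurable h (T : 'rV[R]_n -> R) N : measurable N ->
  (forall x, (Gamma `\` N) x -> nt_limit Omega h x (T x)) ->
  measurable_fun (Gamma `\` N) T.
Proof.
move=> mN HT; have [q Hq] := dense_sequence R n.
(* In [4 * C1] one factor [2] comes from taking the corkscrew point at half the scale and another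
   from replacing it by a nearby dense point. *)
pose A k i := [set x | [/\ Omega (q i), 2^-1 ^+ k <= 4 * C1 * delta (q i) &
   enorm (q i - x) < 2^-1 ^+ k]].
have mA k i : measurable (A k i).
  have [[Oq dq]|nq] := pselect (Omega (q i) /\ 2^-1 ^+ k <= 4 * C1 * delta (q i)).
    rewrite (_ : A k i = [set x | enorm (q i - x) < 2^-1 ^+ k]).
      by apply: measurable_lt_set => //; exact: measurable_enormB.
    by apply/seteqP; split => [x []|x] //=.
  rewrite (_ : A k i = set0)//; apply/seteqP; split => // x [? ? _].
  exact: nq.
have mD : measurable (Gamma `\` N) by exact: measurableD.
have DA k : Gamma `\` N `<=` \bigcup_i A k i.
  move=> x [Gx _]; pose r : R := 2^-1 ^+ k / 2.
  have k0 : 0 < 2^-1 ^+ k :> R by rewrite exprn_gt0// invr_gt0.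
  have r0 : 0 < r by rewrite divr_gt0.
  have [X [OX Xx dX]] := corkscrew oO Gamma0 C1_gt0 cs Gx r0.
  have dX' : r <= C1 * delta X by rewrite -ler_pdivrMl.
  pose e := Num.min r (delta X / 2).
  have dX0 : 0 < delta X by exact: delta_gt0.
  have e0 : 0 < e by rewrite lt_min r0 divr_gt0.
  have [i qi] := Hq X e e0; exists i => //.
  have er : e <= r by rewrite ge_min lexx.
  have ed : e <= delta X / 2 by rewrite ge_min lexx orbT.
  have dq := delta_lip Gamma0 X (q i); rewrite (enorm_sub X) in dq.
  split.
  - by apply: (eball_delta oO Gamma0 OX); rewrite /eball/=; lra.
  - have : C1 * delta X <= C1 * (2 * delta (q i)) by rewrite ler_pM2l//; lra.
    by rewrite /r in dX'; lra.
  - by have := enorm_triangle X (q i) x; rewrite /r in er Xx; lra.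
have /choice[idx Hidx] k := measurable_selection R mD (mA k) (DA k).
apply: (@measurable_fun_cvg _ _ _ _ (fun k x => h (q (idx k x)))).
  by move=> k; have [_ /(_ (fun i => h (q i)))] := Hidx k.
move=> x Dx; have Tx := HT x Dx; apply/cvgrPdist_lt => e e0.
have K0 : 0 < 4 * C1 by rewrite mulr_gt0.
have [eta eta0 H] := Tx (4 * C1) e K0 e0.
have [J HJ] := expr_half_lt eta0.
exists J => // k /= Jk; have [/(_ x Dx)[Oq dq qx] _] := Hidx k.
rewrite distrC; apply: H => //; first by rewrite (le_trans (ltW qx)).
rewrite (lt_trans qx)//; apply: le_lt_trans HJ.
by rewrite ler_wiXn2l// ?invr_ge0// invf_le1// ler1n.
Qed.

Local Notation havg := (interior_average Omega m).
Local Notation E := (energy_space Omega m).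

(** Defined by choice at every point. For [u] in the energy space a limit exists at almost every
    boundary point, so arbitrary values occur there only on a null set. *)
Definition trace_op (u : 'rV[R]_n -> R) x : R := get (nt_limit Omega (havg u) x).

(** The function [h] is allowed to be any expression for the averages on [Omega], such as the linear
    combination used in [trace_op_lin]. *)
Lemma trace_op_eq u h x l : Gamma x -> (forall X, Omega X -> h X = havg u X) ->
  nt_limit Omega h x l -> trace_op u x = l.
Proof.
move=> Gx hu hl; have hl' := nt_limit_eq hu hl.
by apply: (nt_limit_unique Gx _ hl'); rewrite /trace_op; apply: getPex; exists l.
Qed.

Lemma energy_nabla u : space_mem E u -> weak_gradient Omega m u (nabla Omega m u).
Proof. by move=> [_ [v uv]]; apply: getPex; exists v. Qed.

Lemma trace_op_nt u : space_mem E u -> exists N, [/\ measurable N, mu N = 0%E &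
  forall x, (Gamma `\` N) x -> nt_limit Omega (havg u) x (trace_op u x)].
Proof.
move=> Eu; have Lu := proj1 Eu; have gu := energy_nabla Eu.
have [N0 [u' [w EV]]] := energy_version_exists oO Lu gu.
have [C0 C0_ge0 HC0] := energy_oscillation oO O0 Gamma0 m_ball m_dbl poinc.
have osc := HC0 _ _ _ _ _ Lu gu EV; have [mf f0 fI _] := osc.
have [N [mN muN HN]] := good_ae oO Gamma0 mu_ball mu_dbl mf f0 fI.
exists N; split => // x [Gx nNx].
have gx : good Omega m mu (fun Z => enorm (w Z) ^+ 2) x.
  by apply: contrapT => ng; apply: nNx; apply: HN => /= /(_ Gx).
have [l xl] := nt_limit_exists oO O0 Gamma0 C1_gt0 cs hc m_ball m_dbl mu_ball mu_dbl rho_gr C0_ge0 osc Gx gx.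
by rewrite (trace_op_eq Gx _ xl).
Qed.

Lemma trace_op_measurable u : space_mem E u -> nu_measurable_fun mu Gamma (trace_op u).
Proof.
move=> /trace_op_nt[N [mN N0 HN]].
by apply: (Borel_nu_measurable_fun mG mN N0); exact: nt_limit_measurable HN.
Qed.

Lemma trace_op_bounded : exists2 C : R, 0 <= C & forall u, space_mem E u ->
  (\int[mu]_(x in Gamma) \int[mu]_(y in Gamma) (boundary_integrand Omega m mu (trace_op u) x y)%:E
   <= C%:E * \int[m]_(Z in Omega) (enorm (nabla Omega m u Z) ^+ 2)%:E)%E.
Proof.
have [C0 C0_ge0 HC0] := energy_oscillation oO O0 Gamma0 m_ball m_dbl poinc.
have [C C_ge0 HC] := trace_norm_le oO O0 Gamma0 C1_gt0 cs hc m_ball m_dbl mu_ball mu_dbl rho_gr C0_ge0.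
exists C => // u Eu; have Lu := proj1 Eu; have gu := energy_nabla Eu.
have [N0 [u' [w EV]]] := energy_version_exists oO Lu gu.
have osc := HC0 _ _ _ _ _ Lu gu EV.
rewrite -(integral_energy_version EV); apply: (HC _ _ osc) => x Gx gx.
have [l xl] := nt_limit_exists oO O0 Gamma0 C1_gt0 cs hc m_ball m_dbl mu_ball mu_dbl rho_gr C0_ge0 osc Gx gx.
by rewrite (trace_op_eq Gx _ xl).
Qed.

Lemma trace_op_ae_eq u v : {ae m, forall x, Omega x -> u x = v x} ->
  forall x, trace_op u x = trace_op v x.
Proof.
move=> [N [mN N0 HN]] x; rewrite /trace_op.
have huv X : Omega X -> havg u X = havg v X.
  move=> OX; apply: (average_ae_eq mN N0) => Y [BY nNY].
  have OY : Omega Y.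
    apply: (eball_delta oO Gamma0 OX); move: BY; rewrite /eball/=.
    by have := delta_gt0 oO Gamma0 OX; lra.
  by apply: contrapT => ne; apply: nNY; apply: HN => /= /(_ OY).
congr get; apply/seteqP; split => l; apply: nt_limit_eq => X OX; rewrite huv//.
Qed.

Lemma trace_op_lin a u v : space_mem E u -> space_mem E v ->
  {ae mu, forall x, Gamma x ->
    trace_op (fun X => a * u X + v X) x = a * trace_op u x + trace_op v x}.
Proof.
move=> Eu Ev; have [N [mN N0 HN]] := trace_op_nt Eu.
have [N2 [mN2 N20 HN2]] := trace_op_nt Ev.
exists (N `|` N2); split; [exact: measurableU|exact: null_set_setU|].
move=> x /= /not_implyP[Gx nx]; apply: contrapT => /not_orP[n1 n2]; apply: nx.
apply: (trace_op_eq Gx _ (nt_limit_lin a (HN x _) (HN2 x _))) => // X OX.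
rewrite /interior_average (average_ball_lin oO a (proj1 Eu) (proj1 Ev))//.
  by rewrite divr_gt0// delta_gt0.
exact: delta_ball.
Qed.

(** The Whitney condition gives [4 * diam I <= delta X], hence four times the side is at most
    [delta X]. Distance and diameter bounds for [Q] put [x] within a few [l(Q)] of the cube [I], and
    [l(Q)] is at most [Ca] times the side of [I]. *)
Lemma access_cone_subset cubes a0 : (0 < n)%N -> christ_decomposition Omega mu a0 cubes ->
  exists2 K : R, 0 < K & forall x X, access_cone Omega C1 cubes x X ->
    Omega X /\ enorm (X - x) <= K * delta X.
Proof.
move=> n0 chr.
have [Ca CaE] : exists Ca, 1000 * C1 * Num.sqrt n%:R = Ca by eexists.
have Ca0 : 0 < Ca.
  rewrite -CaE; apply: mulr_gt0; last by rewrite sqrtr_gt0 ltr0n.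
  apply: mulr_gt0; last exact: C1_gt0.
  exact: (ltr0Sn R 999).
exists (1 + Ca) => [|x X [j [Q [cQ Qx [k [z [[wz ek dQ] IX]]]]]]].
  by rewrite addr_gt0.
have [IO [wsz _]] := (let: And3 a b c := wz in conj a (conj b c)).
split; first exact: IO.
rewrite CaE in ek.
pose s : R := generation_length k; pose t : R := generation_length j.
have s0 : 0 < s by rewrite /s /generation_length exprz_gt0.
have t0 : 0 < t by rewrite /t /generation_length exprz_gt0.
have ts : t <= Ca * s by move: ek; rewrite ler_pdivrMl.
set I := dyadic_cube k z in IO IX dQ.
have d4 : Defs.edist (dilated_cube 4 k z) Gamma <= delta X.
  have I4 : dilated_cube 4 k z X.
    move=> i; rewrite (le_trans (IX i))// -/s; have := s0; lra.
  apply: (delta_lb Gamma0) => y Gy; apply: ge_inf; last by exists X => //; exists y.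
  by exists 0 => _ [a _ [b _ <-]]; exact: enorm_ge0.
have diamI p q : I p -> I q -> 4 * enorm (p - q) <= delta X.
  move=> Ip Iq; rewrite -lee_fin EFinM; apply: le_trans (le_trans wsz _); last by rewrite lee_fin; exact: d4.
  by apply: lee_wpmul2l => //; apply: ereal_sup_ubound; exists p => //; exists q.
(* The diameter of the cube is at least its side: two opposite corners differ by [s] in every
   coordinate, and there is one since [n] is positive. *)
have sdX : 4 * s <= delta X.
  pose c (b : R) : 'rV[R]_n := \row_i (((z i)%:~R + b) * s).
  have Ic b : 0 <= b <= 1 -> I (c b).
    move=> /andP[b0 b1] i; rewrite mxE -/s.
    have -> : ((z i)%:~R + b) * s - ((z i)%:~R + 2^-1) * s = (b - 2^-1) * s by ring.
    have h : `|b - 2^-1| <= 2^-1 by rewrite ler_norml; apply/andP; split; lra.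
    by rewrite normrM (gtr0_norm s0) mul1r mulrC ler_pM2l.
  have := diamI _ _ (Ic 1 _) (Ic 0 _); rewrite ?lexx ?ler01// => /(_ isT isT).
  apply: le_trans; rewrite ler_pM2l//.
  have := coord_le_enorm (c 1 - c 0) (Ordinal n0); rewrite !mxE; apply: le_trans.
  have -> : ((z (Ordinal n0))%:~R + 1) * s - ((z (Ordinal n0))%:~R + 0) * s = s by ring.
  exact: ler_norm.
(* The distance is an infimum that need not be attained, hence [3 * t] instead of [2 * t]. *)
have [p [q [Ip Qq pq]]] : exists p q, [/\ I p, Q q & enorm (p - q) < 3 * t].
  have hi : has_inf [set enorm (x - y) | x in I & y in Q].
    split; first by exists (enorm (X - x)); exists X => //; exists x.
    by exists 0 => _ [a _ [b _ <-]]; exact: enorm_ge0.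
  have [_ [p Ip [q Qq <-]] pq] := inf_adherent t0 hi.
  exists p, q; split => //; apply: lt_le_trans pq _.
  by move: dQ; rewrite /Defs.edist -/t; lra.
have qx : enorm (q - x) <= t.
  rewrite -lee_fin; apply: le_trans (christ_diam chr cQ).
  by apply: ereal_sup_ubound; exists q => //; exists x.
have := diamI X p IX Ip; have := enorm_triangle p X x; have := enorm_triangle q p x.
have := enorm_ge0 (X - p).
have : Ca * (4 * s) <= Ca * delta X by rewrite ler_pM2l.
lra.
Qed.

Lemma nt_limit_cone_limit cubes a0 h x l : (0 < n)%N -> christ_decomposition Omega mu a0 cubes ->
  nt_limit Omega h x l -> cone_limit Omega C1 cubes h x l.
Proof.
move=> n0 chr xl e e0; have [K K0 HK] := access_cone_subset n0 chr.
have [eta eta0 H] := xl K e K0 e0.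
exists (eta / K) => [|X /HK[OX XK] dX]; first by rewrite divr_gt0.
by apply: H => //; rewrite (le_lt_trans XK)// mulrC -ltr_pdivlMr.
Qed.

End trace.

(** * Energy of boundary functions *)

Section jensen.
Context {R : realType} {n : nat} (nu : {sigma_finite_measure set 'rV[R]_n -> \bar R}).
Implicit Types (A B : set 'rV[R]_n) (f g : 'rV[R]_n -> R).

(** With [a] the mean of [f - c], integrate the tangent inequality
    [2 * a * (f - c) - a ^+ 2 <= (f - c) ^+ 2]. *)
Lemma average_jensen B f c : measurable B -> (0 < nu B < +oo)%E -> measurable_fun setT f ->
  nu.-integrable B (EFin \o f) ->
  (((average nu B f - c) ^+ 2)%:E <=
   ((fine (nu B))^-1)%:E * \int[nu]_(x in B) ((f x - c) ^+ 2)%:E)%E.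
Proof.
move=> mB /andP[B0 Boo] mf fi.
have fB : 0 < fine (nu B) by rewrite fine_gt0// B0.
have mh : measurable_fun B (fun x => ((f x - c) ^+ 2)%:E).
  apply/measurable_EFinP/measurable_funTS; apply: measurable_funX.
  by apply: measurable_funB.
have h0 x : (0 <= ((f x - c) ^+ 2)%:E)%E by rewrite lee_fin sqr_ge0.
have [Ioo|] := ltP (\int[nu]_(x in B) ((f x - c) ^+ 2)%:E)%E +oo%E; last first.
  by rewrite leye_eq => /eqP ->; rewrite gt0_muley ?leey// lte_fin invr_gt0.
have ih : nu.-integrable B (EFin \o (fun x => (f x - c) ^+ 2)).
  apply/integrableP; split => //.
  suff -> : (\int[nu]_(x in B) `|(EFin \o (fun x => (f x - c) ^+ 2)%R) x| =
    \int[nu]_(x in B) ((f x - c) ^+ 2)%:E)%E by [].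
  by apply: eq_integral => x _; exact: gee0_abs (h0 x).
have ic (a : R) : nu.-integrable B (EFin \o cst a) by exact: integrable_cst_fin.
have id : nu.-integrable B (EFin \o (fun x => f x - c)) by exact: (integrableB mB fi (ic c)).
pose mu' := average nu B f - c.
have Eid : \int[nu]_(x in B) (f x - c) = mu' * fine (nu B).
  rewrite (RintegralB mB fi (ic c)) Rintegral_cst// /mu' /average.
  by field; rewrite gt_eqF.
have i1 : nu.-integrable B (EFin \o (fun x => (2 * mu') * (f x - c))).
  by have := integrableZl mB (2 * mu') id; apply: eq_integrable.
have i2 : nu.-integrable B (EFin \o (fun x => (2 * mu') * (f x - c) - mu' ^+ 2)).
  exact: (integrableB mB i1 (ic _)).
have := le_Rintegral mB i2 ih.
rewrite (RintegralB mB i1 (ic _)) (RintegralZl _ mB id) Rintegral_cst// Eid => H.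
rewrite -(fineK (_ : (\int[nu]_(x in B) ((f x - c) ^+ 2)%:E)%E \is a fin_num)); last first.
  by rewrite ge0_fin_numE// integral_ge0.
rewrite -EFinM lee_fin ler_pdivlMl//.
apply: (@le_trans _ _ (2 * mu' * (mu' * fine (nu B)) - mu' ^+ 2 * fine (nu B))); last first.
  by apply: H => x _; have := sqr_ge0 (f x - c - mu'); lra.
by rewrite -/mu' le_eqVlt; apply/orP; left; apply/eqP; ring.
Qed.

Lemma average_double_jensen A B g : measurable A -> measurable B ->
  (0 < nu A < +oo)%E -> (0 < nu B < +oo)%E -> measurable_fun setT g ->
  nu.-integrable A (EFin \o g) -> nu.-integrable B (EFin \o g) ->
  (((average nu A g - average nu B g) ^+ 2)%:E <= ((fine (nu A) * fine (nu B))^-1)%:E *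
   \int[nu]_(x in A) \int[nu]_(y in B) ((g x - g y) ^+ 2)%:E)%E.
Proof.
move=> mA mB A0 B0 mg gA gB.
apply: (le_trans (average_jensen _ mA A0 mg gA)).
rewrite invfM EFinM -muleA; apply: lee_wpmul2l; first by rewrite lee_fin invr_ge0 fine_ge0.
have mk : measurable_fun setT (fun p : 'rV[R]_n * 'rV[R]_n => ((g p.1 - g p.2) ^+ 2)%:E).
  apply/measurable_EFinP; apply: measurable_funX; apply: measurable_funB.
    exact: (measurableT_comp mg measurable_fst).
  exact: (measurableT_comp mg measurable_snd).
have k0 (p : 'rV[R]_n * 'rV[R]_n) : (0 <= ((g p.1 - g p.2) ^+ 2)%:E)%E.
  by rewrite lee_fin sqr_ge0.
rewrite -ge0_integralZl//; last 3 first.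
- apply: measurable_funTS.
  have := measurable_section_integral nu (measurableX measurableT mB) mk k0.
  apply: eq_measurable_fun => x _; congr (integral _ _ _).
  by apply/seteqP; split => y //= [].
- by move=> x _; apply: integral_ge0 => y _; exact: (k0 (x, y)).
- by rewrite lee_fin invr_ge0 fine_ge0.
apply: le_integral_ge0 => x _; first by rewrite lee_fin sqr_ge0.
have := average_jensen (g x) mB B0 mg gB; rewrite -[in leLHS]sqrrN opprB => h.
apply: (le_trans h); apply: lee_wpmul2l; first by rewrite lee_fin invr_ge0 fine_ge0.
apply: le_integral_ge0 => y _; first by rewrite lee_fin sqr_ge0.
by rewrite -[in leLHS]sqrrN opprB.
Qed.

End jensen.

(** * Kernels for the boundary energy and the extension *)

Section extension.
Context {R : realType} {n : nat} (Omega : set 'rV[R]_n).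
Variables (m mu : {sigma_finite_measure set 'rV[R]_n -> \bar R}).
Variables (C1 C3 C4 C5 : R).
Local Notation Gamma := (boundary Omega).
Local Notation delta := (delta Omega).
Hypothesis oO : open Omega.
Hypothesis O0 : Omega !=set0.
Hypothesis Gamma0 : Gamma !=set0.
Hypothesis m_ball : forall X r, closure Omega X -> 0 < r ->
  (0 < m (eball X r `&` Omega) < +oo)%E.
Hypothesis m_dbl : forall X r, closure Omega X -> 0 < r ->
  (m (eball X (2 * r) `&` Omega) <= C4%:E * m (eball X r `&` Omega))%E.
Hypothesis mu_ball : forall x r, Gamma x -> 0 < r ->
  (0 < mu (eball x r `&` setT) < +oo)%E.
Hypothesis mu_dbl : forall x r, Gamma x -> 0 < r ->
  (mu (eball x (2 * r) `&` setT) <= C3%:E * mu (eball x r `&` setT))%E.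
Hypothesis mu_null : mu (~` Gamma) = 0%E.
Hypothesis rho_gr : rho_growth Omega m mu C5.

Local Notation M := (vol m Omega).
Local Notation U := (vol mu setT).
Local Notation inv_rho := (inv_rho Omega m mu).
Local Notation gexp := (gexp C5).

Let mO : measurable Omega. Proof. exact: open_measurable_mx. Qed.
Let mG : measurable Gamma. Proof. exact: measurable_boundary. Qed.
Let M0 X r : closure Omega X -> 0 < r -> 0 < M X r.
Proof. exact: (vol_gt0 m_ball). Qed.
Let U0 x r : Gamma x -> 0 < r -> 0 < U x r.
Proof. exact: (vol_gt0 mu_ball). Qed.

(** This is [rho ^+ 2 / M ^+ 2] at scale [t]; multiplied by [M] it is the kernel of the boundary
    norm. *)
Definition pair_weight x t : R := (t ^+ 2 * U x t ^+ 2)^-1.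

Lemma pair_weight_ge0 x t : 0 <= pair_weight x t.
Proof. by rewrite /pair_weight invr_ge0; apply: mulr_ge0; exact: sqr_ge0. Qed.

Lemma pair_weight_mono x s t : Gamma x -> 0 < s -> s <= t ->
  pair_weight x t <= pair_weight x s.
Proof.
move=> Gx s0 st; have t0 : 0 < t by exact: lt_le_trans st.
have us := U0 Gx s0; have ut := U0 Gx t0.
rewrite /pair_weight lef_pV2 ?posrE ?mulr_gt0 ?exprn_gt0//.
apply: ler_pM; rewrite ?sqr_ge0//; rewrite ler_pXn2r// ?nnegrE ?(ltW s0) ?(ltW t0) ?(ltW us) ?(ltW ut)//.
exact: (vol_le_radius measurableT mu_ball).
Qed.

Lemma pair_weightE x t : Gamma x -> 0 < t -> M x t * pair_weight x t = (inv_rho x t * U x t)^-1.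
Proof.
move=> Gx t0; have ut := U0 Gx t0; have mt : 0 < M x t by apply: M0 => //; exact: boundary_closure.
by rewrite /pair_weight /inv_rho; field; rewrite !gt_eqF.
Qed.

(** Inside the ball of radius [d] the weight is at most its value at [d]. On the annulus at distance
    [2 ^ k * d], [M * pair_weight] equals [(inv_rho * U)^-1], and the growth condition makes this
    decay geometrically in [k]. *)
Lemma integral_pair_weight_le : exists2 C : R, 0 <= C & forall x d, Gamma x -> 0 < d ->
  (\int[m]_(X in Omega) (pair_weight x (enorm (X - x) + d))%:E <=
   (C * (M x d * pair_weight x d))%:E)%E.
Proof.
have [Cg Cg1 HCg] := growth oO Gamma0 m_ball mu_ball rho_gr.
have Cg0 : 0 < Cg by lra.
have C40 : 0 < C4 := doubling_gt0 m_ball m_dbl (let: ex_intro X OX := O0 in ex_intro _ X (subset_closure OX)).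
have g0 : 0 < gexp by rewrite /gexp invr_gt0; exact: growth_gt0 oO Gamma0 m_ball mu_ball rho_gr.
pose q : R := 2^-1 `^ gexp.
have q0 : 0 < q by rewrite powR_gt0// invr_gt0.
have q1 : q < 1.
  have := @gt0_ltr_powR R gexp g0 2^-1 1.
  by rewrite !nnegrE powR1; apply => //; rewrite ?invr_ge0// invf_lt1// ltr1n.
have C0 : 0 <= C4 * Cg / (1 - q).
  by apply: divr_ge0; [exact: mulr_ge0 (ltW C40) (ltW Cg0)|rewrite subr_ge0 ltW].
exists (1 + C4 * Cg / (1 - q)) => [|x d Gx d0]; first by rewrite addr_ge0.
have cx : closure Omega x by exact: boundary_closure.
have mw : measurable_fun setT (fun X : 'rV[R]_n => pair_weight x (enorm (X - x) + d)).
  apply: measurable_inv_ge0 => [X|]; first by apply: mulr_ge0; exact: sqr_ge0.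
  have mt : measurable_fun setT (fun X : 'rV[R]_n => enorm (X - x) + d).
    by apply: measurable_funD => //; exact: measurable_enormB.
  apply: measurable_funM; apply: measurable_funX => //.
  by apply: measurable_vol.
pose A := Omega `&` [set X | enorm (X - x) < d].
pose B := Omega `&` [set X | d <= enorm (X - x)].
have mA : measurable A.
  by apply: measurableI => //; apply: measurable_lt_set => //; exact: measurable_enormB.
have BE : B = Omega `\` [set X | enorm (X - x) < d].
  apply/seteqP; split => X /= [OX h]; split => //.
    by apply/negP; rewrite -leNgt.
  by rewrite /= leNgt; apply/negP.
have mB : measurable B.
  rewrite BE; apply: measurableD => //; apply: measurable_lt_set => //; exact: measurable_enormB.
have OE : Omega = A `|` B.
  apply/seteqP; split => X; last by case => -[].
  by move=> OX; have [h|h] := ltP (enorm (X - x)) d; [left|right].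
rewrite [X in (\int[m]_(_ in X) _ <= _)%E]OE ge0_integral_setU//; last 3 first.
- by apply/measurable_EFinP/measurable_funTS.
- by move=> X _; rewrite lee_fin pair_weight_ge0.
- by apply/disj_setPS => X [[_ /= h1] [_ /=]]; rewrite leNgt h1.
rewrite mulrDl mul1r EFinD; apply: leeD.
  apply: (@le_trans _ _ (\int[m]_(X in A) (pair_weight x d)%:E)%E).
    apply: le_integral_ge0 => X _; first by rewrite lee_fin pair_weight_ge0.
    by rewrite lee_fin pair_weight_mono// lerDr enorm_ge0.
  rewrite integral_cst// muleC mulrC EFinM muleC; apply: lee_wpmul2l; first by rewrite lee_fin pair_weight_ge0.
  rewrite -(volE m_ball)//; apply: le_measure; rewrite ?inE//.
    by apply: measurableI => //; exact: measurable_eball.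
  by move=> X [].
apply: (@le_trans _ _ (\int[m]_(X in B) (pair_weight x (enorm (X - x)))%:E)%E).
  apply: le_integral_ge0 => X [OX /= h]; first by rewrite lee_fin pair_weight_ge0.
  by rewrite lee_fin pair_weight_mono ?lerDl ?(ltW d0)//; exact: lt_le_trans h.
have -> : C4 * Cg / (1 - q) * (M x d * pair_weight x d) =
   C4 * Cg * (M x d * pair_weight x d) / (1 - q) by ring.
have wd0 : 0 <= M x d * pair_weight x d by apply: mulr_ge0; [exact: vol_ge0|exact: pair_weight_ge0].
apply: (integral_annuli_le (nu := m) mO (x := x) (phi := pair_weight x) d0 (ltW q0) q1).
- by apply: mulr_ge0 => //; exact: mulr_ge0 (ltW C40) (ltW Cg0).
- by move=> t t0; exact: pair_weight_ge0.
- by move=> s t s0 st; exact: pair_weight_mono.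
- move=> k; set t := 2 ^+ k * d.
  have t0 : 0 < t by rewrite mulr_gt0// exprn_gt0.
  have dt : d <= t by rewrite ler_peMl ?(ltW d0)// exprn_ege1// ler1n.
  apply: (@le_trans _ _ ((pair_weight x t)%:E * (C4 * M x t)%:E)%E).
    apply: lee_wpmul2l; first by rewrite lee_fin pair_weight_ge0.
    rewrite exprS -mulrA -/t; apply: (le_trans (m_dbl cx t0)).
    by rewrite (volE m_ball)// EFinM.
  rewrite -EFinM lee_fin mulrCA -[leRHS]mulrA -[leRHS]mulrA ler_pM2l// [leLHS]mulrC.
  rewrite !pair_weightE//.
  have id := inv_rho_gt0 oO m_ball mu_ball Gx d0; have it := inv_rho_gt0 oO m_ball mu_ball Gx t0.
  have ud := U0 Gx d0; have ut := U0 Gx t0.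
  have udt : U x d <= U x t by exact: (vol_le_radius measurableT mu_ball).
  have h := HCg x t d Gx d0 dt.
  have hq : (d / t) `^ gexp = q ^+ k.
    have -> : d / t = 2^-1 ^+ k by rewrite /t exprVn; field; rewrite !gt_eqF ?exprn_gt0.
    rewrite /q; elim: (k) => [|j IH]; first by rewrite !expr0 powR1.
    by rewrite !exprS powRM ?invr_ge0 ?exprn_ge0 ?invr_ge0// IH.
  rewrite hq in h.
  rewrite -[leLHS]mul1r ler_pdivrMr; last exact: mulr_gt0.
  have -> : Cg * ((inv_rho x d * U x d)^-1 * q ^+ k) * (inv_rho x t * U x t) =
    (Cg * (q ^+ k * inv_rho x t) / inv_rho x d) * (U x t / U x d) by field; rewrite !gt_eqF.
  have h1 : 1 <= Cg * (q ^+ k * inv_rho x t) / inv_rho x d by rewrite ler_pdivlMr// mul1r.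
  have h2 : 1 <= U x t / U x d by rewrite ler_pdivlMr// mul1r.
  by rewrite -[leLHS]mulr1; apply: ler_pM.
Qed.

Definition boundary_kernel x y : R := M x (enorm (x - y)) * pair_weight x (enorm (x - y)).

Lemma boundary_kernel_ge0 x y : 0 <= boundary_kernel x y.
Proof. by apply: mulr_ge0; [exact: vol_ge0|exact: pair_weight_ge0]. Qed.

Lemma boundary_integrandE (g : 'rV[R]_n -> R) x y : Gamma x ->
  boundary_integrand Omega m mu g x y = (g x - g y) ^+ 2 * boundary_kernel x y.
Proof.
move=> Gx; rewrite /boundary_integrand; have [->|xy] := eqVneq x y.
  by rewrite subrr expr2 !mul0r.
have d0 : 0 < enorm (x - y).
  rewrite lt_neqAle enorm_ge0 andbT eq_sym; apply: contraNneq xy.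
  by move=> /enorm_eq0/eqP; rewrite subr_eq0.
have ud := U0 Gx d0; have md : 0 < M x (enorm (x - y)) by apply: M0 => //; exact: boundary_closure.
rewrite rhoE real_normK ?num_real// -/(M x _) /boundary_kernel /pair_weight.
by field; rewrite !gt_eqF.
Qed.

Lemma measurable_pair_weight d (T : measurableType d) (y : T -> 'rV[R]_n) (t : T -> R) :
  measurable_fun setT y -> measurable_fun setT t ->
  measurable_fun setT (fun p => pair_weight (y p) (t p)).
Proof.
move=> my mt; apply: measurable_inv_ge0 => [p|].
  by apply: mulr_ge0; exact: sqr_ge0.
apply: measurable_funM; apply: measurable_funX => //.
exact: measurable_vol.
Qed.

Lemma measurable_boundary_kernel :
  measurable_fun setT (fun p : 'rV[R]_n * 'rV[R]_n => boundary_kernel p.1 p.2).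
Proof.
have md : measurable_fun setT (fun p : 'rV[R]_n * 'rV[R]_n => enorm (p.1 - p.2)).
  by apply: measurable_enormB; [exact: measurable_fst|exact: measurable_snd].
apply: measurable_funM.
  by apply: measurable_vol => //; exact: measurable_fst.
by apply: measurable_pair_weight => //; exact: measurable_fst.
Qed.

(** The kernel is [(inv_rho * U)^-1] at scale [enorm (x - y)], and both factors grow with the scale
    up to a constant. Hence unweighted integrals over a ball are controlled by [energy_at]. *)
Lemma kernel_lower_bound : exists2 C : R, 0 < C & forall x y s, Gamma x ->
  x != y -> enorm (x - y) <= s -> 1 <= C * (inv_rho x s * U x s) * boundary_kernel x y.
Proof.
have [Cg Cg1 HCg] := growth oO Gamma0 m_ball mu_ball rho_gr.
have Cg0 : 0 < Cg by lra.
have g0 : 0 < gexp by rewrite /gexp invr_gt0; exact: growth_gt0 oO Gamma0 m_ball mu_ball rho_gr.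
exists Cg => // x y s Gx xy; rewrite /boundary_kernel; set d := enorm (x - y) => ds.
have d0 : 0 < d.
  rewrite lt_neqAle enorm_ge0 andbT eq_sym; apply: contraNneq xy.
  by move=> /enorm_eq0/eqP; rewrite subr_eq0.
have s0 : 0 < s by exact: lt_le_trans ds.
have id := inv_rho_gt0 oO m_ball mu_ball Gx d0; have js := inv_rho_gt0 oO m_ball mu_ball Gx s0.
have ud := U0 Gx d0; have us := U0 Gx s0.
have uds : U x d <= U x s by exact: (vol_le_radius measurableT mu_ball).
rewrite pair_weightE// ler_pdivlMr; last exact: mulr_gt0.
rewrite mul1r mulrA; apply: (ler_pM (ltW id) (ltW ud)) => //.
apply: le_trans (HCg x s d Gx d0 ds) _; rewrite ler_pM2l//.
rewrite ger_pMl//.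
have := @ge0_ler_powR R gexp (ltW g0) (d / s) 1.
rewrite powR1 !nnegrE; apply => //; first by rewrite divr_ge0 ?ltW.
by rewrite ler_pdivrMr// mul1r.
Qed.

Lemma mu_setI_boundary A : measurable A -> mu (A `&` Gamma) = mu A.
Proof.
move=> mA; have -> : mu A = (mu (A `\` Gamma) + mu (A `&` Gamma))%E by exact: measureDI.
rewrite (_ : mu (A `\` Gamma) = 0%E) ?add0e//; apply/eqP; rewrite -measure_le0 -mu_null.
apply: le_measure; rewrite ?inE; [exact: measurableD|exact: measurableC|by move=> x []].
Qed.

Section boundary_function.
Variable g : 'rV[R]_n -> R.
Hypothesis mg : measurable_fun setT g.

Definition energy_at x : \bar R :=
  (\int[mu]_(y in Gamma) ((g x - g y) ^+ 2 * boundary_kernel x y)%:E)%E.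

Lemma energy_at_ge0 x : (0 <= energy_at x)%E.
Proof.
by apply: integral_ge0 => y _; rewrite lee_fin mulr_ge0 ?sqr_ge0 ?boundary_kernel_ge0.
Qed.

Let mgg : measurable_fun setT (fun p : 'rV[R]_n * 'rV[R]_n => (g p.1 - g p.2) ^+ 2).
Proof.
apply: measurable_funX; apply: measurable_funB.
  exact: (measurableT_comp mg measurable_fst).
exact: (measurableT_comp mg measurable_snd).
Qed.

Let mk : measurable_fun setT (fun p : 'rV[R]_n * 'rV[R]_n =>
  ((g p.1 - g p.2) ^+ 2 * boundary_kernel p.1 p.2)%:E).
Proof.
by apply/measurable_EFinP; apply: measurable_funM => //; exact: measurable_boundary_kernel.
Qed.

Lemma measurable_section_on (D : set 'rV[R]_n) (k : 'rV[R]_n * 'rV[R]_n -> \bar R) : measurable D ->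
  measurable_fun setT k -> (forall p, 0 <= k p)%E ->
  measurable_fun setT (fun x => \int[mu]_(y in D) k (x, y))%E.
Proof.
move=> mD mk' k0.
have := measurable_section_integral mu (measurableX measurableT mD) mk' k0.
apply: eq_measurable_fun => x _; congr (integral _ _ _).
by apply/seteqP; split => y //= [].
Qed.

Lemma measurable_energy_at : measurable_fun setT energy_at.
Proof.
apply: (measurable_section_on mG mk) => p.
by rewrite lee_fin mulr_ge0 ?sqr_ge0 ?boundary_kernel_ge0.
Qed.

Lemma boundary_energyE : (\int[mu]_(x in Gamma) \int[mu]_(y in Gamma)
  (boundary_integrand Omega m mu g x y)%:E = \int[mu]_(x in Gamma) energy_at x)%E.
Proof.
apply: eq_integral => x /set_mem Gx; apply: eq_integral => y _.
by rewrite boundary_integrandE.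
Qed.

Lemma integral_ball_sqr_le : exists2 C : R, 0 < C & forall x s, Gamma x -> 0 < s ->
  (\int[mu]_(y in eball x s `&` Gamma) ((g x - g y) ^+ 2)%:E <=
   (C * (inv_rho x s * U x s))%:E * energy_at x)%E.
Proof.
have [C C0 HC] := kernel_lower_bound; exists C => // x s Gx s0.
have js := inv_rho_gt0 oO m_ball mu_ball Gx s0; have us := U0 Gx s0.
rewrite -ge0_integralZl//; last 3 first.
- apply: measurable_funTS; exact: (measurableT_comp mk (measurable_pair1 x)).
- by move=> y _; rewrite lee_fin mulr_ge0 ?sqr_ge0 ?boundary_kernel_ge0.
- by rewrite lee_fin; exact: mulr_ge0 (ltW C0) (mulr_ge0 (ltW js) (ltW us)).
rewrite [leLHS]integral_mkcond [leRHS]integral_mkcond.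
apply: le_integral_ge0 => y _; rewrite !patchE.
  by case: ifP => // _; rewrite lee_fin sqr_ge0.
case: ifPn => [/set_mem[yB Gy]|_]; last first.
  case: ifP => // _; rewrite -EFinM lee_fin; apply: mulr_ge0.
    by apply: mulr_ge0; [exact: ltW|exact: mulr_ge0 (ltW js) (ltW us)].
  by apply: mulr_ge0; [exact: sqr_ge0|exact: boundary_kernel_ge0].
rewrite mem_set// -EFinM lee_fin; have [<-|xy] := eqVneq x y.
  by rewrite subrr expr2 !(mul0r, mulr0).
rewrite mulrCA ler_peMr ?sqr_ge0//; apply: HC => //.
by move: yB; rewrite /eball/= enorm_sub => /ltW.
Qed.

Hypothesis gfin : (\int[mu]_(x in Gamma) energy_at x < +oo)%E.

Lemma energy_at_fin : exists N, [/\ measurable N, mu N = 0%E &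
  forall x, (Gamma `\` N) x -> (energy_at x < +oo)%E].
Proof.
have int : mu.-integrable Gamma energy_at.
  apply/integrableP; split; first by apply: measurable_funTS; exact: measurable_energy_at.
  rewrite (eq_integral energy_at)// => x _; rewrite gee0_abs//; exact: energy_at_ge0.
have [N [mN N0 HN]] := integrable_ae mG int.
exists N; split => // x [Gx nNx].
have : energy_at x \is a fin_num by apply: contrapT => h; apply: nNx; apply: HN => /= /(_ Gx).
by rewrite ge0_fin_numE ?energy_at_ge0.
Qed.

(** Almost every point of the ball has finite [energy_at]; at one such [y0] the function [g y0 - g]
    is square integrable on a larger ball, and [|g|] is at most [|g y0| + 1 + (g y0 - g) ^+ 2]. *)
Lemma boundary_function_integrable x r : Gamma x -> 0 < r ->
  mu.-integrable (eball x r `&` Gamma) (EFin \o g).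
Proof.
move=> Gx r0; have [N [mN N0 HN]] := energy_at_fin.
have mB y s : measurable (eball y s `&` Gamma).
  by apply: measurableI => //; exact: measurable_eball.
have Boo y s : Gamma y -> 0 < s -> (0 < mu (eball y s `&` Gamma) < +oo)%E.
  move=> Gy s0; rewrite mu_setI_boundary; last exact: measurable_eball.
  by have := mu_ball Gy s0; rewrite setIT.
have [y0 [[yB Gy] nNy]] : exists y, (eball x r `&` Gamma) y /\ ~ N y.
  apply: contrapT => /forallNP h.
  have : (mu (eball x r `&` Gamma) <= mu N)%E.
    apply: le_measure; rewrite ?inE// => y By; apply: contrapT => nN; exact: (h y).
  by rewrite N0 leNgt; case/andP: (Boo x r Gx r0) => ->.
have r2 : 0 < 2 * r by rewrite mulr_gt0.
have [C C0 HC] := integral_ball_sqr_le.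
have H := HC y0 _ Gy r2.
have sub : eball x r `&` Gamma `<=` eball y0 (2 * r) `&` Gamma.
  apply: setSI; apply: eball_subset; move: yB; rewrite /eball/= => /ltW.
  by rewrite enorm_sub => h; lra.
apply: (integrableS (mB y0 (2 * r)) (mB x r) sub).
set B := eball y0 _ `&` _.
have [_ Bfin] := andP (Boo y0 _ Gy r2).
have Ifin : (\int[mu]_(y in B) ((g y0 - g y) ^+ 2)%:E < +oo)%E.
  apply: le_lt_trans H _.
  rewrite -(fineK (_ : energy_at y0 \is a fin_num)); first by rewrite -EFinM ltry.
  by rewrite ge0_fin_numE ?energy_at_ge0// HN.
apply/integrableP; split; first by apply/measurable_EFinP; exact: measurable_funTS.
apply: (@le_lt_trans _ _ (\int[mu]_(y in B) ((`|g y0| + 1)%:E + ((g y0 - g y) ^+ 2)%:E))%E).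
  apply: le_integral_ge0 => y _ //=; rewrite -EFinD lee_fin.
  have := lerB_dist (g y) (g y0); rewrite distrC => h.
  have := sqr_ge0 (`|g y0 - g y| - 1); rewrite -(real_normK (num_real (g y0 - g y))).
  by have := sqr_ge0 `|g y0 - g y|; lra.
rewrite ge0_integralD; last 5 first.
- exact: mB.
- by move=> y _; rewrite lee_fin addr_ge0.
- exact: measurable_cst.
- by move=> y _; rewrite lee_fin sqr_ge0.
- apply: measurable_funTS; apply/measurable_EFinP.
  exact: (measurableT_comp mgg (measurable_pair1 y0)).
rewrite integral_cst; last exact: mB.
by rewrite lte_add_pinfty// lte_mul_pinfty ?lee_fin ?addr_ge0.
Qed.

(* Up to a constant, dominates [enorm (grad (ext_approx g K) X) ^+ 2] uniformly
   in [K]. *)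
Definition ext_density X : \bar R :=
  (\int[mu]_(y in Gamma) \int[mu]_(y' in Gamma)
   ((g y - g y') ^+ 2 * pair_weight y (enorm (X - y) + enorm (y - y')))%:E)%E.

Definition ext_kernel (p : ('rV[R]_n * 'rV[R]_n) * 'rV[R]_n) : \bar R :=
  ((g p.1.2 - g p.2) ^+ 2 *
   pair_weight p.1.2 (enorm (p.1.1 - p.1.2) + enorm (p.1.2 - p.2)))%:E.

Lemma ext_kernel_ge0 p : (0 <= ext_kernel p)%E.
Proof. by rewrite lee_fin mulr_ge0 ?sqr_ge0 ?pair_weight_ge0. Qed.

Lemma measurable_ext_kernel : measurable_fun setT ext_kernel.
Proof.
have m11 : measurable_fun setT (fun p : ('rV[R]_n * 'rV[R]_n) * 'rV[R]_n => p.1.1).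
  exact: (measurableT_comp measurable_fst measurable_fst).
have m12 : measurable_fun setT (fun p : ('rV[R]_n * 'rV[R]_n) * 'rV[R]_n => p.1.2).
  exact: (measurableT_comp measurable_snd measurable_fst).
apply/measurable_EFinP; apply: measurable_funM.
  apply: measurable_funX; apply: measurable_funB; first exact: (measurableT_comp mg m12).
  exact: (measurableT_comp mg measurable_snd).
apply: measurable_pair_weight => //.
apply: measurable_funD; apply: measurable_enormB => //.
Qed.

Lemma measurable_ext_section : measurable_fun setT (fun p : 'rV[R]_n * 'rV[R]_n => \int[mu]_(y' in Gamma) ext_kernel (p, y'))%E.
Proof.
have := measurable_section_integral mu (measurableX measurableT mG) measurable_ext_kernel ext_kernel_ge0.
apply: eq_measurable_fun => x _; congr (integral _ _ _).
by apply/seteqP; split => y //= [].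
Qed.

Lemma ext_density_ge0 X : (0 <= ext_density X)%E.
Proof.
by apply: integral_ge0 => y _; apply: integral_ge0 => y' _; exact: (ext_kernel_ge0 ((X, y), y')).
Qed.

Lemma measurable_ext_density : measurable_fun setT ext_density.
Proof.
apply: (measurable_section_on mG measurable_ext_section) => p; apply: integral_ge0 => y' _; exact: ext_kernel_ge0.
Qed.

(** Tonelli's theorem makes the integral over [X] innermost; integrating it out turns [pair_weight]
    into the kernel of the boundary energy. *)
Lemma integral_ext_density_le C : 0 <= C ->
  (forall x d, Gamma x -> 0 < d ->
   (\int[m]_(X in Omega) (pair_weight x (enorm (X - x) + d))%:E <=
   (C * (M x d * pair_weight x d))%:E)%E) ->
  (\int[m]_(X in Omega) ext_density X <= C%:E * \int[mu]_(x in Gamma) energy_at x)%E.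
Proof.
move=> C0 HC.
rewrite (tonelli_on m mu mO mG measurable_ext_section); last by move=> p; apply: integral_ge0 => y' _; exact: ext_kernel_ge0.
rewrite -ge0_integralZl//; last 2 first.
- by apply: measurable_funTS; exact: measurable_energy_at.
- by move=> x _; exact: energy_at_ge0.
apply: le_integral_ge0 => y Gy.
  by apply: integral_ge0 => X _; apply: integral_ge0 => y' _; exact: ext_kernel_ge0.
have mky : measurable_fun setT (fun p : 'rV[R]_n * 'rV[R]_n => ext_kernel ((p.1, y), p.2)).
  have mp : measurable_fun setT (fun p : 'rV[R]_n * 'rV[R]_n => ((p.1, y), p.2)).
    apply/measurable_fun_pairP; split; last exact: measurable_snd.
    apply: (measurable_fun_pair (f := fst) (g := fun=> y)) => //; exact: measurable_fst.
  exact: (measurableT_comp measurable_ext_kernel mp).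
rewrite (tonelli_on m mu mO mG mky); last by move=> p; exact: ext_kernel_ge0.
rewrite -ge0_integralZl//; last 2 first.
- apply: measurable_funTS; exact: (measurableT_comp mk (measurable_pair1 y)).
- by move=> y' _; rewrite lee_fin mulr_ge0 ?sqr_ge0 ?boundary_kernel_ge0.
apply: le_integral_ge0 => y' Gy'; first by apply: integral_ge0 => X _; exact: ext_kernel_ge0.
rewrite /ext_kernel /= -EFinM.
have [<-|yy'] := eqVneq y y'.
  rewrite subrr expr2 !mul0r mulr0 integral0_eq// => X _; by rewrite mul0r.
have d0 : 0 < enorm (y - y').
  rewrite lt_neqAle enorm_ge0 andbT eq_sym; apply: contraNneq yy'.
  by move=> /enorm_eq0/eqP; rewrite subr_eq0.
under eq_integral do rewrite EFinM.
rewrite ge0_integralZl//; last 3 first.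
- apply: measurable_funTS; apply/measurable_EFinP; apply: measurable_pair_weight => //.
  by apply: measurable_funD => //; exact: measurable_enormB.
- by move=> X _; rewrite lee_fin pair_weight_ge0.
- by rewrite lee_fin sqr_ge0.
rewrite mulrCA [leRHS]EFinM; apply: lee_wpmul2l; first by rewrite lee_fin sqr_ge0.
exact: HC.
Qed.

End boundary_function.

End extension.

(** * The extension operator *)

Section extension_operator.
Context {R : realType} {n : nat} (Omega : set 'rV[R]_n).
Variable mu : {sigma_finite_measure set 'rV[R]_n -> \bar R}.
Local Notation Gamma := (boundary Omega).
Local Notation delta := (delta Omega).
Local Notation lattice := {ffun 'I_n -> int}.
Hypothesis oO : open Omega.
Hypothesis Gamma0 : Gamma !=set0.
Hypothesis n_gt0 : (0 < n)%N.
Implicit Types (g : 'rV[R]_n -> R) (k : int) (z : lattice) (X : 'rV[R]_n).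

Definition mesh k : R := 2 ^ (- k).

Lemma mesh_gt0 k : 0 < mesh k.
Proof. by rewrite /mesh exprz_gt0. Qed.

Lemma meshM k : mesh k * 2 ^ k = 1.
Proof. by rewrite /mesh -expfzDr ?pnatr_eq0// addNr expr0z. Qed.

Lemma mesh_prev k : mesh (k - 1) = 2 * mesh k.
Proof. by rewrite /mesh opprB addrC expfzDr ?pnatr_eq0// expr1z mulrC. Qed.

Lemma mesh_next k : mesh k = 2 * mesh (k + 1).
Proof. by rewrite -mesh_prev addrK. Qed.

Lemma mesh_le j k : j <= k -> mesh k <= mesh j.
Proof. by move=> jk; rewrite /mesh ler_weXz2l ?lerN2// ler1n. Qed.

Lemma mesh_lt j k : mesh k < mesh j -> j < k.
Proof. by rewrite ltNge => h; rewrite ltNge; apply: contra h; exact: mesh_le. Qed.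

Definition node k z : 'rV[R]_n := mesh k *: lattice_point z.

Lemma node_dist k z X r : 0 <= r -> (forall i, `|2 ^ k * X ord0 i - (z i)%:~R| <= r) ->
  enorm (node k z - X) <= n%:R * (r * mesh k).
Proof.
move=> r0 h; apply: enorm_le_max => i; rewrite !mxE.
have -> : mesh k * (z i)%:~R - X ord0 i = mesh k * ((z i)%:~R - 2 ^ k * X ord0 i).
  by rewrite mulrBr mulrA meshM mul1r.
by rewrite normrM gtr0_norm ?mesh_gt0// distrC mulrC ler_pM2r ?mesh_gt0.
Qed.

(** An almost nearest boundary point: the slack [mesh k] provides one directly from the infimum. It
    is defined for all nodes, also those outside [Omega]. *)
Definition cell_center k z : 'rV[R]_n :=
  get [set x | Gamma x /\ enorm (node k z - x) < delta (node k z) + mesh k].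

Lemma cell_centerP k z :
  Gamma (cell_center k z) /\ enorm (node k z - cell_center k z) < delta (node k z) + mesh k.
Proof.
have : delta (node k z) < delta (node k z) + mesh k by rewrite ltrDl mesh_gt0.
by move=> /(delta_lt Gamma0)[x Gx xz]; apply: (@getPex _ [set x | Gamma x /\ enorm (node k z - x) < delta (node k z) + mesh k]); exists x.
Qed.

Definition coef g k z : R := average mu (eball (cell_center k z) (mesh k) `&` Gamma) g.

(** Only nodes within [n * mesh k] of [X] enter the sum at [X], so the threshold [5] makes the
    cutoff exactly [1] below [4 * n * mesh k] and exactly [0] above [6 * n * mesh k]. *)
Definition cutoff_coef k z : R := if delta (node k z) <= 5 * n%:R * mesh k then 1 else 0.

Definition averaged g k := scaled_sum k (coef g k).

Definition cutoff k := scaled_sum k (cutoff_coef k).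

(** Passes from the coarser generation [k - 1], away from the boundary, to generation [k], close to
    it. *)
Definition layer g k X := averaged g (k - 1) X +
  cutoff k X * (averaged g k X - averaged g (k - 1) X).

Let nR : 1 <= n%:R :> R.
Proof. by rewrite ler1n. Qed.

Definition strip : R := 7 * n%:R / 2.

Definition in_strip k X := strip * mesh k <= delta X < 2 * strip * mesh k.

(** The strips partition the set where [delta] is positive, so the default [0] is taken only on the
    boundary. *)
Definition level X : int := xget 0 [set k | in_strip k X].

Definition ext_op g X := layer g (level X) X.

(* Freezing the scale at [mesh K] close to the boundary makes the extension
   smooth on the whole space. *)
Definition ext_approx g (K : nat) X :=
  if delta X < strip * mesh K then averaged g K X else ext_op g X.

Let strip_gt0 : 0 < strip. Proof. by rewrite /strip; have := nR; lra. Qed.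
Let strip2_gt0 : 0 < 2 * strip. Proof. by rewrite mulr_gt0. Qed.
Let nR0 : 0 < n%:R :> R. Proof. by rewrite ltr0n. Qed.

Lemma level_exists X : 0 < delta X -> exists k, in_strip k X.
Proof.
move=> dX; have [k /andP[k1 k2]] := dyadic_floor (divr_gt0 dX strip_gt0).
exists (- k); rewrite /in_strip /mesh opprK; apply/andP; split.
  by move: k1; rewrite ler_pdivlMr// mulrC.
rewrite ltr_pdivrMr// in k2; apply: lt_le_trans k2 _.
by rewrite expfzDr ?pnatr_eq0// expr1z le_eqVlt; apply/orP; left; apply/eqP; ring.
Qed.

Lemma in_strip_unique k j X : in_strip k X -> in_strip j X -> k = j.
Proof.
suff H a b : in_strip a X -> in_strip b X -> a <= b.
  by move=> hk hj; apply/eqP; rewrite eq_le !H.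
move=> /andP[a1 a2] /andP[b1 b2]; rewrite -ltzD1; apply: mesh_lt.
rewrite -(ltr_pM2l strip2_gt0).
apply: le_lt_trans a2; apply: le_trans b1.
by rewrite (mesh_next b) le_eqVlt; apply/orP; left; apply/eqP; ring.
Qed.

Lemma in_strip_level k X : in_strip k X -> level X = k.
Proof.
move=> kX; apply: (@in_strip_unique _ _ X) => //.
by apply: (@xgetPex _ 0 [set k | in_strip k X]); exists k.
Qed.

Lemma scaled_sum_dist k c (a r : R) X :
  (forall z, enorm (node k z - X) <= n%:R * mesh k -> `|c z - a| <= r) ->
  `|scaled_sum k c X - a| <= r.
Proof.
move=> H; apply: lattice_sum_dist => z hz; apply: H.
have := @node_dist k z X 1 ler01; rewrite mul1r; apply => i.
by have := hz i; rewrite !mxE => /ltW.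
Qed.

Lemma cutoff_eq1 k X : delta X < 4 * n%:R * mesh k -> cutoff k X = 1.
Proof.
move=> dX; apply/eqP; rewrite -subr_eq0 -normr_le0; apply: scaled_sum_dist => z hz.
rewrite /cutoff_coef; case: ifPn => [_|]; first by rewrite subrr normr0.
by rewrite -ltNge; have := delta_lip Gamma0 (node k z) X; lra.
Qed.

Lemma cutoff_eq0 k X : 6 * n%:R * mesh k < delta X -> cutoff k X = 0.
Proof.
move=> dX; apply/eqP; rewrite -normr_le0 -[X in `|X|]subr0; apply: scaled_sum_dist => z hz.
rewrite /cutoff_coef; case: ifPn => [|_]; last by rewrite subrr normr0.
by have := delta_lip Gamma0 X (node k z); rewrite (enorm_sub X); lra.
Qed.

Lemma cutoff_itv k X : 0 <= cutoff k X <= 1.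
Proof.
have : `|cutoff k X - 2^-1| <= 2^-1.
  apply: scaled_sum_dist => z _; rewrite /cutoff_coef; case: ifP => _.
    by rewrite ger0_norm; lra.
  by rewrite sub0r normrN ger0_norm// invr_ge0.
by rewrite ler_norml => /andP[h1 h2]; apply/andP; split; lra.
Qed.

Lemma layer_eq_coarse g k X : 6 * n%:R * mesh k < delta X -> layer g k X = averaged g (k - 1) X.
Proof. by move=> h; rewrite /layer cutoff_eq0// mul0r addr0. Qed.

Lemma layer_eq_fine g k X : delta X < 4 * n%:R * mesh k -> layer g k X = averaged g k X.
Proof. by move=> h; rewrite /layer cutoff_eq1// mul1r addrC subrK. Qed.

Lemma ext_op_layer g k X : in_strip k X -> ext_op g X = layer g k X.
Proof. by move=> /in_strip_level; rewrite /ext_op => ->. Qed.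

Lemma delta_near X e : 0 < e -> \forall Y \near X, `|delta Y - delta X| < e.
Proof.
move=> e0; apply: filterS (eball_nbhs X e0) => Y; rewrite /eball/= => YX.
have := delta_lip Gamma0 X Y; have := delta_lip Gamma0 Y X; rewrite (enorm_sub X Y).
by move=> h1 h2; rewrite ltr_norml; apply/andP; split; lra.
Qed.

Lemma mesh_lt_half j k : j < k -> 2 * mesh k <= mesh j.
Proof. by move=> jk; rewrite -mesh_prev; apply: mesh_le; lia. Qed.

Lemma ext_approx_near_strip g (K : nat) k X : k <= K -> strip * mesh k < delta X < 2 * strip * mesh k ->
  \forall Y \near X, ext_approx g K Y = layer g k Y.
Proof.
move=> kK /andP[h1 h2].
pose e := Num.min (delta X - strip * mesh k) (2 * strip * mesh k - delta X).
have e0 : 0 < e by rewrite lt_min !subr_gt0 h1.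
have e1 : e <= delta X - strip * mesh k by rewrite ge_min lexx.
have e2 : e <= 2 * strip * mesh k - delta X by rewrite ge_min lexx orbT.
apply: filterS (delta_near X e0) => Y; rewrite ltr_norml => /andP[h3 h4].
have kY : in_strip k Y by apply/andP; split; lra.
have KY : strip * mesh K <= strip * mesh k by rewrite ler_pM2l//; exact: mesh_le.
by rewrite /ext_approx ltNge (le_trans KY)/= ?(ext_op_layer _ kY)//; case/andP: kY.
Qed.

Lemma ext_approx_near_fine g (K : nat) X : delta X < strip * mesh K ->
  \forall Y \near X, ext_approx g K Y = averaged g K Y.
Proof.
rewrite -subr_gt0 => e0; apply: filterS (delta_near X e0) => Y.
by rewrite ltr_norml /ext_approx => /andP[_ h]; rewrite ifT//; lra.
Qed.

(* [strip] lies strictly between [3 n] and [4 n], so that on the sphere between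
   two strips the cutoff of the outer one is [1] and that of the inner one [0]. *)
Lemma ext_approx_near_sphere g (K : nat) k X : k <= K -> delta X = strip * mesh k ->
  \forall Y \near X, ext_approx g K Y = averaged g k Y.
Proof.
move=> kK dX; have s0 := mesh_gt0 k.
have ns : 0 < n%:R * mesh k by rewrite mulr_gt0.
have e0 : 0 < n%:R * mesh k / 2 by rewrite divr_gt0.
apply: filterS (delta_near X e0) => Y; rewrite ltr_norml dX => /andP[h1 h2].
have d3 : 3 * n%:R * mesh k < delta Y by rewrite /strip in h1; lra.
have d4 : delta Y < 4 * n%:R * mesh k by rewrite /strip in h2; lra.
rewrite /ext_approx; have [KY|KY] := ltP (delta Y) (strip * mesh K).
  have -> // : k = K; apply/eqP; rewrite eq_le kK leNgt; apply/negP => kK'.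
  by have := mesh_lt_half kK'; rewrite /strip in KY; have := nR; nra.
have [kY|kY] := leP (strip * mesh k) (delta Y).
  rewrite (@ext_op_layer _ k) ?layer_eq_fine// /in_strip kY /= /strip; lra.
have E := mesh_next k.
rewrite (@ext_op_layer _ (k + 1)) ?layer_eq_coarse ?addrK//.
  by rewrite E in d3; lra.
rewrite /in_strip; rewrite E in kY d3; apply/andP; split; last lra.
by rewrite /strip in kY *; lra.
Qed.

(** Near every point of the space the approximant is given by one of two smooth formulas. The bound
    [7 * n], twice [strip], makes the mesh large enough there for all relevant cells to stay close
    to [X]. *)
Lemma ext_approx_local g (K : nat) X : exists k : int,
  delta X <= 7 * n%:R * mesh k /\
  ((\forall Y \near X, ext_approx g K Y = layer g k Y) \/
   (\forall Y \near X, ext_approx g K Y = averaged g k Y)).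
Proof.
have ns := mulr_gt0 strip_gt0 (mesh_gt0 K).
have [KX|KX] := ltP (delta X) (strip * mesh K).
  exists K; split; first by rewrite /strip in ns KX; lra.
  by right; exact: ext_approx_near_fine.
have [k kX] := level_exists (lt_le_trans ns KX).
have /andP[k1 k2] := kX.
have kK : k <= K.
  rewrite -ltzD1; apply: mesh_lt; rewrite -(ltr_pM2l strip2_gt0).
  by apply: le_lt_trans k2; apply: le_trans KX; rewrite (mesh_next K); lra.
exists k; split; first by rewrite /strip in k2; lra.
move: k1; rewrite le_eqVlt => /predU1P[k1|k1].
  by right; apply: ext_approx_near_sphere.
by left; apply: ext_approx_near_strip => //; rewrite k1.
Qed.

Lemma Ck_averaged j g k : Ck j (averaged g k).
Proof. exact: Ck_scaled_sum. Qed.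

Lemma Ck_layer j g k : Ck j (layer g k).
Proof.
apply: CkD; first exact: Ck_averaged.
apply: CkM; first exact: Ck_scaled_sum.
apply: (CkD (Ck_averaged _ _ _)).
have := CkM (Ck_cst j (-1 : R)) (Ck_averaged j g (k - 1)).
by under eq_fun do rewrite mulN1r.
Qed.

Lemma smooth_ext_approx g K : smooth (ext_approx g K).
Proof.
apply/smoothP => j; apply: Ck_local => X.
have [k [_ [h|h]]] := ext_approx_local g K X.
  by exists (layer g k) => //; exact: Ck_layer.
by exists (averaged g k) => //; exact: Ck_averaged.
Qed.

Lemma ext_approx_eq g (K : nat) X : strip * mesh K <= delta X -> ext_approx g K X = ext_op g X.
Proof. by rewrite /ext_approx leNgt => /negbTE ->. Qed.

Lemma partial_near_eq (f h : 'rV[R]_n -> R) X i : (\forall Y \near X, f Y = h Y) ->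
  partial i f X = partial i h X.
Proof. by move=> fh; rewrite /partial (near_eq_derive _ fh). Qed.

Lemma averaged_lin a g g' k X : (forall j z, coef (fun x => a * g x + g' x) j z = a * coef g j z + coef g' j z) ->
  averaged (fun x => a * g x + g' x) k X = a * averaged g k X + averaged g' k X.
Proof.
move=> h; rewrite /averaged /scaled_sum -lattice_sumZ -lattice_sumD.
by apply: (congr1 (lattice_sum ^~ _)); apply/funext => z; rewrite h.
Qed.

Lemma ext_op_lin a g g' X : (forall j z, coef (fun x => a * g x + g' x) j z = a * coef g j z + coef g' j z) ->
  ext_op (fun x => a * g x + g' x) X = a * ext_op g X + ext_op g' X.
Proof. move=> h; rewrite /ext_op /layer !(averaged_lin _ _ h).
move: (averaged g _ X) (averaged g _ X) (averaged g' _ X) (averaged g' _ X) => a1 a2 a3 a4.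
by ring. Qed.

Lemma ext_op_congr g g' : (forall j z, coef g j z = coef g' j z) -> ext_op g = ext_op g'.
Proof.
move=> h; apply/funext => X; rewrite /ext_op /layer /averaged.
by have -> : coef g = coef g' by apply/funext => j; apply/funext => z.
Qed.

(** The constant is [7 + 2 + 2 + 1]: the distance from [X] to the boundary, the distance to the node
    counted twice, and the slack of [cell_center]. *)
Lemma coef_near k z X r : delta X <= 7 * n%:R * mesh k -> 0 <= r -> r <= 2 ->
  (forall i, `|2 ^ k * X ord0 i - (z i)%:~R| <= r) ->
  enorm (cell_center k z - X) <= 12 * n%:R * mesh k.
Proof.
move=> dX r0 r2 h; have := node_dist r0 h; have [_ h1] := cell_centerP k z.
have h2 := delta_lip Gamma0 (node k z) X => h3.
have := enorm_triangle (node k z) (cell_center k z) X; rewrite (enorm_sub (cell_center k z) (node k z)).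
have s0 := mesh_gt0 k; have ns : mesh k <= n%:R * mesh k by rewrite ler_peMl// ltW.
have : n%:R * (r * mesh k) <= 2 * (n%:R * mesh k).
  by rewrite mulrCA ler_pM2r// mulr_gt0.
lra.
Qed.

End extension_operator.

Lemma le_integral_subset d (T : measurableType d) (R : realType) (nu : {measure set T -> \bar R})
    (D D' : set T) (f h : T -> \bar R) : D `<=` D' ->
  (forall x, D x -> 0 <= f x)%E -> (forall x, D x -> f x <= h x)%E ->
  (forall x, D' x -> 0 <= h x)%E ->
  (\int[nu]_(x in D) f x <= \int[nu]_(x in D') h x)%E.
Proof.
move=> DD f0 fh h0; rewrite integral_mkcond [leRHS]integral_mkcond.
apply: le_integral_ge0 => x _; rewrite !patchE.
  by case: ifPn => [/set_mem/f0|].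
case: ifPn => [/set_mem Dx|_]; first by rewrite mem_set ?fh//; exact: DD.
by case: ifPn => [/set_mem/h0|].
Qed.

Lemma partial_interpolation (R : realType) (n : nat) (A B C : 'rV[R]_n -> R) i X :
  derivable A X (delta_mx ord0 i) -> derivable B X (delta_mx ord0 i) ->
  derivable C X (delta_mx ord0 i) ->
  partial i (fun Y => A Y + C Y * (B Y - A Y)) X =
  partial i A X + (C X * (partial i B X - partial i A X) + (B X - A X) * partial i C X).
Proof.
move=> dA dB dC.
have dBA := derivableB dB dA.
have e1 := deriveD dA (derivableM dC dBA); have e2 := deriveM dC dBA.
by rewrite /partial; apply: (etrans e1); rewrite e2 (deriveB dB dA).
Qed.

Lemma interpolation_bound (R : realType) (pA pB pC c d q r : R) : 0 <= c <= 1 ->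
  0 <= q -> 0 <= r -> `|pA| <= q * r -> `|pB| <= q * r -> `|pC| <= q -> `|d| <= 2 * r ->
  `|pA + (c * (pB - pA) + d * pC)| <= 6 * (q * r).
Proof.
move=> /andP[c0 c1] q0 r0 hA hB hC hd.
have h1 : `|c * (pB - pA)| <= 2 * (q * r).
  rewrite normrM (ger0_norm c0) (le_trans (ler_piMl _ c1))//.
  by rewrite (le_trans (ler_normB _ _))//; lra.
have h2 : `|d * pC| <= 2 * (q * r).
  by rewrite normrM mulrC [leRHS]mulrCA ler_pM.
have := ler_normD pA (c * (pB - pA) + d * pC); have := ler_normD (c * (pB - pA)) (d * pC).
have : 0 <= q * r by rewrite mulr_ge0.
lra.
Qed.

(** * Oscillation of the averages and boundary behaviour of the extension *)

Section extension_estimates.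
Context {R : realType} {n : nat} (Omega : set 'rV[R]_n).
Variables (m mu : {sigma_finite_measure set 'rV[R]_n -> \bar R}).
Variables (C3 C4 C5 : R).
Local Notation Gamma := (boundary Omega).
Local Notation delta := (delta Omega).
Local Notation lattice := {ffun 'I_n -> int}.
Hypothesis oO : open Omega.
Hypothesis O0 : Omega !=set0.
Hypothesis Gamma0 : Gamma !=set0.
Hypothesis n_gt0 : (0 < n)%N.
Hypothesis m_ball : forall X r, closure Omega X -> 0 < r ->
  (0 < m (eball X r `&` Omega) < +oo)%E.
Hypothesis m_dbl : forall X r, closure Omega X -> 0 < r ->
  (m (eball X (2 * r) `&` Omega) <= C4%:E * m (eball X r `&` Omega))%E.
Hypothesis mu_ball : forall x r, Gamma x -> 0 < r ->
  (0 < mu (eball x r `&` setT) < +oo)%E.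
Hypothesis mu_dbl : forall x r, Gamma x -> 0 < r ->
  (mu (eball x (2 * r) `&` setT) <= C3%:E * mu (eball x r `&` setT))%E.
Hypothesis mu_null : mu (~` Gamma) = 0%E.
Hypothesis rho_gr : rho_growth Omega m mu C5.
Implicit Types (g : 'rV[R]_n -> R) (j k : int) (z : lattice) (X : 'rV[R]_n).

Local Notation M := (vol m Omega).
Local Notation U := (vol mu setT).
Local Notation inv_rho := (inv_rho Omega m mu).
Local Notation coef := (coef Omega mu).
Local Notation cell_center := (cell_center Omega).
Local Notation ext_op := (ext_op Omega mu).
Local Notation ext_approx := (ext_approx Omega mu).
Local Notation averaged := (averaged Omega mu).
Local Notation layer := (layer Omega mu).
Local Notation cutoff := (cutoff Omega).
Local Notation ext_density := (ext_density Omega mu).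
Local Notation energy_at := (energy_at Omega m mu).

Let mO : measurable Omega. Proof. exact: open_measurable_mx. Qed.
Let mG : measurable Gamma. Proof. exact: measurable_boundary. Qed.
Let U0 x r : Gamma x -> 0 < r -> 0 < U x r.
Proof. exact: (vol_gt0 mu_ball). Qed.
Let nR : 1 <= n%:R :> R. Proof. by rewrite ler1n. Qed.
Let nR0 : 0 < n%:R :> R. Proof. by rewrite ltr0n. Qed.

Definition admissible (g : 'rV[R]_n -> R) :=
  measurable_fun setT g /\ (\int[mu]_(x in Gamma) energy_at g x < +oo)%E.

Definition cell k z := eball (cell_center k z) (mesh k) `&` Gamma.

Let mcell k z : measurable (cell k z).
Proof. by apply: measurableI => //; exact: measurable_eball. Qed.

Lemma mu_cell k z : (0 < mu (cell k z) < +oo)%E /\ fine (mu (cell k z)) = U (cell_center k z) (mesh k).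
Proof.
have [Gz _] := cell_centerP Gamma0 k z.
rewrite /cell mu_setI_boundary//; last exact: measurable_eball.
by split; [have := mu_ball Gz (@mesh_gt0 R k)|]; rewrite /vol setIT.
Qed.

Lemma coef_integrable g k z : admissible g -> mu.-integrable (cell k z) (EFin \o g).
Proof.
move=> [mg gfin]; have [Gz _] := cell_centerP Gamma0 k z.
exact: (boundary_function_integrable oO Gamma0 m_ball mu_ball mu_null rho_gr mg gfin Gz (@mesh_gt0 R k)).
Qed.

(** The radius [2] is that of [partial_scaled_sum], so these are the coefficients that its
    derivative bound requires. *)
Definition lattice_near k (z : lattice) X := forall i, `|2 ^ k * X ord0 i - (z i)%:~R| <= 2.

(** The coarser mesh is [2 * mesh k], so [12 * n] becomes [24 * n], and the radius of the cell adds
    [2 * mesh k]. *)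
Lemma cell_near k j z X : j = k \/ j = k - 1 -> delta X <= 7 * n%:R * mesh k ->
  lattice_near j z X -> forall y, cell j z y -> enorm (y - X) < 26 * n%:R * mesh k.
Proof.
move=> jk dX zX y [/= yz _]; have s0 := @mesh_gt0 R k.
have sj : (mesh j : R) <= 2 * mesh k.
  by case: jk => ->; rewrite ?mesh_prev//; lra.
have sk : (mesh k : R) <= mesh j.
  by case: jk => ->; rewrite ?mesh_prev//; lra.
have dXj : delta X <= 7 * n%:R * mesh j.
  by apply: (le_trans dX); rewrite ler_pM2l// mulr_gt0.
have h := coef_near Gamma0 n_gt0 dXj (ler0n _ 2) (lexx 2) zX.
rewrite /eball/= in yz; have := enorm_triangle (cell_center j z) y X.
have : (n%:R : R) * mesh j <= n%:R * (2 * mesh k) by rewrite ler_pM2l.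
have : (mesh k : R) <= n%:R * mesh k by rewrite ler_peMl// ltW.
lra.
Qed.

Lemma mesh_comparable k j : j = k \/ j = k - 1 -> (@mesh R k <= @mesh R j <= 2 * @mesh R k).
Proof.
have s0 := @mesh_gt0 R k.
by case=> ->; rewrite ?mesh_prev; apply/andP; split; lra.
Qed.

(** Jensen's inequality gives a mean of [(g y - g y') ^+ 2] over two cells. There
    [enorm (X - y) + enorm (y - y')] is at most [78 = 26 + 52] times [n * mesh k], and doubling
    compares both cells with the ball of this radius at [y]; so [mesh k ^+ 2 * pair_weight]
    dominates the reciprocal of the product of the two measures. *)
Lemma coef_oscillation : exists2 C : R, 0 < C & forall g, admissible g ->
  forall X k j j' z z', Omega X -> delta X <= 7 * n%:R * mesh k ->
  j = k \/ j = k - 1 -> j' = k \/ j' = k - 1 -> lattice_near j z X -> lattice_near j' z' X ->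
  (((coef g j z - coef g j' z') ^+ 2)%:E <= (C * mesh k ^+ 2)%:E * ext_density g X)%E.
Proof.
have [C' C'1 HC'] := vol_dilate measurableT mu_ball mu_dbl (78 * n%:R) Gamma0.
have C'0 : 0 < C' by lra.
have b0 : 0 < 78 * n%:R :> R by rewrite mulr_gt0.
exists ((78 * n%:R) ^+ 2 * C' ^+ 2) => [|g ag X k j j' z z' OX dX jk jk' zX zX'].
  by rewrite mulr_gt0 ?exprn_gt0.
have [mg gfin] := ag.
have [cA fA] := mu_cell j z; have [cB fB] := mu_cell j' z'.
have := average_double_jensen (mcell j z) (mcell j' z') cA cB mg (coef_integrable j z ag) (coef_integrable j' z' ag).
rewrite -/(coef g j z) -/(coef g j' z') fA fB => h; apply: (le_trans h) => {h}.
have s0 := @mesh_gt0 R k; have sj := @mesh_gt0 R j; have sj' := @mesh_gt0 R j'.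
have [Gz _] := cell_centerP Gamma0 j z; have [Gz' _] := cell_centerP Gamma0 j' z'.
have ua := U0 Gz sj; have ub := U0 Gz' sj'.
set c := (78 * n%:R) ^+ 2 * C' ^+ 2 * mesh k ^+ 2.
have c0 : 0 < c by rewrite /c !mulr_gt0 ?exprn_gt0 ?mulr_gt0.
have s1 := measurable_ext_section mu oO mg.
have secX : measurable_fun setT (fun y => \int[mu]_(y' in Gamma) ext_kernel mu g ((X, y), y'))%E.
  exact: (measurableT_comp s1 (measurable_pair1 X)).
have kX : measurable_fun setT (fun p : 'rV[R]_n * 'rV[R]_n => ext_kernel mu g ((X, p.1), p.2)).
  have mp : measurable_fun setT (fun p : 'rV[R]_n * 'rV[R]_n => ((X, p.1), p.2)).
    apply/measurable_fun_pairP; split; last exact: measurable_snd.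
    apply: (measurable_fun_pair (f := fun=> X) (g := fst)) => //; exact: measurable_fst.
  exact: (measurableT_comp (measurable_ext_kernel mu mg) mp).
have -> : (c%:E * ext_density g X = \int[mu]_(y in Gamma) \int[mu]_(y' in Gamma)
    (c%:E * ext_kernel mu g ((X, y), y')))%E.
  rewrite -ge0_integralZl; last 4 first.
  - exact: mG.
  - exact: measurable_funTS secX.
  - by move=> y _; apply: integral_ge0 => y' _; exact: (ext_kernel_ge0 mu g ((X, y), y')).
  - by rewrite lee_fin ltW.
  apply: eq_integral => y _; rewrite -ge0_integralZl//.
  - apply: measurable_funTS; exact: (measurableT_comp kX (measurable_pair1 y)).
  - by move=> y' _; exact: (ext_kernel_ge0 mu g ((X, y), y')).
  - by rewrite lee_fin ltW.
rewrite -ge0_integralZl; last 4 first.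
- exact: mcell.
- have mgg : measurable_fun setT (fun p : 'rV[R]_n * 'rV[R]_n => ((g p.1 - g p.2) ^+ 2)%:E).
    apply/measurable_EFinP; apply: measurable_funX; apply: measurable_funB.
      exact: (measurableT_comp mg measurable_fst).
    exact: (measurableT_comp mg measurable_snd).
  apply: measurable_funTS; apply: (measurable_section_on mu (mcell j' z') mgg).
  by move=> p; rewrite lee_fin sqr_ge0.
- by move=> y _; apply: integral_ge0 => y' _; rewrite lee_fin sqr_ge0.
- by rewrite lee_fin invr_ge0 mulr_ge0 ?ltW.
have i0 : (0 <= ((U (cell_center j z) (mesh j) * U (cell_center j' z') (mesh j'))^-1)%:E)%E.
  by rewrite lee_fin invr_ge0 mulr_ge0 ?ltW.
apply: le_integral_subset => [y []//|y _|y yA|y _].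
- by rewrite mule_ge0//; apply: integral_ge0 => y' _; rewrite lee_fin sqr_ge0.
- rewrite -ge0_integralZl; last 4 first.
  + exact: mcell.
  + apply: measurable_funTS; apply/measurable_EFinP; apply: measurable_funX.
    exact: measurable_funB.
  + by move=> y' _; rewrite lee_fin sqr_ge0.
  + exact: i0.
  apply: le_integral_subset => [y' []//|y' _|y' yB|y' _].
  + by rewrite mule_ge0// lee_fin sqr_ge0.
  + have [_ Gy] := yA; have [_ Gy'] := yB.
    rewrite /ext_kernel /= -!EFinM lee_fin mulrC mulrCA ler_wpM2l ?sqr_ge0//.
    have d1 := cell_near jk dX zX yA; have d2 := cell_near jk' dX zX' yB.
    set t := enorm (X - y) + enorm (y - y').
    have t0 : 0 < t.
      rewrite ltr_pwDl ?enorm_ge0//; apply: lt_le_trans (delta_gt0 oO Gamma0 OX) _.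
      exact: delta_le.
    have t78 : t <= 78 * n%:R * mesh k.
      have := enorm_triangle X y y'; rewrite (enorm_sub X y') /t (enorm_sub X y); lra.
    have /andP[m1 m2] := mesh_comparable jk; have /andP[m1' m2'] := mesh_comparable jk'.
    have st : 0 < (78 * n%:R * mesh k : R) by rewrite mulr_gt0.
    have nj : (78 * n%:R * mesh k : R) <= 78 * n%:R * mesh j by rewrite ler_pM2l.
    have nj' : (78 * n%:R * mesh k : R) <= 78 * n%:R * mesh j' by rewrite ler_pM2l.
    have uy := U0 Gy t0.
    have u1 : U y t <= C' * U (cell_center j z) (mesh j).
      apply: HC' => //; last lra.
      have [/= yz _] := yA; rewrite /eball/= enorm_sub in yz.
      by apply: (le_trans (ltW yz)); rewrite ler_peMl ?(ltW sj)//; have := nR; lra.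
    have u2 : U y t <= C' * U (cell_center j' z') (mesh j').
      apply: HC' => //; last lra.
      have [/= yz _] := yB; rewrite /eball/= enorm_sub in yz.
      have n1 : (mesh j' : R) <= n%:R * mesh j' by rewrite ler_peMl// ltW.
      have := enorm_triangle y' (cell_center j' z') y; have := enorm_triangle X y' y.
      by rewrite (enorm_sub X y); lra.
    rewrite /pair_weight -[leLHS]mul1r ler_pdivrMr ?mulr_gt0//.
    set a := U (cell_center j z) _ in ua u1 *; set b := U (cell_center j' z') _ in ub u2 *.
    set u := U y t in uy u1 u2 *.
    rewrite mulrAC ler_pdivlMr ?mulr_gt0 ?exprn_gt0// mul1r.
    have -> : c * (a * b) = (78 * n%:R * mesh k) ^+ 2 * ((C' * a) * (C' * b)).
      by rewrite /c; ring.
    apply: ler_pM; rewrite ?sqr_ge0//.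
      by rewrite ler_pXn2r// nnegrE ltW.
    by rewrite expr2 ler_pM// ltW.
  + by rewrite mule_ge0 ?(ext_kernel_ge0 mu g ((X, y), y'))// lee_fin ltW.
- apply: integral_ge0 => y' _; by rewrite mule_ge0 ?(ext_kernel_ge0 mu g ((X, y), y'))// lee_fin ltW.
Qed.

(** By Jensen's inequality against the constant [g x]. The cell lies within [L * mesh k] of [x],
    where [kernel_lower_bound] replaces the uniform mean by the boundary kernel. *)
Lemma coef_trace (K : R) : 0 <= K -> exists C L : R, [/\ 0 < C, 0 < L & forall g, admissible g ->
  forall x X k j z, Gamma x -> delta X <= 7 * n%:R * mesh k -> enorm (X - x) <= K * mesh k ->
  j = k \/ j = k - 1 -> lattice_near j z X ->
  (((coef g j z - g x) ^+ 2)%:E <= (C * inv_rho x (L * mesh k))%:E * energy_at g x)%E].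
Proof.
move=> K0; pose L : R := 26 * n%:R + K.
have L0 : 0 < L by rewrite /L; have := nR; lra.
have [C' C'1 HC'] := vol_dilate measurableT mu_ball mu_dbl (L + K + 26 * n%:R) Gamma0.
have C'0 : 0 < C' by lra.
have [Ck Ck0 HCk] := kernel_lower_bound oO Gamma0 m_ball mu_ball rho_gr.
exists (C' * Ck), L; split => //; first by rewrite mulr_gt0.
move=> g ag x X k j z Gx dX Xx jk zX; have [mg gfin] := ag.
have [cA fA] := mu_cell j z.
have := average_jensen (g x) (mcell j z) cA mg (coef_integrable j z ag).
rewrite -/(coef g j z) fA => h; apply: (le_trans h) => {h}.
have s0 := @mesh_gt0 R k; have sj := @mesh_gt0 R j.
have [Gz _] := cell_centerP Gamma0 j z.
have ua := U0 Gz sj; have t0 : 0 < L * mesh k by rewrite mulr_gt0.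
have ux := U0 Gx t0; have ix := inv_rho_gt0 oO m_ball mu_ball Gx t0.
have /andP[m1 m2] := mesh_comparable jk.
have cz : cell j z (cell_center j z) by split => //; exact: eball_center.
have dz := cell_near jk dX zX cz.
have uU : U x (L * mesh k) <= C' * U (cell_center j z) (mesh j).
  have e1 : L * mesh k <= L * mesh j by rewrite ler_pM2l.
  have e2 : 0 <= K * (mesh j : R) by rewrite mulr_ge0// ltW.
  have e3 : 0 <= (n%:R : R) * mesh j by rewrite mulr_ge0// ltW.
  apply: HC' => //; last lra.
  have := enorm_triangle X (cell_center j z) x; rewrite /L in e1 *; lra.
have iu := inv_le_div ua ux uU.
set c := C' * Ck * inv_rho x (L * mesh k).
have c0 : 0 <= c by rewrite /c; apply: mulr_ge0; [rewrite mulr_ge0// ltW|exact: ltW].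
have mk : measurable_fun setT (fun y => ((g x - g y) ^+ 2 * boundary_kernel Omega m mu x y)%:E).
  apply/measurable_EFinP; apply: measurable_funM.
    by apply: measurable_funX; exact: measurable_funB.
  have := measurableT_comp (measurable_boundary_kernel m mu oO) (measurable_pair1 x).
  by apply: eq_measurable_fun => y _.
have k0 y : (0 <= ((g x - g y) ^+ 2 * boundary_kernel Omega m mu x y)%:E)%E.
  by rewrite lee_fin; apply: mulr_ge0; [exact: sqr_ge0|exact: boundary_kernel_ge0].
rewrite -ge0_integralZl; last 4 first.
- exact: mcell.
- apply: measurable_funTS; apply/measurable_EFinP; apply: measurable_funX; exact: measurable_funB.
- by move=> y _; rewrite lee_fin sqr_ge0.
- by rewrite lee_fin invr_ge0 ltW.
rewrite -ge0_integralZl; last 4 first.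
- exact: mG.
- exact: measurable_funTS mk.
- by move=> y _; exact: k0.
- by rewrite lee_fin.
apply: le_integral_subset => [y []//|y _|y yA|y _].
- by rewrite -EFinM lee_fin mulr_ge0 ?sqr_ge0// invr_ge0 ltW.
- rewrite -!EFinM lee_fin; have [<-|xy] := eqVneq x y.
    by rewrite subrr expr2 !(mul0r, mulr0).
  rewrite -[in leLHS]sqrrN opprB [leRHS]mulrCA [leLHS]mulrC ler_wpM2l ?sqr_ge0//.
  apply: (le_trans iu).
  have := HCk x y (L * mesh k) Gx xy _.
  have dy := cell_near jk dX zX yA.
  have -> : enorm (x - y) <= L * mesh k.
    have := enorm_triangle X y x; rewrite (enorm_sub y x) /L; lra.
  move=> /(_ isT) hk.
  have -> : c * boundary_kernel Omega m mu x y = (C' / U x (L * mesh k)) *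
    (Ck * (inv_rho x (L * mesh k) * U x (L * mesh k)) * boundary_kernel Omega m mu x y).
    by rewrite /c; field; rewrite gt_eqF.
  by rewrite ler_peMr// divr_ge0// ltW.
- by rewrite mule_ge0// lee_fin.
Qed.

Lemma scaled_sum_near k (c : lattice -> R) (a r : R) X :
  (forall z, lattice_near k z X -> `|c z - a| <= r) -> `|scaled_sum k c X - a| <= r.
Proof.
move=> H; apply: lattice_sum_dist => z hz; apply: H => i.
have := hz i; rewrite !mxE => h; apply: ltW; apply: lt_trans h _.
by rewrite ltr1n.
Qed.

Lemma lattice_near_exists k X : exists z, lattice_near k z X.
Proof.
exists [ffun i => Num.floor (2 ^ k * X ord0 i)] => i; rewrite ffunE.
have /andP[h1 h2] := floor_itv (2 ^ k * X ord0 i).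
by rewrite intrD in h2; rewrite ger0_norm; lra.
Qed.

Lemma partial_layer g k i X : partial i (layer g k) X =
  partial i (averaged g (k - 1)) X +
  (cutoff k X * (partial i (averaged g k) X - partial i (averaged g (k - 1)) X) +
  (averaged g k X - averaged g (k - 1) X) * partial i (cutoff k) X).
Proof.
have dA j : derivable (averaged g j) X (delta_mx ord0 i).
  by have [_ /(_ i)[]] := Ck_scaled_sum 1 j (coef g j).
have dC : derivable (cutoff k) X (delta_mx ord0 i).
  by have [_ /(_ i)[]] := Ck_scaled_sum 1 k (cutoff_coef Omega k).
exact: partial_interpolation (dA _) (dA _) dC.
Qed.

(** All coefficients entering near [X] are within [r] of one of them, so the averages have
    derivatives [O(2 ^ k * r)]. The cutoff has derivative [O(2 ^ k)] but multiplies a difference of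
    averages of size [r]. The factor [mesh k] in [r] cancels [2 ^ k], which makes the bound
    independent of the scale and of [K]. *)
Lemma ext_approx_grad_le : exists2 C : R, 0 < C & forall g, admissible g -> forall K X, Omega X ->
  ((enorm (grad (ext_approx g K) X) ^+ 2)%:E <= C%:E * ext_density g X)%E.
Proof.
have [C1 C10 H1] := coef_oscillation.
have [C2 C20 H2] := @partial_scaled_sum R n.
exists (n%:R * (6 * C2) ^+ 2 * C1) => [|g ag K X OX].
  by rewrite !mulr_gt0 ?exprn_gt0 ?mulr_gt0.
have E0 := ext_density_ge0 Omega mu g X.
have CC : 0 < n%:R * (6 * C2) ^+ 2 * C1 by rewrite !mulr_gt0 ?exprn_gt0 ?mulr_gt0.
have [k [dX loc]] := ext_approx_local mu Gamma0 n_gt0 g K X.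
have Hc := H1 g ag X k _ _ _ _ OX dX.
have [e eE] : exists e, ext_density g X = e by eexists.
rewrite {}eE in E0 Hc *.
case: e E0 Hc => [h| |] //; last by move=> _ _; rewrite gt0_muley ?leey// lte_fin.
rewrite lee_fin => h0 Hc; rewrite -EFinM lee_fin.
have s0 := @mesh_gt0 R k.
pose r := Num.sqrt (C1 * mesh k ^+ 2 * h).
have rr : r ^+ 2 = C1 * mesh k ^+ 2 * h.
  by rewrite sqr_sqrtr// !mulr_ge0 ?sqr_ge0// ltW.
have r0 : 0 <= r by exact: sqrtr_ge0.
have osc j j' z z' : j = k \/ j = k - 1 -> j' = k \/ j' = k - 1 ->
    lattice_near j z X -> lattice_near j' z' X -> `|coef g j z - coef g j' z'| <= r.
  move=> jk jk' zX zX'; rewrite -sqrtr_sqr ler_wsqrtr//.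
  by rewrite -lee_fin EFinM; exact: Hc.
have [z0 z0X] := lattice_near_exists k X.
pose a := coef g k z0.
have ca j z : j = k \/ j = k - 1 -> lattice_near j z X -> `|coef g j z - a| <= r.
  by move=> jk zX; apply: osc => //; left.
have k20 : 0 < 2 ^ k :> R by rewrite exprz_gt0.
have dA j i : j = k \/ j = k - 1 -> `|partial i (averaged g j) X| <= C2 * 2 ^ k * r.
  move=> jk; apply: (le_trans (H2 j (coef g j) a r X i _)); first by move=> z; exact: ca.
  rewrite ler_wpM2r// ler_pM2l//; case: jk => -> //.
  by rewrite ler_eXz2l ?ltr1n// gerBl.
have dC i : `|partial i (cutoff k) X| <= C2 * 2 ^ k * 1.
  apply: (H2 k (cutoff_coef Omega k) 0) => z _; rewrite /cutoff_coef.
  by case: ifP => _; rewrite ?subr0 ?subrr ?normr1 ?normr0//.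
have AA : `|averaged g k X - averaged g (k - 1) X| <= 2 * r.
  have h1 : `|averaged g k X - a| <= r by apply: scaled_sum_near => z; apply: ca; left.
  have h2 : `|averaged g (k - 1) X - a| <= r by apply: scaled_sum_near => z; apply: ca; right.
  have -> : 2 * r = r + r by ring.
  apply: (le_trans (ler_distD a _ _)); apply: lerD; first exact: h1.
  by rewrite distrC; exact: h2.
have Cr : 0 <= C2 * 2 ^ k * r by rewrite !mulr_ge0// ltW.
have dall i : `|partial i (ext_approx g K) X| <= 6 * (C2 * 2 ^ k * r).
  case: loc => loc; rewrite (partial_near_eq i loc); last first.
    by apply: (le_trans (dA k i _)); [left|lra].
  rewrite partial_layer; apply: interpolation_bound.
  - exact: cutoff_itv.
  - by rewrite mulr_ge0 ?ltW.
  - exact: r0.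
  - by apply: dA; right.
  - by apply: dA; left.
  - by have := dC i; rewrite mulr1.
  - exact: AA.
rewrite enorm_sqr; apply: (@le_trans _ _ (\sum_(i < n) (6 * (C2 * 2 ^ k * r)) ^+ 2)).
  apply: ler_sum => i _; rewrite mxE -real_normK ?num_real//.
  have c6 : 0 <= 6 * (C2 * 2 ^ k * r) by apply: mulr_ge0.
  by rewrite ler_pXn2r ?nnegrE//; exact: dall.
rewrite sumr_const card_ord -[leLHS]mulr_natl.
have -> : (6 * (C2 * 2 ^ k * r)) ^+ 2 = (6 * C2) ^+ 2 * (2 ^ k) ^+ 2 * r ^+ 2 by ring.
rewrite rr; have /(congr1 (fun x => x ^+ 2)) := @meshM R k; rewrite exprMn expr1n => mm.
rewrite le_eqVlt; apply/orP; left; apply/eqP.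
have -> : n%:R * ((6 * C2) ^+ 2 * (2 ^ k) ^+ 2 * (C1 * mesh k ^+ 2 * h)) =
  n%:R * (6 * C2) ^+ 2 * C1 * h * (mesh k ^+ 2 * (2 ^ k) ^+ 2) by ring.
by rewrite mm mulr1.
Qed.

Lemma ext_op_dist g k X (a r : R) : in_strip Omega k X ->
  (forall j z, j = k \/ j = k - 1 -> lattice_near j z X -> `|coef g j z - a| <= r) ->
  `|ext_op g X - a| <= r.
Proof.
move=> kX H; rewrite (ext_op_layer mu n_gt0 g kX) /layer.
have h1 : `|averaged g k X - a| <= r by apply: scaled_sum_near => z; apply: H; left.
have h2 : `|averaged g (k - 1) X - a| <= r by apply: scaled_sum_near => z; apply: H; right.
have /andP[c0 c1] := cutoff_itv Omega k X.
move: (averaged g (k - 1) X) (averaged g k X) (cutoff k X) h1 h2 c0 c1 => A B c h1 h2 c0 c1.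
have -> : A + c * (B - A) - a = (1 - c) * (A - a) + c * (B - a) by ring.
rewrite (le_trans (ler_normD _ _))// !normrM (ger0_norm c0) ger0_norm ?subr_ge0//.
have := ler_wpM2l c0 h1; have := ler_wpM2l (_ : 0 <= 1 - c) h2.
rewrite subr_ge0 => /(_ c1); lra.
Qed.

(** By [growth], [inv_rho x] tends to [0] like the power [gexp] of the scale; [eta] is obtained by
    inverting that power. *)
Lemma inv_rho_small x (L e : R) : Gamma x -> 0 < L -> 0 < e -> exists2 eta : R, 0 < eta &
  forall t, 0 < t -> t < eta -> inv_rho x (L * t) < e.
Proof.
move=> Gx L0 e0; have [Cg Cg1 HCg] := growth oO Gamma0 m_ball mu_ball rho_gr.
have Cg0 : 0 < Cg by lra.
have g0 : 0 < gexp C5 by rewrite /gexp invr_gt0; exact: growth_gt0 oO Gamma0 m_ball mu_ball rho_gr.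
have i1 := inv_rho_gt0 oO m_ball mu_ball Gx (@ltr01 R).
pose b := e / (Cg * inv_rho x 1).
have b0 : 0 < b by rewrite divr_gt0// mulr_gt0.
pose eta := Num.min L^-1 (b `^ (gexp C5)^-1 / L).
exists eta => [|t t0]; first by rewrite lt_min invr_gt0 L0 divr_gt0// powR_gt0.
rewrite lt_min => /andP[t1 t2].
have Lt : 0 < L * t by rewrite mulr_gt0.
have Lt1 : L * t <= 1 by rewrite -ler_pdivlMl// mulr1 ltW.
apply: le_lt_trans (HCg x 1 (L * t) Gx Lt Lt1) _.
rewrite divr1 mulrCA -ltr_pdivlMr; last exact: mulr_gt0.
rewrite ltr_pdivlMr// mulrC in t2; rewrite -/b.
have -> : b = (b `^ (gexp C5)^-1) `^ gexp C5.
  by rewrite -powRrM mulVf ?gt_eqF// powRr1// ltW.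
by apply: gt0_ltr_powR => //; rewrite ?nnegrE ?powR_ge0 ?mulr_ge0// ltW.
Qed.

Lemma ext_op_nt_limit g x : admissible g -> Gamma x -> (energy_at g x < +oo)%E ->
  nt_limit Omega (interior_average Omega m (ext_op g)) x (g x).
Proof.
move=> ag Gx gx K e K0 e0.
pose K' := 2 * (K + 1) * (2 * @strip R n).
have sp : 0 < @strip R n by rewrite /strip mulr_gt0 ?mulr_gt0.
have K'0 : 0 <= K' by rewrite /K' !mulr_ge0 ?addr_ge0// ltW.
have [C [L [C0 L0 HC]]] := coef_trace K'0.
pose E := fine (energy_at g x).
have E0 : 0 <= E by apply: fine_ge0; exact: energy_at_ge0.
have EE : energy_at g x = E%:E by apply/esym/fineK; rewrite ge0_fin_numE//; exact: energy_at_ge0.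
have CE : 0 < C * (E + 1) by rewrite mulr_gt0// ltr_wpDl.
have e2 : 0 < e / 2 by rewrite divr_gt0.
(* Chosen so that the square in [coef_trace] is at most [(e / 2) ^+ 2]; [E + 1] replaces [E], which
   may be [0]. *)
have [eta' eta'0 Heta] := inv_rho_small Gx L0 (divr_gt0 (exprn_gt0 2 e2) CE).
exists (eta' * @strip R n / 2) => [|X OX XK Xe]; first by rewrite divr_gt0// mulr_gt0.
have dX0 : 0 < delta X by exact: delta_gt0.
have dXx := delta_le Gamma0 X Gx.
have near Y : eball X (delta X / 2) Y -> delta X / 2 < delta Y /\ `|ext_op g Y - g x| <= e / 2.
  rewrite /eball/= => YX.
  have l1 := delta_lip Gamma0 X Y; have l2 := delta_lip Gamma0 Y X; rewrite (enorm_sub X Y) in l1.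
  have dY : delta X / 2 < delta Y by lra.
  split => //; have dY0 : 0 < delta Y by lra.
  have [k kY] := level_exists n_gt0 dY0; have /andP[k1 k2] := kY.
  have s0 := @mesh_gt0 R k.
  have dY7 : delta Y <= 7 * n%:R * mesh k by rewrite /strip in k2; lra.
  have Yx : enorm (Y - x) <= K' * mesh k.
    have : enorm (Y - x) <= (K + 1) * (2 * delta Y).
      have : K * delta X <= K * (2 * delta Y) by rewrite ler_pM2l//; lra.
      have := enorm_triangle X Y x; lra.
    move=> h; apply: (le_trans h).
    have : (K + 1) * (2 * delta Y) <= (K + 1) * (2 * (2 * @strip R n * mesh k)).
      by apply: ler_wpM2l; [rewrite addr_ge0// ltW|lra].
    by move=> h'; apply: (le_trans h'); rewrite /K' le_eqVlt; apply/orP; left; apply/eqP; ring.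
  have me : mesh k < eta'.
    rewrite -(ltr_pM2l sp); lra.
  have ik := Heta _ s0 me.
  apply: (ext_op_dist kY) => j z jk zY.
  have := HC g ag x Y k j z Gx dY7 Yx jk zY; rewrite EE -EFinM lee_fin => h.
  rewrite -[leRHS]ger0_norm ?(ltW e2)// -[leLHS]sqrtr_sqr -[leRHS]sqrtr_sqr ler_wsqrtr//.
  apply: (le_trans h); rewrite ltr_pdivlMr// in ik; apply: le_trans (ltW ik).
  have i0 : 0 <= inv_rho x (L * mesh k).
    by apply: ltW; apply: (inv_rho_gt0 oO m_ball mu_ball Gx); exact: mulr_gt0.
  move: (inv_rho x _) i0 => t t0.
  have : 0 <= t * C by rewrite mulr_ge0// ltW.
  lra.
have [J HJ] := expr_half_lt (divr_gt0 dX0 (mulr_gt0 (ltr0n R 2) sp)).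
have JX : @strip R n * mesh J < delta X / 2.
  have -> : mesh J = 2^-1 ^+ J :> R by rewrite /mesh -invr_expz -exprnP exprVn.
  rewrite ltr_pdivlMr ?mulr_gt0// in HJ; lra.
have hX : 0 < delta X / 2 by rewrite divr_gt0.
have BO : eball X (delta X / 2) `<=` Omega.
  by move=> Y YX; apply: (eball_delta oO Gamma0 OX); move: YX; rewrite /eball/=; lra.
have [B0 Boo _] := interior_ball m_ball hX BO.
have mB : measurable (eball X (delta X / 2)) by exact: measurable_eball.
(* On the averaging ball the extension coincides with one of its smooth approximants, which supplies
   integrability. *)
rewrite /interior_average (@average_ae_eq _ _ m _ set0 _ (ext_approx g J))//; last first.
  move=> Y [/near[dY _] _]; rewrite (ext_approx_eq mu g)// ltW//; exact: lt_trans dY.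
have iphi : m.-integrable (eball X (delta X / 2)) (EFin \o ext_approx g J).
  apply: continuous_integrable_eball => //.
  by have /(_ [::])[] := smooth_ext_approx mu Gamma0 n_gt0 g J.
apply: le_lt_trans (average_sub_le (g x) mB mB (@subset_refl _ _) B0 Boo iphi) _.
have fB : 0 < fine (m (eball X (delta X / 2))) by rewrite fine_gt0// B0.
apply: (@le_lt_trans _ _ (e / 2)); last lra.
rewrite ler_pdivrMl// [leRHS]mulrC.
have <- : \int[m]_(_ in eball X (delta X / 2)) (e / 2) = e / 2 * fine (m (eball X (delta X / 2))).
  exact: Rintegral_cst.
apply: le_Rintegral => //.
- exact: integrable_abs_diff_cst.
- exact: integrable_cst_fin.
- move=> Y YB; have [dY dg] := near Y YB.
  by rewrite (ext_approx_eq mu g)// ltW//; exact: lt_trans dY.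
Qed.

End extension_estimates.

(** * Boundedness of the extension *)

Section gradient_uniqueness.
Context {R : realType} {n : nat} (Omega : set 'rV[R]_n).
Variable m : {sigma_finite_measure set 'rV[R]_n -> \bar R}.
Hypothesis oO : open Omega.
Hypothesis gu : gradient_uniqueness Omega m.

Let mO : measurable Omega. Proof. exact: open_measurable_mx. Qed.

Lemma smooth_derivable (f : 'rV[R]_n -> R) x i : smooth f -> derivable f x (delta_mx ord0 i : 'rV[R]_n).
Proof. by move=> /(_ [::])[_]. Qed.

Lemma smoothB (f h : 'rV[R]_n -> R) : smooth f -> smooth h -> smooth (fun x => f x - h x).
Proof.
move=> /smoothP sf /smoothP sh; apply/smoothP => k; apply: (CkD (sf k)).
have := CkM (Ck_cst k (-1 : R)) (sh k).
by under eq_fun do rewrite mulN1r.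
Qed.

Lemma gradB (f h : 'rV[R]_n -> R) x : smooth f -> smooth h ->
  grad (fun x => f x - h x) x = grad f x - grad h x.
Proof.
move=> sf sh; apply/rowP => i; rewrite !mxE.
by have e := deriveB (@smooth_derivable f x i sf) (@smooth_derivable h x i sh); exact: e.
Qed.

Lemma enorm_sqrB_le (a b : 'rV[R]_n) : enorm (a - b) ^+ 2 <= 2 * enorm a ^+ 2 + 2 * enorm b ^+ 2.
Proof.
have := enorm_sqr_le_double (a - b) (- b).
by rewrite opprK subrK enormN => h; rewrite [leRHS]addrC.
Qed.

Lemma integral_sqrB_le (D : set 'rV[R]_n) (a b : 'rV[R]_n -> 'rV[R]_n) : measurable D ->
  measurable_fun setT a -> measurable_fun setT b ->
  (\int[m]_(x in D) (enorm (a x - b x) ^+ 2)%:E <=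
   2%:E * \int[m]_(x in D) (enorm (a x) ^+ 2)%:E + 2%:E * \int[m]_(x in D) (enorm (b x) ^+ 2)%:E)%E.
Proof.
move=> mD ma mb.
have ms (w : 'rV[R]_n -> 'rV[R]_n) : measurable_fun setT w ->
    measurable_fun D (fun x => (enorm (w x) ^+ 2)%:E).
  by move=> mw; apply/measurable_EFinP/measurable_funTS; exact: measurable_enorm_sqr.
have s0 (w : 'rV[R]_n -> 'rV[R]_n) x : (0 <= (enorm (w x) ^+ 2)%:E)%E.
  by rewrite lee_fin sqr_ge0.
rewrite -!ge0_integralZl//; try exact: ms.
rewrite -ge0_integralD; last 5 first.
- exact: mD.
- by move=> x _; rewrite mule_ge0.
- by apply: measurable_funeM; exact: ms.
- by move=> x _; rewrite mule_ge0.
- by apply: measurable_funeM; exact: ms.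
apply: le_integral_ge0 => x _; first by rewrite lee_fin sqr_ge0.
by rewrite -!EFinM -EFinD lee_fin enorm_sqrB_le.
Qed.

Lemma closure_eball_subset (X : 'rV[R]_n) r : closure (eball X r) `<=` [set y | enorm (y - X) <= r].
Proof.
rewrite [X in _ `<=` X](closure_id _).1; last exact: closed_eball.
by apply: closure_subset => y /=; rewrite /eball/= => /ltW.
Qed.

(** The differences of the two approximating sequences tend to [0] in the [L^1] norm on the ball,
    and their gradients tend to [v - v'], so [gradient_uniqueness] applies. Borel versions are used
    because integrals of sums are split. *)
Lemma weak_gradient_ball_unique u v v' X r : L1loc m Omega u -> 0 < r ->
  eball X (2 * r) `<=` Omega ->
  weak_gradient Omega m u v -> weak_gradient Omega m u v' ->
  {ae m, forall x, eball X r x -> v x = v' x}.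
Proof.
move=> Lu r0 XO wv wv'.
have [N [u1 [w [mN N0 mu1 mw H]]]] := energy_version_exists oO Lu wv.
have [N' [u2 [w' [mN' N'0 _ mw' H']]]] := energy_version_exists oO Lu wv'.
have w2E := integral_energy_version (And5 mN N0 mu1 mw H).
move: wv wv' => [[mv v2] [phi [sphi gphi hu hv]]] [[mv' v'2] [phi' [sphi' gphi' hu' hv']]].
pose N2 := N `|` N'.
have mN2 : measurable N2 by exact: measurableU.
have N20 : m N2 = 0%E by exact: null_set_setU.
set B := eball X r.
have mB : measurable B by exact: measurable_eball.
have BO : B `<=` Omega by apply: subset_trans XO; apply: eball_subset; rewrite subrr enorm0; lra.
have swap (f f' : 'rV[R]_n -> \bar R) D : (forall x, (D `\` N2) x -> f x = f' x) ->
    (\int[m]_(x in D) f x = \int[m]_(x in D) f' x)%E.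
  move=> ff; rewrite (integral_setD_null _ _ mN2 N20) [RHS](integral_setD_null _ _ mN2 N20).
  by apply: eq_integral => x /set_mem; exact: ff.
have wE x : (Omega `\` N2) x -> [/\ u1 x = u x, w x = v x & w' x = v' x].
  by move=> [Ox /not_orP[n1 n2]]; have [] := H x (conj Ox n1); have [] := H' x (conj Ox n2).
have wB x : (B `\` N2) x -> [/\ u1 x = u x, w x = v x & w' x = v' x].
  by move=> [/BO Ox nx]; exact: wE.
have mdiff (a b : 'rV[R]_n -> 'rV[R]_n) : measurable_fun setT a -> measurable_fun setT b ->
    measurable_fun setT (fun x => a x - b x).
  move=> ma mb; apply: measurable_rV => j.
  rewrite (_ : (fun t => _) = (fun t => a t ord0 j - b t ord0 j)); last first.
    by apply/funext => t; rewrite !mxE.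
  apply: measurable_funB; first exact: (measurableT_comp (measurable_coord j) ma).
  exact: (measurableT_comp (measurable_coord j) mb).
have w2 : (\int[m]_(x in Omega) (enorm (w x) ^+ 2)%:E < +oo)%E by rewrite w2E.
have w'2 : (\int[m]_(x in Omega) (enorm (w' x) ^+ 2)%:E < +oo)%E.
  by rewrite (swap _ (fun x => (enorm (v' x) ^+ 2)%:E))// => x /wE[_ _ ->].
have le_sub (f : 'rV[R]_n -> R) : (forall x, 0 <= f x) ->
    (\int[m]_(x in B) (f x)%:E <= \int[m]_(x in Omega) (f x)%:E)%E.
  by move=> f0; apply: le_integral_subset => // x _; rewrite lee_fin.
have mphi i : measurable_fun setT (phi i).
  by apply: continuous_measurable_rV; have [] := sphi i [::].
have mphi' i : measurable_fun setT (phi' i).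
  by apply: continuous_measurable_rV; have [] := sphi' i [::].
have B2 := gu (D := B) (u := fun i x => phi i x - phi' i x) (v := fun x => w x - w' x).
have cB : closure B `<=` Omega.
  apply: (subset_trans (@closure_eball_subset X r)).
  by move=> y /= yX; apply: XO; rewrite /eball/=; lra.
have kB : compact (closure B).
  apply: (subclosed_compact (@closed_closure _ _) (@compact_eball _ _ X r)).
  exact: closure_eball_subset.
have sB i := smoothB (sphi i) (sphi' i).
have L2 : L2vec m B (fun x => w x - w' x).
  split.
    move=> i; apply: (Borel_nu_measurable_fun mB measurable0 (measure0 m)).
    apply: measurable_funTS; apply: (measurableT_comp (measurable_coord i)).
    exact: mdiff.
  apply: le_lt_trans (integral_sqrB_le mB mw mw') _.
  have h (a : 'rV[R]_n -> 'rV[R]_n) : (\int[m]_(x in Omega) (enorm (a x) ^+ 2)%:E < +oo)%E ->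
      (2%:E * \int[m]_(x in B) (enorm (a x) ^+ 2)%:E < +oo)%E.
    move=> aoo; rewrite lte_mul_pinfty//.
    apply: le_lt_trans aoo; apply: le_sub => x; exact: sqr_ge0.
  by rewrite lte_add_pinfty ?h.
have i1 : (\int[m]_(x in B) `|phi i x - phi' i x|%:E)%E @[i --> \oo] --> 0%E.
  have := cvgeD _ (hu X r r0 XO) (hu' X r r0 XO); rewrite adde0 => /(_ _ isT).
  apply: squeeze_cvge; last exact: cvg_cst.
  apply: nearW => i; apply/andP; split; first by apply: integral_ge0 => x _; rewrite lee_fin.
  rewrite -/B (swap (fun x => `|phi i x - u x|%:E) (fun x => `|phi i x - u1 x|%:E) B) => [|x /wB[-> _ _]]//.
  rewrite (swap (fun x => `|phi' i x - u x|%:E) (fun x => `|phi' i x - u1 x|%:E) B) => [|x /wB[-> _ _]]//.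
  have mm (f : 'rV[R]_n -> R) : measurable_fun setT f -> measurable_fun B (fun x => `|f x - u1 x|%:E).
    move=> mf; apply/measurable_EFinP/measurable_funTS; apply: measurableT_comp => //.
    exact: measurable_funB.
  rewrite -ge0_integralD; last 5 first.
  - exact: mB.
  - by move=> x _; rewrite lee_fin.
  - exact: mm.
  - by move=> x _; rewrite lee_fin.
  - exact: mm.
  apply: le_integral_ge0 => x _; first by rewrite lee_fin.
  by rewrite -EFinD lee_fin (distrC (phi' i x)); exact: ler_distD.
have i2 : (\int[m]_(x in B) (enorm (grad (fun y => phi i y - phi' i y) x - (w x - w' x)) ^+ 2)%:E)%E
    @[i --> \oo] --> 0%E.
  have h1 := cvgeZl (isT : (2%:E : \bar R) \is a fin_num) hv.
  have h2 := cvgeZl (isT : (2%:E : \bar R) \is a fin_num) hv'.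
  have := cvgeD _ h1 h2; rewrite !mule0 adde0 => /(_ _ isT).
  apply: squeeze_cvge; last exact: cvg_cst.
  apply: nearW => i; apply/andP; split; first by apply: integral_ge0 => x _; rewrite lee_fin sqr_ge0.
  have e x : grad (fun y => phi i y - phi' i y) x - (w x - w' x) = (grad (phi i) x - w x) - (grad (phi' i) x - w' x).
    by rewrite (gradB x (sphi i) (sphi' i)); apply/rowP => j; rewrite !mxE; ring.
  under eq_integral do rewrite e.
  apply: le_trans (integral_sqrB_le mB (mdiff _ _ (measurable_grad (sphi i)) mw)
    (mdiff _ _ (measurable_grad (sphi' i)) mw')) _.
  apply: leeD; (apply: lee_wpmul2l; first by rewrite lee_fin).
    rewrite (swap (fun x => (enorm (grad (phi i) x - v x) ^+ 2)%:E) (fun x => (enorm (grad (phi i) x - w x) ^+ 2)%:E) Omega) => [|x /wE[_ -> _]]//.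
    by apply: le_sub => x; exact: sqr_ge0.
  rewrite (swap (fun x => (enorm (grad (phi' i) x - v' x) ^+ 2)%:E) (fun x => (enorm (grad (phi' i) x - w' x) ^+ 2)%:E) Omega) => [|x /wE[_ _ ->]]//.
  by apply: le_sub => x; exact: sqr_ge0.
have [P [mP P0 HP]] := B2 (@eball_open _ _ X r) kB cB sB L2 i1 i2.
exists (P `|` N2); split; first exact: measurableU.
  exact: null_set_setU.
move=> x /= /not_implyP[Bx vx]; apply: contrapT => /not_orP[nP nN].
have [_ e1 e2] := wB x (conj Bx nN).
apply: vx; rewrite -e1 -e2; apply/subr0_eq.
by apply: contrapT => h; apply: nP; apply: HP => /= /(_ Bx).
Qed.

(** The set [Omega] is covered by countably many balls, with centers in a dense sequence and dyadic
    radii, whose doubles lie in [Omega]. *)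
Lemma weak_gradient_unique u v v' : L1loc m Omega u ->
  weak_gradient Omega m u v -> weak_gradient Omega m u v' ->
  {ae m, forall x, Omega x -> v x = v' x}.
Proof.
move=> Lu wv wv'.
have [q Hq] := dense_sequence R n.
pose rad j : R := 2^-1 ^+ j.
pose B i j := eball (q i) (rad j).
have rad0 j : 0 < rad j by rewrite exprn_gt0.
pose P := [set x | Omega x /\ v x <> v' x].
pose Q i j := [set x | [/\ eball (q i) (2 * rad j) `<=` Omega, eball (q i) (rad j) x & v x <> v' x]].
suff : m.-negligible (\bigcup_i \bigcup_j Q i j).
  apply: negligibleS.
  move=> x /= /not_implyP[Ox vx].
  have [r /= r0 rO] := (nbhs_eballP _ _).1 (oO Ox).
  have [j jr] : exists j, 4 * rad j < r.
    have [j hj] := expr_half_lt (divr_gt0 r0 (ltr0n _ 4)).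
    by exists j; rewrite mulrC -ltr_pdivlMr.
  have [i iX] := Hq x _ (rad0 j).
  exists i => //; exists j => //; split; rewrite // /eball/= 1?enorm_sub//.
  by apply: subset_trans rO; apply: eball_subset; lra.
apply: negligible_bigcup => i; apply: negligible_bigcup => j.
have [h|h] := pselect (eball (q i) (2 * rad j) `<=` Omega); last first.
  by rewrite (_ : Q i j = set0); [exact: negligible_set0|rewrite -subset0 => x []].
apply: negligibleS (weak_gradient_ball_unique Lu (rad0 j) h wv wv').
by move=> x [_ Bx vx]/=; apply/not_implyP.
Qed.

End gradient_uniqueness.

(** * The extension belongs to the energy space *)

Section extension_energy.
Context {R : realType} {n : nat} (Omega : set 'rV[R]_n).
Variables (m mu : {sigma_finite_measure set 'rV[R]_n -> \bar R}).
Variables (C3 C4 C5 : R).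
Local Notation Gamma := (boundary Omega).
Local Notation delta := (delta Omega).
Local Notation lattice := {ffun 'I_n -> int}.
Hypothesis oO : open Omega.
Hypothesis O0 : Omega !=set0.
Hypothesis Gamma0 : Gamma !=set0.
Hypothesis n_gt0 : (0 < n)%N.
Hypothesis m_ball : forall X r, closure Omega X -> 0 < r ->
  (0 < m (eball X r `&` Omega) < +oo)%E.
Hypothesis m_dbl : forall X r, closure Omega X -> 0 < r ->
  (m (eball X (2 * r) `&` Omega) <= C4%:E * m (eball X r `&` Omega))%E.
Hypothesis mu_ball : forall x r, Gamma x -> 0 < r ->
  (0 < mu (eball x r `&` setT) < +oo)%E.
Hypothesis mu_dbl : forall x r, Gamma x -> 0 < r ->
  (mu (eball x (2 * r) `&` setT) <= C3%:E * mu (eball x r `&` setT))%E.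
Hypothesis mu_null : mu (~` Gamma) = 0%E.
Hypothesis rho_gr : rho_growth Omega m mu C5.
Implicit Types (g : 'rV[R]_n -> R) (j k : int) (z : lattice) (X : 'rV[R]_n).

Local Notation ext_op := (ext_op Omega mu).
Local Notation ext_approx := (ext_approx Omega mu).
Local Notation ext_density := (ext_density Omega mu).
Local Notation energy_at := (energy_at Omega m mu).

Let mO : measurable Omega. Proof. exact: open_measurable_mx. Qed.
Let mG : measurable Gamma. Proof. exact: measurable_boundary. Qed.
Let nR : 1 <= n%:R :> R. Proof. by rewrite ler1n. Qed.
Let strip_gt0 : 0 < @strip R n. Proof. by rewrite /strip; have := nR; lra. Qed.

Lemma strip_mesh_lt (e : R) : 0 < e -> exists K : nat, forall L : nat, (K <= L)%N -> @strip R n * mesh L < e.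
Proof.
move=> e0; have [K hK] := expr_half_lt (divr_gt0 e0 strip_gt0).
exists K => L KL; rewrite mulrC -ltr_pdivlMr//; apply: le_lt_trans hK.
rewrite (_ : 2^-1 ^+ K = @mesh R K) ?mesh_le ?lez_nat//.
by rewrite /mesh exprVn exprnN.
Qed.

(** At each point of [Omega] the approximants and their gradients are eventually constant, so
    pointwise convergence is immediate; measurability of the extension and of its gradient
    follows. *)
Lemma ext_approx_stable X : Omega X -> exists K : nat, forall g (L : nat), (K <= L)%N ->
  ext_approx g L X = ext_op g X /\ grad (ext_approx g L) X = grad (ext_op g) X.
Proof.
move=> OX; have dX := delta_gt0 oO Gamma0 OX.
have [K HK] := strip_mesh_lt dX; exists K => g L /HK LX.
split; first by apply: ext_approx_eq; exact: ltW.
apply/rowP => i; rewrite !mxE; apply: partial_near_eq.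
have e0 : 0 < delta X - @strip R n * mesh L by rewrite subr_gt0.
have hnear := delta_near Gamma0 X e0.
apply: (@filterS _ _ (nbhs_filter X) _ _ _ hnear) => Y; rewrite ltr_norml => /andP[h _].
by apply: ext_approx_eq; move: h; lra.
Qed.

Lemma ext_approx_cvg g X : Omega X -> (fun K : nat => ext_approx g K X) @ \oo --> ext_op g X.
Proof.
move=> /ext_approx_stable[K HK]; apply: cvg_near_cst.
by exists K => // L /= /HK => /(_ g)[].
Qed.

Lemma grad_ext_approx_cvg g X (F : 'rV[R]_n -> R) : Omega X ->
  (fun K : nat => F (grad (ext_approx g K) X)) @ \oo --> F (grad (ext_op g) X).
Proof.
move=> /ext_approx_stable[K HK]; apply: cvg_near_cst.
by exists K => // L /= /HK => /(_ g)[_ ->].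
Qed.

Lemma measurable_ext_op g : measurable_fun Omega (ext_op g).
Proof.
apply: (@measurable_fun_cvg _ _ _ _ (fun (K : nat) X => ext_approx g K X)) => [K|X OX].
  apply: measurable_funTS; apply: continuous_measurable_rV.
  by have [] := smooth_ext_approx mu Gamma0 n_gt0 g K [::].
exact: ext_approx_cvg.
Qed.

Lemma measurable_grad_ext_op g i : measurable_fun Omega (fun X => grad (ext_op g) X ord0 i).
Proof.
apply: (@measurable_fun_cvg _ _ _ _ (fun (K : nat) X => grad (ext_approx g K) X ord0 i)) => [K|X OX].
  apply: measurable_funTS; apply: (measurableT_comp (measurable_coord i)).
  by apply: measurable_grad; exact: smooth_ext_approx.
exact: (@grad_ext_approx_cvg g X (fun v => v ord0 i)).
Qed.

(** A compact subset of [Omega] stays at positive distance from the boundary, so the extension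
    equals a single continuous approximant on it and is bounded there. *)
Lemma ext_op_L1loc g : L1loc m Omega (ext_op g).
Proof.
split; first by apply: (Borel_nu_measurable_fun mO measurable0 (measure0 m)); rewrite setD0; exact: measurable_ext_op.
move=> K KO kK; have [->|/set0P K0] := eqVneq K set0; first by rewrite integral_set0.
have [c /set_mem Kc cmin] := EVT_min_rV K0 kK (continuous_subspaceT (delta_continuous Gamma0)).
have [J HJ] := strip_mesh_lt (delta_gt0 oO Gamma0 (KO _ Kc)).
have cE : continuous (fun X => `|ext_approx g J X|).
  move=> X; apply: continuous_comp; last exact: norm_continuous.
  by have [+ _] := smooth_ext_approx mu Gamma0 n_gt0 g J [::]; apply.
have [d /set_mem Kd dmax] := EVT_max_rV K0 kK (continuous_subspaceT cE).
have [e /set_mem Ke emax] := EVT_max_rV K0 kK (continuous_subspaceT (@enorm_continuous R n)).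
have mK : measurable K by rewrite -(setCK K); apply: measurableC; apply: open_measurable_mx; apply: closed_openC; exact: compact_closed.
have Koo : (m K < +oo)%E.
  have [X0 OX0] := O0; have r0 : 0 < enorm X0 + enorm e + 1 by have := enorm_ge0 X0; have := enorm_ge0 e; lra.
  have /andP[_] := m_ball (subset_closure OX0) r0; apply: le_lt_trans.
  apply: le_measure; rewrite ?inE//; first by apply: measurableI => //; exact: measurable_eball.
  move=> Y KY; split; last exact: KO.
  rewrite /eball/=; have := enorm_triangle 0 Y X0; rewrite subr0 sub0r enormN.
  by have := emax Y (mem_set KY); lra.
apply: (@le_lt_trans _ _ (\int[m]_(X in K) `|ext_approx g J d|%:E)%E).
  apply: le_integral_ge0 => X KX; first by rewrite lee_fin.
  rewrite lee_fin -(@ext_approx_eq _ _ _ _ g J); first exact: dmax (mem_set KX).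
  by have := cmin X (mem_set KX); have := HJ J (leqnn J); lra.
by rewrite integral_cst// lte_mul_pinfty// lee_fin.
Qed.

(** The gradients converge pointwise, and the gradient bound, being independent of [K], provides one
    integrable majorant for dominated convergence. *)
Lemma ext_op_weak_gradient : exists2 C : R, 0 <= C & forall g, admissible Omega m mu g ->
  weak_gradient Omega m (ext_op g) (grad (ext_op g)) /\
  (\int[m]_(X in Omega) (enorm (grad (ext_op g) X) ^+ 2)%:E <=
   C%:E * \int[mu]_(x in Gamma) energy_at g x)%E.
Proof.
have [C C0 HC] := ext_approx_grad_le oO Gamma0 n_gt0 m_ball mu_ball mu_dbl mu_null rho_gr.
have [C' C'0 HC'] := integral_pair_weight_le oO O0 Gamma0 m_ball m_dbl mu_ball rho_gr.
exists (C * C') => [|g ag]; first by rewrite mulr_ge0// ltW.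
have [mg gfin] := ag.
have gradle X : Omega X -> ((enorm (grad (ext_op g) X) ^+ 2)%:E <= C%:E * ext_density g X)%E.
  move=> OX; have [K HK] := ext_approx_stable OX.
  by have [_ <-] := HK g K (leqnn K); exact: HC.
have mE := measurable_ext_density mu oO mg.
have iE := integral_ext_density_le oO mg C'0 HC'.
have ZE : (\int[m]_(X in Omega) (C%:E * ext_density g X) <= (C * C')%:E * \int[mu]_(x in Gamma) energy_at g x)%E.
  rewrite ge0_integralZl//; last 3 first.
  - exact: measurable_funTS.
  - by move=> X _; exact: ext_density_ge0.
  - by rewrite lee_fin ltW.
  by rewrite EFinM -muleA; apply: lee_wpmul2l => //; rewrite lee_fin ltW.
have le : (\int[m]_(X in Omega) (enorm (grad (ext_op g) X) ^+ 2)%:E <=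
   (C * C')%:E * \int[mu]_(x in Gamma) energy_at g x)%E.
  by apply: le_trans ZE; apply: le_integral_ge0 => X OX; [rewrite lee_fin sqr_ge0|exact: gradle].
have boundoo : ((C * C')%:E * \int[mu]_(x in Gamma) energy_at g x < +oo)%E.
  by rewrite lte_mul_pinfty// lee_fin mulr_ge0// ltW.
split => //; split.
  split; last exact: le_lt_trans le boundoo.
  move=> i; apply: (Borel_nu_measurable_fun mO measurable0 (measure0 m)).
  by rewrite setD0; exact: measurable_grad_ext_op.
have sm K := smooth_ext_approx mu Gamma0 n_gt0 g K.
exists (fun K : nat => ext_approx g K); split => //.
- move=> K; apply: (le_lt_trans _ boundoo); apply: le_trans ZE.
  by apply: le_integral_ge0 => X OX; [rewrite lee_fin sqr_ge0|exact: HC].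
(* Points of the ball are at distance at least [r] from the boundary, so for large [K] the integrand
   vanishes identically. *)
- move=> X r r0 XO; have [K HK] := strip_mesh_lt r0.
  apply: cvg_near_cst; exists K => // L /= /HK Lr.
  apply: integral0_eq => Y XY; rewrite ext_approx_eq ?subrr ?normr0//.
  apply: (le_trans (ltW Lr)); apply: eball_subset_delta => //.
  by apply: subset_trans XO; apply: eball_subset; move: XY; rewrite /eball/=; lra.
pose f_ (K : nat) X := ((enorm (grad (ext_approx g K) X - grad (ext_op g) X) ^+ 2)%:E : \bar R).
have mf K : measurable_fun Omega (f_ K).
  apply/measurable_EFinP.
  apply: (@measurable_fun_cvg _ _ _ _ (fun (L : nat) X => enorm (grad (ext_approx g K) X - grad (ext_approx g L) X) ^+ 2)) => [L|X OX].
    by apply: measurable_funTS; apply: measurable_enormB_sqr; exact: measurable_grad.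
  exact: (@grad_ext_approx_cvg g X (fun v => enorm (grad (ext_approx g K) X - v) ^+ 2)).
(* The factor [4] arises from [|a - b|^2 <= 2 |a|^2 + 2 |b|^2], both gradients being bounded by [C]
   times the density. *)
have intG : m.-integrable Omega (fun X => (4 * C)%:E * ext_density g X)%E.
  apply: integrableZl => //; apply/integrableP; split; first exact: measurable_funTS.
  rewrite (eq_integral (ext_density g)) => [|X _]; last by rewrite gee0_abs//; exact: ext_density_ge0.
  by apply: (le_lt_trans iE); rewrite lte_mul_pinfty// lee_fin.
have := @dominated_convergence _ _ _ m Omega mO f_ (cst 0%E) (fun X => (4 * C)%:E * ext_density g X)%E mf (measurable_cst _).
case=> //.
- apply: aeW => X OX; have [K HK] := ext_approx_stable OX.
  apply: cvg_near_cst; exists K => // L /= /HK => /(_ g)[_ e].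
  by rewrite /f_ e subrr enorm0 expr0n.
- apply: aeW => X K OX; rewrite /f_ gee0_abs; last by rewrite lee_fin sqr_ge0.
  have h1 := HC g ag K X OX; have h2 := gradle X OX.
  apply: (@le_trans _ _ (2%:E * (enorm (grad (ext_approx g K) X) ^+ 2)%:E + 2%:E * (enorm (grad (ext_op g) X) ^+ 2)%:E)%E).
    by rewrite -!EFinM -EFinD lee_fin; exact: enorm_sqrB_le.
  apply: (@le_trans _ _ (2%:E * (C%:E * ext_density g X) + 2%:E * (C%:E * ext_density g X))%E).
    by apply: leeD; [apply: (lee_wpmul2l _ h1)|apply: (lee_wpmul2l _ h2)]; rewrite lee_fin.
  rewrite !muleA -!(EFinM 2) -ge0_muleDl; last 2 first.
  - by rewrite lee_fin mulr_ge0// ltW.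
  - by rewrite lee_fin mulr_ge0// ltW.
  rewrite -EFinD (_ : 2 * C + 2 * C = 4 * C); first exact: lexx.
  by ring.
move=> _ + _; under eq_fun do under eq_integral do rewrite sube0 gee0_abs ?lee_fin ?sqr_ge0//.
by [].
Qed.

End extension_energy.

Section boundary_functions.
Context {R : realType} {n : nat} (Omega : set 'rV[R]_n).
Variables (m mu : {sigma_finite_measure set 'rV[R]_n -> \bar R}).
Variables (C3 C4 C5 : R).
Local Notation Gamma := (boundary Omega).
Local Notation lattice := {ffun 'I_n -> int}.
Hypothesis oO : open Omega.
Hypothesis O0 : Omega !=set0.
Hypothesis Gamma0 : Gamma !=set0.
Hypothesis n_gt0 : (0 < n)%N.
Hypothesis m_ball : forall X r, closure Omega X -> 0 < r ->
  (0 < m (eball X r `&` Omega) < +oo)%E.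
Hypothesis m_dbl : forall X r, closure Omega X -> 0 < r ->
  (m (eball X (2 * r) `&` Omega) <= C4%:E * m (eball X r `&` Omega))%E.
Hypothesis mu_ball : forall x r, Gamma x -> 0 < r ->
  (0 < mu (eball x r `&` setT) < +oo)%E.
Hypothesis mu_dbl : forall x r, Gamma x -> 0 < r ->
  (mu (eball x (2 * r) `&` setT) <= C3%:E * mu (eball x r `&` setT))%E.
Hypothesis mu_null : mu (~` Gamma) = 0%E.
Hypothesis rho_gr : rho_growth Omega m mu C5.
Hypothesis gu : gradient_uniqueness Omega m.
Implicit Types (g : 'rV[R]_n -> R) (j k : int) (z : lattice) (X : 'rV[R]_n).

Local Notation havg := (interior_average Omega m).
Local Notation E := (energy_space Omega m).
Local Notation H := (boundary_space Omega m mu).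
Local Notation coef := (coef Omega mu).
Local Notation ext_op := (ext_op Omega mu).

Let mO : measurable Omega. Proof. exact: open_measurable_mx. Qed.
Let mG : measurable Gamma. Proof. exact: measurable_boundary. Qed.

Lemma boundary_energy_ae_eq g g' N : measurable N -> mu N = 0%E ->
  (forall x, (Gamma `\` N) x -> g x = g' x) ->
  (\int[mu]_(x in Gamma) \int[mu]_(y in Gamma) (boundary_integrand Omega m mu g x y)%:E =
   \int[mu]_(x in Gamma) \int[mu]_(y in Gamma) (boundary_integrand Omega m mu g' x y)%:E)%E.
Proof.
move=> mN N0 gg; rewrite (integral_setD_null _ _ mN N0) [RHS](integral_setD_null _ _ mN N0).
apply: eq_integral => x /set_mem/gg gx.
rewrite (integral_setD_null _ _ mN N0) [RHS](integral_setD_null _ _ mN N0).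
by apply: eq_integral => y /set_mem/gg gy; rewrite /boundary_integrand gx gy.
Qed.

Lemma coef_ae_eq g g' N : measurable N -> mu N = 0%E ->
  (forall x, (Gamma `\` N) x -> g x = g' x) -> forall k z, coef g k z = coef g' k z.
Proof.
move=> mN N0 gg k z; apply: (average_ae_eq mN N0) => x [[_ Gx] nx]; exact: gg.
Qed.

Lemma boundary_version g : space_mem H g -> exists N g', [/\ measurable N, mu N = 0%E,
  admissible Omega m mu g' & forall x, (Gamma `\` N) x -> g' x = g x].
Proof.
move=> [mg gH]; have [N [g' [mN N0 mg' gg']]] := Borel_version mG mg.
exists N, g'; split => //; split => //.
rewrite -(boundary_energyE oO m_ball mu_ball) (boundary_energy_ae_eq mN N0 gg').
by apply: lty_poweRy gH; rewrite invr_neq0// pnatr_eq0.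
Qed.

Lemma ext_op_ae_eq g g' : {ae mu, forall x, Gamma x -> g x = g' x} -> ext_op g = ext_op g'.
Proof.
move=> [N [mN N0 HN]]; apply/ext_op_congr/(coef_ae_eq mN N0) => x [Gx nx].
by apply: contrapT => ne; apply: nx; apply: HN => /= /(_ Gx).
Qed.

(** Only the coefficients depend on [g], and averages over cells are linear because finite boundary
    energy makes [g] integrable there; the equality therefore holds at every point. *)
Lemma ext_op_linear a g g' : space_mem H g -> space_mem H g' ->
  ext_op (fun x => a * g x + g' x) = (fun X => a * ext_op g X + ext_op g' X).
Proof.
move=> /boundary_version[N [h [mN N0 ah hg]]] /boundary_version[N' [h' [mN' N'0 ah' hg']]].
apply/funext => X; apply: ext_op_lin => k z.
rewrite -(coef_ae_eq mN N0 hg) -(coef_ae_eq mN' N'0 hg').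
rewrite -(coef_ae_eq (g := fun x => a * h x + h' x) (measurableU _ _ mN mN') (null_set_setU mN mN' N0 N'0)); last first.
  by move=> x [Gx /not_orP[n1 n2]]; rewrite hg ?hg'.
apply: average_lin; first by apply: measurableI => //; exact: measurable_eball.
  exact: (coef_integrable oO Gamma0 m_ball mu_ball mu_null rho_gr).
exact: (coef_integrable oO Gamma0 m_ball mu_ball mu_null rho_gr).
Qed.

Lemma ext_op_bounded : exists2 C : R, 0 <= C & forall g, space_mem H g ->
  space_mem E (ext_op g) /\
  (\int[m]_(X in Omega) (enorm (nabla Omega m (ext_op g) X) ^+ 2)%:E <=
   C%:E * \int[mu]_(x in Gamma) \int[mu]_(y in Gamma) (boundary_integrand Omega m mu g x y)%:E)%E.
Proof.
have [C C0 HC] := ext_op_weak_gradient oO O0 Gamma0 n_gt0 m_ball m_dbl mu_ball mu_dbl mu_null rho_gr.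
exists C => // g /boundary_version[N [g' [mN N0 ag gg]]].
have [wg le] := HC g' ag.
have eg : ext_op g = ext_op g' by apply/esym/ext_op_congr/(coef_ae_eq mN N0).
have Eu : space_mem E (ext_op g).
  split; last by exists (grad (ext_op g')); rewrite eg.
  exact: (@ext_op_L1loc _ _ _ m mu oO O0 Gamma0 n_gt0 m_ball g).
split; first exact: Eu.
rewrite -(boundary_energy_ae_eq mN N0 gg) (boundary_energyE oO m_ball mu_ball).
apply: le_trans le.
rewrite eg in Eu *.
(* The seminorm uses the weak gradient picked by [nabla]; uniqueness identifies it almost everywhere
   with the classical gradient. *)
have [P [mP P0 HP]] := weak_gradient_unique oO gu (proj1 Eu) (energy_nabla Eu) wg.
rewrite (integral_setD_null _ _ mP P0) [leRHS](integral_setD_null _ _ mP P0).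
rewrite (eq_integral (fun X => (enorm (grad (ext_op g') X) ^+ 2)%:E))// => X /set_mem[OX nX].
rewrite (_ : nabla Omega m (ext_op g') X = grad (ext_op g') X)//.
by apply: contrapT => ne; apply: nX; apply: HP => /= /(_ OX).
Qed.

Lemma ext_op_nt g : space_mem H g -> exists N, [/\ measurable N, mu N = 0%E &
  forall x, (Gamma `\` N) x -> nt_limit Omega (havg (ext_op g)) x (g x)].
Proof.
move=> /boundary_version[N [g' [mN N0 [mg gfin] gg]]].
have [N' [mN' N'0 HN']] := energy_at_fin oO mg gfin.
have eg : ext_op g = ext_op g' by apply/esym/ext_op_congr/(coef_ae_eq mN N0).
exists (N `|` N'); split; [exact: measurableU|exact: null_set_setU|].
move=> x [Gx /not_orP[n1 n2]]; rewrite eg -gg//.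
by apply: (ext_op_nt_limit oO Gamma0 n_gt0 m_ball mu_ball mu_dbl mu_null rho_gr) => //; exact: HN'.
Qed.

End boundary_functions.

(** * Assembling the two operators *)

Section trace_extension.
Context {R : realType} {n : nat} (Omega : set 'rV[R]_n).
Variables (m mu : {sigma_finite_measure set 'rV[R]_n -> \bar R}).
Variables (C1 C3 C4 C5 C6 a0 : R) (cubes : int -> set (set 'rV[R]_n)).
Local Notation Gamma := (boundary Omega).

Lemma seminorm_le (a b : \bar R) (C : R) : 0 <= C -> (0 <= a)%E -> (0 <= b)%E ->
  (a <= C%:E * b)%E -> (a `^ 2^-1 <= (C `^ 2^-1)%:E * b `^ 2^-1)%E.
Proof.
move=> C0 a0' b0 h; rewrite -poweR_EFin -poweRM ?lee_fin//.
apply: gt0_ler_poweR; rewrite ?invr_ge0 ?ler0n// in_itv/= leey andbT//.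
by rewrite mule_ge0 ?lee_fin.
Qed.

(** The statement for measures carrying a sigma-finite structure, with the density hypothesis on [m]
    replaced by its consequences for balls. *)
Lemma trace_extension :
  open Omega -> Omega !=set0 -> Gamma !=set0 -> (0 < n)%N ->
  0 < C1 -> corkscrew_points Omega C1 -> harnack_chains Omega C1 ->
  (forall X r, closure Omega X -> 0 < r -> (0 < m (eball X r `&` Omega) < +oo)%E) ->
  (forall X r, closure Omega X -> 0 < r ->
    (m (eball X (2 * r) `&` Omega) <= C4%:E * m (eball X r `&` Omega))%E) ->
  (forall x r, Gamma x -> 0 < r -> (0 < mu (eball x r `&` setT) < +oo)%E) ->
  (forall x r, Gamma x -> 0 < r ->
    (mu (eball x (2 * r) `&` setT) <= C3%:E * mu (eball x r `&` setT))%E) ->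
  mu (~` Gamma) = 0%E -> rho_growth Omega m mu C5 ->
  gradient_uniqueness Omega m -> weak_poincare Omega m C6 ->
  christ_decomposition Omega mu a0 cubes ->
  exists Tr Ext : ('rV[R]_n -> R) -> ('rV[R]_n -> R),
    [/\ bounded_linear_operator (energy_space Omega m) (boundary_space Omega m mu) Tr,
        bounded_linear_operator (boundary_space Omega m mu) (energy_space Omega m) Ext,
        forall u, space_mem (energy_space Omega m) u ->
          \forall x \ae mu, boundary Omega x ->
            cone_limit Omega C1 cubes
              (fun X => average m (eball X (delta Omega X / 2)) u) x (Tr u x) &
        forall g, space_mem (boundary_space Omega m mu) g ->
          \forall x \ae mu, boundary Omega x -> Tr (Ext g) x = g x].
Proof.
move=> oO O0 Gamma0 n0 C1_gt0 cs hc m_ball m_dbl mu_ball mu_dbl mu_null rho_gr gu poinc chr.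
have aeN (N : set 'rV[R]_n) (P : 'rV[R]_n -> Prop) : measurable N -> mu N = 0%E ->
    (forall x, (Gamma `\` N) x -> P x) -> {ae mu, forall x, Gamma x -> P x}.
  move=> mN N0 h; exists N; split => // x /= /not_implyP[Gx nP].
  by apply: contrapT => nx; apply: nP; exact: h.
have i20 (D : set 'rV[R]_n) (v : 'rV[R]_n -> 'rV[R]_n) : (0 <= \int[m]_(x in D) (enorm (v x) ^+ 2)%:E)%E.
  by apply: integral_ge0 => x _; rewrite lee_fin sqr_ge0.
have bi0 g : (0 <= \int[mu]_(x in Gamma) \int[mu]_(y in Gamma) (boundary_integrand Omega m mu g x y)%:E)%E.
  apply: integral_ge0 => x _; apply: integral_ge0 => y _; rewrite lee_fin /boundary_integrand.
  by case: ifP => // _; rewrite divr_ge0 ?fine_ge0// mulr_ge0 ?sqr_ge0.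
have [Ct Ct0 HCt] := trace_op_bounded oO O0 Gamma0 C1_gt0 cs hc m_ball m_dbl mu_ball mu_dbl rho_gr poinc.
have [Ce Ce0 HCe] := ext_op_bounded oO O0 Gamma0 n0 m_ball m_dbl mu_ball mu_dbl mu_null rho_gr gu.
have nt := trace_op_nt oO O0 Gamma0 C1_gt0 cs hc m_ball m_dbl mu_ball mu_dbl rho_gr poinc.
have ent := ext_op_nt oO Gamma0 n0 m_ball mu_ball mu_dbl mu_null rho_gr.
have eqt := trace_op_eq oO Gamma0 C1_gt0 cs.
have sq u : space_mem (energy_space Omega m) u ->
    (boundary_norm Omega m mu (trace_op Omega m u) <= (Ct `^ 2^-1)%:E * seminorm (energy_space Omega m) u)%E.
  by move=> Eu; apply: seminorm_le => //; exact: HCt.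
have nu2 u : space_mem (energy_space Omega m) u -> (seminorm (energy_space Omega m) u < +oo)%E.
  move=> Eu; have [[_ +] _] := energy_nabla Eu => h.
  by apply: poweR_lty; exact: h.
exists (trace_op Omega m), (ext_op Omega mu); split.
- split.
  + move=> u Eu; split.
      exact: (trace_op_measurable oO O0 Gamma0 C1_gt0 cs hc m_ball m_dbl mu_ball mu_dbl rho_gr poinc Eu).
    by apply: le_lt_trans (sq u Eu) _; rewrite lte_mul_pinfty ?lee_fin ?powR_ge0// nu2.
  + move=> u v _ _ uv; apply: aeW => x _.
    exact: (trace_op_ae_eq oO Gamma0).
  + move=> a u v Eu Ev.
    exact: (trace_op_lin oO O0 Gamma0 C1_gt0 cs hc m_ball m_dbl mu_ball mu_dbl rho_gr poinc).
  + by exists (Ct `^ 2^-1).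
- split.
  + by move=> g /HCe[].
  + by move=> g g' _ _ gg; rewrite (@ext_op_ae_eq _ _ Omega mu g g' gg); exact: aeW.
  + move=> a g g' Hg Hg'; apply: aeW => X _.
    exact: (congr1 (@^~ X) (ext_op_linear oO Gamma0 m_ball mu_ball mu_null rho_gr a Hg Hg')).
  + by exists (Ce `^ 2^-1) => g /HCe[_ h]; exact: seminorm_le.
- move=> u /nt[N [mN N0 HN]]; apply: (aeN N) => // x Nx.
  exact: (nt_limit_cone_limit Gamma0 C1_gt0 n0 chr (HN x Nx)).
- move=> g /ent[N [mN N0 HN]]; apply: (aeN N) => // x Nx.
  exact: (eqt m (ext_op Omega mu g) _ x (g x) Nx.1 (fun X _ => erefl _) (HN x Nx)).
Qed.

End trace_extension.

Theorem theorem1p3 (R : realType) (n : nat) (Omega : set 'rV[R]_n)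
    (m mu : {measure set 'rV[R]_n -> \bar R}) (C1 C3 C4 C5 C6 a0 : R)
    (cubes : int -> set (set 'rV[R]_n)) :
  domain Omega ->
  ~ bounded_set (boundary Omega) ->
  borel_measure_on_boundary Omega mu ->
  0 < C1 -> corkscrew_points Omega C1 ->
  harnack_chains Omega C1 ->
  mu_doubling Omega mu C3 ->
  m_density_doubling Omega m C4 ->
  rho_growth Omega m mu C5 ->
  gradient_uniqueness Omega m -> weak_poincare Omega m C6 ->
  0 < a0 -> christ_decomposition Omega mu a0 cubes ->
  exists Tr Ext : ('rV[R]_n -> R) -> ('rV[R]_n -> R),
    [/\ bounded_linear_operator (energy_space Omega m) (boundary_space Omega m mu) Tr,
        bounded_linear_operator (boundary_space Omega m mu) (energy_space Omega m) Ext,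
        forall u, space_mem (energy_space Omega m) u ->
          \forall x \ae mu, boundary Omega x ->
            cone_limit Omega C1 cubes
              (fun X => average m (eball X (delta Omega X / 2)) u) x (Tr u x) &
        forall g, space_mem (boundary_space Omega m mu) g ->
          \forall x \ae mu, boundary Omega x -> Tr (Ext g) x = g x].
Proof.
move=> [oO _ O0] Gub [mu_null mu_ball] C1_gt0 cs hc [_ mu_dbl] Hm rho_gr gu poinc _ chr.
have Gamma0 : boundary Omega !=set0.
  apply/set0P/eqP => G0; apply: Gub; rewrite G0; apply: compact_bounded; exact: compact0.
(* In dimension [0] the boundary would be a single point, hence bounded. *)
have n_gt0 : (0 < n)%N.
  rewrite lt0n; apply/eqP => n0; apply: Gub; subst n.
  have -> : boundary Omega = [set 0].
    have [x Gx] := Gamma0; apply/seteqP; split => [y _|y ->]; first by apply/rowP => -[].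
    by rewrite (_ : 0 = x)//; apply/rowP => -[].
  by apply: compact_bounded; exact: compact_set1.
(* Tonelli's theorem needs measures with a sigma-finite structure; both measures are finite on the
   balls around the origin. *)
have [m' em] := sigma_finite_pack (sigma_finite_balls (density_ball_fin oO O0 Hm)).
have mufin r : 0 < r -> (mu (eball (0 : 'rV[R]_n) r) < +oo)%E.
  move=> r0; have [x Gx] := Gamma0.
  have r1 : 0 < enorm x + r by rewrite ltr_wpDl// enorm_ge0.
  have /andP[_] := mu_ball x _ Gx r1; apply: le_lt_trans; apply: le_measure; rewrite ?inE; try exact: measurable_eball.
  by apply: eball_subset; rewrite sub0r enormN.
have [mu' emu] := sigma_finite_pack (sigma_finite_balls mufin).
have m_ball := density_ball oO O0 Hm.
have [_ m_dbl] := Hm.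
have mu_ball' x r : boundary Omega x -> 0 < r -> (0 < mu (eball x r `&` setT) < +oo)%E.
  by rewrite setIT; exact: mu_ball.
have mu_dbl' x r : boundary Omega x -> 0 < r ->
    (mu (eball x (2 * r) `&` setT) <= C3%:E * mu (eball x r `&` setT))%E.
  by rewrite !setIT; exact: mu_dbl.
move: m_ball m_dbl mu_ball' mu_dbl' mu_null rho_gr gu poinc chr; clear mu_ball mu_dbl mufin Hm; rewrite em emu.
move=> h1 h2 h3 h4 h5 h6 h7 h8 h9.
exact: (@trace_extension R n Omega m' mu' C1 C3 C4 C5 C6 a0 cubes
  oO O0 Gamma0 n_gt0 C1_gt0 cs hc h1 h2 h3 h4 h5 h6 h7 h8 h9).
Qed.
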